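(* Work in $\mathrm{ZF}+\mathrm{DC}_\lambda$. A cardinal $\lambda$ is exacting if and only if for every nonempty ordinal definable set $A\subseteq V_{\lambda+1}$ there exist $x,y\in A$ and a non-identity elementary embedding $j:(V_\lambda,x)\to(V_\lambda,y)$.
   Context: $\mathrm{DC}_\lambda$ is the assertion that every ${<}\lambda$-closed tree with no terminal nodes has a branch of length $\lambda$. For a natural number $n$, $C^{(n)}$ denotes the class of ordinals $\alpha$ such that $V_\alpha$ is a $\Sigma_n$-elementary substructure of $V$. Let $\lambda$ be a limit cardinal. $\lambda$ is called exacting if there exist a natural number $n>0$, a cardinal $\eta\in C^{(n)}$ with $\eta>\lambda$, an elementary substructure $X\prec V_\eta$ with $V_\lambda\cup\{\lambda\}\subseteq X$, a cardinal $\zeta\in C^{(n+1)}$ with $\zeta>\lambda$, and an elementary embedding $j:X\to V_\zeta$ with $j(\lambda)=\lambda$ and $j\restriction\lambda\neq\mathrm{id}_\lambda$. A set is ordinal definable if it is definable in $V$ by a first-order formula with ordinal parameters. *)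

(* Defs.v *)
(* "ZF proves ..." is rendered as truth in every structure (V, mem) satisfying
   the first-order theory ZF; V need not be well-founded or an omega-model.
   Set-theoretic notions are first-order over (V, mem): every set quantifier
   ranges over V, and functions, sequences, embeddings, etc. are elements of V.
   Operations such as {a, b} or V_alpha are given by their graphs ([is_...]). *)

From Stdlib Require Import Arith.

Set Implicit Arguments.
Unset Strict Implicit.
Unset Printing Implicit Defensive.

Record set_structure := SetStructure {
  carrier :> Type;
  mem : carrier -> carrier -> Prop
}.
Arguments mem {s} _ _.

Notation "x 'in_' y" := (mem x y) (at level 70, no associativity).

Inductive fml :=
| FMem (i j : nat)
| FEq (i j : nat)
| FNeg (p : fml)
| FAnd (p q : fml)
| FEx (i : nat) (p : fml).

Definition upd {T : Type} (v : nat -> T) (i : nat) (x : T) : nat -> T :=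
  fun k => if Nat.eqb k i then x else v k.

(* Satisfaction in the substructure (D, mem) of V with underlying class D. *)
Fixpoint sat {V : set_structure} (D : V -> Prop) (v : nat -> V) (p : fml) : Prop :=
  match p with
  | FMem i j => v i in_ v j
  | FEq i j => v i = v j
  | FNeg q => ~ sat D v q
  | FAnd q r => sat D v q /\ sat D v r
  | FEx i q => exists x : V, D x /\ sat D (upd v i x) q
  end.

Definition all_sets {V : set_structure} : V -> Prop := fun _ => True.

(* The Levy hierarchy. Universal quantifiers are negated existential ones, so
   Pi_n formulas are the negations of Sigma_n formulas. *)
Inductive delta0 : fml -> Prop :=
| delta0_mem i j : delta0 (FMem i j)
| delta0_eq i j : delta0 (FEq i j)
| delta0_neg p : delta0 p -> delta0 (FNeg p)
| delta0_and p q : delta0 p -> delta0 q -> delta0 (FAnd p q)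
| delta0_bex i j p : i <> j -> delta0 p -> delta0 (FEx i (FAnd (FMem i j) p)).

Inductive sigma : nat -> fml -> Prop :=
| sigma_delta0 p : delta0 p -> sigma 0 p
| sigma_pi n p : sigma n p -> sigma (S n) (FNeg p)
| sigma_ex n i p : sigma (S n) p -> sigma (S n) (FEx i p).

Definition subset {V : set_structure} (a b : V) := forall x, x in_ a -> x in_ b.

Definition nonempty {V : set_structure} (a : V) := exists x, x in_ a.

Definition is_empty {V : set_structure} (a : V) := forall x, ~ x in_ a.

Definition is_pair {V : set_structure} (p a b : V) :=
  forall z, z in_ p <-> z = a \/ z = b.

Definition is_opair {V : set_structure} (p a b : V) :=
  exists s d, is_pair s a a /\ is_pair d a b /\ is_pair p s d.

(* s = a U {a} *)
Definition is_succ {V : set_structure} (s a : V) :=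
  forall z, z in_ s <-> z in_ a \/ z = a.

Definition inductive {V : set_structure} (w : V) :=
  (exists e, is_empty e /\ e in_ w) /\
  forall n, n in_ w -> exists s, is_succ s n /\ s in_ w.

Definition is_omega {V : set_structure} (w : V) :=
  inductive w /\ forall u, inductive u -> subset w u.

Record ZF (V : set_structure) : Prop := {
  ZF_extensionality : forall a b : V, (forall x, x in_ a <-> x in_ b) -> a = b;
  ZF_foundation : forall a : V, nonempty a ->
    exists x, x in_ a /\ forall y, y in_ x -> ~ y in_ a;
  ZF_pairing : forall a b : V, exists p, is_pair p a b;
  ZF_union : forall a : V, exists u, forall x,
    x in_ u <-> exists y, y in_ a /\ x in_ y;
  ZF_powerset : forall a : V, exists p, forall x, x in_ p <-> subset x a;
  ZF_infinity : exists w : V, inductive w;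
  ZF_separation : forall (p : fml) (v : nat -> V) (a : V), exists b, forall x,
    x in_ b <-> x in_ a /\ sat all_sets (upd v 0 x) p;
  ZF_replacement : forall (p : fml) (v : nat -> V) (a : V),
    (forall x, x in_ a -> exists! y, sat all_sets (upd (upd v 0 x) 1 y) p) ->
    exists b, forall y,
      y in_ b <-> exists x, x in_ a /\ sat all_sets (upd (upd v 0 x) 1 y) p
}.

Definition transitive {V : set_structure} (a : V) := forall x, x in_ a -> subset x a.

(* Under Foundation, ordinals are the transitive sets of transitive sets. *)
Definition ordinal {V : set_structure} (a : V) :=
  transitive a /\ forall x, x in_ a -> transitive x.

(* (x, y) belongs to f; for a function f this is f(x) = y. *)
Definition maps {V : set_structure} (f x y : V) :=
  exists p, is_opair p x y /\ p in_ f.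

Definition is_fun {V : set_structure} (f D E : V) :=
  (forall p, p in_ f -> exists x y, x in_ D /\ y in_ E /\ is_opair p x y) /\
  forall x, x in_ D -> exists! y, maps f x y.

Definition is_bijection {V : set_structure} (f D E : V) :=
  is_fun f D E /\ forall y, y in_ E -> exists! x, maps f x y.

(* u = V_a, through the recursion V_b = U_{c < b} P(V_c) on b <= a *)
Definition is_rank {V : set_structure} (u a : V) :=
  ordinal a /\
  exists f sa E, is_succ sa a /\ is_fun f sa E /\ maps f a u /\
    forall b r, maps f b r ->
      forall x, x in_ r <-> exists c q, c in_ b /\ maps f c q /\ subset x q.

Definition cardinal {V : set_structure} (k : V) :=
  ordinal k /\ forall a, a in_ k -> ~ exists f, is_bijection f a k.

Definition limit_cardinal {V : set_structure} (k : V) :=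
  cardinal k /\ nonempty k /\
  forall m, m in_ k -> cardinal m -> exists m', m' in_ k /\ cardinal m' /\ m in_ m'.

(* A tree is a strict partial order in which the predecessors of each node are
   well-ordered; [maps R s t] reads s <_R t. *)
Definition is_tree {V : set_structure} (T R : V) :=
  (forall s t, maps R s t -> s in_ T /\ t in_ T) /\
  (forall s, ~ maps R s s) /\
  (forall s t u, maps R s t -> maps R t u -> maps R s u) /\
  forall t u, t in_ T -> nonempty u -> (forall s, s in_ u -> maps R s t) ->
    exists m, m in_ u /\ forall s, s in_ u -> s = m \/ maps R m s.

Definition no_terminal_node {V : set_structure} (T R : V) :=
  forall s, s in_ T -> exists t, maps R s t.

Definition increasing_seq {V : set_structure} (T R s d : V) :=
  is_fun s d T /\
  forall a b x y, a in_ b -> maps s a x -> maps s b y -> maps R x y.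

(* For 0 < k the case of the empty sequence forces T to be nonempty. *)
Definition lt_closed {V : set_structure} (k T R : V) :=
  forall d s, d in_ k -> increasing_seq T R s d ->
    exists t, t in_ T /\ forall a x, maps s a x -> x = t \/ maps R x t.

(* A branch is a downward closed chain, not necessarily a maximal one. *)
Definition is_branch_of_length {V : set_structure} (T R b k : V) :=
  increasing_seq T R b k /\
  forall a x y, maps b a x -> maps R y x -> exists c, maps b c y.

Definition DC {V : set_structure} (k : V) :=
  forall T R, is_tree T R -> lt_closed k T R -> no_terminal_node T R ->
    exists b, is_branch_of_length T R b k.

(* Satisfaction for set-sized structures is defined inside V. The structures are (D, mem) or (D, mem, P) with P a unary predicate; the
   second argument of type [option V] is [None], resp. [Some P]. Formulas are
   coded by sets of V, so that in an omega-nonstandard V the notion of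
   elementarity is the one V itself computes. Assignments are functions from
   omega to D. *)

Fixpoint is_numeral {V : set_structure} (n : nat) (x : V) : Prop :=
  match n with
  | 0 => is_empty x
  | S m => exists y, is_numeral m y /\ is_succ x y
  end.

Definition tagged {V : set_structure} (n : nat) (c x : V) :=
  exists t, is_numeral n t /\ is_opair c t x.

Definition code_mem {V : set_structure} (c i j : V) :=
  exists p, is_opair p i j /\ tagged 0 c p.
Definition code_eq {V : set_structure} (c i j : V) :=
  exists p, is_opair p i j /\ tagged 1 c p.
Definition code_neg {V : set_structure} (c a : V) := tagged 2 c a.
Definition code_and {V : set_structure} (c a b : V) :=
  exists p, is_opair p a b /\ tagged 3 c p.
Definition code_ex {V : set_structure} (c i a : V) :=
  exists p, is_opair p i a /\ tagged 4 c p.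
Definition code_pred {V : set_structure} (c i : V) := tagged 5 c i.

Definition has_pred {V : set_structure} (P : option V) : bool :=
  match P with None => false | Some _ => true end.

Definition formula_closed {V : set_structure} (hp : bool) (F : V) :=
  forall w, is_omega w ->
  (forall i j c, i in_ w -> j in_ w -> code_mem c i j -> c in_ F) /\
  (forall i j c, i in_ w -> j in_ w -> code_eq c i j -> c in_ F) /\
  (forall a c, a in_ F -> code_neg c a -> c in_ F) /\
  (forall a b c, a in_ F -> b in_ F -> code_and c a b -> c in_ F) /\
  (forall i a c, i in_ w -> a in_ F -> code_ex c i a -> c in_ F) /\
  (hp = true -> forall i c, i in_ w -> code_pred c i -> c in_ F).

Definition is_formula {V : set_structure} (hp : bool) (c : V) :=
  forall F, formula_closed hp F -> c in_ F.

(* s' is the assignment s with the value at i replaced by x. *)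
Definition is_update {V : set_structure} (s' s i x : V) :=
  maps s' i x /\ forall k y, k <> i -> (maps s' k y <-> maps s k y).

(* Tarski's clauses for a set T of pairs (formula, assignment) *)
Definition truth_set {V : set_structure} (D : V) (P : option V) (T : V) :=
  forall w s, is_omega w -> is_fun s w D ->
  (forall c i j, i in_ w -> j in_ w -> code_mem c i j ->
    (maps T c s <-> exists x y, maps s i x /\ maps s j y /\ x in_ y)) /\
  (forall c i j, i in_ w -> j in_ w -> code_eq c i j ->
    (maps T c s <-> exists x, maps s i x /\ maps s j x)) /\
  (forall c a, is_formula (has_pred P) a -> code_neg c a ->
    (maps T c s <-> ~ maps T a s)) /\
  (forall c a b, is_formula (has_pred P) a -> is_formula (has_pred P) b ->
    code_and c a b -> (maps T c s <-> maps T a s /\ maps T b s)) /\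
  (forall c i a, i in_ w -> is_formula (has_pred P) a -> code_ex c i a ->
    (maps T c s <-> exists x s',
       x in_ D /\ is_fun s' w D /\ is_update s' s i x /\ maps T a s')) /\
  match P with
  | None => True
  | Some p => forall c i, i in_ w -> code_pred c i ->
      (maps T c s <-> exists x, maps s i x /\ x in_ p)
  end.

Definition satisfies {V : set_structure} (D : V) (P : option V) (c s : V) :=
  exists T, truth_set D P T /\ maps T c s.

Definition elementary_substructure {V : set_structure} (D E : V) :=
  subset D E /\
  forall w c s, is_omega w -> is_formula false c -> is_fun s w D ->
    (satisfies D None c s <-> satisfies E None c s).

Definition elementary_embedding {V : set_structure}
    (j D : V) (P : option V) (E : V) (Q : option V) :=
  has_pred P = has_pred Q /\ is_fun j D E /\
  forall w c s t, is_omega w -> is_formula (has_pred P) c ->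
    is_fun s w D -> is_fun t w E ->
    (forall i x y, maps s i x -> maps j x y -> maps t i y) ->
    (satisfies D P c s <-> satisfies E Q c t).

(* The class C^(n). As V has no uniform Sigma_n truth predicate, n is a natural
   number of the metatheory and elementarity in V is for the formulas [fml]. *)
Definition C_ {V : set_structure} (n : nat) (a : V) :=
  ordinal a /\
  exists Va, is_rank Va a /\
    forall (p : fml) (v : nat -> V), sigma n p -> (forall i, v i in_ Va) ->
      (sat (fun x => x in_ Va) v p <-> sat all_sets v p).

Definition exacting {V : set_structure} (lam : V) :=
  limit_cardinal lam /\
  exists (n : nat) (eta X zeta j Vlam Veta Vzeta : V),
    0 < n /\
    is_rank Vlam lam /\ is_rank Veta eta /\ is_rank Vzeta zeta /\
    cardinal eta /\ C_ n eta /\ lam in_ eta /\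
    elementary_substructure X Veta /\ subset Vlam X /\ lam in_ X /\
    cardinal zeta /\ C_ (S n) zeta /\ lam in_ zeta /\
    elementary_embedding j X None Vzeta None /\
    maps j lam lam /\
    exists a, a in_ lam /\ ~ maps j a a.

(* Only finitely many of the parameters v i occur in p. *)
Definition ordinal_definable {V : set_structure} (A : V) :=
  exists (p : fml) (v : nat -> V),
    (forall i, ordinal (v i)) /\
    forall x, sat all_sets (upd v 0 x) p <-> x = A.

(* Main.v *)
(** Suppose lam is exacting, witnessed by j : X -> V_zeta, and some ordinal
    definable A violates the right-hand side. That a level V_u sees such a
    counterexample, defined over it by a fixed formula with ordinal parameters,
    is Delta_0 in u and V_lam, so by reflection it happens for some u < zeta;
    the least such u and the least parameters are definable from V_lam and hence
    fixed by j, and so is the corresponding A. Then j restricted to V_lam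
    maps (V_lam, x) elementarily to (V_lam, j(x)) for any x in A and X.

    Conversely, take a cardinal zeta > lam in C^(2). Using DC_lam one closes
    V_lam U {lam} under Skolem functions of V_zeta, which gives a surjection
    g : V_lam -> X onto an elementary submodel X of V_zeta; its diagram
    {(c, s) : V_zeta |= c[g o s]} is a subset of V_lam, and the set of all such
    diagrams is definable from lam and zeta. An embedding j between two of them
    induces g(a) |-> g'(j(a)), an elementary embedding X -> V_zeta that extends j
    and fixes lam. The closure requires that each V_a with a < lam is
    well-ordered in length < lam. This, and that lam is a limit cardinal,
    follow from embeddings whose critical point lies above a given m < lam: with
    th the Hartogs number of m, Ulam's matrix yields maps f : th -> th all of whose
    fibres are omega-stationary, and an embedding from one such (V_lam, f) to
    another fixes every ordinal below th, because its critical point would be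
    the value of f' at a fixed point. *)

From Stdlib Require Import Arith Lia Classical ClassicalEpsilon FunctionalExtensionality.
Require Import Defs.

Set Implicit Arguments.
Unset Strict Implicit.
Unset Printing Implicit Defensive.

(** * Formulas and definability *)

(** In the forward direction only zeta, being in C^(n+1) with n > 0, is sure to see a Sigma_2 truth
    such as the existence of a counterexample; eta may be no better than C^(1). So the
    counterexample is found in V_zeta, pulled back along j into X, and only then made canonical by
    minimality.

    A map from omega to V_lam need not be an element of V_lam, as lam may have cofinality omega.
    Elementarity is therefore tested on assignments altered outside the finite support of the
    formula, which are elements of V_lam. Since V may be omega-nonstandard, supports and codes are
    handled by induction inside V.

    Conversely, X contains lam and so is no subset of V_lam, while the right-hand side speaks only
    of such subsets; a diagram over names from V_lam replaces it. Both hulls lie in the same V_zeta,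
    so n = 1 and eta = zeta. The Skolem witnesses are chosen rank by rank, one step of DC_lam for
    all names of a rank; this is why each V_a below lam must be well-ordered in fewer than lam
    steps. *)

Fixpoint var_bound (p : fml) : nat :=
  match p with
  | FMem i j | FEq i j => S (max i j)
  | FNeg q => var_bound q
  | FAnd q r => max (var_bound q) (var_bound r)
  | FEx i q => max (S i) (var_bound q)
  end.

Lemma upd_same T (v : nat -> T) i x : upd v i x i = x.
Proof. unfold upd; now rewrite Nat.eqb_refl. Qed.

Lemma upd_other T (v : nat -> T) i x k : k <> i -> upd v i x k = v k.
Proof. intros H; unfold upd; apply Nat.eqb_neq in H; now rewrite H. Qed.

Lemma sat_ext (V : set_structure) (D : V -> Prop) p : forall v w : nat -> V,
  (forall k, k < var_bound p -> v k = w k) -> (sat D v p <-> sat D w p).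
Proof.
  induction p as [i j|i j|p IH|p IHp q IHq|i p IH]; cbn [sat var_bound]; intros v w H.
  - rewrite !H by lia; tauto.
  - rewrite !H by lia; tauto.
  - rewrite (IH v w) by (intros; apply H; lia); tauto.
  - rewrite (IHp v w), (IHq v w) by (intros; apply H; lia); tauto.
  - assert (E : forall x, sat D (upd v i x) p <-> sat D (upd w i x) p).
    { intros x; apply IH; intros k Hk; unfold upd.
      destruct (Nat.eqb k i); auto; apply H; lia. }
    split; intros [x [Hx Hs]]; exists x; split; auto; now apply E.
Qed.

Fixpoint max_upto (r : nat -> nat) (n : nat) : nat :=
  match n with 0 => 0 | S m => max (r m) (max_upto r m) end.

Lemma le_max_upto r n k : k < n -> r k <= max_upto r n.
Proof.
  induction n as [|n IH]; simpl; intros H; [lia|].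
  destruct (Nat.eq_dec k n) as [->|]; [lia|specialize (IH ltac:(lia)); lia].
Qed.

(* The bound variable is renamed to a fresh one: [r] need not be injective. *)
Fixpoint ren (r : nat -> nat) (p : fml) : fml :=
  match p with
  | FMem i j => FMem (r i) (r j)
  | FEq i j => FEq (r i) (r j)
  | FNeg q => FNeg (ren r q)
  | FAnd q s => FAnd (ren r q) (ren r s)
  | FEx i q => let n := S (max_upto r (var_bound q)) in FEx n (ren (upd r i n) q)
  end.

Lemma sat_ren (V : set_structure) (D : V -> Prop) p : forall r (v : nat -> V),
  sat D v (ren r p) <-> sat D (fun k => v (r k)) p.
Proof.
  induction p as [i j|i j|p IH|p IHp q IHq|i p IH]; simpl; intros r v.
  - tauto.
  - tauto.
  - rewrite IH; tauto.
  - rewrite IHp, IHq; tauto.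
  - set (n := S (max_upto r (var_bound p))).
    assert (E : forall x, sat D (upd v n x) (ren (upd r i n) p) <->
                          sat D (upd (fun k => v (r k)) i x) p).
    { intros x; rewrite IH; apply sat_ext; intros k Hk.
      destruct (Nat.eq_dec k i) as [->|Hne]; [now rewrite !upd_same|].
      rewrite !(upd_other _ _ Hne), upd_other; auto.
      pose proof (le_max_upto r Hk); lia. }
    split; intros [x [Hx Hs]]; exists x; split; auto; now apply E.
Qed.

Lemma delta0_ren p : delta0 p -> forall r, delta0 (ren r p).
Proof.
  induction 1; cbn [ren]; intros r; try (constructor; auto).
  rewrite upd_same, (upd_other _ _ (k := j)) by auto.
  apply delta0_bex; auto.
  match goal with |- ?x <> _ => assert (r j < x) end; [|lia].
  match goal with |- _ < S (max_upto r ?n) => pose proof (@le_max_upto r n j ltac:(cbn [var_bound]; lia)) end.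
  lia.
Qed.

(* Definability uniformly in a family of structures [M], with the parameters
   [c i a] for [a : C]; the flag [b] requires the defining formula to be Delta_0. *)
Section Definability.
Context (I : Type) (M : I -> set_structure) (C : Type) (c : forall i, C -> M i).

Definition lookup (t : nat -> nat + C) i (v : nat -> M i) (k : nat) : M i :=
  match t k with inl n => v n | inr a => c i a end.

(** [t] sends each variable of the formula to an environment entry or to a parameter. Formulas are
    thus combined by changing [t] and renaming variables, never by substitution. *)
Definition definable (b : bool) (Q : forall i, (nat -> M i) -> Prop) :=
  exists p t, (b = true -> delta0 p) /\
    forall i v, Q i v <-> sat all_sets (lookup t v) p.

Lemma definable_iff b (Q R : forall i, (nat -> M i) -> Prop) :
  (forall i v, Q i v <-> R i v) -> definable b Q -> definable b R.
Proof.
  intros H (p & t & Hp & E); exists p, t; split; auto.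
  intros i v; rewrite <- H; apply E.
Qed.

Definition atom_value (x : nat + C) i (v : nat -> M i) : M i :=
  match x with inl n => v n | inr a => c i a end.

Lemma definable_mem b x y :
  definable b (fun i v => atom_value x v in_ atom_value y v).
Proof.
  exists (FMem 0 1), (fun k => if Nat.eqb k 0 then x else y); split; [constructor|].
  intros i v; simpl; unfold lookup, atom_value; simpl; tauto.
Qed.

Lemma definable_eq b x y :
  definable b (fun i v => atom_value x v = atom_value y v).
Proof.
  exists (FEq 0 1), (fun k => if Nat.eqb k 0 then x else y); split; [constructor|].
  intros i v; simpl; unfold lookup, atom_value; simpl; tauto.
Qed.

Lemma definable_not b Q : definable b Q -> definable b (fun i v => ~ Q i v).
Proof.
  intros (p & t & Hp & E); exists (FNeg p), t; split.
  - intros Hb; constructor; auto.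
  - intros i v; simpl; rewrite E; tauto.
Qed.

Lemma definable_and b Q R :
  definable b Q -> definable b R -> definable b (fun i v => Q i v /\ R i v).
Proof.
  intros (p & t & Hp & E) (q & u & Hq & F).
  (* [p] moves to the even variables and [q] to the odd ones, so that [t] and [u] cannot clash. *)
  exists (FAnd (ren (fun k => 2 * k) p) (ren (fun k => 2 * k + 1) q)),
    (fun k => if Nat.even k then t (Nat.div2 k) else u (Nat.div2 k)); split.
  - intros Hb; constructor; apply delta0_ren; auto.
  - intros i v; simpl; rewrite !sat_ren, E, F.
    assert (E1 : forall k, lookup t v k = lookup (fun k0 => if Nat.even k0
       then t (Nat.div2 k0) else u (Nat.div2 k0)) v (2 * k)).
    { intros k; unfold lookup; now rewrite Nat.even_even, Nat.div2_even. }
    assert (E2 : forall k, lookup u v k = lookup (fun k0 => if Nat.even k0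
       then t (Nat.div2 k0) else u (Nat.div2 k0)) v (2 * k + 1)).
    { intros k; unfold lookup.
      rewrite Nat.even_odd.
      replace (Nat.div2 (2 * k + 1)) with k; auto.
      symmetry; apply Nat.div2_odd'. }
    rewrite (@sat_ext _ _ p (lookup t v) _ (fun k _ => E1 k)).
    rewrite (@sat_ext _ _ q (lookup u v) _ (fun k _ => E2 k)).
    tauto.
Qed.

Lemma definable_ex Q :
  definable false (fun i v => Q i (v 0) (fun k => v (S k))) ->
  definable false (fun i v => exists x, Q i x v).
Proof.
  intros (p & t & Hp & E).
  (* Several variables of [p] may stand for entry 0; all of them become the fresh bound variable
     [var_bound p]. *)
  exists (FEx (var_bound p) (ren (fun k => match t k with inl 0 => var_bound p | _ => k end) p)),
    (fun k => match t k with inl (S n) => inl n | x => x end); split; [discriminate|].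
  intros i v; simpl.
  assert (F : forall x, Q i x v <-> sat all_sets
     (upd (lookup (fun k => match t k with inl (S n) => inl n | x => x end) v) (var_bound p) x)
     (ren (fun k => match t k with inl 0 => var_bound p | _ => k end) p)).
  { intros x; rewrite sat_ren.
    pose proof (E i (fun k => match k with 0 => x | S n => v n end)) as Ex; simpl in Ex.
    etransitivity; [exact Ex|].
    apply sat_ext; intros k Hk; unfold lookup.
    destruct (t k) as [[|n]|a] eqn:Et; [now rewrite upd_same| |];
      rewrite upd_other by lia; now rewrite Et. }
  split; intros [x Hx]; exists x; [split; [exact Logic.I|now apply F]|apply F; apply Hx].

Qed.

Lemma definable_bex b Q n :
  definable b (fun i v => Q i (v 0) (fun k => v (S k))) ->
  definable b (fun i v => exists x, x in_ v n /\ Q i x v).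
Proof.
  intros (p & t & Hp & E).
  (* Variable 0 is kept for the bounding set [v n]. The variables of [p] are therefore shifted by
     one, and the bound variable differs from 0, as [delta0_bex] demands. *)
  set (r := fun k => match t k with inl 0 => S (var_bound p) | _ => S k end).
  set (u := fun k => match k with 0 => inl n | S k =>
       match t k with inl (S n) => inl n | x => x end end).
  exists (FEx (S (var_bound p)) (FAnd (FMem (S (var_bound p)) 0) (ren r p))), u; split.
  { intros Hb; constructor; [lia|apply delta0_ren; auto]. }
  intros i v; simpl.
  assert (F : forall x, Q i x v <-> sat all_sets
     (upd (lookup u v) (S (var_bound p)) x) (ren r p)).
  { intros x; rewrite sat_ren.
    pose proof (E i (fun k => match k with 0 => x | S n => v n end)) as Ex; simpl in Ex.
    etransitivity; [exact Ex|].
    apply sat_ext; intros k Hk; unfold lookup, r.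
    destruct (t k) as [[|m]|a] eqn:Et; [now rewrite upd_same| |];
      rewrite upd_other by lia; simpl; now rewrite Et. }
  split.
  - intros [x [Hx HQ]]; exists x; split; [exact Logic.I|].
    rewrite upd_same; split; [exact Hx|now apply F].
  - intros [x [_ [Hx HQ]]]; exists x; rewrite upd_same in Hx.
    split; [exact Hx|now apply F].
Qed.

Lemma definable_or b Q R :
  definable b Q -> definable b R -> definable b (fun i v => Q i v \/ R i v).
Proof.
  intros HQ HR.
  apply definable_iff with (2 := definable_not (definable_and (definable_not HQ) (definable_not HR))).
  intros; tauto.
Qed.

Lemma definable_imp b Q R :
  definable b Q -> definable b R -> definable b (fun i v => Q i v -> R i v).
Proof.
  intros HQ HR.
  apply definable_iff with (2 := definable_not (definable_and HQ (definable_not HR))).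
  intros; tauto.
Qed.

Lemma definable_equiv b Q R :
  definable b Q -> definable b R -> definable b (fun i v => Q i v <-> R i v).
Proof. intros HQ HR; apply definable_and; apply definable_imp; auto. Qed.

Lemma definable_all Q :
  definable false (fun i v => Q i (v 0) (fun k => v (S k))) ->
  definable false (fun i v => forall x, Q i x v).
Proof.
  intros HQ.
  apply definable_iff with (2 := definable_not (definable_ex (Q := fun i x v => ~ Q i x v) (definable_not HQ))).
  intros i v; split; [|firstorder].
  intros H x; apply NNPP; intros Hx; apply H; now exists x.
Qed.

Lemma definable_prop b (P : Prop) : definable b (fun _ _ => P).
Proof.
  destruct (classic P) as [H|H].
  - apply definable_iff with (2 := definable_eq b (inl 0) (inl 0)); intros; tauto.
  - apply definable_iff with (2 := definable_not (definable_eq b (inl 0) (inl 0))).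
    intros; tauto.
Qed.

Lemma definable_rename b Q (r : nat -> nat) :
  definable b Q -> definable b (fun i v => Q i (fun k => v (r k))).
Proof.
  intros (p & t & Hp & E).
  exists p, (fun k => match t k with inl n => inl (r n) | x => x end); split; auto.
  intros i v; rewrite E; apply sat_ext; intros k _; unfold lookup.
  destruct (t k); auto.
Qed.

(** All quantifiers of [p] become bounded by [v n], so truth of a fixed formula in a set is Delta_0
    in that set, whatever the complexity of [p]. This keeps the existence of a counterexample at
    Sigma_2. *)
Lemma definable_sat b (r : nat -> nat) n p :
  definable b (fun i v => sat (fun x => x in_ v n) (fun k => v (r k)) p).
Proof.
  revert r n; induction p as [i j|i j|p IH|p IHp q IHq|i p IH]; simpl; intros r n.
  - apply (definable_mem b (inl (r i)) (inl (r j))).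
  - apply (definable_eq b (inl (r i)) (inl (r j))).
  - now apply definable_not.
  - now apply definable_and.
  - apply (definable_bex
      (Q := fun _ x v => sat (fun x => x in_ v n) (upd (fun k => v (r k)) i x) p)).
    apply definable_iff with (2 := IH (upd (fun k => S (r k)) i 0) (S n)).
    intros i0 v; apply sat_ext; intros k _; unfold upd; destruct (Nat.eqb k i); auto.
Qed.

End Definability.

(* Definability over one structure, with arbitrary parameters. A term is
   definable when its graph is; [v] lists the free variables, newest first. *)
Section DefinableInOne.
Context {V : set_structure}.

Definition dP (Q : (nat -> V) -> Prop) :=
  definable (I := unit) (M := fun _ => V) (C := V) (fun _ a => a) false (fun _ v => Q v).

Definition dT (t : (nat -> V) -> V) := dP (fun v => v 0 = t (fun k => v (S k))).

Lemma dP_iff (Q R : (nat -> V) -> Prop) : (forall v, Q v <-> R v) -> dP Q -> dP R.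
Proof. intros H; apply definable_iff; auto. Qed.

Lemma dP_not Q : dP Q -> dP (fun v => ~ Q v).
Proof. apply definable_not. Qed.
Lemma dP_and Q R : dP Q -> dP R -> dP (fun v => Q v /\ R v).
Proof. apply definable_and. Qed.
Lemma dP_or Q R : dP Q -> dP R -> dP (fun v => Q v \/ R v).
Proof. apply definable_or. Qed.
Lemma dP_imp Q R : dP Q -> dP R -> dP (fun v => Q v -> R v).
Proof. apply definable_imp. Qed.
Lemma dP_equiv Q R : dP Q -> dP R -> dP (fun v => Q v <-> R v).
Proof. apply definable_equiv. Qed.
Lemma dP_ex (Q : V -> (nat -> V) -> Prop) :
  dP (fun v => Q (v 0) (fun k => v (S k))) -> dP (fun v => exists x, Q x v).
Proof. apply (definable_ex (M := fun _ : unit => V) (Q := fun _ x v => Q x v)). Qed.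
Lemma dP_all (Q : V -> (nat -> V) -> Prop) :
  dP (fun v => Q (v 0) (fun k => v (S k))) -> dP (fun v => forall x, Q x v).
Proof. apply (definable_all (M := fun _ : unit => V) (Q := fun _ x v => Q x v)). Qed.
Lemma dP_prop (P : Prop) : dP (fun _ => P).
Proof. exact (definable_prop (I := unit) (M := fun _ => V) (fun _ (a : V) => a) false P). Qed.
Lemma dP_rename Q (r : nat -> nat) : dP Q -> dP (fun v => Q (fun k => v (r k))).
Proof. exact (definable_rename (I := unit) (M := fun _ => V) (Q := fun _ v => Q v) r). Qed.

Lemma dT_var n : dT (fun v => v n).
Proof.
  exact (definable_eq (I := unit) (M := fun _ => V) (fun _ (a : V) => a) false (inl 0) (inl (S n))).
Qed.
Lemma dT_const a : dT (fun _ => a).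
Proof.
  exact (definable_eq (I := unit) (M := fun _ => V) (fun _ (a : V) => a) false (inl 0) (inr a)).
Qed.
Lemma dT_shift t (r : nat -> nat) : dT t -> dT (fun v => t (fun k => v (r k))).
Proof.
  intros H; exact (dP_rename (fun k => match k with 0 => 0 | S n => S (r n) end) H).
Qed.

Lemma dP_let (Q : V -> (nat -> V) -> Prop) t :
  dT t -> dP (fun v => Q (v 0) (fun k => v (S k))) -> dP (fun v => Q (t v) v).
Proof.
  intros Ht HQ.
  apply dP_iff with (fun v => exists x, x = t v /\ Q x v).
  - intros v; split; [intros (x & -> & H); auto|intros H; eauto].
  - apply dP_ex, dP_and; auto.
Qed.

Lemma dP_mem s t : dT s -> dT t -> dP (fun v => s v in_ t v).
Proof.
  intros Hs Ht.
  apply (dP_let (Q := fun x v => x in_ t v)); auto.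
  apply (dP_let (Q := fun x v => v 0 in_ x)); [apply (dT_shift S); auto|].
  exact (definable_mem (I := unit) (M := fun _ => V) (fun _ (a : V) => a) false (inl 1) (inl 0)).
Qed.
Lemma dP_eq s t : dT s -> dT t -> dP (fun v => s v = t v).
Proof.
  intros Hs Ht.
  apply (dP_let (Q := fun x v => x = t v)); auto.
Qed.

(** Terms meet the formula only at its atoms, where [dP_mem] and [dP_eq] replace them by their
    graphs; under a quantifier they are shifted by one entry. *)
Lemma dP_sat_terms (t : nat -> (nat -> V) -> V) (D : V -> Prop) p :
  dP (fun v => D (v 0)) -> (forall k, dT (t k)) -> dP (fun v => sat D (fun k => t k v) p).
Proof.
  intros HD; revert t; induction p as [i j|i j|p IH|p IHp q IHq|i p IH]; simpl; intros t Ht.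
  - now apply dP_mem.
  - now apply dP_eq.
  - apply dP_not; auto.
  - apply dP_and; auto.
  - apply dP_ex with (Q := fun x v => D x /\ sat D (upd (fun k => t k v) i x) p).
    apply dP_and; auto.
    eapply dP_iff; [|apply (IH (upd (fun k v => t k (fun k => v (S k))) i (fun v => v 0)))].
    + intros v; apply sat_ext; intros k _; unfold upd; destruct (Nat.eqb k i); auto.
    + intros k; unfold upd; destruct (Nat.eqb k i); [apply dT_var|apply dT_shift; auto].
Qed.

Lemma dP_subst Q (t : nat -> (nat -> V) -> V) :
  dP Q -> (forall k, dT (t k)) -> dP (fun v => Q (fun k => t k v)).
Proof.
  intros (p & u & _ & E) Ht.
  eapply dP_iff; [intros v; symmetry; apply (E tt)|].
  eapply dP_iff; [|apply (@dP_sat_terms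
    (fun k v => match u k with inl n => t n v | inr a => a end) all_sets p)].
  - intros v; apply sat_ext; intros k _; unfold lookup; destruct (u k); reflexivity.
  - apply (dP_prop True).
  - intros k; destruct (u k); [auto|apply dT_const].
Qed.

Lemma dP_sub1 (P : V -> Prop) s :
  dP (fun v => P (v 0)) -> dT s -> dP (fun v => P (s v)).
Proof. intros H Hs; apply (dP_subst (t := fun _ => s) H); auto. Qed.

Lemma dP_sub2 (P : V -> V -> Prop) s t :
  dP (fun v => P (v 0) (v 1)) -> dT s -> dT t -> dP (fun v => P (s v) (t v)).
Proof.
  intros H Hs Ht.
  apply (dP_subst (t := fun k => match k with 0 => s | _ => t end) H).
  intros [|]; auto.
Qed.
Lemma dP_sub3 (P : V -> V -> V -> Prop) s t u :
  dP (fun v => P (v 0) (v 1) (v 2)) -> dT s -> dT t -> dT u ->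
  dP (fun v => P (s v) (t v) (u v)).
Proof.
  intros H Hs Ht Hu.
  apply (dP_subst (t := fun k => match k with 0 => s | 1 => t | _ => u end) H).
  intros [|[|]]; auto.
Qed.
Lemma dP_sub4 (P : V -> V -> V -> V -> Prop) s t u w :
  dP (fun v => P (v 0) (v 1) (v 2) (v 3)) -> dT s -> dT t -> dT u -> dT w ->
  dP (fun v => P (s v) (t v) (u v) (w v)).
Proof.
  intros H Hs Ht Hu Hw.
  apply (dP_subst (t := fun k => match k with 0 => s | 1 => t | 2 => u | _ => w end) H).
  intros [|[|[|]]]; auto.
Qed.

Lemma dT_sub1 (f : V -> V) s :
  dP (fun v => v 0 = f (v 1)) -> dT s -> dT (fun v => f (s v)).
Proof.
  intros H Hs; apply (dP_sub2 (P := fun x y => x = f y)); auto.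
  - apply dT_var.
  - apply dT_shift; auto.
Qed.
Lemma dT_sub2 (f : V -> V -> V) s t :
  dP (fun v => v 0 = f (v 1) (v 2)) -> dT s -> dT t -> dT (fun v => f (s v) (t v)).
Proof.
  intros H Hs Ht; apply (dP_sub3 (P := fun x y z => x = f y z)); auto.
  - apply dT_var.
  - apply (dT_shift S); auto.
  - apply (dT_shift S); auto.
Qed.
Lemma dT_sub3 (f : V -> V -> V -> V) s t u :
  dP (fun v => v 0 = f (v 1) (v 2) (v 3)) -> dT s -> dT t -> dT u ->
  dT (fun v => f (s v) (t v) (u v)).
Proof.
  intros H Hs Ht Hu; apply (dP_sub4 (P := fun x y z w => x = f y z w)); auto.
  - apply dT_var.
  - apply (dT_shift S); auto.
  - apply (dT_shift S); auto.
  - apply (dT_shift S); auto.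
Qed.

End DefinableInOne.

(** An extension point of [dp], redefined whenever new definable operations become available. *)
Ltac dp_user := fail.

Ltac dp_step :=
  cbv beta;
  lazymatch goal with
  | |- dT (fun v => v ?n) => apply dT_var
  | |- dT (fun _ => ?a) => apply dT_const
  | |- dT _ => first
      [ match goal with
        | H : dP (fun v => v 0 = ?f (v 1)) |- _ => apply (dT_sub1 H)
        | H : dP (fun v => v 0 = ?f (v 1) (v 2)) |- _ => apply (dT_sub2 H)
        | H : dP (fun v => v 0 = ?f (v 1) (v 2) (v 3)) |- _ => apply (dT_sub3 H)
        | H : dT _ |- _ => exact H
        end
      | dp_user ]
  | |- dP (fun _ => ?a) => apply dP_prop
  | |- dP (fun v => _ /\ _) => apply dP_and
  | |- dP (fun v => _ \/ _) => apply dP_or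
  | |- dP (fun v => ~ _) => apply dP_not
  | |- dP (fun v => _ <-> _) => apply dP_equiv
  | |- dP (fun v => ex _) => apply dP_ex
  | |- dP (fun v => @eq _ _ _) => apply dP_eq
  | |- dP (fun v => mem _ _) => apply dP_mem
  | |- dP (fun v => forall x, _) => first [apply dP_imp | apply dP_all]
  | |- dP _ => first
      [ match goal with
        | H : dP (fun v => ?P (v 0)) |- _ => apply (dP_sub1 (P := P) H)
        | H : dP (fun v => ?P (v 0) (v 1)) |- _ => apply (dP_sub2 (P := P) H)
        | H : dP (fun v => ?P (v 0) (v 1) (v 2)) |- _ => apply (dP_sub3 (P := P) H)
        | H : dP (fun v => ?P (v 0) (v 1) (v 2) (v 3)) |- _ => apply (dP_sub4 (P := P) H)
        | H : dP _ |- _ => exact H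
        end
      | dp_user | apply dP_all | apply dP_ex | apply dP_and
      | apply dP_or | apply dP_not | apply dP_imp ]
  end.
Ltac dp := repeat dp_step.
Ltac dpw tac := repeat (cbv beta; first [tac | dp_step]).

(* Comprehension terms and elementary set theory *)
Existing Class ZF.

Section SetOf.
Context {V : set_structure} {hZF : ZF V}.

Lemma ZF_inhabited : inhabited V.
Proof. destruct (ZF_infinity hZF) as [w _]; exact (inhabits w). Qed.

Definition isset (P : V -> Prop) := exists b, forall x, x in_ b <-> P x.

(** The metatheoretic epsilon only names a set that extensionality makes unique, so no choice is
    used inside [V]. The content lies in the proofs of [isset]. *)
Definition setof (P : V -> Prop) : V :=
  epsilon ZF_inhabited (fun b => forall x, x in_ b <-> P x).

Lemma in_setof P x : isset P -> (x in_ setof P <-> P x).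
Proof. intros H; unfold setof; apply (epsilon_spec ZF_inhabited _ H). Qed.

Lemma setof_E P x : isset P -> x in_ setof P -> P x.
Proof. intros H; apply (in_setof x H). Qed.
Lemma setof_I (P : V -> Prop) x : isset P -> P x -> x in_ setof P.
Proof. intros H; apply (in_setof x H). Qed.

Lemma ext (a b : V) : (forall x, x in_ a <-> x in_ b) -> a = b.
Proof. apply (ZF_extensionality hZF). Qed.

Lemma setof_eq P (a : V) : (forall x, x in_ a <-> P x) -> setof P = a.
Proof.
  intros H; apply ext; intros x; rewrite H; apply in_setof; now exists a.
Qed.

Lemma isset_iff P Q : (forall x, P x <-> Q x) -> isset P -> isset Q.
Proof. intros H [b Hb]; exists b; intros x; rewrite Hb; auto. Qed.

Lemma dP_assign (P : V -> Prop) : dP (fun v => P (v 0)) ->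
  exists p v, forall x, P x <-> sat all_sets (upd v 0 x) p.
Proof.
  intros (p & t & _ & E).
  exists (ren (fun k => match t k with inl 0 => 0 | _ => S k end) p).
  destruct ZF_inhabited as [d].
  exists (fun k => match k with 0 => d | S k => match t k with inr a => a | _ => d end end).
  intros x; rewrite (E tt (fun n => match n with 0 => x | _ => d end)), sat_ren.
  apply sat_ext; intros k _; unfold lookup, upd; destruct (t k) as [[|n]|a] eqn:Et; simpl;
    rewrite ?Et; auto.
Qed.

Lemma dP_assign2 (P : V -> V -> Prop) : dP (fun v => P (v 0) (v 1)) ->
  exists p v, forall x y, P x y <-> sat all_sets (upd (upd v 0 x) 1 y) p.
Proof.
  intros (p & t & _ & E).
  exists (ren (fun k => match t k with inl 0 => 0 | inl 1 => 1 | _ => S (S k) end) p).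
  destruct ZF_inhabited as [d].
  exists (fun k => match k with S (S k) => match t k with inr a => a | _ => d end | _ => d end).
  intros x y; rewrite (E tt (fun n => match n with 0 => x | 1 => y | _ => d end)), sat_ren.
  apply sat_ext; intros k _; unfold lookup, upd; destruct (t k) as [[|[|n]]|a] eqn:Et; simpl;
    rewrite ?Et; auto.
Qed.

End SetOf.

#[global] Opaque dP setof.

Section BasicSets.
Context {V : set_structure} {hZF : ZF V}.

Lemma isset_sep (a : V) P : dP (fun v => P (v 0)) -> isset (fun x => x in_ a /\ P x).
Proof.
  intros H; destruct (dP_assign H) as (p & v & E).
  destruct (ZF_separation hZF p v a) as [b Hb]; exists b; intros x.
  rewrite Hb, E; tauto.
Qed.

Lemma isset_sub (a : V) P :
  (forall x, P x -> x in_ a) -> dP (fun v => P (v 0)) -> isset P.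
Proof.
  intros H HP; apply isset_iff with (2 := isset_sep a HP); firstorder.
Qed.

Lemma isset_repl (a : V) (R : V -> V -> Prop) : dP (fun v => R (v 0) (v 1)) ->
  (forall x y y', x in_ a -> R x y -> R x y' -> y = y') ->
  isset (fun y => exists x, x in_ a /\ R x y).
Proof.
  intros HR Hf.
  (* Replacement demands a value at every element, so [a] is first cut down to the domain of [R]. *)
  assert (Hs : isset (fun x => x in_ a /\ exists y, R x y)) by (apply isset_sep; dp).
  destruct Hs as [a' Ha'].
  destruct (dP_assign2 HR) as (p & v & E).
  destruct (@ZF_replacement _ hZF p v a') as [b Hb].
  - intros x Hx; apply Ha' in Hx; destruct Hx as [Hx [y Hy]].
    exists y; split; [now apply E|]; intros y' Hy'; apply E in Hy'; eauto.
  - exists b; intros y; rewrite Hb; split.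
    + intros (x & Hx & HR'); apply E in HR'; apply Ha' in Hx; firstorder.
    + intros (x & Hx & HR'); exists x; split; [apply Ha'; eauto|now apply E].
Qed.

Lemma isset_image (a : V) (f : V -> V) : dP (fun v => v 0 = f (v 1)) ->
  isset (fun y => exists x, x in_ a /\ y = f x).
Proof.
  intros Hf; apply isset_repl; [dp|congruence].
Qed.

Lemma dT_setof (P : V -> (nat -> V) -> Prop) :
  (forall v, isset (fun x => P x v)) ->
  dP (fun v => P (v 0) (fun k => v (S k))) -> dT (fun v => setof (fun x => P x v)).
Proof.
  intros H HP; red.
  apply dP_iff with (fun v => forall x, x in_ v 0 <-> P x (fun k => v (S k))).
  - intros v; split.
    + intros Hx; symmetry; now apply setof_eq.
    + intros -> x; apply (in_setof x (H _)).
  - apply dP_all, dP_equiv; [dp|].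
    apply (dP_rename (fun k => match k with 0 => 0 | S n => S (S n) end) HP).
Qed.

Lemma setof1_def (P : V -> V -> Prop) : (forall a, isset (fun x => P x a)) ->
  dP (fun v => P (v 0) (v 1)) -> dP (fun v => v 0 = setof (fun x => P x (v 1))).
Proof. intros H HP; apply (dT_setof (P := fun x v => P x (v 0))); auto. Qed.

Definition emp : V := setof (fun _ => False).
Definition upair a b : V := setof (fun z => z = a \/ z = b).
Definition opair a b : V := upair (upair a a) (upair a b).
Definition bigU a : V := setof (fun x => exists y, y in_ a /\ x in_ y).
Definition pow a : V := setof (fun x => subset x a).
Definition cup a b : V := setof (fun x => x in_ a \/ x in_ b).
Definition suc a : V := setof (fun z => z in_ a \/ z = a).

Lemma isset_emp : isset (fun _ : V => False).
Proof.
  destruct ZF_inhabited as [d]; apply isset_sub with d; [tauto|dp].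
Qed.
Lemma in_emp x : x in_ emp <-> False.
Proof. apply (in_setof _ (isset_emp)). Qed.
Lemma isset_upair a b : isset (fun z : V => z = a \/ z = b).
Proof. apply (ZF_pairing hZF). Qed.
Lemma in_upair z a b : z in_ upair a b <-> z = a \/ z = b.
Proof. apply (in_setof _ (isset_upair _ _)). Qed.
Lemma isset_bigU (a : V) : isset (fun x => exists y, y in_ a /\ x in_ y).
Proof. apply (ZF_union hZF). Qed.
Lemma in_bigU x a : x in_ bigU a <-> exists y, y in_ a /\ x in_ y.
Proof. apply (in_setof _ (isset_bigU _)). Qed.
Lemma isset_pow (a : V) : isset (fun x => subset x a).
Proof. apply (ZF_powerset hZF). Qed.
Lemma in_pow x a : x in_ pow a <-> subset x a.
Proof. apply (in_setof x (isset_pow a)). Qed.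
Lemma isset_cup (a b : V) : isset (fun x => x in_ a \/ x in_ b).
Proof.
  exists (bigU (upair a b)); intros x; rewrite in_bigU; split.
  - intros (y & Hy & Hx); apply in_upair in Hy; destruct Hy; subst; auto.
  - intros [H|H]; [exists a|exists b]; rewrite in_upair; auto.
Qed.
Lemma in_cup x a b : x in_ cup a b <-> x in_ a \/ x in_ b.
Proof. apply (in_setof _ (isset_cup _ _)). Qed.
Lemma isset_suc (a : V) : isset (fun z => z in_ a \/ z = a).
Proof.
  exists (cup a (upair a a)); intros x; rewrite in_cup, in_upair; tauto.
Qed.
Lemma in_suc x a : x in_ suc a <-> x in_ a \/ x = a.
Proof. apply (in_setof _ (isset_suc _)). Qed.

Lemma dT_upair s t : dT s -> dT t -> dT (fun v => upair (s v) (t v)).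
Proof.
  apply dT_sub2; apply (dT_setof (P := fun z v => z = v 0 \/ z = v 1)); [intros; apply isset_upair|dp].
Qed.
Lemma dT_opair s t : dT s -> dT t -> dT (fun v => opair (s v) (t v)).
Proof. intros; repeat apply dT_upair; auto. Qed.
Lemma dT_bigU s : dT s -> dT (fun v => bigU (s v)).
Proof.
  apply dT_sub1; apply (dT_setof (P := fun x v => exists y, y in_ v 0 /\ x in_ y)); [intros; apply isset_bigU|dp].
Qed.
Lemma dT_pow s : dT s -> dT (fun v => pow (s v)).
Proof.
  apply dT_sub1; apply (dT_setof (P := fun x v => subset x (v 0))); [intros; apply isset_pow|dp].
Qed.
Lemma dT_cup s t : dT s -> dT t -> dT (fun v => cup (s v) (t v)).
Proof.
  apply dT_sub2; apply (dT_setof (P := fun z v => z in_ v 0 \/ z in_ v 1)); [intros; apply isset_cup|dp].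
Qed.
Lemma dT_suc s : dT s -> dT (fun v => suc (s v)).
Proof.
  apply dT_sub1; apply (dT_setof (P := fun z v => z in_ v 0 \/ z = v 0)); [intros; apply isset_suc|dp].
Qed.

Lemma is_empty_iff (x : V) : is_empty x <-> x = emp.
Proof.
  split; [|intros -> y; now rewrite in_emp].
  intros H; apply ext; intros y; rewrite in_emp; firstorder.
Qed.
Lemma is_pair_iff (p a b : V) : is_pair p a b <-> p = upair a b.
Proof.
  split; [intros H; apply ext; intros z; now rewrite in_upair|].
  intros -> z; apply in_upair.
Qed.
Lemma is_opair_iff (p a b : V) : is_opair p a b <-> p = opair a b.
Proof.
  unfold is_opair, opair; split.
  - intros (s & d & Hs & Hd & Hp); apply is_pair_iff in Hs, Hd, Hp; now subst.
  - intros ->; do 2 eexists; rewrite !is_pair_iff; eauto.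
Qed.
Lemma is_succ_iff (s a : V) : is_succ s a <-> s = suc a.
Proof.
  split; [intros H; apply ext; intros z; now rewrite in_suc|].
  intros -> z; apply in_suc.
Qed.
Lemma maps_iff (f x y : V) : maps f x y <-> opair x y in_ f.
Proof.
  unfold maps; split; [intros (p & H & Hp); apply is_opair_iff in H; now subst|].
  intros H; exists (opair x y); now rewrite is_opair_iff.
Qed.

Lemma upair_inj a b c d : upair a b = upair c d -> (a = c /\ b = d) \/ (a = d /\ b = c).
Proof.
  intros H.
  assert (H1 : forall z, (z = a \/ z = b) <-> (z = c \/ z = d)).
  { intros z; rewrite <- !in_upair, H; tauto. }
  pose proof (proj1 (H1 a) (or_introl eq_refl)).
  pose proof (proj1 (H1 b) (or_intror eq_refl)).
  pose proof (proj2 (H1 c) (or_introl eq_refl)).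
  pose proof (proj2 (H1 d) (or_intror eq_refl)).
  intuition congruence.
Qed.
Lemma opair_inj a b c d : opair a b = opair c d <-> a = c /\ b = d.
Proof.
  split; [|intros [-> ->]; auto]; intros H; unfold opair in H.
  apply upair_inj in H; destruct H as [[H1 H2]|[H1 H2]];
    apply upair_inj in H1, H2; intuition congruence.
Qed.

Definition prod a b : V := setof (fun p => exists x y, x in_ a /\ y in_ b /\ p = opair x y).

Lemma isset_prod (a b : V) : isset (fun p => exists x y, x in_ a /\ y in_ b /\ p = opair x y).
Proof.
  apply isset_sub with (pow (pow (cup a b))).
  - intros p (x & y & Hx & Hy & ->); apply in_pow; intros z Hz; apply in_pow; intros w Hw.
    apply in_upair in Hz; apply in_cup.
    destruct Hz; subst z; apply in_upair in Hw; destruct Hw; subst; auto.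
  - dp; apply dT_opair; dp.
Qed.
Lemma in_prod p a b : p in_ prod a b <-> exists x y, x in_ a /\ y in_ b /\ p = opair x y.
Proof. apply (in_setof _ (isset_prod _ _)). Qed.
Lemma opair_in_prod x y a b : opair x y in_ prod a b <-> x in_ a /\ y in_ b.
Proof.
  rewrite in_prod; split; [|firstorder].
  intros (x' & y' & Hx & Hy & E); apply opair_inj in E; destruct E; subst; auto.
Qed.
Lemma dT_prod s t : dT s -> dT t -> dT (fun v => prod (s v) (t v)).
Proof.
  apply dT_sub2; apply (dT_setof (P := fun p v => exists x y, x in_ v 0 /\ y in_ v 1 /\ p = opair x y));
   [intros; apply isset_prod|dp; apply dT_opair; dp].
Qed.

(* Union of all values of [f] at [x]; the value itself when it is unique. *)
Definition app f x : V := setof (fun z => exists y, opair x y in_ f /\ z in_ y).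

Lemma isset_app (f x : V) : isset (fun z => exists y, opair x y in_ f /\ z in_ y).
Proof.
  apply isset_sub with (bigU (bigU (bigU f))).
  - intros z (y & Hp & Hz); apply in_bigU; exists y; split; auto.
    apply in_bigU; exists (upair x y); split; [|apply in_upair; auto].
    apply in_bigU; exists (opair x y); split; auto; apply in_upair; auto.
  - dp; apply dT_opair; dp.
Qed.
Lemma dT_app s t : dT s -> dT t -> dT (fun v => app (s v) (t v)).
Proof.
  apply dT_sub2; apply (dT_setof (P := fun z v => exists y, opair (v 1) y in_ (v 0) /\ z in_ y));
   [intros; apply isset_app|dp; apply dT_opair; dp].
Qed.
Lemma app_unique f x y : opair x y in_ f -> (forall y', opair x y' in_ f -> y' = y) -> app f x = y.
Proof.
  intros H Hu; apply setof_eq; intros z; split; [firstorder|].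
  intros (y' & Hy & Hz); apply Hu in Hy; now subst.
Qed.

Definition func f a := (forall p, p in_ f -> exists x, x in_ a /\ p = opair x (app f x)) /\
  forall x, x in_ a -> opair x (app f x) in_ f.

Lemma func_app f a x y : func f a -> (opair x y in_ f <-> x in_ a /\ y = app f x).
Proof.
  intros [H1 H2]; split.
  - intros H; destruct (H1 _ H) as (x' & Hx & E); apply opair_inj in E; destruct E; subst; auto.
  - intros [Hx ->]; auto.
Qed.

Lemma is_fun_iff f a b : is_fun f a b <-> func f a /\ forall x, x in_ a -> app f x in_ b.
Proof.
  split.
  - intros [H1 H2].
    assert (Ha : forall x, x in_ a -> opair x (app f x) in_ f /\ forall y, opair x y in_ f -> y = app f x).
    { intros x Hx; destruct (H2 x Hx) as (y & Hy & Hu); rewrite maps_iff in Hy.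
      assert (E : app f x = y).
      { apply app_unique; auto; intros y' Hy'; symmetry; apply Hu; now apply maps_iff. }
      rewrite E; split; auto; intros y' Hy'; symmetry; apply Hu; now apply maps_iff. }
    split; [split|].
    + intros p Hp; destruct (H1 p Hp) as (x & y & Hx & Hy & E); apply is_opair_iff in E; subst.
      exists x; split; auto; f_equal; now apply Ha.
    + intros x Hx; now apply Ha.
    + intros x Hx; destruct (Ha x Hx) as [Hp _]; destruct (H1 _ Hp) as (x' & y & _ & Hy & E).
      apply is_opair_iff, opair_inj in E; destruct E as [_ E]; now rewrite E.
  - intros [Hf Hb]; split.
    + intros p Hp; destruct Hf as [Hf _]; destruct (Hf p Hp) as (x & Hx & E).
      exists x, (app f x); rewrite is_opair_iff; auto.
    + intros x Hx; exists (app f x); split; [apply maps_iff; now apply Hf|].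
      intros y Hy; apply maps_iff in Hy; apply (func_app _ _ Hf) in Hy; now destruct Hy.
Qed.

Lemma func_ext f g a : func f a -> func g a -> (forall x, x in_ a -> app f x = app g x) -> f = g.
Proof.
  intros Hf Hg H; apply ext; intros p; split; intros Hp.
  - destruct Hf as [H1 H2]; destruct (H1 p Hp) as (x & Hx & ->); rewrite H by auto; now apply Hg.
  - destruct Hg as [H1 H2]; destruct (H1 p Hp) as (x & Hx & ->); rewrite <- H by auto; now apply Hf.
Qed.

Definition mkfun a (g : V -> V) : V := setof (fun p => exists x, x in_ a /\ p = opair x (g x)).

Lemma isset_mkfun a (g : V -> V) : dP (fun v => v 0 = g (v 1)) ->
  isset (fun p => exists x, x in_ a /\ p = opair x (g x)).
Proof. intros H; apply (isset_image a (f := fun x => opair x (g x))). dp; apply dT_opair; dp. Qed.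

Lemma in_mkfun a g p : dP (fun v => v 0 = g (v 1)) ->
  (p in_ mkfun a g <-> exists x, x in_ a /\ p = opair x (g x)).
Proof. intros H; apply (in_setof _ (isset_mkfun _ H)). Qed.

Lemma app_mkfun a g x : dP (fun v => v 0 = g (v 1)) -> x in_ a -> app (mkfun a g) x = g x.
Proof.
  intros H Hx; apply app_unique; [apply in_mkfun; eauto|].
  intros y Hy; apply (in_mkfun _ _ H) in Hy; destruct Hy as (x' & _ & E); apply opair_inj in E.
  destruct E; subst; auto.
Qed.

Lemma func_mkfun a g : dP (fun v => v 0 = g (v 1)) -> func (mkfun a g) a.
Proof.
  intros H; split.
  - intros p Hp; apply (in_mkfun _ _ H) in Hp; destruct Hp as (x & Hx & ->).
    exists x; rewrite app_mkfun; auto.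
  - intros x Hx; rewrite app_mkfun by auto; apply in_mkfun; eauto.
Qed.

Lemma dP_func s t : dT s -> dT t -> dP (fun v => func (s v) (t v)).
Proof.
  apply dP_sub2; unfold func; dp; apply dT_opair; dp; apply dT_app; dp.
Qed.

Definition funspace a b : V := setof (fun f => func f a /\ forall x, x in_ a -> app f x in_ b).

Lemma isset_funspace a b : isset (fun f => func f a /\ forall x, x in_ a -> app f x in_ b).
Proof.
  apply isset_sub with (pow (prod a b)).
  - intros f [[H1 _] H2]; apply in_pow; intros p Hp; destruct (H1 p Hp) as (x & Hx & ->).
    apply opair_in_prod; auto.
  - dp; repeat (first [apply dT_opair|apply dT_app]; dp).
Qed.
Lemma in_funspace f a b : f in_ funspace a b <-> is_fun f a b.
Proof. rewrite is_fun_iff; apply (in_setof _ (isset_funspace _ _)). Qed.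

End BasicSets.

Ltac dp_sets := first [apply dT_opair | apply dT_app | apply dT_upair | apply dT_suc | apply dT_bigU
  | apply dT_pow | apply dT_cup | apply dT_prod | apply dP_func].
Ltac dp_user ::= dp_sets.

(** * Ordinals, recursion and the cumulative hierarchy *)

Section Ordinals.
Context {V : set_structure} {hZF : ZF V}.
Implicit Types a b c x y z f : V.

Lemma mem_irrefl x : ~ x in_ x.
Proof.
  intros H; destruct (ZF_foundation hZF (a := upair x x)) as (y & Hy & Hm).
  - exists x; apply in_upair; auto.
  - apply in_upair in Hy; assert (y = x) by tauto; subst y.
    apply (Hm x H), in_upair; auto.
Qed.

Lemma mem_asym x y : x in_ y -> ~ y in_ x.
Proof.
  intros H1 H2; destruct (ZF_foundation hZF (a := upair x y)) as (z & Hz & Hm).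
  - exists x; apply in_upair; auto.
  - apply in_upair in Hz; destruct Hz; subst z;
      [apply (Hm y)|apply (Hm x)]; auto; apply in_upair; auto.
Qed.

Lemma ord_in a x : ordinal a -> x in_ a -> ordinal x.
Proof.
  intros [H1 H2] Hx; split; [auto|]; intros y Hy; apply H2, (H1 x); auto.
Qed.

Lemma ord_trans a b c : ordinal c -> a in_ b -> b in_ c -> a in_ c.
Proof. intros [H _] Ha Hb; exact (H b Hb a Ha). Qed.

Lemma ord_ind (P : V -> Prop) : dP (fun v => P (v 0)) ->
  (forall a, ordinal a -> (forall b, b in_ a -> P b) -> P a) -> forall a, ordinal a -> P a.
Proof.
  intros HP IH a Ha; apply NNPP; intros Hn.
  assert (Hs : isset (fun x => x in_ suc a /\ ~ P x)) by (apply isset_sep; dp).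
  destruct (ZF_foundation hZF (a := setof (fun x => x in_ suc a /\ ~ P x))) as (x & Hx & Hm).
  - exists a; apply setof_I; auto; rewrite in_suc; auto.
  - apply setof_E in Hx; auto; destruct Hx as [Hx Hnx]; apply Hnx.
    assert (Ox : ordinal x).
    { apply in_suc in Hx; destruct Hx; subst; auto; now apply ord_in with a. }
    apply IH; auto; intros y Hy; apply NNPP; intros Hny; apply (Hm y Hy).
    apply setof_I; auto; split; auto; apply in_suc; left.
    apply in_suc in Hx; destruct Hx; subst; auto; now apply ord_trans with x.
Qed.

Lemma ord_tri a b : ordinal a -> ordinal b -> a in_ b \/ a = b \/ b in_ a.
Proof.
  intros Ha; revert a Ha b.
  apply (ord_ind (P := fun a => forall b, ordinal b -> a in_ b \/ a = b \/ b in_ a)); [dp|].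
  intros a Ha IHa.
  apply (ord_ind (P := fun b => a in_ b \/ a = b \/ b in_ a)); [dp|].
  intros b Hb IHb; apply NNPP; intros Hn; apply Hn; right; left; apply ext; intros x; split; intros Hx.
  - destruct (IHa x Hx b Hb) as [H|[H|H]]; auto; exfalso; apply Hn; subst; auto.
    right; right; now apply ord_trans with x.
  - destruct (IHb x Hx) as [H|[H|H]]; auto; exfalso; apply Hn; subst; auto.
    left; now apply ord_trans with x.
Qed.

Lemma ord_sub a b : ordinal a -> ordinal b -> (subset a b <-> a in_ b \/ a = b).
Proof.
  intros Ha Hb; split.
  - intros H; destruct (ord_tri Ha Hb) as [|[|H1]]; auto.
    exfalso; exact (mem_irrefl (H _ H1)).
  - intros [H| ->] x Hx; auto; now apply ord_trans with a.
Qed.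

Lemma ord_le_or_lt a b : ordinal a -> ordinal b -> subset a b \/ b in_ a.
Proof.
  intros Ha Hb; destruct (ord_tri Ha Hb) as [H|[H|H]]; auto; left; apply ord_sub; auto.
Qed.

Lemma sub_lt_trans a b c : ordinal a -> ordinal c -> subset a b -> ordinal b -> b in_ c -> a in_ c.
Proof.
  intros Ha Hc H Hb Hbc; apply ord_sub in H; auto; destruct H; subst; auto.
  now apply ord_trans with b.
Qed.

Lemma ord_emp : ordinal emp.
Proof. split; intros x Hx; now apply in_emp in Hx. Qed.

Lemma ord_suc a : ordinal a -> ordinal (suc a).
Proof.
  intros [H1 H2]; split.
  - intros x Hx y Hy; apply in_suc; left; apply in_suc in Hx; destruct Hx; subst; auto.
    exact (H1 x H y Hy).
  - intros x Hx; apply in_suc in Hx; destruct Hx; subst; auto.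
Qed.

Lemma ord_bigU s : (forall x, x in_ s -> ordinal x) -> ordinal (bigU s).
Proof.
  intros H; split.
  - intros x Hx y Hy; apply in_bigU in Hx; destruct Hx as (z & Hz & Hx).
    apply in_bigU; exists z; split; auto; apply ord_trans with x; auto.
  - intros x Hx; apply in_bigU in Hx; destruct Hx as (z & Hz & Hx).
    exact (proj1 (ord_in (H z Hz) Hx)).
Qed.

Lemma suc_sub a b : ordinal b -> a in_ b -> subset (suc a) b.
Proof. intros Hb H x Hx; apply in_suc in Hx; destruct Hx; subst; auto; now apply ord_trans with a. Qed.

Lemma bigU_suc a : ordinal a -> bigU (suc a) = a.
Proof.
  intros Ha; apply ext; intros x; rewrite in_bigU; split.
  - intros (y & Hy & Hx); apply in_suc in Hy; destruct Hy; subst; auto; now apply ord_trans with y.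
  - intros Hx; exists a; rewrite in_suc; auto.
Qed.

Lemma ord_least (P : V -> Prop) : dP (fun v => P (v 0)) ->
  (exists a, ordinal a /\ P a) ->
  exists a, ordinal a /\ P a /\ forall b, b in_ a -> ~ P b.
Proof.
  intros HP [a [Ha Pa]]; apply NNPP; intros Hn.
  revert Pa; revert a Ha.
  apply (ord_ind (P := fun a => ~ P a)); [dp|].
  intros a Ha IH Pa; apply Hn; exists a; auto.
Qed.

(** Burali-Forti: otherwise the ordinals would form a set, which would be an ordinal and so a member
    of itself. *)
Lemma ord_unbounded s : exists a, ordinal a /\ ~ a in_ s.
Proof.
  apply NNPP; intros Hn.
  assert (H : forall a, ordinal a -> a in_ s) by (intros a Ha; apply NNPP; eauto).
  assert (Hs : isset (fun x : V => ordinal x)).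
  { apply isset_sub with s; auto; unfold ordinal, transitive, subset; dp. }
  assert (Ho : ordinal (setof (@ordinal V))).
  { split; intros x Hx; (apply setof_E in Hx; [|assumption]).
    - intros y Hy; apply setof_I; auto; now apply ord_in with x.
    - exact (proj1 Hx). }
  apply (@mem_irrefl (setof (@ordinal V))), setof_I; auto.
Qed.

Lemma dP_ordinal (s : (nat -> V) -> V) : dT s -> dP (fun v => ordinal (s v)).
Proof. apply dP_sub1 with (P := @ordinal V); unfold ordinal, transitive, subset; dp. Qed.
Lemma dP_subset (s t : (nat -> V) -> V) : dT s -> dT t -> dP (fun v => subset (s v) (t v)).
Proof. apply dP_sub2; unfold subset; dp. Qed.

Definition omega : V := setof (fun n => forall u, inductive u -> n in_ u).

Lemma inductive_iff u : inductive u <-> emp in_ u /\ forall n, n in_ u -> suc n in_ u.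
Proof.
  unfold inductive; split.
  - intros [(e & He & Heu) H]; apply is_empty_iff in He; subst; split; auto.
    intros n Hn; destruct (H n Hn) as (s & Hs & Hsu); apply is_succ_iff in Hs; now subst.
  - intros [H1 H2]; split; [exists emp; rewrite is_empty_iff; auto|].
    intros n Hn; exists (suc n); rewrite is_succ_iff; auto.
Qed.

Lemma isset_omega : isset (fun n : V => forall u, inductive u -> n in_ u).
Proof.
  destruct (ZF_infinity hZF) as [w Hw]; apply isset_sub with w; [auto|].
  unfold inductive, is_empty, is_succ; dp.
Qed.
Lemma in_omega n : n in_ omega <-> forall u, inductive u -> n in_ u.
Proof. apply (in_setof _ (isset_omega)). Qed.

Lemma emp_omega : emp in_ omega.
Proof. apply in_omega; intros u Hu; now apply inductive_iff in Hu. Qed.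
Lemma suc_omega n : n in_ omega -> suc n in_ omega.
Proof.
  rewrite !in_omega; intros H u Hu; pose proof (H u Hu); apply inductive_iff in Hu.
  now apply Hu.
Qed.
Lemma is_omega_iff w : is_omega w <-> w = omega.
Proof.
  assert (Hi : inductive omega).
  { apply inductive_iff; split; [apply emp_omega|apply suc_omega]. }
  split.
  - intros [H1 H2]; apply ext; intros x; split; intros Hx.
    + exact (H2 omega Hi x Hx).
    + apply in_omega; auto.
  - intros ->; split; auto; intros u Hu x Hx; exact (proj1 (in_omega x) Hx u Hu).
Qed.

(** Restricted to definable predicates, as [omega] may contain nonstandard numbers. For this reason
    inductions over numbers and codes begin by proving their predicate definable. *)
Lemma omega_ind (P : V -> Prop) : dP (fun v => P (v 0)) ->
  P emp -> (forall n, n in_ omega -> P n -> P (suc n)) -> forall n, n in_ omega -> P n.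
Proof.
  intros HP H0 HS n Hn.
  assert (Hs : isset (fun x => x in_ omega /\ P x)) by (apply isset_sep; dp).
  enough (Hi : inductive (setof (fun x => x in_ omega /\ P x))).
  - apply (proj1 (in_omega n) Hn), setof_E in Hi; tauto.
  - apply inductive_iff; split; [apply setof_I; auto using emp_omega|].
    intros m Hm; apply setof_E in Hm; auto; apply setof_I; auto; destruct Hm; auto using suc_omega.
Qed.

Lemma ord_nat n : n in_ omega -> ordinal n.
Proof.
  apply (omega_ind (P := fun n => ordinal n)); [apply dP_ordinal; dp|apply ord_emp|].
  intros; now apply ord_suc.
Qed.

Lemma ord_omega : ordinal omega.
Proof.
  split; [|intros x Hx; exact (proj1 (ord_nat Hx))].
  intros n; apply (omega_ind (P := fun n => subset n omega)); [apply dP_subset; dp| |].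
  - intros x Hx; now apply in_emp in Hx.
  - intros m Hm IH x Hx; apply in_suc in Hx; destruct Hx; subst; auto.
Qed.

Lemma nat_case n : n in_ omega -> n = emp \/ exists m, m in_ omega /\ n = suc m.
Proof.
  apply (omega_ind (P := fun n => n = emp \/ exists m, m in_ omega /\ n = suc m)); [dp; dp_sets; dp|auto|].
  intros m Hm _; right; eauto.
Qed.

Fixpoint num (n : nat) : V := match n with 0 => emp | S m => suc (num m) end.

Lemma num_omega n : num n in_ omega.
Proof. induction n; simpl; auto using emp_omega, suc_omega. Qed.

Lemma is_numeral_iff n x : is_numeral n x <-> x = num n.
Proof.
  revert x; induction n as [|n IH]; simpl; intros x; [apply is_empty_iff|].
  split.
  - intros (y & Hy & Hs); apply IH in Hy; apply is_succ_iff in Hs; now subst.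
  - intros ->; exists (num n); rewrite IH, is_succ_iff; auto.
Qed.

Lemma num_lt m n : m < n -> num m in_ num n.
Proof.
  induction 1; simpl; apply in_suc; auto.
Qed.

Lemma num_inj m n : num m = num n -> m = n.
Proof.
  intros H; destruct (Nat.lt_trichotomy m n) as [L|[L|L]]; auto; exfalso;
    apply num_lt in L; rewrite H in L; exact (mem_irrefl L).
Qed.

End Ordinals.

Ltac dp_ord := first [dp_sets | apply dP_ordinal | apply dP_subset].
Ltac dp_user ::= dp_ord.

Section Recursion.
Context {V : set_structure} {hZF : ZF V}.
Implicit Types a b c x y z f : V.

Definition restr f d : V := setof (fun p => p in_ f /\ exists x y, x in_ d /\ p = opair x y).

Lemma isset_restr f d : isset (fun p => p in_ f /\ exists x y, x in_ d /\ p = opair x y).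
Proof. apply isset_sep; dp. Qed.
Lemma dT_restr (s t : (nat -> V) -> V) : dT s -> dT t -> dT (fun v => restr (s v) (t v)).
Proof.
  apply dT_sub2; apply (dT_setof (P := fun p v => p in_ v 0 /\ exists x y, x in_ v 1 /\ p = opair x y));
   [intros; apply isset_restr|dp].
Qed.
Lemma in_restr f d x y : opair x y in_ restr f d <-> opair x y in_ f /\ x in_ d.
Proof.
  unfold restr; rewrite (in_setof _ (isset_restr f d)); split.
  - intros [H (x' & y' & Hx & E)]; apply opair_inj in E; destruct E; subst; auto.
  - intros [H1 H2]; split; eauto.
Qed.
Lemma app_restr f d x : x in_ d -> app (restr f d) x = app f x.
Proof.
  intros Hx; apply ext; intros z; unfold app; rewrite !(in_setof _ (isset_app _ _)).
  split; intros (y & Hy & Hz); exists y; split; auto; [now apply in_restr in Hy|].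
  apply in_restr; auto.
Qed.
Lemma func_restr f a d : func f a -> subset d a -> func (restr f d) d.
Proof.
  intros Hf Hd; split.
  - intros p Hp; unfold restr in Hp; apply setof_E in Hp; [|apply isset_restr].
    destruct Hp as [Hp (x & y & Hx & ->)]; exists x; split; auto.
    rewrite app_restr by auto; apply (func_app _ _ Hf) in Hp; destruct Hp; now subst.
  - intros x Hx; rewrite app_restr by auto; apply in_restr; split; auto; now apply Hf, Hd.
Qed.

(** Well-foundedness is assumed as induction for definable predicates. The same recursion then
    serves the ordinals, comparison of ranks, restricted membership and the ordering of pairs. *)
Variables (Rel : V -> V -> Prop) (H : V -> V -> V).
Hypotheses (Rel_def : dP (fun v => Rel (v 0) (v 1)))
  (Rel_trans : forall a b c, Rel a b -> Rel b c -> Rel a c)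
  (Rel_set : forall a, isset (fun b => Rel b a))
  (Rel_ind : forall P, dP (fun v => P (v 0)) ->
     (forall a, (forall b, Rel b a -> P b) -> P a) -> forall a, P a)
  (H_def : dP (fun v => v 0 = H (v 1) (v 2))).

Definition below a : V := setof (fun b => Rel b a).
Lemma in_below b a : b in_ below a <-> Rel b a.
Proof. apply (in_setof b (Rel_set a)). Qed.
Lemma dT_below s : dT s -> dT (fun v => below (s v)).
Proof. apply dT_sub1; apply (dT_setof (P := fun b v => Rel b (v 0))); auto; dp. Qed.

Definition attempt a f := func f (below a) /\
  forall b, Rel b a -> app f b = H b (restr f (below b)).

Lemma dP_attempt s t : dT s -> dT t -> dP (fun v => attempt (s v) (t v)).
Proof.
  apply dP_sub2; unfold attempt; dpw ltac:(first [apply dT_below|apply dT_restr]).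
Qed.

Lemma attempt_unique a f g : attempt a f -> attempt a g -> f = g.
Proof.
  intros [Ff Hf] [Fg Hg]; apply func_ext with (below a); auto.
  enough (forall x, Rel x a -> app f x = app g x) by (intros x Hx; apply in_below in Hx; auto).
  apply (Rel_ind (P := fun x => Rel x a -> app f x = app g x)); [dp|].
  intros b IH Hb; rewrite Hf, Hg by auto; f_equal.
  apply func_ext with (below b).
  - apply func_restr with (below a); auto; intros x Hx; apply in_below in Hx; apply in_below; eauto.
  - apply func_restr with (below a); auto; intros x Hx; apply in_below in Hx; apply in_below; eauto.
  - intros x Hx; rewrite !app_restr by auto; apply in_below in Hx; eauto.
Qed.

Lemma below_sub b a : Rel b a -> subset (below b) (below a).
Proof. intros Hb x Hx; apply in_below in Hx; apply in_below; eauto. Qed.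

Lemma attempt_restr a f b : attempt a f -> Rel b a -> attempt b (restr f (below b)).
Proof.
  intros [Ff Hf] Hb; split; [apply func_restr with (below a); auto using below_sub|].
  intros c Hc; rewrite app_restr by (now apply in_below); rewrite Hf by eauto; f_equal.
  apply func_ext with (below c).
  - apply func_restr with (below a); auto; apply below_sub; eauto.
  - apply func_restr with (below b); auto using below_sub.
    apply func_restr with (below a); auto using below_sub.
  - intros x Hx; rewrite !app_restr; auto; apply in_below in Hx; apply in_below; eauto.
Qed.

Lemma attempt_exists a : exists f, attempt a f.
Proof.
  revert a; apply (Rel_ind (P := fun a => exists f, attempt a f)).
  { dpw ltac:(apply dP_attempt). }
  intros a IH.
  set (R := fun b p => exists f, attempt b f /\ p = opair b (H b f)).
  assert (HR : dP (fun v => R (v 0) (v 1))) by (unfold R; dpw ltac:(apply dP_attempt)).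
  assert (Hs : isset (fun p => exists b, b in_ below a /\ R b p)).
  { apply isset_repl; auto; intros x y y' _ (f & Hf & ->) (g & Hg & ->).
    now rewrite (attempt_unique Hf Hg). }
  set (F := setof (fun p => exists b, b in_ below a /\ R b p)).
  assert (HF : forall b f, Rel b a -> attempt b f -> opair b (H b f) in_ F /\ app F b = H b f).
  { intros b f Hb Hf.
    assert (Hin : opair b (H b f) in_ F).
    { apply setof_I; auto; exists b; split; [now apply in_below|]; exists f; auto. }
    split; auto; apply app_unique; auto; intros y Hy; apply setof_E in Hy; auto.
    destruct Hy as (b' & _ & g & Hg & E); apply opair_inj in E; destruct E; subst.
    now rewrite (attempt_unique Hf Hg). }
  exists F; split; [split|].
  - intros p Hp; pose proof Hp as Hp'; apply setof_E in Hp; auto.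
    destruct Hp as (b & Hb & f & Hf & ->); exists b; split; auto.
    apply in_below in Hb; now rewrite (proj2 (HF b f Hb Hf)).
  - intros b Hb; apply in_below in Hb; destruct (IH b Hb) as [f Hf].
    rewrite (proj2 (HF b f Hb Hf)); now apply HF.
  - intros b Hb; destruct (IH b Hb) as [f Hf]; rewrite (proj2 (HF b f Hb Hf)); f_equal.
    assert (HFb : forall c, Rel c b -> opair c (app f c) in_ F /\ app F c = app f c).
    { intros c Hc; pose proof (attempt_restr Hf Hc) as Hg.
      rewrite (proj2 Hf c Hc); apply HF; eauto. }
    apply ext; intros p; split.
    + intros Hp; destruct Hf as [[Hf1 _] _]; destruct (Hf1 p Hp) as (c & Hc & ->).
      apply in_restr; split; auto; apply in_below in Hc; now apply HFb.
    + intros Hp; pose proof Hp as Hp'; unfold restr in Hp; apply setof_E in Hp; [|apply isset_restr].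
      destruct Hp as [_ (c & y & Hc & ->)]; apply in_restr in Hp'; destruct Hp' as [Hp' _].
      pose proof Hc as Hc'; apply in_below in Hc; apply setof_E in Hp'; auto.
      destruct Hp' as (c' & Hc'' & g & Hg & E); apply opair_inj in E; destruct E; subst c' y.
      apply (func_app _ _ (proj1 Hf)); split; auto.
      rewrite <- (proj2 (HFb c Hc)), (proj2 (HF c g ltac:(eauto) Hg)); auto.
Qed.

(** The inner set is the union of all attempts at [a], that is, the unique one; the union makes it a
    comprehension term. *)
Definition recfun a : V := H a (setof (fun p => exists f, attempt a f /\ p in_ f)).

Lemma recfun_attempt a f : attempt a f -> recfun a = H a f.
Proof.
  intros Hf; unfold recfun; f_equal; apply setof_eq; intros p; split; eauto.
  intros (g & Hg & Hp); now rewrite (attempt_unique Hf Hg).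
Qed.

Lemma recfun_def : dP (fun v => v 0 = recfun (v 1)).
Proof.
  apply dP_iff with (fun v => exists f, attempt (v 1) f /\ v 0 = H (v 1) f).
  - intros v; split.
    + intros (f & Hf & ->); now rewrite (recfun_attempt Hf).
    + intros ->; destruct (attempt_exists (v 1)) as [f Hf]; exists f; split; auto.
      now apply recfun_attempt.
  - dpw ltac:(apply dP_attempt).
Qed.

Lemma recfun_eq a : recfun a = H a (mkfun (below a) recfun).
Proof.
  destruct (attempt_exists a) as [f Hf]; rewrite (recfun_attempt Hf); f_equal.
  pose proof recfun_def.
  apply func_ext with (below a); [apply Hf|now apply func_mkfun|].
  intros b Hb; rewrite app_mkfun by auto; apply in_below in Hb.
  rewrite (recfun_attempt (attempt_restr Hf Hb)); now apply Hf.
Qed.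

End Recursion.

Section Hierarchy.
Context {V : set_structure} {hZF : ZF V}.
Implicit Types a b c x y z f : V.

(** Requiring [a] to be an ordinal leaves other sets without predecessors, so the relation is
    transitive and well-founded on all of [V], as [recfun] demands. *)
Definition ord_lt b a := ordinal a /\ b in_ a.

Lemma ord_lt_def : dP (fun v : nat -> V => ord_lt (v 0) (v 1)).
Proof. unfold ord_lt; dp. Qed.
Lemma ord_lt_trans a b c : ord_lt a b -> ord_lt b c -> ord_lt a c.
Proof. intros [H1 H2] [H3 H4]; split; auto; now apply ord_trans with b. Qed.
Lemma ord_lt_set a : isset (fun b => ord_lt b a).
Proof. apply isset_sub with a; unfold ord_lt; [tauto|dp]. Qed.
Lemma ord_lt_ind (P : V -> Prop) : dP (fun v => P (v 0)) ->
  (forall a, (forall b, ord_lt b a -> P b) -> P a) -> forall a, P a.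
Proof.
  intros HP IH a; destruct (classic (ordinal a)) as [Ha|Ha].
  - revert a Ha; apply ord_ind; auto; intros a Ha H; apply IH; intros b [_ Hb]; auto.
  - apply IH; intros b [Hb _]; tauto.
Qed.

Definition ordfun (H : V -> V -> V) := recfun ord_lt H.

Lemma ordfun_def H : dP (fun v => v 0 = H (v 1) (v 2)) -> dP (fun v => v 0 = ordfun H (v 1)).
Proof.
  intros HH; exact (recfun_def ord_lt_def ord_lt_trans ord_lt_set ord_lt_ind HH).
Qed.

Lemma ordfun_eq H a : dP (fun v => v 0 = H (v 1) (v 2)) -> ordinal a ->
  ordfun H a = H a (mkfun a (ordfun H)).
Proof.
  intros HH Ha; unfold ordfun at 1; rewrite (recfun_eq ord_lt_def ord_lt_trans ord_lt_set ord_lt_ind HH).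
  f_equal; f_equal; apply setof_eq; intros x; unfold ord_lt; tauto.
Qed.

Definition Vstep a f : V := setof (fun x => exists c, c in_ a /\ subset x (app f c)).

Lemma isset_Vstep a f : isset (fun x => exists c, c in_ a /\ subset x (app f c)).
Proof.
  assert (Hd : dP (fun v => v 0 = app f (v 1))) by dp.
  apply isset_sub with (bigU (setof (fun y => exists c, c in_ a /\ y = pow (app f c)))).
  - intros x (c & Hc & Hx); apply in_bigU; exists (pow (app f c)); split; [|now apply in_pow].
    apply setof_I; [|eauto]; apply (isset_image a (f := fun c => pow (app f c))); dp.
  - dp.
Qed.
Lemma Vstep_def : dP (fun v => v 0 = Vstep (v 1) (v 2)).
Proof.
  apply (dT_setof (P := fun x v => exists c, c in_ v 0 /\ subset x (app (v 1) c))); [intros; apply isset_Vstep|dp].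
Qed.

Definition Vf : V -> V := ordfun Vstep.

Lemma Vf_def : dP (fun v => v 0 = Vf (v 1)).
Proof. apply ordfun_def, Vstep_def. Qed.
Lemma dT_Vf s : dT s -> dT (fun v => Vf (s v)).
Proof. apply dT_sub1, Vf_def. Qed.

Lemma in_Vf x a : ordinal a -> (x in_ Vf a <-> exists c, c in_ a /\ subset x (Vf c)).
Proof.
  intros Ha; unfold Vf at 1; rewrite (ordfun_eq Vstep_def Ha); unfold Vstep.
  rewrite (in_setof _ (isset_Vstep _ _)).
  split; intros (c & Hc & Hx); exists c; (split; [auto|]);
    rewrite (app_mkfun Vf_def Hc) in *; auto.
Qed.

Lemma Vf_mono_sub a b : ordinal a -> b in_ a -> subset (Vf b) (Vf a).
Proof.
  intros Ha Hb x Hx; assert (Ob := ord_in Ha Hb); apply in_Vf in Hx; auto.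
  destruct Hx as (c & Hc & Hx); apply in_Vf; auto; exists c; split; auto; now apply ord_trans with b.
Qed.
Lemma Vf_in a b : ordinal a -> b in_ a -> Vf b in_ Vf a.
Proof. intros Ha Hb; apply in_Vf; auto; exists b; split; auto; intros x; auto. Qed.
Lemma Vf_super a x y : ordinal a -> y in_ Vf a -> subset x y -> x in_ Vf a.
Proof.
  intros Ha Hy Hx; apply in_Vf in Hy; auto; destruct Hy as (c & Hc & Hy).
  apply in_Vf; auto; exists c; split; auto; intros z Hz; auto.
Qed.
Lemma Vf_trans a : ordinal a -> transitive (Vf a).
Proof.
  intros Ha x Hx y Hy; apply in_Vf in Hx; auto; destruct Hx as (c & Hc & Hx).
  apply (Vf_mono_sub Ha Hc); auto.
Qed.
Lemma in_Vf_suc x a : ordinal a -> (x in_ Vf (suc a) <-> subset x (Vf a)).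
Proof.
  intros Ha; rewrite in_Vf by (now apply ord_suc); split.
  - intros (c & Hc & Hx); apply in_suc in Hc; destruct Hc; subst; auto.
    intros z Hz; apply (Vf_mono_sub Ha H); auto.
  - intros H; exists a; rewrite in_suc; auto.
Qed.

Lemma ord_sub_Vf a : ordinal a -> subset a (Vf a).
Proof.
  apply (ord_ind (P := fun a => subset a (Vf a))).
  { dpw ltac:(apply dT_Vf). }
  intros b Hb IH c Hc; apply in_Vf; auto; exists c; split; auto.
Qed.
Lemma ord_in_Vf a b : ordinal a -> ordinal b -> (b in_ Vf a <-> b in_ a).
Proof.
  intros Ha Hb; split; [|intros H; now apply ord_sub_Vf].
  revert a Ha; revert b Hb.
  apply (ord_ind (P := fun b => forall a, ordinal a -> b in_ Vf a -> b in_ a)).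
  { dpw ltac:(apply dT_Vf). }
  intros b Hb IH a Ha H; apply in_Vf in H; auto; destruct H as (c & Hc & H).
  assert (Oc := ord_in Ha Hc).
  apply sub_lt_trans with c; auto; intros x Hx; apply IH; auto.
Qed.

Lemma is_rank_iff u a : is_rank u a <-> ordinal a /\ u = Vf a.
Proof.
  split.
  - intros [Ha (f & sa & E & Hs & Hf & Hu & Hr)]; split; auto.
    apply is_succ_iff in Hs; subst sa; apply is_fun_iff in Hf; destruct Hf as [Hf _].
    rewrite maps_iff, (func_app _ _ Hf) in Hu; destruct Hu as [_ ->].
    enough (Hb : forall b, ordinal b -> b in_ suc a -> app f b = Vf b).
    { apply Hb; auto; apply in_suc; auto. }
    apply (ord_ind (P := fun b => b in_ suc a -> app f b = Vf b)).
    { dpw ltac:(apply dT_Vf). }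
    intros b Hb IH Hba; apply ext; intros x; rewrite in_Vf by auto.
    rewrite (Hr b (app f b)) by (apply maps_iff; now apply Hf).
    assert (Os := ord_suc Ha).
    split.
    + intros (c & q & Hc & Hq & Hx); exists c; split; auto.
      rewrite maps_iff, (func_app _ _ Hf) in Hq; destruct Hq as [Hc' ->].
      now rewrite <- IH.
    + intros (c & Hc & Hx); exists c, (app f c); split; auto.
      assert (c in_ suc a) by now apply ord_trans with b.
      rewrite IH by auto; split; auto; rewrite <- IH by auto; apply maps_iff; now apply Hf.
  - intros [Ha ->]; split; auto.
    exists (mkfun (suc a) Vf), (suc a), (suc (Vf a)); rewrite is_succ_iff; split; auto.
    pose proof Vf_def as Hd; pose proof (func_mkfun (suc a) Hd) as Hf.
    split; [|split; [|intros b r H x; split]].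
    + rewrite is_fun_iff; split; auto; intros x Hx; rewrite app_mkfun by auto.
      apply in_suc; apply in_suc in Hx; destruct Hx; subst; auto; left; now apply Vf_in.
    + rewrite maps_iff, (func_app _ _ Hf), app_mkfun; auto; rewrite in_suc; auto.
    + intros Hx; rewrite maps_iff, (func_app _ _ Hf) in H; destruct H as [Hb ->].
      rewrite app_mkfun in Hx by auto.
      assert (Ob : ordinal b) by (apply ord_in with (suc a); auto using ord_suc).
      apply in_Vf in Hx; auto; destruct Hx as (c & Hc & Hx); exists c, (Vf c).
      split; auto; split; auto; rewrite maps_iff, (func_app _ _ Hf).
      assert (c in_ suc a) by (apply ord_trans with b; auto using ord_suc).
      rewrite app_mkfun; auto.
    + intros (c & q & Hc & Hq & Hx).
      rewrite maps_iff, (func_app _ _ Hf) in H; destruct H as [Hb ->].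
      rewrite maps_iff, (func_app _ _ Hf) in Hq; destruct Hq as [Hc' ->].
      rewrite app_mkfun in * by auto.
      assert (Ob : ordinal b) by (apply ord_in with (suc a); auto using ord_suc).
      apply in_Vf; auto; exists c; auto.
Qed.

(* [x], [x] union its elements, ...: the union of all stages is transitive. *)
Definition tcstep x a f : V :=
  cup x (setof (fun z => exists m y, m in_ a /\ y in_ app f m /\ z in_ y)).

Lemma isset_tcstep a f : isset (fun z => exists m y, m in_ a /\ y in_ app f m /\ z in_ y).
Proof.
  assert (Hd : dP (fun v => v 0 = app f (v 1))) by dp.
  apply isset_sub with (bigU (bigU (setof (fun y => exists c, c in_ a /\ y = app f c)))); [|dp].
  intros z (m & y & Hm & Hy & Hz); apply in_bigU; exists y; split; auto.
  apply in_bigU; exists (app f m); split; auto; apply setof_I; eauto; now apply isset_image.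
Qed.
Lemma tcstep_def x : dP (fun v => v 0 = tcstep x (v 1) (v 2)).
Proof.
  apply (dT_cup (s := fun _ => x) (t := fun v => setof (fun z => exists m y, m in_ v 0 /\ y in_ app (v 1) m /\ z in_ y))); [dp|].
  apply (dT_setof (P := fun z v => exists m y, m in_ v 0 /\ y in_ app (v 1) m /\ z in_ y)); [intros; apply isset_tcstep|dp].
Qed.

Lemma trans_superset x : exists t, transitive t /\ subset x t.
Proof.
  set (F := ordfun (tcstep x)).
  assert (HF : dP (fun v => v 0 = F (v 1))) by apply ordfun_def, tcstep_def.
  assert (EF : forall n z, n in_ omega -> (z in_ F n <-> z in_ x \/ exists m y, m in_ n /\ y in_ F m /\ z in_ y)).
  { intros n z Hn; unfold F at 1; rewrite (ordfun_eq (tcstep_def x) (ord_nat Hn)).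
    unfold tcstep; rewrite in_cup, (in_setof _ (isset_tcstep _ _)).
    split; (intros [H|(m & y & Hm & H)]; [auto|right; exists m, y; split; auto]);
      rewrite (app_mkfun HF Hm) in *; auto. }
  set (t := bigU (setof (fun y => exists c, c in_ omega /\ y = F c))).
  assert (Et : forall z, z in_ t <-> exists n, n in_ omega /\ z in_ F n).
  { intros z; unfold t; rewrite in_bigU; split.
    - intros (y & Hy & Hz); apply setof_E in Hy; [|now apply isset_image].
      destruct Hy as (n & Hn & ->); eauto.
    - intros (n & Hn & Hz); exists (F n); split; auto; apply setof_I; eauto; now apply isset_image. }
  exists t; split.
  - intros y Hy z Hz; apply Et in Hy; destruct Hy as (n & Hn & Hy); apply Et.
    exists (suc n); split; [now apply suc_omega|].
    apply EF; [now apply suc_omega|]; right; exists n, y; rewrite in_suc; auto.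
  - intros z Hz; apply Et; exists emp; split; [apply emp_omega|]; apply EF; auto using emp_omega.
Qed.

(** Foundation speaks of sets; a transitive superset of [suc x] cuts the class of counterexamples
    down to one. *)
Lemma mem_ind (P : V -> Prop) : dP (fun v => P (v 0)) ->
  (forall x, (forall y, y in_ x -> P y) -> P x) -> forall x, P x.
Proof.
  intros HP IH x; apply NNPP; intros Hn.
  destruct (trans_superset (suc x)) as (t & Ht & Hx).
  assert (Hs : isset (fun y => y in_ t /\ ~ P y)) by (apply isset_sep; dp).
  destruct (ZF_foundation hZF (a := setof (fun y => y in_ t /\ ~ P y))) as (y & Hy & Hm).
  - exists x; apply setof_I; auto; split; auto; apply Hx, in_suc; auto.
  - apply setof_E in Hy; auto; destruct Hy as [Hy Hny]; apply Hny, IH; intros z Hz.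
    apply NNPP; intros Hnz; apply (Hm z Hz), setof_I; auto; split; auto; exact (Ht y Hy z Hz).
Qed.

Lemma Vf_cover x : exists a, ordinal a /\ subset x (Vf a).
Proof.
  revert x; apply (mem_ind (P := fun x => exists a, ordinal a /\ subset x (Vf a))).
  { dpw ltac:(apply dT_Vf). }
  intros x IH.
  (* Least indices make this relation functional, so that Replacement applies without choosing
     levels. *)
  set (R := fun y a => ordinal a /\ subset y (Vf a) /\ forall b, b in_ a -> ~ subset y (Vf b)).
  assert (HR : dP (fun v => R (v 0) (v 1))) by (unfold R; dpw ltac:(apply dT_Vf)).
  assert (Hs : isset (fun a => exists y, y in_ x /\ R y a)).
  { apply isset_repl; auto; intros y a b _ (Oa & Ha & Ma) (Ob & Hb & Mb).
    destruct (ord_tri Oa Ob) as [H|[H|H]]; auto; [now apply Mb in H|now apply Ma in H]. }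
  set (A := setof (fun a => exists y, y in_ x /\ R y a)).
  assert (OA : forall a, a in_ A -> ordinal a).
  { intros a Ha; apply setof_E in Ha; auto; destruct Ha as (y & _ & H); apply H. }
  assert (OU := ord_bigU OA).
  exists (suc (bigU A)); split; [now apply ord_suc|].
  intros y Hy; apply in_Vf_suc; auto.
  destruct (ord_least (P := fun a => subset y (Vf a))) as (a & Oa & Ha & Hl).
  { dpw ltac:(apply dT_Vf). }
  { apply IH; auto. }
  assert (HaA : a in_ A) by (apply setof_I; auto; exists y; split; [auto|split; auto]).
  assert (Hle : subset a (bigU A)) by (intros z Hz; apply in_bigU; eauto).
  apply ord_sub in Hle; auto; destruct Hle as [Hle|Hle]; [|now rewrite <- Hle].
  intros z Hz; apply (Vf_mono_sub OU Hle), Ha, Hz.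
Qed.

(** The rank of [x]; as an intersection of candidate ordinals it is a comprehension term, hence
    definable. *)
Definition rho x : V := setof (fun b => forall a, ordinal a -> subset x (Vf a) -> b in_ a).

Lemma isset_rho x : isset (fun b => forall a, ordinal a -> subset x (Vf a) -> b in_ a).
Proof.
  destruct (Vf_cover x) as (a & Oa & Ha); apply isset_sub with a; auto; dpw ltac:(apply dT_Vf).
Qed.
Lemma rho_def : dP (fun v => v 0 = rho (v 1)).
Proof.
  apply (dT_setof (P := fun b v => forall a, ordinal a -> subset (v 0) (Vf a) -> b in_ a));
    [intros; apply isset_rho|dpw ltac:(apply dT_Vf)].
Qed.
Lemma dT_rho s : dT s -> dT (fun v => rho (s v)).
Proof. apply dT_sub1, rho_def. Qed.

Lemma rho_spec x : ordinal (rho x) /\ subset x (Vf (rho x)) /\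
  forall a, ordinal a -> subset x (Vf a) -> subset (rho x) a.
Proof.
  destruct (ord_least (P := fun a => subset x (Vf a))) as (a & Oa & Ha & Hl).
  { dpw ltac:(apply dT_Vf). }
  { apply Vf_cover. }
  assert (E : rho x = a).
  { apply setof_eq; intros b; split; [|auto].
    intros Hb c Oc Hc; destruct (ord_le_or_lt Oa Oc) as [H|H]; [now apply H|].
    now apply Hl in H. }
  rewrite E; split; [auto|split; auto]; intros c Oc Hc.
  destruct (ord_le_or_lt Oa Oc) as [H|H]; auto; now apply Hl in H.
Qed.

Lemma ord_rho x : ordinal (rho x).
Proof. apply rho_spec. Qed.
Lemma sub_Vf x a : ordinal a -> (subset x (Vf a) <-> subset (rho x) a).
Proof.
  intros Ha; split; [now apply rho_spec|]; intros H z Hz.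
  apply ord_sub in H; auto using ord_rho; destruct (rho_spec x) as (O & Hx & _).
  destruct H as [H|H]; [apply (Vf_mono_sub Ha H); auto|rewrite <- H; auto].
Qed.
Lemma in_Vf_rho x a : ordinal a -> (x in_ Vf a <-> rho x in_ a).
Proof.
  intros Ha; rewrite in_Vf by auto; split.
  - intros (c & Hc & Hx); assert (Oc := ord_in Ha Hc); apply sub_Vf in Hx; auto.
    apply sub_lt_trans with c; auto using ord_rho.
  - intros H; exists (rho x); split; auto; apply rho_spec.
Qed.
Lemma rho_mem x y : y in_ x -> rho y in_ rho x.
Proof. intros H; apply in_Vf_rho; [apply ord_rho|]; now apply rho_spec. Qed.
Lemma rho_ord a : ordinal a -> rho a = a.
Proof.
  intros Ha; apply ext; intros b; split; intros Hb.
  - revert Hb; apply sub_Vf; auto; now apply ord_sub_Vf.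
  - rewrite <- ord_in_Vf; auto using ord_rho; [|now apply ord_in with a].
    now apply rho_spec.
Qed.
Lemma rho_Vf a : ordinal a -> rho (Vf a) = a.
Proof.
  intros Ha; apply ext; intros b; split; intros Hb.
  - revert Hb; apply sub_Vf; auto; intros x; auto.
  - rewrite <- (rho_ord (ord_in Ha Hb)); apply rho_mem; now apply ord_sub_Vf.
Qed.
Lemma in_own_Vf x : x in_ Vf (suc (rho x)).
Proof. apply in_Vf_rho; [apply ord_suc, ord_rho|apply in_suc; auto]. Qed.

Definition lim a := ordinal a /\ emp in_ a /\ forall b, b in_ a -> suc b in_ a.

Lemma lim_omega : lim omega.
Proof. split; [apply ord_omega|split; [apply emp_omega|apply suc_omega]]. Qed.
Lemma lim_max a b c : lim a -> b in_ a -> c in_ a -> exists d, d in_ a /\ subset b d /\ subset c d.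
Proof.
  intros (Oa & _ & _) Hb Hc.
  assert (Ob := ord_in Oa Hb); assert (Oc := ord_in Oa Hc).
  destruct (ord_le_or_lt Ob Oc) as [H|H]; [exists c|exists b]; repeat split; auto; try (intros z; auto; fail).
  apply ord_sub; auto.
Qed.
Lemma lim_bound2 a x y : lim a -> x in_ Vf a -> y in_ Vf a ->
  exists c, c in_ a /\ x in_ Vf c /\ y in_ Vf c.
Proof.
  intros Ha Hx Hy; pose proof Ha as (Oa & _ & Sa); apply in_Vf_rho in Hx, Hy; auto.
  destruct (lim_max Ha Hx Hy) as (d & Hd & H1 & H2).
  assert (Od := ord_in Oa Hd).
  exists (suc d); split; auto; split; (apply in_Vf_suc; auto; apply sub_Vf; auto).
Qed.
Lemma lim_sub a c x : lim a -> c in_ a -> subset x (Vf c) -> x in_ Vf a.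
Proof. intros (Oa & _ & _) Hc Hx; apply in_Vf; eauto. Qed.
Lemma lim_upair a x y : lim a -> x in_ Vf a -> y in_ Vf a -> upair x y in_ Vf a.
Proof.
  intros Ha Hx Hy; destruct (lim_bound2 Ha Hx Hy) as (c & Hc & H1 & H2).
  apply lim_sub with c; auto; intros z Hz; apply in_upair in Hz; destruct Hz; subst; auto.
Qed.
Lemma lim_opair a x y : lim a -> x in_ Vf a -> y in_ Vf a -> opair x y in_ Vf a.
Proof. intros; apply lim_upair; auto; apply lim_upair; auto. Qed.
Lemma lim_pow a x : lim a -> x in_ Vf a -> pow x in_ Vf a.
Proof.
  intros Ha Hx; destruct (lim_bound2 Ha Hx Hx) as (c & Hc & H1 & _).
  assert (Oc := ord_in (proj1 Ha) Hc).
  apply lim_sub with c; auto; intros z Hz; apply in_pow in Hz; now apply Vf_super with x.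
Qed.
Lemma lim_cup a x y : lim a -> x in_ Vf a -> y in_ Vf a -> cup x y in_ Vf a.
Proof.
  intros Ha Hx Hy; destruct (lim_bound2 Ha Hx Hy) as (c & Hc & H1 & H2).
  assert (Oc := ord_in (proj1 Ha) Hc).
  apply lim_sub with c; auto; intros z Hz; apply in_cup in Hz; destruct Hz;
    [exact (Vf_trans Oc H1 H)|exact (Vf_trans Oc H2 H)].
Qed.
Lemma lim_suc a x : lim a -> x in_ Vf a -> suc x in_ Vf a.
Proof.
  intros Ha Hx; apply Vf_super with (cup x (upair x x)); [apply Ha| |].
  - apply lim_cup; auto using lim_upair.
  - intros z Hz; apply in_suc in Hz; rewrite in_cup, in_upair; tauto.
Qed.
Lemma lim_prod a x y : lim a -> x in_ Vf a -> y in_ Vf a -> prod x y in_ Vf a.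
Proof.
  intros Ha Hx Hy; apply Vf_super with (pow (pow (cup x y))); [apply Ha| |].
  - auto using lim_pow, lim_cup.
  - intros p Hp; apply in_prod in Hp; destruct Hp as (u & w & Hu & Hw & ->).
    apply in_pow; intros z Hz; apply in_pow; intros t Ht.
    apply in_upair in Hz; apply in_cup.
    destruct Hz; subst z; apply in_upair in Ht; destruct Ht; subst; auto.
Qed.
Lemma lim_emp a : lim a -> emp in_ Vf a.
Proof. intros (Oa & H & _); apply ord_in_Vf; auto using ord_emp. Qed.

(** [bigU a] is the predecessor of a successor [a]; the iteration is only read at elements of
    [omega]. *)
Definition iterstep (G : V -> V) x a f : V :=
  setof (fun z => (a = emp /\ z in_ x) \/ (a <> emp /\ z in_ G (app f (bigU a)))).

Lemma iterstep_def G x : dP (fun v => v 0 = G (v 1)) ->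
  dP (fun v => v 0 = iterstep G x (v 1) (v 2)).
Proof.
  intros HG.
  apply (dT_setof (P := fun z v => (v 0 = emp /\ z in_ x) \/ (v 0 <> emp /\ z in_ G (app (v 1) (bigU (v 0))))));
   [intros v|dp].
  destruct (classic (v 0 = emp)) as [E|E];
    [apply isset_iff with (fun z => z in_ x)|apply isset_iff with (fun z => z in_ G (app (v 1) (bigU (v 0))))];
    try (intros; tauto); eexists; intros; reflexivity.
Qed.

Definition iter (G : V -> V) x : V -> V := ordfun (iterstep G x).

Lemma iter_def G x : dP (fun v => v 0 = G (v 1)) -> dP (fun v => v 0 = iter G x (v 1)).
Proof. intros; now apply ordfun_def, iterstep_def. Qed.

Lemma iter_emp G x : dP (fun v => v 0 = G (v 1)) -> iter G x emp = x.
Proof.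
  intros HG; unfold iter; rewrite (ordfun_eq (iterstep_def x HG) ord_emp).
  apply setof_eq; intros z; tauto.
Qed.
Lemma iter_suc G x n : dP (fun v => v 0 = G (v 1)) -> ordinal n -> iter G x (suc n) = G (iter G x n).
Proof.
  intros HG Hn; unfold iter at 1; rewrite (ordfun_eq (iterstep_def x HG) (ord_suc Hn)).
  assert (Hne : suc n <> emp).
  { intros E; apply (in_emp n); rewrite <- E; apply in_suc; auto. }
  apply setof_eq; intros z; rewrite bigU_suc by auto.
  pose proof (iter_def x HG) as Hd; unfold iter in Hd.
  rewrite (app_mkfun Hd) by (apply in_suc; auto); unfold iter; tauto.
Qed.

End Hierarchy.

Ltac dp_hier := first [dp_ord | apply dT_Vf | apply dT_rho | apply dT_restr].
Ltac dp_user ::= dp_hier.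

#[global] Opaque emp upair opair bigU pow cup suc prod app mkfun funspace omega restr
  recfun ordfun Vf rho iter.

Section LevelsAndClosure.
Context {V : set_structure} {hZF : ZF V}.
Implicit Types a b c x y z f : V.

(** The index is the supremum of the successors of the indices in [s]. This is the step of level
    theory from a set of lower levels to the next level. *)
Lemma Vf_hull s : (forall y, y in_ s -> exists b, ordinal b /\ y = Vf b) ->
  exists a, ordinal a /\ forall z, z in_ Vf a <-> exists c, c in_ s /\ subset z c.
Proof.
  intros Hs.
  assert (Hi : isset (fun b => exists y, y in_ s /\ b = suc (rho y))).
  { apply (isset_image s (f := fun y => suc (rho y))); dp. }
  set (B := setof (fun b => exists y, y in_ s /\ b = suc (rho y))).
  assert (OB : ordinal (bigU B)).
  { apply ord_bigU; intros b Hb; apply setof_E in Hb; auto; destruct Hb as (y & _ & ->).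
    apply ord_suc, ord_rho. }
  exists (bigU B); split; auto; intros z; rewrite in_Vf by auto; split.
  - intros (c & Hc & Hz); apply in_bigU in Hc; destruct Hc as (b & Hb & Hc).
    apply setof_E in Hb; auto; destruct Hb as (y & Hy & ->); exists y; split; auto.
    destruct (Hs y Hy) as (d & Od & ->); rewrite rho_Vf in Hc by auto.
    apply in_suc in Hc; destruct Hc; subst; auto.
    intros w Hw; apply (Vf_mono_sub Od H); auto.
  - intros (c & Hc & Hz); exists (rho c); destruct (Hs c Hc) as (d & Od & E); split.
    + apply in_bigU; exists (suc (rho c)); split; [apply setof_I; eauto|apply in_suc; auto].
    + rewrite E, rho_Vf; auto; now rewrite <- E.
Qed.

End LevelsAndClosure.

(* Button's level theory: with [h] the set of lower levels, "[u] is some V_a"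
   becomes Sigma_2 in a form where all unbounded quantifiers are visible. *)
Definition history {M : set_structure} (h : M) :=
  forall y z, y in_ h -> (z in_ y <-> exists c, c in_ h /\ c in_ y /\ subset z c).
Definition level_of {M : set_structure} (u h : M) :=
  forall z, z in_ u <-> exists c, c in_ h /\ subset z c.
Definition level {M : set_structure} (u : M) := exists h : M, history h /\ level_of u h.

Section Levels.
Context {V : set_structure} {hZF : ZF V}.
Implicit Types a b c x y z f : V.

Lemma level_iff u : level u <-> exists a : V, ordinal a /\ u = Vf a.
Proof.
  split.
  - intros (h & Hh & Hu).
    (* By epsilon-induction the members of a history are levels, each being the hull of the members
       it contains. *)
    assert (Hy : forall y, y in_ h -> exists b, ordinal b /\ y = Vf b).
    { apply (mem_ind (P := fun y => y in_ h -> exists b, ordinal b /\ y = Vf b)); [dp|].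
      intros y IH Hy.
      assert (Hi : isset (fun c => c in_ h /\ c in_ y)) by (apply isset_sep; dp).
      destruct (@Vf_hull V hZF (setof (fun c => c in_ h /\ c in_ y))) as (a & Oa & Ha).
      - intros c Hc; apply setof_E in Hc; auto; destruct Hc; auto.
      - exists a; split; auto; apply ext; intros z; rewrite Ha, (Hh y z Hy).
        split; [intros (c & H1 & H2 & H3)|intros (c & H1 & H2)]; exists c.
        + split; auto; now apply setof_I.
        + apply setof_E in H1; auto; tauto. }
    destruct (Vf_hull Hy) as (a & Oa & Ha); exists a; split; auto; apply ext; intros z.
    rewrite Ha; apply Hu.
  - intros (a & Oa & ->).
    assert (Hi : isset (fun y => exists b, b in_ a /\ y = Vf b)) by (apply isset_image; dp).
    exists (setof (fun y => exists b, b in_ a /\ y = Vf b)); split.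
    + intros y z Hy; apply setof_E in Hy; auto; destruct Hy as (b & Hb & ->).
      assert (Ob := ord_in Oa Hb); rewrite in_Vf by auto; split.
      * intros (c & Hc & Hz); exists (Vf c); split; [|split; auto; now apply Vf_in].
        apply setof_I; auto; exists c; split; auto; now apply ord_trans with b.
      * intros (y & H1 & H2 & H3); apply setof_E in H1; auto; destruct H1 as (c & Hc & ->).
        exists c; split; auto; apply in_Vf_rho in H2; auto; rewrite rho_Vf in H2; auto.
        now apply ord_in with a.
    + intros z; rewrite in_Vf by auto; split.
      * intros (c & Hc & Hz); exists (Vf c); split; auto; apply setof_I; eauto.
      * intros (y & H1 & H2); apply setof_E in H1; auto; destruct H1 as (c & Hc & ->); eauto.
Qed.

Definition leastord (P : V -> Prop) : V := setof (fun z => forall c, ordinal c -> P c -> z in_ c).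

Lemma isset_leastord (P : V -> Prop) : dP (fun v => P (v 0)) -> (exists a, ordinal a /\ P a) ->
  isset (fun z => forall c, ordinal c -> P c -> z in_ c).
Proof.
  intros HP (a & Oa & Pa); apply isset_sub with a; [auto|dp].
Qed.

Lemma leastord_spec (P : V -> Prop) : dP (fun v => P (v 0)) -> (exists a, ordinal a /\ P a) ->
  ordinal (leastord P) /\ P (leastord P) /\ forall c, ordinal c -> P c -> subset (leastord P) c.
Proof.
  intros HP He; destruct (ord_least HP He) as (a & Oa & Pa & Ha).
  assert (E : leastord P = a).
  { apply setof_eq; intros z; split; [|auto].
    intros Hz c Oc Pc; destruct (ord_le_or_lt Oa Oc) as [H|H]; [now apply H|now apply Ha in H]. }
  rewrite E; split; [auto|split; auto]; intros c Oc Pc.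
  destruct (ord_le_or_lt Oa Oc) as [H|H]; auto; now apply Ha in H.
Qed.

(** Collection: a witness is replaced by the least index of a level containing one, which is
    unique. *)
Lemma bounded_witnesses (R : V -> V -> Prop) : dP (fun v => R (v 0) (v 1)) ->
  (forall a, exists x, R a x) ->
  forall s, exists c, ordinal c /\ forall a, a in_ s -> exists x, x in_ Vf c /\ R a x.
Proof.
  intros HR Htot s.
  set (Q := fun a c => ordinal c /\ (exists x, x in_ Vf c /\ R a x) /\
     forall d, d in_ c -> ~ exists x, x in_ Vf d /\ R a x).
  assert (HQ : dP (fun v => Q (v 0) (v 1))) by (unfold Q; dp).
  assert (Hs : isset (fun c => exists a, a in_ s /\ Q a c)).
  { apply isset_repl; auto; intros a c d _ (Oc & Hc & Mc) (Od & Hd & Md).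
    destruct (ord_tri Oc Od) as [H|[H|H]]; auto; [now apply Md in H|now apply Mc in H]. }
  set (B := setof (fun c => exists a, a in_ s /\ Q a c)).
  assert (OB : forall b, b in_ B -> ordinal b).
  { intros b Hb; apply setof_E in Hb; auto; destruct Hb as (a & _ & H); apply H. }
  exists (bigU B); split; [now apply ord_bigU|]; intros a Ha.
  destruct (ord_least (P := fun c => exists x, x in_ Vf c /\ R a x)) as (c & Oc & (x & Hx & Hr) & Mc).
  { dp. }
  { destruct (Htot a) as [x Hx]; exists (suc (rho x)); split; [apply ord_suc, ord_rho|].
    exists x; split; auto using in_own_Vf. }
  assert (HcB : c in_ B) by (apply setof_I; auto; exists a; split; auto; split; eauto).
  exists x; split; auto; apply in_Vf_rho; [now apply ord_bigU|]; apply in_bigU; exists c.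
  split; auto; now apply in_Vf_rho.
Qed.

Definition reflstep (R : V -> V -> Prop) b : V :=
  leastord (fun c => rho b in_ c /\ forall a, a in_ Vf b -> exists x, x in_ Vf c /\ R a x).

(** The supremum of omega steps, each to the least ordinal whose level answers all elements of the
    previous level. An element of the limit level occurs at a finite stage and is answered at the
    next one. *)
Lemma closure_point (R : V -> V -> Prop) : dP (fun v => R (v 0) (v 1)) ->
  (forall a, exists x, R a x) ->
  forall b, exists l, lim l /\ b in_ Vf l /\ forall a, a in_ Vf l -> exists x, x in_ Vf l /\ R a x.
Proof.
  intros HR Htot b0.
  assert (Hex : forall b, exists c, ordinal c /\ rho b in_ c /\
     forall a, a in_ Vf b -> exists x, x in_ Vf c /\ R a x).
  { intros b; destruct (bounded_witnesses HR Htot (Vf b)) as (c & Oc & Hc).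
    assert (O1 : ordinal (suc (rho b))) by apply ord_suc, ord_rho.
    destruct (ord_le_or_lt Oc O1) as [H|H].
    - exists (suc (rho b)); split; [auto|split; [apply in_suc; auto|]].
      intros a Ha; destruct (Hc a Ha) as (x & Hx & Hr); exists x; split; auto.
      rewrite in_Vf_rho in * by auto; auto.
    - exists c; split; [auto|split; auto].
      apply ord_trans with (suc (rho b)); auto; apply in_suc; auto. }
  assert (Hd : forall b, dP (fun v => (fun c => rho b in_ c /\
     forall a, a in_ Vf b -> exists x, x in_ Vf c /\ R a x) (v 0))) by (intros b; dp).
  assert (HG : dP (fun v => v 0 = reflstep R (v 1))).
  { refine (dP_iff _ (setof1_def (P := fun z b => forall c, ordinal c -> (rho b in_ c /\
     forall a, a in_ Vf b -> exists x, x in_ Vf c /\ R a x) -> z in_ c) _ _)); [| |dp].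
    { intros v; reflexivity. }
    intros b; apply (isset_leastord (Hd b) (Hex b)). }
  assert (SG : forall b, ordinal (reflstep R b) /\ rho b in_ reflstep R b /\
     forall a, a in_ Vf b -> exists x, x in_ Vf (reflstep R b) /\ R a x).
  { intros b; destruct (leastord_spec (Hd b) (Hex b)) as (H1 & H2 & _); auto. }
  set (F := iter (reflstep R) (suc (rho b0))).
  assert (HF : dP (fun v => v 0 = F (v 1))) by now apply iter_def.
  assert (OF : forall n, n in_ omega -> ordinal (F n)).
  { apply (omega_ind (P := fun n => ordinal (F n))); [dp| |].
    - unfold F; rewrite iter_emp by auto; apply ord_suc, ord_rho.
    - intros n Hn _; unfold F; rewrite iter_suc; [apply SG|exact HG|exact (ord_nat Hn)]. }
  assert (SF : forall n, n in_ omega -> F n in_ F (suc n) /\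
     forall a, a in_ Vf (F n) -> exists x, x in_ Vf (F (suc n)) /\ R a x).
  { intros n Hn; unfold F; rewrite iter_suc; [|exact HG|exact (ord_nat Hn)]; fold F.
    pose proof (SG (F n)) as H; rewrite (rho_ord (OF n Hn)) in H; tauto. }
  assert (Hi : isset (fun y => exists n, n in_ omega /\ y = F n)) by now apply isset_image.
  set (l := bigU (setof (fun y => exists n, n in_ omega /\ y = F n))).
  assert (El : forall z, z in_ l <-> exists n, n in_ omega /\ z in_ F n).
  { intros z; unfold l; rewrite in_bigU; split.
    - intros (y & Hy & Hz); apply setof_E in Hy; auto; destruct Hy as (n & Hn & ->); eauto.
    - intros (n & Hn & Hz); exists (F n); split; auto; apply setof_I; eauto. }
  assert (Ol : ordinal l).
  { apply ord_bigU; intros y Hy; apply setof_E in Hy; auto; destruct Hy as (n & Hn & ->); auto. }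
  assert (Hb0 : rho b0 in_ l).
  { apply El; exists emp; split; [apply emp_omega|]; unfold F; rewrite iter_emp by auto.
    apply in_suc; auto. }
  exists l; split; [split; [auto|split]|split].
  - destruct (ord_le_or_lt Ol ord_emp) as [H|H]; auto; exfalso; apply (in_emp (rho b0)); auto.
  - intros z Hz; apply El in Hz; destruct Hz as (n & Hn & Hz); apply El; exists (suc n).
    split; [now apply suc_omega|].
    apply sub_lt_trans with (F n); [apply ord_suc, ord_in with (F n); auto|auto using suc_omega|
      apply suc_sub; auto|auto|now apply SF].
  - now apply in_Vf_rho.
  - intros a Ha; apply in_Vf_rho in Ha; auto; apply El in Ha; destruct Ha as (n & Hn & Ha).
    apply in_Vf_rho in Ha; auto; destruct (proj2 (SF n Hn) a Ha) as (x & Hx & Hr).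
    exists x; split; auto; apply in_Vf_rho; auto; apply El; exists (suc n).
    split; [now apply suc_omega|]; apply in_Vf_rho; auto using suc_omega.
Qed.

End Levels.

(** * Satisfaction inside V *)

Section InternalLogic.
Context {V : set_structure} {hZF : ZF V}.
Implicit Types a b c x y z f s t D : V.

Definition cmem i j : V := opair (num 0) (opair i j).
Definition ceq i j : V := opair (num 1) (opair i j).
Definition cneg a : V := opair (num 2) a.
Definition cand a b : V := opair (num 3) (opair a b).
Definition cex i a : V := opair (num 4) (opair i a).
Definition cpred i : V := opair (num 5) i.

Lemma tagged_iff n c x : tagged n c x <-> c = opair (num n) x.
Proof.
  unfold tagged; split.
  - intros (t & Ht & Hc); apply is_numeral_iff in Ht; apply is_opair_iff in Hc; now subst.
  - intros ->; exists (num n); rewrite is_numeral_iff, is_opair_iff; auto.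
Qed.
Lemma code_mem_iff c i j : code_mem c i j <-> c = cmem i j.
Proof.
  unfold code_mem, cmem; split.
  - intros (p & Hp & Hc); apply tagged_iff in Hc; apply is_opair_iff in Hp; now subst.
  - intros ->; exists (opair i j); rewrite tagged_iff, is_opair_iff; auto.
Qed.
Lemma code_eq_iff c i j : code_eq c i j <-> c = ceq i j.
Proof.
  unfold code_eq, ceq; split.
  - intros (p & Hp & Hc); apply tagged_iff in Hc; apply is_opair_iff in Hp; now subst.
  - intros ->; exists (opair i j); rewrite tagged_iff, is_opair_iff; auto.
Qed.
Lemma code_neg_iff c a : code_neg c a <-> c = cneg a.
Proof. apply tagged_iff. Qed.
Lemma code_and_iff c i j : code_and c i j <-> c = cand i j.
Proof.
  unfold code_and, cand; split.
  - intros (p & Hp & Hc); apply tagged_iff in Hc; apply is_opair_iff in Hp; now subst.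
  - intros ->; exists (opair i j); rewrite tagged_iff, is_opair_iff; auto.
Qed.
Lemma code_ex_iff c i j : code_ex c i j <-> c = cex i j.
Proof.
  unfold code_ex, cex; split.
  - intros (p & Hp & Hc); apply tagged_iff in Hc; apply is_opair_iff in Hp; now subst.
  - intros ->; exists (opair i j); rewrite tagged_iff, is_opair_iff; auto.
Qed.
Lemma code_pred_iff c i : code_pred c i <-> c = cpred i.
Proof. apply tagged_iff. Qed.

Lemma formula_closed_iff hp F : formula_closed hp F <->
  (forall i j, i in_ omega -> j in_ omega -> cmem i j in_ F) /\
  (forall i j, i in_ omega -> j in_ omega -> ceq i j in_ F) /\
  (forall a, a in_ F -> cneg a in_ F) /\
  (forall a b, a in_ F -> b in_ F -> cand a b in_ F) /\
  (forall i a, i in_ omega -> a in_ F -> cex i a in_ F) /\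
  (hp = true -> forall i, i in_ omega -> cpred i in_ F).
Proof.
  split.
  - intros H; destruct (H omega (proj2 (is_omega_iff omega) eq_refl)) as (H1 & H2 & H3 & H4 & H5 & H6).
    repeat match goal with |- _ /\ _ => split end.
    + intros i j Hi Hj; exact (H1 i j _ Hi Hj (proj2 (code_mem_iff _ _ _) eq_refl)).
    + intros i j Hi Hj; exact (H2 i j _ Hi Hj (proj2 (code_eq_iff _ _ _) eq_refl)).
    + intros a Ha; exact (H3 a _ Ha (proj2 (code_neg_iff _ _) eq_refl)).
    + intros a b Ha Hb; exact (H4 a b _ Ha Hb (proj2 (code_and_iff _ _ _) eq_refl)).
    + intros i a Hi Ha; exact (H5 i a _ Hi Ha (proj2 (code_ex_iff _ _ _) eq_refl)).
    + intros E i Hi; exact (H6 E i _ Hi (proj2 (code_pred_iff _ _) eq_refl)).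
  - intros (H1 & H2 & H3 & H4 & H5 & H6) w Hw; apply is_omega_iff in Hw; subst w.
    repeat split; intros.
    + rewrite code_mem_iff in *; subst; auto.
    + rewrite code_eq_iff in *; subst; auto.
    + rewrite code_neg_iff in *; subst; auto.
    + rewrite code_and_iff in *; subst; auto.
    + rewrite code_ex_iff in *; subst; auto.
    + rewrite code_pred_iff in *; subst; auto.
Qed.

Lemma Vomega_nat n : n in_ omega -> n in_ Vf omega.
Proof. intros Hn; apply (ord_in_Vf ord_omega (ord_nat Hn)); auto. Qed.

Lemma formula_closed_Vomega hp : formula_closed hp (Vf omega).
Proof.
  assert (L := @lim_omega V hZF).
  assert (N : forall n, num n in_ Vf omega) by (intros; apply Vomega_nat, num_omega).
  apply formula_closed_iff; repeat split; intros; repeat apply lim_opair; auto using Vomega_nat.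
Qed.

Lemma is_formula_Vomega hp c : is_formula hp c -> c in_ Vf omega.
Proof. intros H; apply H, formula_closed_Vomega. Qed.

Lemma is_formula_def hp : dP (fun v : nat -> V => is_formula hp (v 0)).
Proof.
  apply dP_iff with (fun v : nat -> V => forall F, (
  (forall i j, i in_ omega -> j in_ omega -> cmem i j in_ F) /\
  (forall i j, i in_ omega -> j in_ omega -> ceq i j in_ F) /\
  (forall a, a in_ F -> cneg a in_ F) /\
  (forall a b, a in_ F -> b in_ F -> cand a b in_ F) /\
  (forall i a, i in_ omega -> a in_ F -> cex i a in_ F) /\
  (hp = true -> forall i, i in_ omega -> cpred i in_ F)) -> v 0 in_ F).
  { intros v; unfold is_formula; split; intros H F HF; apply H; now apply formula_closed_iff. }
  unfold cmem, ceq, cneg, cand, cex, cpred; dp.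
Qed.

Lemma isset_formula hp : isset (fun c : V => is_formula hp c).
Proof. apply isset_sub with (Vf omega); [apply is_formula_Vomega|apply is_formula_def]. Qed.

Lemma formula_intro hp :
  (forall i j, i in_ omega -> j in_ omega -> is_formula hp (cmem i j)) /\
  (forall i j, i in_ omega -> j in_ omega -> is_formula hp (ceq i j)) /\
  (forall a, is_formula hp a -> is_formula hp (cneg a)) /\
  (forall a b, is_formula hp a -> is_formula hp b -> is_formula hp (cand a b)) /\
  (forall i a, i in_ omega -> is_formula hp a -> is_formula hp (cex i a)) /\
  (hp = true -> forall i, i in_ omega -> is_formula hp (cpred i)).
Proof.
  unfold is_formula; repeat split; intros;
    match goal with H : formula_closed hp _ |- _ =>
      pose proof (proj1 (formula_closed_iff hp _) H) end; intuition.
Qed.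

Lemma formula_ind hp (P : V -> Prop) : dP (fun v => P (v 0)) ->
  (forall i j, i in_ omega -> j in_ omega -> P (cmem i j)) ->
  (forall i j, i in_ omega -> j in_ omega -> P (ceq i j)) ->
  (forall a, is_formula hp a -> P a -> P (cneg a)) ->
  (forall a b, is_formula hp a -> is_formula hp b -> P a -> P b -> P (cand a b)) ->
  (forall i a, i in_ omega -> is_formula hp a -> P a -> P (cex i a)) ->
  (hp = true -> forall i, i in_ omega -> P (cpred i)) ->
  forall c, is_formula hp c -> P c.
Proof.
  intros HP H1 H2 H3 H4 H5 H6 c Hc.
  assert (Hi : isset (fun c => is_formula hp c /\ P c)).
  { apply isset_sub with (Vf omega); [intros x [H _]; now apply is_formula_Vomega in H|].
    apply dP_and; [apply is_formula_def|auto]. }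
  destruct (formula_intro hp) as (I1 & I2 & I3 & I4 & I5 & I6).
  enough (Hc' : formula_closed hp (setof (fun c => is_formula hp c /\ P c))).
  { apply Hc, setof_E in Hc'; tauto. }
  apply formula_closed_iff; repeat split; intros; (apply setof_I; [exact Hi|]);
    repeat match goal with H : _ in_ setof _ |- _ => apply setof_E in H; [destruct H|exact Hi] end; auto.
Qed.

Lemma num_neq m n : m <> n -> num m <> num n :> V.
Proof. intros H E; apply H, num_inj, E. Qed.

Definition updf s i x : V :=
  setof (fun p => (p in_ s /\ ~ exists y, p = opair i y) \/ p = opair i x).

Lemma isset_updf s i x : isset (fun p => (p in_ s /\ ~ exists y, p = opair i y) \/ p = opair i x).
Proof.
  apply isset_sub with (cup s (upair (opair i x) (opair i x))); [|dp].
  intros p H; rewrite in_cup, in_upair; tauto.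
Qed.
Lemma dT_updf (s t u : (nat -> V) -> V) : dT s -> dT t -> dT u -> dT (fun v => updf (s v) (t v) (u v)).
Proof.
  apply dT_sub3; apply (dT_setof (P := fun p v => (p in_ v 0 /\ ~ exists y, p = opair (v 1) y) \/
    p = opair (v 1) (v 2))); [intros; apply isset_updf|dp].
Qed.
Lemma in_updf s i x k y : opair k y in_ updf s i x <-> (k <> i /\ opair k y in_ s) \/ (k = i /\ y = x).
Proof.
  unfold updf; rewrite (in_setof _ (isset_updf _ _ _)), opair_inj; split.
  - intros [[H1 H2]|H]; auto; left; split; auto; intros ->; apply H2; eauto.
  - intros [[H1 H2]|H]; auto; left; split; auto; intros [z Hz]; apply opair_inj in Hz; tauto.
Qed.

Lemma updf_spec s i x D : is_fun s omega D -> i in_ omega -> x in_ D ->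
  is_fun (updf s i x) omega D /\ app (updf s i x) i = x /\
  forall k, k <> i -> app (updf s i x) k = app s k.
Proof.
  intros Hs Hi Hx; apply is_fun_iff in Hs; destruct Hs as [Fs Hs].
  assert (H1 : app (updf s i x) i = x).
  { apply app_unique; [apply in_updf; auto|]; intros y Hy; apply in_updf in Hy; tauto. }
  assert (H2 : forall k, k in_ omega -> k <> i -> app (updf s i x) k = app s k).
  { intros k Ho Hk; apply app_unique; [apply in_updf; left; split; auto; now apply Fs|].
    intros y Hy; apply in_updf in Hy; destruct Hy as [[_ Hy]|[]]; [|tauto].
    apply (func_app _ _ Fs) in Hy; tauto. }
  assert (H3 : forall k, k <> i -> app (updf s i x) k = app s k).
  { intros k Hk; destruct (classic (k in_ omega)) as [Ho|Ho]; auto.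
    (* Outside the domain [app] takes its default value [emp] for both assignments. *)
    transitivity (emp (V := V)).
    - apply ext; intros z; rewrite in_emp; split; [|tauto]; intros Hz.
      Transparent app. unfold app in Hz. Opaque app.
      apply setof_E in Hz; [|apply isset_app].
      destruct Hz as (y & Hy & _); apply in_updf in Hy; destruct Hy as [[_ Hy]|[]]; [|tauto].
      apply (func_app _ _ Fs) in Hy; tauto.
    - apply ext; intros z; rewrite in_emp; split; [tauto|]; intros Hz.
      Transparent app. unfold app in Hz. Opaque app.
      apply setof_E in Hz; [|apply isset_app].
      destruct Hz as (y & Hy & _); apply (func_app _ _ Fs) in Hy; tauto. }
  split; [|auto]; apply is_fun_iff; split; [split|].
  - intros p Hp; pose proof Hp as Hp'; unfold updf in Hp; apply setof_E in Hp; [|apply isset_updf].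
    destruct Hp as [[Hp _]| ->]; [|exists i; split; auto; now rewrite H1].
    destruct (proj1 Fs p Hp) as (k & Hk & ->); exists k; split; auto.
    apply in_updf in Hp'; destruct Hp' as [[Hne _]|[-> E]]; [now rewrite H3|].
    now rewrite E, H1.
  - intros k Hk; apply in_updf; destruct (classic (k = i)) as [->|Hne]; [now rewrite H1; auto|].
    rewrite H3 by auto; left; split; auto; now apply Fs.
  - intros k Hk; destruct (classic (k = i)) as [->|Hne]; [now rewrite H1|rewrite H3; auto].
Qed.

Lemma fun_eq s s' D : is_fun s omega D -> is_fun s' omega D ->
  (forall k, k in_ omega -> app s k = app s' k) -> s = s'.
Proof. intros H H'; apply is_fun_iff in H, H'; apply func_ext; tauto. Qed.

Lemma fun_maps s a D k y : is_fun s a D -> (maps s k y <-> k in_ a /\ y = app s k).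
Proof. intros H; apply is_fun_iff in H; rewrite maps_iff; now apply func_app. Qed.

Lemma is_update_iff s s' i x D : is_fun s omega D -> i in_ omega -> x in_ D ->
  (is_fun s' omega D /\ is_update s' s i x <-> s' = updf s i x).
Proof.
  intros Hs Hi Hx; destruct (updf_spec Hs Hi Hx) as (Hu & Hu1 & Hu2); split.
  - intros [Hs' [H1 H2]]; apply fun_eq with D; auto; intros k Hk.
    destruct (classic (k = i)) as [->|Hne].
    + rewrite (fun_maps _ _ Hs') in H1; rewrite Hu1; symmetry; tauto.
    + rewrite Hu2 by auto; specialize (H2 k (app s' k) Hne).
      rewrite (fun_maps _ _ Hs), (fun_maps _ _ Hs') in H2; tauto.
  - intros ->; split; auto; split; [rewrite (fun_maps _ _ Hu); auto|].
    intros k y Hk; rewrite (fun_maps _ _ Hs), (fun_maps _ _ Hu), Hu2; tauto.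
Qed.

Section Denotation.
Context (D : V) (P : option V).

Definition holds_pred x := match P with None => False | Some p => x in_ p end.

Definition dclause c f s :=
  (exists i j, c = cmem i j /\ app s i in_ app s j) \/
  (exists i j, c = ceq i j /\ app s i = app s j) \/
  (exists a, c = cneg a /\ ~ s in_ app f a) \/
  (exists a b, c = cand a b /\ s in_ app f a /\ s in_ app f b) \/
  (exists i a, c = cex i a /\ exists x, x in_ D /\ updf s i x in_ app f a) \/
  (exists i, c = cpred i /\ holds_pred (app s i)).

Definition dstep c f : V := setof (fun s => s in_ funspace omega D /\ dclause c f s).

Lemma dclause_def : dP (fun v => dclause (v 0) (v 1) (v 2)).
Proof.
  unfold dclause, cmem, ceq, cneg, cand, cex, cpred, holds_pred.
  destruct P; dpw ltac:(apply dT_updf).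
Qed.
Lemma isset_dstep c f : isset (fun s => s in_ funspace omega D /\ dclause c f s).
Proof. pose proof dclause_def; apply isset_sep; dp. Qed.
Lemma dstep_def : dP (fun v => v 0 = dstep (v 1) (v 2)).
Proof.
  pose proof dclause_def.
  apply (dT_setof (P := fun s v => s in_ funspace omega D /\ dclause (v 0) (v 1) s));
    [intros; apply isset_dstep|dp].
Qed.

Definition rk_lt b a : Prop := rho b in_ rho a.

Lemma rk_lt_ind (Q : V -> Prop) : dP (fun v => Q (v 0)) ->
  (forall a, (forall b, rk_lt b a -> Q b) -> Q a) -> forall a, Q a.
Proof.
  intros HQ IH.
  enough (H : forall r, ordinal r -> forall a, rho a in_ r -> Q a).
  { intros a; apply (H (suc (rho a))); [apply ord_suc, ord_rho|apply in_suc; auto]. }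
  apply (ord_ind (P := fun r => forall a, rho a in_ r -> Q a)); [dp|].
  intros r Hr IHr a Ha; apply IH; intros b Hb; exact (IHr _ Ha b Hb).
Qed.

(** The set of assignments satisfying a code. The recursion is on rank, as the parts of a code have
    smaller rank, and it reaches nonstandard codes as well. Arguments about [satisfies] pass through
    it by [satisfies_den]. *)
Definition den : V -> V := recfun rk_lt dstep.

Lemma den_eq c : den c = dstep c (mkfun (Vf (rho c)) den).
Proof.
  unfold den; rewrite recfun_eq.
  - f_equal; f_equal; apply setof_eq; intros x; apply in_Vf_rho, ord_rho.
  - unfold rk_lt; dp.
  - unfold rk_lt; intros a b d H1 H2; apply ord_trans with (rho b); auto using ord_rho.
  - intros a; exists (Vf (rho a)); intros x; apply in_Vf_rho, ord_rho.
  - apply rk_lt_ind.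
  - apply dstep_def.
Qed.

Lemma den_def : dP (fun v => v 0 = den (v 1)).
Proof.
  apply recfun_def.
  - unfold rk_lt; dp.
  - unfold rk_lt; intros a b d H1 H2; apply ord_trans with (rho b); auto using ord_rho.
  - intros a; exists (Vf (rho a)); intros x; apply in_Vf_rho, ord_rho.
  - apply rk_lt_ind.
  - apply dstep_def.
Qed.

Lemma opair_rk x y : x in_ Vf (rho (opair x y)) /\ y in_ Vf (rho (opair x y)).
Proof.
  assert (H : upair x y in_ opair x y) by (rewrite <- (proj1 (is_opair_iff _ x y) (ex_intro _ (upair x x) (ex_intro _ (upair x y) (conj (proj2 (is_pair_iff _ _ _) eq_refl) (conj (proj2 (is_pair_iff _ _ _) eq_refl) (proj2 (is_pair_iff _ _ _) eq_refl)))))); apply in_upair; auto).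
  split; apply in_Vf_rho; try apply ord_rho; apply ord_trans with (rho (upair x y));
    auto using ord_rho, rho_mem; apply rho_mem, in_upair; auto.
Qed.

Lemma den_sub c a : a in_ Vf (rho c) -> app (mkfun (Vf (rho c)) den) a = den a.
Proof. intros H; apply app_mkfun; auto using den_def. Qed.

Lemma in_den c s : s in_ den c <-> is_fun s omega D /\ dclause c (mkfun (Vf (rho c)) den) s.
Proof.
  rewrite den_eq; unfold dstep; rewrite (in_setof _ (isset_dstep _ _)), in_funspace; tauto.
Qed.

Ltac code_inv :=
  repeat match goal with
  | H : _ \/ _ |- _ => destruct H
  | H : exists _, _ |- _ => destruct H
  | H : _ /\ _ |- _ => destruct H
  | H : opair (num _) _ = opair (num _) _ |- _ => apply opair_inj in H; destruct H
  | H : opair _ _ = opair _ _ |- _ => apply opair_inj in H; destruct H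
  | H : num _ = num _ |- _ => apply num_inj in H; try discriminate H; clear H
  end; subst.

Lemma den_clauses s : is_fun s omega D ->
  (forall i j, s in_ den (cmem i j) <-> app s i in_ app s j) /\
  (forall i j, s in_ den (ceq i j) <-> app s i = app s j) /\
  (forall a, s in_ den (cneg a) <-> ~ s in_ den a) /\
  (forall a b, s in_ den (cand a b) <-> s in_ den a /\ s in_ den b) /\
  (forall i a, s in_ den (cex i a) <-> exists x, x in_ D /\ updf s i x in_ den a) /\
  (forall i, s in_ den (cpred i) <-> holds_pred (app s i)).
Proof.
  intros Hs.
  assert (R1 : forall n x, x in_ Vf (rho (opair (num n) x))) by (intros; apply opair_rk).
  assert (R2 : forall n x y, x in_ Vf (rho (opair (num n) (opair x y))) /\
     y in_ Vf (rho (opair (num n) (opair x y)))).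
  { intros n x y; pose proof (R1 n (opair x y)) as H; apply in_Vf_rho in H; [|apply ord_rho].
    destruct (opair_rk x y) as [H1 H2]; apply in_Vf_rho in H1, H2; try apply ord_rho.
    split; (apply in_Vf_rho; [apply ord_rho|]); apply ord_trans with (rho (opair x y)); auto using ord_rho. }
  repeat match goal with |- _ /\ _ => split end; intros; rewrite in_den;
    unfold dclause, cmem, ceq, cneg, cand, cex, cpred; split; intros H.
  - code_inv; auto.
  - split; auto; left; eauto.
  - code_inv; auto.
  - split; auto; right; left; eauto.
  - code_inv; rewrite den_sub in *; auto.
  - split; auto; do 2 right; left; eexists; split; [reflexivity|]; rewrite den_sub; auto.
  - code_inv; rewrite den_sub in *; auto; apply R2.
  - split; auto; do 3 right; left; do 2 eexists; split; [reflexivity|]; rewrite !den_sub; auto; apply R2.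
  - code_inv; rewrite den_sub in *; eauto; apply R2.
  - split; auto; do 4 right; left; do 2 eexists; split; [reflexivity|].
    destruct H as (x & Hx & H); exists x; rewrite !den_sub; auto; apply R2.
  - code_inv; auto.
  - split; auto; do 5 right; eauto.
Qed.

End Denotation.

End InternalLogic.

Section Satisfaction.
Context {V : set_structure} {hZF : ZF V}.
Implicit Types a b c x y z f s t D E : V.

Definition Tr D P : V := setof (fun p => exists c s, is_formula (has_pred P) c /\
  s in_ funspace omega D /\ s in_ den D P c /\ p = opair c s).

Lemma isset_Tr D P : isset (fun p => exists c s, is_formula (has_pred P) c /\
  s in_ funspace omega D /\ s in_ den D P c /\ p = opair c s).
Proof.
  apply isset_sub with (prod (Vf omega) (funspace omega D)).
  - intros p (c & s & Hc & Hs & _ & ->); apply opair_in_prod; split; auto.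
    now apply is_formula_Vomega in Hc.
  - pose proof (is_formula_def (has_pred P)); pose proof (den_def D P); dp.
Qed.

Lemma maps_Tr D P c s : is_formula (has_pred P) c -> is_fun s omega D ->
  (maps (Tr D P) c s <-> s in_ den D P c).
Proof.
  intros Hc Hs; rewrite maps_iff; unfold Tr; rewrite (in_setof _ (isset_Tr D P)); split.
  - intros (c' & s' & _ & _ & H & E); apply opair_inj in E; destruct E; now subst.
  - intros H; exists c, s; rewrite in_funspace; auto.
Qed.

(** Tarski's clauses determine a truth set on pairs of a formula and an assignment, by induction on
    codes inside [V]; elsewhere it may contain anything. *)
Lemma truth_set_iff D P T : truth_set D P T <->
  forall c s, is_formula (has_pred P) c -> is_fun s omega D -> (maps T c s <-> s in_ den D P c).
Proof.
  destruct (@formula_intro V hZF (has_pred P)) as (I1 & I2 & I3 & I4 & I5 & I6).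
  split.
  - intros HT; enough (H : forall c, is_formula (has_pred P) c -> forall s, is_fun s omega D ->
      (opair c s in_ T <-> s in_ den D P c)).
    { intros c s Hc Hs; rewrite maps_iff; auto. }
    assert (Hd := den_def D P).
    apply (formula_ind (P := fun c => forall s, is_fun s omega D -> (opair c s in_ T <-> s in_ den D P c)));
      [unfold is_fun, maps, is_opair, is_pair, unique; dp|..];
    intros; match goal with Hs : is_fun ?s omega D |- _ =>
      destruct (HT omega s (proj2 (is_omega_iff omega) eq_refl) Hs) as (T1 & T2 & T3 & T4 & T5 & T6);
      destruct (den_clauses P Hs) as (D1 & D2 & D3 & D4 & D5 & D6) end; rewrite <- maps_iff.
    + rewrite (T1 _ i j), D1 by (auto; now apply code_mem_iff); split.
      * intros (x & y & Hx & Hy & Hxy); rewrite (fun_maps _ _ H1) in Hx; rewrite (fun_maps _ _ H1) in Hy.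
        destruct Hx as [_ ->], Hy as [_ ->]; auto.
      * intros Hxy; exists (app s i), (app s j); rewrite !(fun_maps _ _ H1); auto.
    + rewrite (T2 _ i j), D2 by (auto; now apply code_eq_iff); split.
      * intros (x & Hx & Hy); rewrite (fun_maps _ _ H1) in Hx; rewrite (fun_maps _ _ H1) in Hy.
        destruct Hx as [_ ->], Hy as [_ ->]; auto.
      * intros Hxy; exists (app s i); rewrite !(fun_maps _ _ H1); auto.
    + rewrite (T3 _ a), D3, maps_iff, H0 by (auto; now apply code_neg_iff); tauto.
    + rewrite (T4 _ a b), D4, !maps_iff, H1, H2 by (auto; now apply code_and_iff); tauto.
    + rewrite (T5 _ i a), D5 by (auto; now apply code_ex_iff); split.
      * intros (x & s' & Hx & Hs' & Hu & HT').
        assert (Es : s' = updf s i x) by (apply (@is_update_iff V hZF s s' i x D); auto).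
        subst s'; exists x; split; auto; apply H1; auto; now apply maps_iff.
      * intros (x & Hx & Hu); destruct (proj2 (@is_update_iff V hZF s _ i x D H2 H Hx) eq_refl).
        exists x, (updf s i x); split; auto; split; auto; split; auto.
        apply maps_iff, H1; auto.
    + destruct P as [p|]; [|discriminate].
      rewrite (T6 _ i), D6 by (auto; now apply code_pred_iff); simpl; split.
      * intros (x & Hx & Hp); rewrite (fun_maps _ _ H1) in Hx; destruct Hx; now subst.
      * intros Hp; exists (app s i); rewrite (fun_maps _ _ H1); auto.
  - intros HT w s Hw Hs; apply is_omega_iff in Hw; subst w.
    destruct (den_clauses P Hs) as (D1 & D2 & D3 & D4 & D5 & D6).
    repeat match goal with |- _ /\ _ => split end.
    + intros c i j Hi Hj Hc; apply code_mem_iff in Hc; subst c; rewrite HT, D1 by auto; split.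
      * intros Hxy; exists (app s i), (app s j); rewrite !(fun_maps _ _ Hs); auto.
      * intros (x & y & Hx & Hy & Hxy); rewrite (fun_maps _ _ Hs) in Hx; rewrite (fun_maps _ _ Hs) in Hy.
        destruct Hx as [_ ->], Hy as [_ ->]; auto.
    + intros c i j Hi Hj Hc; apply code_eq_iff in Hc; subst c; rewrite HT, D2 by auto; split.
      * intros Hxy; exists (app s i); rewrite !(fun_maps _ _ Hs); auto.
      * intros (x & Hx & Hy); rewrite (fun_maps _ _ Hs) in Hx; rewrite (fun_maps _ _ Hs) in Hy.
        destruct Hx as [_ ->], Hy as [_ ->]; auto.
    + intros c a Ha Hc; apply code_neg_iff in Hc; subst c; rewrite !HT, D3 by auto; tauto.
    + intros c a b Ha Hb Hc; apply code_and_iff in Hc; subst c; rewrite !HT, D4 by auto; tauto.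
    + intros c i a Hi Ha Hc; apply code_ex_iff in Hc; subst c; rewrite HT, D5 by auto; split.
      * intros (x & Hx & Hu); destruct (proj2 (@is_update_iff V hZF s _ i x D Hs Hi Hx) eq_refl).
        exists x, (updf s i x); split; auto; split; auto; split; auto; apply HT; auto.
      * intros (x & s' & Hx & Hs' & Hu & HT').
        assert (Es : s' = updf s i x) by (apply (@is_update_iff V hZF s s' i x D); auto).
        subst s'; exists x; split; auto; apply HT; auto.
    + destruct P as [p|]; [|exact Logic.I].
      intros c i Hi Hc; apply code_pred_iff in Hc; subst c; rewrite HT, D6 by auto; simpl; split.
      * intros Hp; exists (app s i); rewrite (fun_maps _ _ Hs); auto.
      * intros (x & Hx & Hp); rewrite (fun_maps _ _ Hs) in Hx; destruct Hx; now subst.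
Qed.

Lemma truth_set_Tr D P : truth_set D P (Tr D P).
Proof. apply truth_set_iff; intros; now apply maps_Tr. Qed.

Lemma satisfies_den D P c s : is_formula (has_pred P) c -> is_fun s omega D ->
  (satisfies D P c s <-> s in_ den D P c).
Proof.
  intros Hc Hs; split.
  - intros (T & HT & H); rewrite truth_set_iff in HT; apply HT; auto.
  - intros H; exists (Tr D P); split; [apply truth_set_Tr|now apply maps_Tr].
Qed.

(** The bound [n] is a number of [V], possibly nonstandard. It allows an assignment to be altered
    above [n] so that it becomes an element of the level at hand. *)
Lemma finite_support D P c : is_formula (has_pred P) c ->
  exists n, n in_ omega /\ forall s s', is_fun s omega D -> is_fun s' omega D ->
    (forall k, k in_ n -> app s k = app s' k) -> (s in_ den D P c <-> s' in_ den D P c).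
Proof.
  assert (Hd := den_def D P).
  assert (Hmax : forall i j, i in_ omega -> j in_ omega ->
    exists n, n in_ omega /\ subset i n /\ subset j n) by (intros; now apply lim_max with (a := omega); auto using lim_omega).
  apply (formula_ind (P := fun c => exists n, n in_ omega /\ forall s s', is_fun s omega D -> is_fun s' omega D ->
    (forall k, k in_ n -> app s k = app s' k) -> (s in_ den D P c <-> s' in_ den D P c))).
  { unfold is_fun, maps, is_opair, is_pair, unique; dp. }
  - intros i j Hi Hj; destruct (Hmax (suc i) (suc j)) as (n & Hn & H1 & H2); auto using suc_omega.
    exists n; split; auto; intros s s' Hs Hs' H.
    rewrite (proj1 (den_clauses P Hs)), (proj1 (den_clauses P Hs')).
    rewrite !H; [tauto|apply H2, in_suc; auto|apply H1, in_suc; auto].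
  - intros i j Hi Hj; destruct (Hmax (suc i) (suc j)) as (n & Hn & H1 & H2); auto using suc_omega.
    exists n; split; auto; intros s s' Hs Hs' H.
    rewrite (proj1 (proj2 (den_clauses P Hs))), (proj1 (proj2 (den_clauses P Hs'))).
    rewrite !H; [tauto|apply H2, in_suc; auto|apply H1, in_suc; auto].
  - intros a _ (n & Hn & IH); exists n; split; auto; intros s s' Hs Hs' H.
    destruct (den_clauses P Hs) as (_ & _ & -> & _), (den_clauses P Hs') as (_ & _ & -> & _).
    rewrite (IH s s'); tauto.
  - intros a b _ _ (n & Hn & IHa) (m & Hm & IHb); destruct (Hmax n m) as (k & Hk & H1 & H2); auto.
    exists k; split; auto; intros s s' Hs Hs' H.
    destruct (den_clauses P Hs) as (_ & _ & _ & -> & _), (den_clauses P Hs') as (_ & _ & _ & -> & _).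
    rewrite (IHa s s'), (IHb s s') by auto; tauto.
  - intros i a Hi _ (n & Hn & IH); exists n; split; auto.
    enough (Hw : forall s s', is_fun s omega D -> is_fun s' omega D ->
       (forall k, k in_ n -> app s k = app s' k) -> s in_ den D P (cex i a) -> s' in_ den D P (cex i a)).
    { intros s s' Hs Hs' H; split; apply Hw; auto; intros; symmetry; auto. }
    intros s s' Hs Hs' H.
    destruct (den_clauses P Hs) as (_ & _ & _ & _ & -> & _), (den_clauses P Hs') as (_ & _ & _ & _ & -> & _).
    intros (x & Hx & Hd'); exists x; split; auto.
    destruct (updf_spec Hs Hi Hx) as (U1 & U2 & U3), (updf_spec Hs' Hi Hx) as (U1' & U2' & U3').
    apply (IH (updf s i x) (updf s' i x)); auto.
    intros k Hk; destruct (classic (k = i)) as [->|Hne]; [congruence|rewrite U3, U3'; auto].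
  - intros HP i Hi; exists (suc i); split; [now apply suc_omega|]; intros s s' Hs Hs' H.
    destruct (den_clauses P Hs) as (_ & _ & _ & _ & _ & ->), (den_clauses P Hs') as (_ & _ & _ & _ & _ & ->).
    rewrite H; [tauto|apply in_suc; auto].
Qed.

Fixpoint code (p : fml) : V :=
  match p with
  | FMem i j => cmem (num i) (num j)
  | FEq i j => ceq (num i) (num j)
  | FNeg q => cneg (code q)
  | FAnd q r => cand (code q) (code r)
  | FEx i q => cex (num i) (code q)
  end.

Lemma is_formula_code hp p : is_formula hp (code p).
Proof.
  destruct (@formula_intro V hZF hp) as (I1 & I2 & I3 & I4 & I5 & I6).
  induction p; simpl; auto using num_omega.
Qed.

Lemma den_code D P p : forall s v, is_fun s omega D ->
  (forall k, k < var_bound p -> app s (num k) = v k) ->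
  (s in_ den D P (code p) <-> sat (fun x => x in_ D) v p).
Proof.
  induction p as [i j|i j|p IH|p IHp q IHq|i p IH]; cbn [code sat var_bound]; intros s v Hs H;
    destruct (den_clauses P Hs) as (D1 & D2 & D3 & D4 & D5 & D6).
  - rewrite D1, !H by lia; tauto.
  - rewrite D2, !H by lia; tauto.
  - rewrite D3, (IH s v); auto; tauto.
  - rewrite D4, (IHp s v), (IHq s v); auto; try tauto; intros; apply H; lia.
  - rewrite D5; assert (Hx : forall x, x in_ D -> (updf s (num i) x in_ den D P (code p) <->
      sat (fun x => x in_ D) (upd v i x) p)).
    { intros x Hx; destruct (updf_spec Hs (num_omega i) Hx) as (U1 & U2 & U3).
      apply IH; auto; intros k Hk; destruct (Nat.eq_dec k i) as [->|Hne]; [now rewrite upd_same|].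
      rewrite upd_other by auto; rewrite U3 by (now apply num_neq); apply H; lia. }
    split; intros (x & Hx1 & Hx2); exists x; split; auto; now apply Hx.
Qed.

(** Carries the first [n] values of a metatheoretic environment as an assignment in [V]; the other
    positions get [v 0], which is a legal value. *)
Fixpoint asg (v : nat -> V) (n : nat) : V :=
  match n with 0 => mkfun omega (fun _ => v 0) | S k => updf (asg v k) (num k) (v k) end.

Lemma is_fun_mkfun a b (g : V -> V) : dP (fun v => v 0 = g (v 1)) ->
  (forall x, x in_ a -> g x in_ b) -> is_fun (mkfun a g) a b.
Proof.
  intros Hd Hg; apply is_fun_iff; split; [now apply func_mkfun|].
  intros x Hx; rewrite app_mkfun; auto.
Qed.

Lemma asg_spec D v n : (forall k, v k in_ D) -> is_fun (asg v n) omega D /\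
  (forall k, k < n -> app (asg v n) (num k) = v k).
Proof.
  intros Hv; induction n as [|n [IH1 IH2]]; simpl.
  - split; [|lia]; apply is_fun_mkfun; [dp|auto].
  - destruct (updf_spec IH1 (num_omega n) (Hv n)) as (U1 & U2 & U3); split; auto.
    intros k Hk; destruct (Nat.eq_dec k n) as [->|Hne]; auto.
    rewrite U3; [apply IH2; lia|now apply num_neq].
Qed.

Lemma asg_comp D E j v n : is_fun j D E -> (forall k, v k in_ D) ->
  forall i, i in_ omega -> app (asg (fun k => app j (v k)) n) i = app j (app (asg v n) i).
Proof.
  intros Hj Hv; assert (Hv' : forall k, app j (v k) in_ E).
  { intros k; apply is_fun_iff in Hj; now apply Hj. }
  induction n as [|n IH]; simpl; intros i Hi.
  - rewrite !app_mkfun; auto; dp.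
  - destruct (updf_spec (proj1 (asg_spec n Hv)) (num_omega n) (Hv n)) as (_ & U2 & U3).
    destruct (updf_spec (proj1 (asg_spec (v := fun k => app j (v k)) n Hv')) (num_omega n) (Hv' n))
      as (_ & U2' & U3').
    destruct (classic (i = num n)) as [->|Hne]; [now rewrite U2, U2'|].
    rewrite U3, U3' by auto; auto.
Qed.

Lemma emb_fun j D P E Q : elementary_embedding j D P E Q -> is_fun j D E.
Proof. intros H; apply H. Qed.

Lemma fun_in j D E x : is_fun j D E -> x in_ D -> app j x in_ E.
Proof. intros H; apply is_fun_iff in H; now apply H. Qed.

Lemma emb_den j D P E Q : elementary_embedding j D P E Q <->
  has_pred P = has_pred Q /\ is_fun j D E /\
  forall c s t, is_formula (has_pred P) c -> is_fun s omega D -> is_fun t omega E ->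
    (forall i, i in_ omega -> app t i = app j (app s i)) -> (s in_ den D P c <-> t in_ den E Q c).
Proof.
  unfold elementary_embedding; split; (intros (H1 & H2 & H3); split; [auto|split; auto]).
  - intros c s t Hc Hs Ht Hst.
    assert (Hc' : is_formula (has_pred Q) c) by (now rewrite <- H1).
    rewrite <- (satisfies_den Hc Hs), <- (satisfies_den Hc' Ht).
    apply (H3 omega); auto; [now apply is_omega_iff|].
    intros i x y; rewrite (fun_maps _ _ Hs), (fun_maps _ _ H2), (fun_maps _ _ Ht).
    intros [Hi ->] [_ ->]; auto; split; auto; symmetry; auto.
  - intros w c s t Hw Hc Hs Ht Hst; apply is_omega_iff in Hw; subst w.
    assert (Hc' : is_formula (has_pred Q) c) by (now rewrite <- H1).
    rewrite (satisfies_den Hc Hs), (satisfies_den Hc' Ht); apply H3; auto.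
    intros i Hi; assert (Hm : maps t i (app j (app s i))).
    { apply (Hst i (app s i)); [apply (fun_maps _ _ Hs); auto|].
      apply (fun_maps _ _ H2); split; auto; now apply fun_in with omega. }
    apply (fun_maps _ _ Ht) in Hm; symmetry; tauto.
Qed.

Lemma emb_sat j D P E Q : elementary_embedding j D P E Q -> forall p v, (forall k, v k in_ D) ->
  (sat (fun x => x in_ D) v p <-> sat (fun x => x in_ E) (fun k => app j (v k)) p).
Proof.
  intros H p v Hv; apply emb_den in H; destruct H as (H1 & H2 & H3).
  assert (Hv' : forall k, app j (v k) in_ E) by (intros; now apply fun_in with D).
  destruct (asg_spec (var_bound p) Hv) as [A1 A2].
  destruct (asg_spec (v := fun k => app j (v k)) (var_bound p) Hv') as [B1 B2].
  rewrite <- (den_code P A1 A2), <- (den_code Q B1 B2); apply H3; auto using is_formula_code.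
  now apply asg_comp with D E.
Qed.

(** Elementarity for the atomic formula that applies the predicate to variable 0. *)
Lemma emb_pred j D E x y a : elementary_embedding j D (Some x) E (Some y) -> a in_ D ->
  (a in_ x <-> app j a in_ y).
Proof.
  intros H Ha; apply emb_den in H; destruct H as (H1 & H2 & H3); simpl in *.
  assert (Hv : forall k : nat, (fun _ => a) k in_ D) by auto.
  assert (Hv' : forall k : nat, (fun _ => app j a) k in_ E) by (intros; now apply fun_in with D).
  destruct (asg_spec 1 Hv) as [A1 A2], (asg_spec 1 Hv') as [B1 B2].
  assert (Hc : is_formula true (cpred (num 0))) by (apply formula_intro; auto using num_omega).
  specialize (H3 _ _ _ Hc A1 B1 (asg_comp 1 H2 Hv)).
  destruct (den_clauses (Some x) A1) as (_ & _ & _ & _ & _ & E1).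
  destruct (den_clauses (Some y) B1) as (_ & _ & _ & _ & _ & E2).
  rewrite E1, E2 in H3; unfold holds_pred in H3; rewrite A2, B2 in H3 by lia; auto.
Qed.

Lemma sub_den D E : elementary_substructure D E <-> subset D E /\
  forall c s, is_formula false c -> is_fun s omega D -> (s in_ den D None c <-> s in_ den E None c).
Proof.
  unfold elementary_substructure; split; intros [H1 H2]; split; auto.
  - intros c s Hc Hs.
    assert (Hs' : is_fun s omega E).
    { apply is_fun_iff in Hs; apply is_fun_iff; split; [apply Hs|]; intros; now apply H1, Hs. }
    rewrite <- !satisfies_den by auto; apply (H2 omega); auto; now apply is_omega_iff.
  - intros w c s Hw Hc Hs; apply is_omega_iff in Hw; subst w.
    assert (Hs' : is_fun s omega E).
    { apply is_fun_iff in Hs; apply is_fun_iff; split; [apply Hs|]; intros; now apply H1, Hs. }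
    rewrite !satisfies_den by auto; auto.
Qed.

Lemma sub_sat D E : elementary_substructure D E -> forall p v, (forall k, v k in_ D) ->
  (sat (fun x => x in_ D) v p <-> sat (fun x => x in_ E) v p).
Proof.
  intros H p v Hv; apply sub_den in H; destruct H as [H1 H2].
  destruct (asg_spec (var_bound p) Hv) as [A1 A2].
  destruct (asg_spec (D := E) (v := v) (var_bound p)) as [B1 _]; [auto|].
  rewrite <- (den_code None A1 A2), <- (den_code None B1 A2); apply H2; auto using is_formula_code.
Qed.

End Satisfaction.

(** * Absoluteness for limit levels above omega *)

Section Absoluteness.
Context {V : set_structure} {hZF : ZF V}.
Implicit Types a b c x y z f s t D E l : V.

Definition good l := lim l /\ omega in_ l.

Definition envin l (v : nat -> V) := forall k, v k in_ Vf l.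

(** One formula must define [P] at every level indexed by [G]. Elementary maps compare the truth of
    one formula in V_eta, X and V_zeta, so this uniformity is what lets [P] be transferred. *)
Definition abslG (G : V -> Prop) (P : (nat -> V) -> Prop) :=
  exists p, forall l, G l -> forall v, envin l v -> (sat (fun x => x in_ Vf l) v p <-> P v).

(** Two classes are used: [good] indices, when omega or newly formed pairs must belong to the level,
    and all ordinals, for embeddings of V_lam before lam is known to be [good]. *)
Class Levels (G : V -> Prop) := levels_ord : forall l, G l -> ordinal l.
#[global] Instance good_levels : Levels good.
Proof. intros l [[Ol _] _]; exact Ol. Qed.
#[global] Instance ordinal_levels : Levels (@ordinal V).
Proof. intros l; auto. Qed.

Section General.
Context {G : V -> Prop} {HG : Levels G}.
Local Notation absl := (abslG G).

Lemma absl_iff (P Q : (nat -> V) -> Prop) : (forall v, P v <-> Q v) -> absl P -> absl Q.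
Proof. intros H [p Hp]; exists p; intros; rewrite <- H; auto. Qed.
Lemma absl_mem i j : absl (fun v => v i in_ v j).
Proof. exists (FMem i j); simpl; tauto. Qed.
Lemma absl_eq i j : absl (fun v => v i = v j).
Proof. exists (FEq i j); simpl; tauto. Qed.
Lemma absl_not P : absl P -> absl (fun v => ~ P v).
Proof. intros [p Hp]; exists (FNeg p); simpl; intros; rewrite Hp; tauto. Qed.
Lemma absl_and P Q : absl P -> absl Q -> absl (fun v => P v /\ Q v).
Proof. intros [p Hp] [q Hq]; exists (FAnd p q); simpl; intros; rewrite (Hp l), (Hq l); tauto. Qed.
Lemma absl_or P Q : absl P -> absl Q -> absl (fun v => P v \/ Q v).
Proof.
  intros HP HQ; apply absl_iff with (2 := absl_not (absl_and (absl_not HP) (absl_not HQ))).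
  intros; tauto.
Qed.
Lemma absl_imp P Q : absl P -> absl Q -> absl (fun v => P v -> Q v).
Proof.
  intros HP HQ; apply absl_iff with (2 := absl_not (absl_and HP (absl_not HQ))); intros; tauto.
Qed.
Lemma absl_equiv P Q : absl P -> absl Q -> absl (fun v => P v <-> Q v).
Proof. intros; apply absl_and; now apply absl_imp. Qed.

(** An unbounded quantifier is absolute if every witness can be exchanged for one inside the level.
    In [absl_gex] and [absl_gall] a guard [B] already confines it. *)
Lemma absl_ex (Q : V -> (nat -> V) -> Prop) :
  (forall l v x, G l -> envin l v -> Q x v -> exists x', x' in_ Vf l /\ Q x' v) ->
  absl (fun v => Q (v 0) (fun k => v (S k))) -> absl (fun v => exists x, Q x v).
Proof.
  intros Hw [p Hp].
  exists (FEx (var_bound p) (ren (fun k => match k with 0 => var_bound p | S n => n end) p)).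
  intros l Hl v Hv; simpl.
  assert (E : forall x, x in_ Vf l -> (sat (fun x => x in_ Vf l) (upd v (var_bound p) x)
     (ren (fun k => match k with 0 => var_bound p | S n => n end) p) <-> Q x v)).
  { intros x Hx; rewrite sat_ren.
    pose proof (Hp l Hl (fun k => match k with 0 => x | S n => v n end)) as H; simpl in H.
    rewrite <- H by (intros [|k]; auto).
    apply sat_ext; intros [|k] Hk; [now rewrite upd_same|rewrite upd_other by lia; auto]. }
  split.
  - intros (x & Hx & H); exists x; now apply E.
  - intros (x & H); destruct (Hw l v x Hl Hv H) as (x' & Hx' & H'); exists x'; split; auto; now apply E.
Qed.

Lemma absl_gex (B Q : V -> (nat -> V) -> Prop) :
  (forall l v x, G l -> envin l v -> B x v -> x in_ Vf l) ->
  absl (fun v => B (v 0) (fun k => v (S k))) ->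
  absl (fun v => Q (v 0) (fun k => v (S k))) -> absl (fun v => exists x, B x v /\ Q x v).
Proof.
  intros Hb HB HQ; apply absl_ex; [|now apply absl_and].
  intros l v x Hl Hv [H1 H2]; exists x; split; eauto.
Qed.
Lemma absl_gall (B Q : V -> (nat -> V) -> Prop) :
  (forall l v x, G l -> envin l v -> B x v -> x in_ Vf l) ->
  absl (fun v => B (v 0) (fun k => v (S k))) ->
  absl (fun v => Q (v 0) (fun k => v (S k))) -> absl (fun v => forall x, B x v -> Q x v).
Proof.
  intros Hb HB HQ.
  apply absl_iff with (2 := absl_not (absl_gex (Q := fun x v => ~ Q x v) Hb HB (absl_not HQ))).
  intros v; split; [|intros H (x & H1 & H2); auto].
  intros H x Hx; apply NNPP; intros Hn; apply H; eauto.
Qed.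
Lemma absl_all (Q : V -> (nat -> V) -> Prop) :
  (forall l v x, G l -> envin l v -> (forall x', x' in_ Vf l -> Q x' v) -> Q x v) ->
  absl (fun v => Q (v 0) (fun k => v (S k))) -> absl (fun v => forall x, Q x v).
Proof.
  intros Hb HQ.
  assert (HN : absl (fun v => exists x, ~ Q x v)).
  { apply (absl_ex (Q := fun x v => ~ Q x v)); [|now apply absl_not].
    intros l v x Hl Hv H; apply NNPP; intros Hn; apply H, (Hb l v x Hl Hv).
    intros x' Hx'; apply NNPP; intros HQ'; apply Hn; eauto. }
  apply absl_iff with (2 := absl_not HN).
  intros v; split; [|intros H (x & H1); auto].
  intros H x; apply NNPP; intros Hn; apply H; eauto.
Qed.
Lemma mem_bound l v x n : G l -> envin l v -> x in_ v n -> x in_ Vf l.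
Proof. intros Hl Hv; apply (Vf_trans (HG Hl) (Hv n)). Qed.
Lemma absl_bex (Q : V -> (nat -> V) -> Prop) n :
  absl (fun v => Q (v 0) (fun k => v (S k))) -> absl (fun v => exists x, x in_ v n /\ Q x v).
Proof.
  apply (absl_gex (B := fun x v => x in_ v n)); [intros; eapply mem_bound; eauto|apply absl_mem].
Qed.
Lemma absl_ball (Q : V -> (nat -> V) -> Prop) n :
  absl (fun v => Q (v 0) (fun k => v (S k))) -> absl (fun v => forall x, x in_ v n -> Q x v).
Proof.
  apply (absl_gall (B := fun x v => x in_ v n)); [intros; eapply mem_bound; eauto|apply absl_mem].
Qed.
Lemma absl_rename P (r : nat -> nat) : absl P -> absl (fun v => P (fun k => v (r k))).
Proof.
  intros [p Hp]; exists (ren r p); intros l Hl v Hv; rewrite sat_ren; apply Hp; auto.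
  intros k; apply Hv.
Qed.
Lemma absl_sub2 (P : V -> V -> Prop) i j :
  absl (fun v => P (v 0) (v 1)) -> absl (fun v => P (v i) (v j)).
Proof. exact (absl_rename (P := fun v => P (v 0) (v 1)) (fun k => match k with 0 => i | _ => j end)). Qed.

Lemma opair_bound l x y : ordinal l -> opair x y in_ Vf l -> x in_ Vf l /\ y in_ Vf l.
Proof.
  intros Ol H; destruct (opair_rk x y) as [H1 H2]; apply in_Vf_rho in H; auto.
  apply in_Vf_rho in H1, H2; auto using ord_rho.
  rewrite !in_Vf_rho by auto; split; now apply ord_trans with (rho (opair x y)).
Qed.
Lemma maps_bound l f x y : ordinal l -> f in_ Vf l -> maps f x y -> x in_ Vf l /\ y in_ Vf l.
Proof.
  intros Ol Hf H; apply maps_iff in H; apply opair_bound; auto; exact (Vf_trans Ol Hf H).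
Qed.

Lemma absl_subset i j : absl (fun v => subset (v i) (v j)).
Proof. apply absl_ball, absl_mem. Qed.
Lemma absl_empty i : absl (fun v => is_empty (v i)).
Proof.
  apply absl_iff with (fun v => forall x, x in_ v i -> ~ x in_ v i).
  { intros v; split; [intros H x Hx; exact (H x Hx Hx)|intros H x Hx; now apply H in Hx]. }
  apply absl_ball, absl_not, absl_mem.
Qed.
Lemma absl_pair i j k : absl (fun v => is_pair (v i) (v j) (v k)).
Proof.
  apply absl_iff with (fun v => (v j in_ v i /\ v k in_ v i) /\ forall z, z in_ v i -> z = v j \/ z = v k).
  - intros v; split.
    + intros [[H1 H2] H3] z; split; [auto|intros [->| ->]; auto].
    + intros H; split; [split; apply H; auto|intros z Hz; now apply H].
  - apply absl_and; [apply absl_and; apply absl_mem|].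
    apply absl_ball, absl_or; apply absl_eq.
Qed.
Lemma absl_opair i j k : absl (fun v => is_opair (v i) (v j) (v k)).
Proof.
  apply absl_iff with (fun v => exists s, s in_ v i /\ exists d, d in_ v i /\
    (is_pair s (v j) (v j) /\ is_pair d (v j) (v k) /\ is_pair (v i) s d)).
  - intros v; split.
    + intros (s & _ & d & _ & H); exists s, d; auto.
    + intros (s & d & H1 & H2 & H3); exists s; split; [apply H3; auto|].
      exists d; split; [apply H3; auto|auto].
  - apply absl_bex, absl_bex; repeat apply absl_and; apply absl_pair.
Qed.
Lemma absl_succ i j : absl (fun v => is_succ (v i) (v j)).
Proof.
  apply absl_iff with (fun v => (subset (v j) (v i) /\ v j in_ v i) /\ forall z, z in_ v i -> z in_ v j \/ z = v j).
  - intros v; split.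
    + intros [[H1 H2] H3] z; split; [auto|intros [H| ->]; auto].
    + intros H; split; [split; [intros z Hz|]; apply H; auto|intros z Hz; now apply H].
  - apply absl_and; [apply absl_and; [apply absl_subset|apply absl_mem]|].
    apply absl_ball, absl_or; [apply absl_mem|apply absl_eq].
Qed.
Lemma absl_maps i j k : absl (fun v => maps (v i) (v j) (v k)).
Proof.
  apply absl_iff with (fun v => exists p, p in_ v i /\ is_opair p (v j) (v k)).
  - intros v; split; intros (p & H1 & H2); exists p; auto.
  - apply absl_bex, absl_opair.
Qed.
Lemma absl_ordinal i : absl (fun v => ordinal (v i)).
Proof.
  apply absl_and; apply absl_ball; [apply absl_subset|].
  apply absl_ball, absl_subset.
Qed.
(** A history of [v i] consists of elements of [v i], since each [c] is a subset of itself and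
    [level_of] applies. It therefore lies in every level containing [v i]. *)
Lemma absl_level i : absl (fun v => level (v i)).
Proof.
  apply absl_iff with (fun v => exists h, subset h (v i) /\
    ((forall y, y in_ h -> ((forall z, z in_ y -> exists c, c in_ h /\ (c in_ y /\ subset z c)) /\
       forall c, c in_ h -> (c in_ y -> forall z, subset z c -> z in_ y))) /\
     (forall z, z in_ v i -> exists c, c in_ h /\ subset z c) /\
     forall c, c in_ h -> forall z, subset z c -> z in_ v i)).
  - intros v; split.
    + intros (h & _ & H1 & H2 & H3); exists h; split.
      * intros y z Hy; destruct (H1 y Hy) as [H4 H5]; split; auto.
        intros (c & Hc & Hcy & Hz); eauto.
      * intros z; split; auto; intros (c & Hc & Hz); eauto.
    + intros (h & H1 & H2); exists h; split; [|split; [|split]].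
      * intros c Hc; apply H2; exists c; split; auto; intros z; auto.
      * intros y Hy; split; [intros z Hz; now apply (H1 y z Hy)|].
        intros c Hc Hcy z Hz; apply (H1 y z Hy); eauto.
      * intros z Hz; now apply H2.
      * intros c Hc z Hz; apply H2; eauto.
  - apply (absl_gex (B := fun h v => subset h (v i))); [|apply absl_subset|].
    { intros l v x Hl Hv H; assert (Ol := HG Hl); now apply Vf_super with (v i). }
    assert (Hb : forall n l v x, G l -> envin l v -> subset x (v n) -> x in_ Vf l).
    { intros n l v x Hl Hv H; assert (Ol := HG Hl); now apply Vf_super with (v n). }
    apply absl_and; [|apply absl_and].
    + apply absl_ball, absl_and.
      * apply absl_ball, absl_bex, absl_and; [apply absl_mem|apply absl_subset].
      * apply absl_ball, absl_imp; [apply absl_mem|].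
        apply (absl_gall (B := fun z v => subset z (v 0))); [eauto|apply absl_subset|apply absl_mem].
    + apply absl_ball, absl_bex, absl_subset.
    + apply absl_ball.
      apply (absl_gall (B := fun z v => subset z (v 0))); [eauto|apply absl_subset|apply absl_mem].
Qed.

End General.

Notation absl := (abslG good).

Lemma absl_is_fun i j k : absl (fun v => is_fun (v i) (v j) (v k)).
Proof.
  apply absl_iff with (fun v =>
   (forall p, p in_ v i -> exists x, x in_ v j /\ exists y, y in_ v k /\ is_opair p x y) /\
   forall x, x in_ v j -> exists y, maps (v i) x y /\ forall y', maps (v i) x y' -> y = y').
  - intros v; split; intros [H1 H2]; split; auto; intros p Hp.
    + destruct (H1 p Hp) as (x & Hx & y & Hy & H); exists x, y; auto.
    + destruct (H1 p Hp) as (x & y & Hx & Hy & H); exists x; split; auto; exists y; auto.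
  - assert (Hb : forall l v x y, good l -> envin l v -> maps (v (S i)) x y -> y in_ Vf l).
    { intros l v x y [[Ol _] _] Hv H; apply (maps_bound Ol (Hv _) H). }
    apply absl_and.
    + apply absl_ball, absl_bex, absl_bex, absl_opair.
    + apply absl_ball; apply (absl_gex (B := fun y v => maps (v (S i)) (v 0) y)); [eauto|apply absl_maps|].
      apply (absl_gall (B := fun y' v => maps (v (S (S i))) (v 1) y')); [|apply absl_maps|apply absl_eq].
      intros l v x [[Ol _] _] Hv H; apply (maps_bound Ol (Hv _) H).
Qed.
Lemma absl_inductive i : absl (fun v => inductive (v i)).
Proof.
  apply absl_iff with (fun v => (exists e, e in_ v i /\ is_empty e) /\
    forall n, n in_ v i -> exists s, s in_ v i /\ is_succ s n).
  - intros v; split; (intros [(e & H1 & H2) H3]; split; [exists e; auto|]); intros n Hn;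
      destruct (H3 n Hn) as (s & Hs1 & Hs2); exists s; auto.
  - apply absl_and; [apply absl_bex, absl_empty|apply absl_ball, absl_bex, absl_succ].
Qed.
Lemma absl_omega i : absl (fun v => is_omega (v i)).
Proof.
  apply absl_iff with (fun v => inductive (v i) /\ forall u, subset u (v i) -> (inductive u -> subset (v i) u)).
  - intros v; split.
    + intros [H1 H2]; apply is_omega_iff, ext; intros x; split; intros Hx.
      * assert (Ho : subset omega (v i)).
        { intros n Hn; exact (proj1 (in_omega n) Hn _ H1). }
        apply (H2 omega Ho); auto; apply (proj2 (is_omega_iff omega) eq_refl).
      * exact (proj1 (in_omega x) Hx _ H1).
    + intros [H1 H2]; auto.
  - apply absl_and; [apply absl_inductive|].
    apply (absl_gall (B := fun u v => subset u (v i))).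
    + intros l v x [[Ol _] _] Hv H; now apply Vf_super with (v i).
    + apply absl_subset.
    + apply absl_imp; [apply absl_inductive|apply absl_subset].
Qed.
Lemma good_num l n : good l -> num n in_ Vf l.
Proof.
  intros [[Ol _] Ho]; apply (Vf_mono_sub Ol Ho), Vomega_nat, num_omega.
Qed.
Lemma absl_numeral n i : absl (fun v => is_numeral n (v i)).
Proof.
  revert i; induction n as [|n IH]; intros i; [apply absl_empty|].
  apply (absl_gex (B := fun y v => is_numeral n y)); [|apply IH|apply absl_succ].
  intros l v x Hl Hv Hx; apply is_numeral_iff in Hx; subst; now apply good_num.
Qed.
Lemma absl_tagged n i j : absl (fun v => tagged n (v i) (v j)).
Proof.
  apply (absl_gex (B := fun t v => is_numeral n t)); [|apply absl_numeral|apply absl_opair].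
  intros l v x Hl Hv Hx; apply is_numeral_iff in Hx; subst; now apply good_num.
Qed.
Lemma good_opair l x y : good l -> x in_ Vf l -> y in_ Vf l -> opair x y in_ Vf l.
Proof. intros [Hl _]; now apply lim_opair. Qed.
Lemma absl_tagged2 n i j k : absl (fun v => exists p, is_opair p (v j) (v k) /\ tagged n (v i) p).
Proof.
  apply (absl_gex (B := fun p v => is_opair p (v j) (v k))); [|apply absl_opair|apply absl_tagged].
  intros l v x Hl Hv Hx; apply is_opair_iff in Hx; subst; now apply good_opair.
Qed.

Lemma code_bounds l : good l -> forall i j, i in_ Vf l -> j in_ Vf l ->
  cmem i j in_ Vf l /\ ceq i j in_ Vf l /\ cneg i in_ Vf l /\ cand i j in_ Vf l /\
  cex i j in_ Vf l /\ cpred i in_ Vf l.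
Proof.
  intros Hl i j Hi Hj; unfold cmem, ceq, cneg, cand, cex, cpred;
    repeat match goal with |- _ /\ _ => split end; repeat apply good_opair; auto using good_num.
Qed.

Lemma absl_formula_closed i : absl (fun v => formula_closed true (v i)).
Proof.
  apply absl_iff with (fun v => forall w, is_omega w ->
    ((forall i0, i0 in_ w -> forall j, j in_ w -> forall c, code_mem c i0 j -> c in_ v i) /\
    (forall i0, i0 in_ w -> forall j, j in_ w -> forall c, code_eq c i0 j -> c in_ v i) /\
    (forall a, a in_ v i -> forall c, code_neg c a -> c in_ v i) /\
    (forall a, a in_ v i -> forall b, b in_ v i -> forall c, code_and c a b -> c in_ v i) /\
    (forall i0, i0 in_ w -> forall a, a in_ v i -> forall c, code_ex c i0 a -> c in_ v i) /\
    (forall i0, i0 in_ w -> forall c, code_pred c i0 -> c in_ v i))).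
  - intros v; unfold formula_closed; split; intros H w Hw; specialize (H w Hw);
      destruct H as (H1 & H2 & H3 & H4 & H5 & H6); repeat match goal with |- _ /\ _ => split end; eauto.
  - apply (absl_gall (B := fun w v => is_omega w)); [|apply absl_omega|].
    { intros l v x [[Ol _] Ho] Hv Hx; apply is_omega_iff in Hx; subst.
      apply ord_in_Vf; auto using ord_omega. }
    repeat apply absl_and; repeat apply absl_ball.
    + apply (absl_gall (B := fun c v => code_mem c (v 1) (v 0))); [|apply absl_tagged2|apply absl_mem].
      intros l v x Hl Hv Hx; apply code_mem_iff in Hx; subst; now apply code_bounds.
    + apply (absl_gall (B := fun c v => code_eq c (v 1) (v 0))); [|apply absl_tagged2|apply absl_mem].
      intros l v x Hl Hv Hx; apply code_eq_iff in Hx; subst; now apply code_bounds.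
    + apply (absl_gall (B := fun c v => code_neg c (v 0))); [|apply absl_tagged|apply absl_mem].
      intros l v x Hl Hv Hx; apply code_neg_iff in Hx; subst; now apply (@code_bounds l Hl (v 0) (v 0)).
    + apply (absl_gall (B := fun c v => code_and c (v 1) (v 0))); [|apply absl_tagged2|apply absl_mem].
      intros l v x Hl Hv Hx; apply code_and_iff in Hx; subst; now apply code_bounds.
    + apply (absl_gall (B := fun c v => code_ex c (v 1) (v 0))); [|apply absl_tagged2|apply absl_mem].
      intros l v x Hl Hv Hx; apply code_ex_iff in Hx; subst; now apply code_bounds.
    + apply (absl_gall (B := fun c v => code_pred c (v 0))); [|apply absl_tagged|apply absl_mem].
      intros l v x Hl Hv Hx; apply code_pred_iff in Hx; subst; now apply (@code_bounds l Hl (v 0) (v 0)).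
Qed.

Lemma formula_bound l c : good l -> is_formula true c -> c in_ Vf l.
Proof.
  intros [[Ol _] Ho] Hc; apply (Vf_mono_sub Ol Ho); now apply is_formula_Vomega in Hc.
Qed.

Lemma absl_formula i : absl (fun v => is_formula true (v i)).
Proof.
  apply (absl_all (Q := fun F v => formula_closed true F -> v i in_ F)).
  - intros l v F Hl Hv H HF.
    assert (Hs := isset_formula (V := V) true).
    (* The set of all formulas is closed and a subset of V_omega, hence in the level; testing
       against it is enough. *)
    assert (H' : v i in_ setof (fun c : V => is_formula true c)).
    { apply H.
      - destruct Hl as [[Ol _] Ho]; apply in_Vf; auto; exists omega; split; auto.
        intros c Hc; apply setof_E in Hc; auto; now apply is_formula_Vomega in Hc.
      - destruct (@formula_intro V hZF true) as (I1 & I2 & I3 & I4 & I5 & I6).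
        apply formula_closed_iff; repeat match goal with |- _ /\ _ => split end; intros;
          (apply setof_I; [exact Hs|]);
          repeat match goal with H : _ in_ setof _ |- _ => apply setof_E in H; [|exact Hs] end; auto. }
    apply setof_E in H'; auto.
  - apply absl_imp; [apply absl_formula_closed|apply absl_mem].
Qed.

Lemma fun_bound l f a b : good l -> is_fun f a b -> a in_ Vf l -> b in_ Vf l -> f in_ Vf l.
Proof.
  intros Hl Hf Ha Hb; apply Vf_super with (prod a b); [apply Hl|apply lim_prod; auto; apply Hl|].
  apply is_fun_iff in Hf; destruct Hf as [[H1 _] H2]; intros p Hp; destruct (H1 p Hp) as (x & Hx & ->).
  apply opair_in_prod; auto.
Qed.

(** The clauses are reordered so that each quantifier is followed directly by a guard confining it
    to the level, as [absl_gall] and [absl_gex] require. *)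
Lemma absl_truth_set i j k : absl (fun v => truth_set (v i) (Some (v j)) (v k)).
Proof.
  apply absl_iff with (fun v => forall w, is_omega w -> forall s, is_fun s w (v i) ->
  ((forall i, i in_ w -> forall j, j in_ w -> forall c, code_mem c i j ->
    (maps (v k) c s <-> exists x, maps s i x /\ exists y, maps s j y /\ x in_ y)) /\
  (forall i, i in_ w -> forall j, j in_ w -> forall c, code_eq c i j ->
    (maps (v k) c s <-> exists x, maps s i x /\ maps s j x)) /\
  (forall a, is_formula true a -> forall c, code_neg c a ->
    (maps (v k) c s <-> ~ maps (v k) a s)) /\
  (forall a, is_formula true a -> forall b, is_formula true b ->
    forall c, code_and c a b -> (maps (v k) c s <-> maps (v k) a s /\ maps (v k) b s)) /\
  (forall i0, i0 in_ w -> forall a, is_formula true a -> forall c, code_ex c i0 a ->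
    (maps (v k) c s <-> exists x, x in_ v i /\ exists s', is_fun s' w (v i) /\ (is_update s' s i0 x /\ maps (v k) a s'))) /\
  (forall i, i in_ w -> forall c, code_pred c i ->
      (maps (v k) c s <-> exists x, maps s i x /\ x in_ v j)))).
  - intros v; unfold truth_set; simpl; split; intros H w.
    + intros s Hw Hs; specialize (H w Hw s Hs); destruct H as (H1 & H2 & H3 & H4 & H5 & H6).
      repeat match goal with |- _ /\ _ => split end; intros; auto.
      * rewrite (H1 _ H _ H0 _ H7); split; [intros (x & Hx & y & Hy & E); exists x, y; auto|].
        intros (x & y & Hx & Hy & E); exists x; split; auto; exists y; auto.
      * rewrite (H5 _ H _ H0 _ H7); split; [intros (x & Hx & y & Hy & E); exists x, y; auto|].
        intros (x & y & Hx & Hy & E); exists x; split; auto; exists y; auto.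
    + intros Hw s Hs; specialize (H w s Hw Hs); destruct H as (H1 & H2 & H3 & H4 & H5 & H6).
      repeat match goal with |- _ /\ _ => split end; intros; auto.
      * rewrite (H1 _ _ _ H H0 H7); split; [intros (x & y & Hx & Hy & E)|intros (x & Hx & y & Hy & E); exists x, y; auto].
        exists x; split; auto; exists y; auto.
      * rewrite (H5 _ _ _ H H0 H7); split; [intros (x & y & Hx & Hy & E)|intros (x & Hx & y & Hy & E); exists x, y; auto].
        exists x; split; auto; exists y; auto.
  - apply (absl_gall (B := fun w v => is_omega w)); [|apply absl_omega|].
    { intros l v x [[Ol _] Ho] Hv Hx; apply is_omega_iff in Hx; subst.
      apply ord_in_Vf; auto using ord_omega. }
    apply (absl_gall (B := fun s v => is_fun s (v 0) (v (S i)))); [|apply absl_is_fun|].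
    { intros l v x Hl Hv Hx; now apply fun_bound with (v 0) (v (S i)). }
    assert (Hb : forall n m l v x, good l -> envin l v -> maps (v n) (v m) x -> x in_ Vf l).
    { intros n m l v x [[Ol _] _] Hv H; apply (maps_bound Ol (Hv _) H). }
    repeat apply absl_and.
    + apply absl_ball, absl_ball.
      apply (absl_gall (B := fun c v => code_mem c (v 1) (v 0))); [|apply absl_tagged2|].
      { intros l v x Hl Hv Hx; apply code_mem_iff in Hx; subst; now apply code_bounds. }
      apply absl_equiv; [apply absl_maps|].
      apply (absl_gex (B := fun x v => maps (v 3) (v 2) x)); [eauto|apply absl_maps|].
      apply (absl_gex (B := fun x v => maps (v 4) (v 2) x)); [eauto|apply absl_maps|apply absl_mem].
    + apply absl_ball, absl_ball.
      apply (absl_gall (B := fun c v => code_eq c (v 1) (v 0))); [|apply absl_tagged2|].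
      { intros l v x Hl Hv Hx; apply code_eq_iff in Hx; subst; now apply code_bounds. }
      apply absl_equiv; [apply absl_maps|].
      apply (absl_gex (B := fun x v => maps (v 3) (v 2) x)); [eauto|apply absl_maps|apply absl_maps].
    + apply (absl_gall (B := fun a v => is_formula true a)); [eauto using formula_bound|apply absl_formula|].
      apply (absl_gall (B := fun c v => code_neg c (v 0))); [|apply absl_tagged|].
      { intros l v x Hl Hv Hx; apply code_neg_iff in Hx; subst; now apply (@code_bounds l Hl (v 0) (v 0)). }
      apply absl_equiv; [apply absl_maps|apply absl_not, absl_maps].
    + apply (absl_gall (B := fun a v => is_formula true a)); [eauto using formula_bound|apply absl_formula|].
      apply (absl_gall (B := fun a v => is_formula true a)); [eauto using formula_bound|apply absl_formula|].
      apply (absl_gall (B := fun c v => code_and c (v 1) (v 0))); [|apply absl_tagged2|].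
      { intros l v x Hl Hv Hx; apply code_and_iff in Hx; subst; now apply code_bounds. }
      apply absl_equiv; [apply absl_maps|apply absl_and; apply absl_maps].
    + apply absl_ball.
      apply (absl_gall (B := fun a v => is_formula true a)); [eauto using formula_bound|apply absl_formula|].
      apply (absl_gall (B := fun c v => code_ex c (v 1) (v 0))); [|apply absl_tagged2|].
      { intros l v x Hl Hv Hx; apply code_ex_iff in Hx; subst; now apply code_bounds. }
      apply absl_equiv; [apply absl_maps|].
      apply absl_bex.
      apply (absl_gex (B := fun s v => is_fun s (v 5) (v (S (S (S (S (S (S i))))))))); [|apply absl_is_fun|].
      { intros l v x Hl Hv Hx; eapply fun_bound; eauto. }
      apply absl_and; [|apply absl_maps].
      apply absl_and; [apply absl_maps|].
      (* This quantifier of [is_update] has no guard, but arguments outside the level are mapped by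
         neither assignment. *)
      apply (absl_all (Q := fun k0 v => forall y, k0 <> v 4 -> (maps (v 0) k0 y <-> maps (v 5) k0 y))).
      { intros l v k0 Hl Hv H y Hne.
        split; intros Hm; destruct (maps_bound (proj1 (proj1 Hl)) (Hv _) Hm) as [B1 B2];
          now apply (H k0 B1 y Hne). }
      apply (absl_all (Q := fun y v => v 0 <> v 5 -> (maps (v 1) (v 0) y <-> maps (v 6) (v 0) y))).
      { intros l v y Hl Hv H Hne.
        split; intros Hm; destruct (maps_bound (proj1 (proj1 Hl)) (Hv _) Hm) as [B1 B2]; now apply (H y B2 Hne). }
      apply absl_imp; [apply absl_not, absl_eq|apply absl_equiv; apply absl_maps].
    + apply absl_ball.
      apply (absl_gall (B := fun c v => code_pred c (v 0))); [|apply absl_tagged|].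
      { intros l v x Hl Hv Hx; apply code_pred_iff in Hx; subst; now apply (@code_bounds l Hl (v 0) (v 0)). }
      apply absl_equiv; [apply absl_maps|].
      apply (absl_gex (B := fun x v => maps (v 2) (v 1) x)); [eauto|apply absl_maps|apply absl_mem].
Qed.

Lemma good_omega l : good l -> omega in_ Vf l.
Proof. intros [[Ol _] Ho]; apply ord_in_Vf; auto using ord_omega. Qed.

Lemma Tr_bound l D P : good l -> D in_ Vf l -> Tr D P in_ Vf l.
Proof.
  intros Hl HD; pose proof Hl as [Ll Ho]; pose proof Ll as [Ol _].
  apply Vf_super with (prod (Vf omega) (pow (prod omega D))); auto.
  - apply lim_prod; auto; [now apply Vf_in|]; apply lim_pow; auto; apply lim_prod; auto using good_omega.
  - intros p Hp; unfold Tr in Hp; apply setof_E in Hp; [|apply isset_Tr].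
    destruct Hp as (c & s & Hc & Hs & _ & ->); apply opair_in_prod; split.
    + now apply is_formula_Vomega in Hc.
    + apply in_funspace in Hs; apply is_fun_iff in Hs; destruct Hs as [[H1 _] H2].
      apply in_pow; intros q Hq; destruct (H1 q Hq) as (x & Hx & ->); apply opair_in_prod; auto.
Qed.

Lemma absl_satisfies i j k m : absl (fun v => satisfies (v i) (Some (v j)) (v k) (v m)).
Proof.
  apply (absl_ex (Q := fun T v => truth_set (v i) (Some (v j)) T /\ maps T (v k) (v m))).
  - intros l v T Hl Hv [HT Hm].
    (* A truth set may be too large for the level, so the canonical one replaces it. The pair is
       added because [v k] and [v m] need not be a formula and an assignment, in which case [Tr] may
       lack it. *)
    exists (cup (Tr (v i) (Some (v j))) (upair (opair (v k) (v m)) (opair (v k) (v m)))).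
    assert (HT' := proj1 (truth_set_iff _ _ _) HT).
    split; [|split].
    + destruct Hl as [Ll Ho] eqn:El; apply lim_cup; auto; [now apply Tr_bound|].
      apply lim_upair; auto; apply lim_opair; auto.
    + apply truth_set_iff; intros c s Hc Hs; rewrite maps_iff, in_cup, in_upair, <- maps_iff, (maps_Tr Hc Hs).
      split; [|auto]; intros [H|H]; auto.
      assert (E : opair c s = opair (v k) (v m)) by tauto.
      apply opair_inj in E; destruct E; subst; apply HT'; auto.
    + apply maps_iff; rewrite in_cup, in_upair; auto.
  - apply absl_and; [apply absl_truth_set|apply absl_maps].
Qed.

Lemma absl_emb i j k m : absl (fun v => elementary_embedding (v i) (v j) (Some (v k)) (v j) (Some (v m))).
Proof.
  apply absl_iff with (fun v => is_fun (v i) (v j) (v j) /\ forall w, is_omega w ->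
    forall c, is_formula true c -> forall s, is_fun s w (v j) -> forall t, is_fun t w (v j) ->
    ((forall i0, i0 in_ w -> forall x, maps s i0 x -> forall y, maps (v i) x y -> maps t i0 y) ->
     (satisfies (v j) (Some (v k)) c s <-> satisfies (v j) (Some (v m)) c t))).
  { intros v; unfold elementary_embedding; split.
    - intros [H1 H2]; split; auto; split; auto; intros w c s t Hw Hc Hs Ht Hst.
      apply (H2 w Hw c Hc s Hs t Ht); intros; eauto.
    - intros (_ & H1 & H2); split; auto; intros w Hw c Hc s Hs t Ht Hst.
      apply (H2 w c s t); auto; intros i0 x y H3 H4; apply (Hst i0) with x; auto.
      apply (fun_maps _ _ Hs) in H3; tauto. }
  apply absl_and; [apply absl_is_fun|].
  apply (absl_gall (B := fun w v => is_omega w)); [|apply absl_omega|].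
  { intros l v x Hl Hv Hx; apply is_omega_iff in Hx; subst; now apply good_omega. }
  apply (absl_gall (B := fun a v => is_formula true a)); [eauto using formula_bound|apply absl_formula|].
  apply (absl_gall (B := fun s v => is_fun s (v 1) (v (S (S j))))); [|apply absl_is_fun|].
  { intros l v x Hl Hv Hx; eapply fun_bound; eauto. }
  apply (absl_gall (B := fun s v => is_fun s (v 2) (v (S (S (S j)))))); [|apply absl_is_fun|].
  { intros l v x Hl Hv Hx; eapply fun_bound; eauto. }
  assert (Hb : forall n m l v x, good l -> envin l v -> maps (v n) (v m) x -> x in_ Vf l).
  { intros n m' l v x [[Ol _] _] Hv H; apply (maps_bound Ol (Hv _) H). }
  apply absl_imp; [|apply absl_equiv; apply absl_satisfies].
  apply absl_ball.
  apply (absl_gall (B := fun x v => maps (v 2) (v 0) x)); [eauto|apply absl_maps|].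
  apply (absl_gall (B := fun y v => maps (v (6 + i)) (v 0) y)); [eauto|apply absl_maps|apply absl_maps].
Qed.

Lemma delta0_trans p : delta0 p -> forall u v, transitive u -> (forall k, v k in_ u) ->
  (sat (fun x => x in_ u) v p <-> sat all_sets v p).
Proof.
  induction 1; simpl; intros u v Hu Hv; try tauto.
  - rewrite IHdelta0; tauto.
  - rewrite IHdelta0_1, IHdelta0_2; tauto.
  - assert (E : forall x, x in_ u -> (sat (fun x => x in_ u) (upd v i x) p <-> sat all_sets (upd v i x) p)).
    { intros x Hx; apply IHdelta0; auto; intros k; unfold upd; destruct (Nat.eqb k i); auto. }
    split; intros (x & Hx & H1 & H2); exists x; rewrite upd_same, upd_other in * by auto.
    + split; [exact Logic.I|split; auto; now apply E].
    + assert (Hxu : x in_ u) by exact (Hu _ (Hv j) x H1).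
      split; [auto|split; auto; now apply E].
Qed.

End Absoluteness.

Notation absl := (abslG good).

(** * Reflection of a formula and Delta_0 conditions *)

Section Reflection.
Context {V : set_structure} {hZF : ZF V}.
Implicit Types a b c x y z f s t D E l : V.

Lemma updf_bound l s i x : good l -> s in_ Vf l -> i in_ Vf l -> x in_ Vf l -> updf s i x in_ Vf l.
Proof.
  intros [Ll _] Hs Hi Hx; apply Vf_super with (cup s (upair (opair i x) (opair i x))); [apply Ll| |].
  - apply lim_cup; auto; apply lim_upair; auto; apply lim_opair; auto.
  - intros p Hp; unfold updf in Hp; apply setof_E in Hp; [|apply isset_updf].
    rewrite in_cup, in_upair; tauto.
Qed.

Lemma const_bound l x : good l -> x in_ Vf l -> mkfun omega (fun _ => x) in_ Vf l.
Proof.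
  intros Hl Hx; apply fun_bound with omega (upair x x); auto using good_omega.
  - apply is_fun_mkfun; [dp|intros; apply in_upair; auto].
  - apply lim_upair; auto; apply Hl.
Qed.

Lemma nat_bound l n : good l -> n in_ omega -> n in_ Vf l.
Proof. intros [[Ol _] Ho] Hn; apply (Vf_mono_sub Ol Ho), Vomega_nat, Hn. Qed.

Lemma asg_bound l v n : good l -> envin l v -> asg v n in_ Vf l.
Proof.
  intros Hl Hv; induction n as [|n IH]; simpl; [now apply const_bound|].
  apply updf_bound; auto using good_num.
Qed.

(** [s] may be cofinal in V_l and so not an element of it. Starting from a constant function, [n]
    updates give an element with the right values below [n]. *)
Lemma truncation l s n : good l -> is_fun s omega (Vf l) -> n in_ omega ->
  exists s', s' in_ Vf l /\ is_fun s' omega (Vf l) /\ forall k, k in_ n -> app s' k = app s k.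
Proof.
  intros Hl Hs.
  apply (omega_ind (P := fun n => exists s', s' in_ Vf l /\ is_fun s' omega (Vf l) /\
    forall k, k in_ n -> app s' k = app s k)).
  - unfold is_fun, maps, is_opair, is_pair, unique; dp.
  - exists (mkfun omega (fun _ => emp)); assert (He : emp in_ Vf l) by (apply lim_emp, Hl).
    split; [now apply const_bound|split; [apply is_fun_mkfun; [dp|auto]|]].
    intros k Hk; now apply in_emp in Hk.
  - intros m Hm (s' & H1 & H2 & H3); exists (updf s' m (app s m)).
    assert (Hx := fun_in Hs Hm); destruct (updf_spec H2 Hm Hx) as (U1 & U2 & U3).
    split; [apply updf_bound; auto using nat_bound|split; auto].
    intros k Hk; apply in_suc in Hk; destruct (classic (k = m)) as [->|Hne]; auto.
    rewrite U3 by auto; apply H3; tauto.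
Qed.

(* [X] contains witnesses at [w] for all existential subformulas of [p]. *)
Fixpoint witnessed (p : fml) (w : nat -> V) (X : V) : Prop :=
  match p with
  | FMem _ _ | FEq _ _ => True
  | FNeg q => witnessed q w X
  | FAnd q r => witnessed q w X /\ witnessed r w X
  | FEx i q => ((exists y, sat all_sets (upd w i y) q) ->
      exists y, y in_ X /\ sat all_sets (upd w i y) q) /\ witnessed q w X
  end.

Lemma witnessed_mono p w X Y : subset X Y -> witnessed p w X -> witnessed p w Y.
Proof.
  intros HXY; induction p; simpl; auto; intros [H1 H2]; split; auto.
  intros H; destruct (H1 H) as (y & Hy & Hs); exists y; auto.
Qed.

Lemma witnessed_ext p w w' X : (forall k, k < var_bound p -> w k = w' k) ->
  witnessed p w X -> witnessed p w' X.
Proof.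
  induction p as [i j|i j|p IH|p IHp q IHq|i p IH]; cbn [witnessed var_bound]; auto; intros Hw [H1 H2].
  - split; [apply IHp|apply IHq]; auto; intros; apply Hw; lia.
  - split; [|apply IH; auto; intros; apply Hw; lia].
    assert (E : forall y, sat all_sets (upd w i y) p <-> sat all_sets (upd w' i y) p).
    { intros y; apply sat_ext; intros k Hk; unfold upd; destruct (Nat.eqb k i); auto; apply Hw; lia. }
    intros [y Hy]; destruct H1 as (z & Hz & Hs); [exists y; now apply E|exists z; split; auto; now apply E].
Qed.

Lemma witnessed_total p w : exists X, witnessed p w X.
Proof.
  induction p as [i j|i j|p IH|p [X HX] q [Y HY]|i p [X HX]]; simpl; auto.
  - exists emp; auto.
  - exists emp; auto.
  - exists (cup X Y); split; [apply witnessed_mono with X|apply witnessed_mono with Y]; auto;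
      intros z Hz; apply in_cup; auto.
  - destruct (classic (exists y, sat all_sets (upd w i y) p)) as [[y Hy]|Hn].
    + exists (cup X (upair y y)); split.
      * intros _; exists y; split; auto; rewrite in_cup, in_upair; auto.
      * apply witnessed_mono with X; auto; intros z Hz; apply in_cup; auto.
    + exists X; tauto.
Qed.

Lemma witnessed_def p (t : nat -> (nat -> V) -> V) u : (forall k, dT (t k)) -> dT u ->
  dP (fun v => witnessed p (fun k => t k v) (u v)).
Proof.
  intros Ht Hu; induction p as [i j|i j|p IH|p IHp q IHq|i p IH]; simpl; auto.
  - apply (dP_prop True).
  - apply (dP_prop True).
  - now apply dP_and.
  - assert (Hs : dP (fun v => sat all_sets (upd (fun k => t k (fun n => v (S n))) i (v 0)) p)).
    { eapply dP_iff; [|apply (@dP_sat_terms V (upd (fun k v => t k (fun k => v (S k))) i (fun v => v 0)) all_sets p)].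
      - intros v; apply sat_ext; intros k _; unfold upd; destruct (Nat.eqb k i); auto.
      - apply (dP_prop True).
      - intros k; unfold upd; destruct (Nat.eqb k i); [apply dT_var|apply (dT_shift S); auto]. }
    apply dP_and; auto; apply dP_imp.
    + apply (dP_ex (Q := fun y v => sat all_sets (upd (fun k => t k v) i y) p)), Hs.
    + apply (dP_ex (Q := fun y v => y in_ u v /\ sat all_sets (upd (fun k => t k v) i y) p)).
      apply dP_and; auto; apply dP_mem; [apply dT_var|apply (dT_shift S); auto].
Qed.

(** V_l is closed under passing from an assignment to a set [witnessed] for it, so the Tarski-Vaught
    argument works for all subformulas of [p] at once. *)
Lemma reflection p b : exists l, good l /\ b in_ Vf l /\
  forall w, envin l w -> (sat (fun x => x in_ Vf l) w p <-> sat all_sets w p).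
Proof.
  destruct (@closure_point V hZF (fun s X => witnessed p (fun k => app s (num k)) X)) with (b := opair b omega)
    as (l & Ll & Hb & Hc).
  - apply (@witnessed_def p (fun k v => app (v 0) (num k)) (fun v => v 1)); intros; dp.
  - intros; apply witnessed_total.
  - destruct (opair_bound (proj1 Ll) Hb) as [Hb1 Hb2].
    assert (Hl : good l) by (split; auto; apply ord_in_Vf; auto using ord_omega; apply Ll).
    exists l; split; [auto|split; auto].
    assert (Hw : forall w, envin l w -> exists X, X in_ Vf l /\ witnessed p w X).
    { intros w Hw; destruct (Hc _ (asg_bound (var_bound p) Hl Hw)) as (X & HX & HwX).
      exists X; split; auto; apply witnessed_ext with (2 := HwX).
      intros k Hk; destruct (asg_spec (D := Vf l) (var_bound p) Hw) as [_ H]; auto. }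
    clear Hc Hb Hb1 Hb2; induction p as [i j|i j|p IH|p IHp q IHq|i p IH]; simpl; intros w Hv.
    + tauto.
    + tauto.
    + rewrite IH; [tauto|auto|auto].
    + rewrite IHp, IHq; auto; [tauto| |]; intros w' Hw'; destruct (Hw w' Hw') as (X & HX & H1 & H2); eauto.
    + assert (IH' : forall y, y in_ Vf l -> (sat (fun x => x in_ Vf l) (upd w i y) p <-> sat all_sets (upd w i y) p)).
      { intros y Hy; apply IH.
        - intros w' Hw'; destruct (Hw w' Hw') as (X & HX & H1 & H2); eauto.
        - intros k; unfold upd; destruct (Nat.eqb k i); auto. }
      split.
      * intros (y & Hy & Hs); exists y; split; [exact Logic.I|now apply IH'].
      * intros (y & _ & Hs); destruct (Hw w Hv) as (X & HX & H1 & _).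
        destruct H1 as (z & Hz & Hz'); [eauto|].
        assert (z in_ Vf l) by exact (Vf_trans (proj1 Ll) HX Hz).
        exists z; split; auto; now apply IH'.
Qed.

Definition d0 (P : (nat -> V) -> Prop) :=
  exists q, delta0 q /\ forall v, P v <-> sat all_sets v q.

Lemma definable_d0 P : definable (I := unit) (M := fun _ => V) (C := Empty_set)
  (fun _ e => match e with end) true (fun _ v => P v) -> d0 P.
Proof.
  intros (q & t & Hq & E); exists (ren (fun k => match t k with inl n => n | inr e => match e with end end) q).
  split; [apply delta0_ren; auto|]; intros v; rewrite sat_ren, (E tt v); apply sat_ext.
  intros k _; unfold lookup; destruct (t k) as [n|[]]; auto.
Qed.

Lemma d0_iff (P Q : (nat -> V) -> Prop) : (forall v, P v <-> Q v) -> d0 P -> d0 Q.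
Proof. intros H (q & H1 & H2); exists q; split; auto; intros; rewrite <- H; auto. Qed.
Lemma d0_mem i j : d0 (fun v => v i in_ v j).
Proof. exists (FMem i j); split; [constructor|simpl; tauto]. Qed.
Lemma d0_eq i j : d0 (fun v => v i = v j).
Proof. exists (FEq i j); split; [constructor|simpl; tauto]. Qed.
Lemma d0_not P : d0 P -> d0 (fun v => ~ P v).
Proof. intros (q & H1 & H2); exists (FNeg q); split; [now constructor|]; simpl; intros; rewrite H2; tauto. Qed.
Lemma d0_and P Q : d0 P -> d0 Q -> d0 (fun v => P v /\ Q v).
Proof.
  intros (p & H1 & H2) (q & H3 & H4); exists (FAnd p q); split; [now constructor|].
  simpl; intros; rewrite H2, H4; tauto.
Qed.
Lemma d0_imp P Q : d0 P -> d0 Q -> d0 (fun v => P v -> Q v).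
Proof.
  intros HP HQ; apply d0_iff with (2 := d0_not (d0_and HP (d0_not HQ))); intros; tauto.
Qed.
Lemma d0_equiv P Q : d0 P -> d0 Q -> d0 (fun v => P v <-> Q v).
Proof. intros; apply d0_and; now apply d0_imp. Qed.
Lemma d0_rename P (r : nat -> nat) : d0 P -> d0 (fun v => P (fun k => v (r k))).
Proof.
  intros (q & H1 & H2); exists (ren r q); split; [now apply delta0_ren|].
  intros v; now rewrite sat_ren, H2.
Qed.
Lemma d0_bex (Q : V -> (nat -> V) -> Prop) n :
  d0 (fun v => Q (v 0) (fun k => v (S k))) -> d0 (fun v => exists x, x in_ v n /\ Q x v).
Proof.
  intros (q & H1 & H2); apply definable_d0.
  apply (definable_bex (I := unit) (M := fun _ => V) (Q := fun _ x v => Q x v)).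
  exists q, inl; split; auto; intros [] v; apply H2.
Qed.
Lemma d0_ball (Q : V -> (nat -> V) -> Prop) n :
  d0 (fun v => Q (v 0) (fun k => v (S k))) -> d0 (fun v => forall x, x in_ v n -> Q x v).
Proof.
  intros H; apply d0_iff with (2 := d0_not (d0_bex (Q := fun x v => ~ Q x v) n (d0_not H))).
  intros v; split; [|intros H1 (x & H2 & H3); auto].
  intros H1 x Hx; apply NNPP; intros Hn; apply H1; eauto.
Qed.
Lemma d0_sat (r : nat -> nat) n p : d0 (fun v => sat (fun x => x in_ v n) (fun k => v (r k)) p).
Proof. apply definable_d0, (definable_sat (I := unit) (M := fun _ => V)). Qed.
Lemma d0_subset i j : d0 (fun v => subset (v i) (v j)).
Proof. apply d0_ball, d0_mem. Qed.
Lemma d0_ordinal i : d0 (fun v => ordinal (v i)).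
Proof. apply d0_and; apply d0_ball; [apply d0_subset|apply d0_ball, d0_subset]. Qed.

Lemma d0_absl {G} {HG : Levels G} P : d0 P -> abslG G P.
Proof.
  intros (q & H1 & H2); exists q; intros l Hl v Hv; rewrite H2.
  apply delta0_trans; auto; apply Vf_trans, HG, Hl.
Qed.

End Reflection.

(** * Infinite cardinals are limit ordinals *)

Section Cardinals.
Context {V : set_structure} {hZF : ZF V}.
Implicit Types a b c k x y z f : V.

Definition ifset (P : Prop) a b : V := setof (fun z => (P /\ z in_ a) \/ (~ P /\ z in_ b)).
Lemma isset_if (P : Prop) a b : isset (fun z => (P /\ z in_ a) \/ (~ P /\ z in_ b)).
Proof. destruct (classic P); [exists a|exists b]; intros; tauto. Qed.
Lemma if_true (P : Prop) a b : P -> ifset P a b = a.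
Proof. intros; apply setof_eq; tauto. Qed.
Lemma if_false (P : Prop) a b : ~ P -> ifset P a b = b.
Proof. intros; apply setof_eq; tauto. Qed.
Lemma dT_if (P : (nat -> V) -> Prop) s t : dP P -> dT s -> dT t -> dT (fun v => ifset (P v) (s v) (t v)).
Proof.
  intros HP Hs Ht; apply (dT_setof (P := fun z v => (P v /\ z in_ s v) \/ (~ P v /\ z in_ t v))).
  - intros; apply isset_if.
  - apply (dP_rename S) in HP; apply (dT_shift S) in Hs; apply (dT_shift S) in Ht; dp.
Qed.

Definition injective_on f a := forall x y, x in_ a -> y in_ a -> app f x = app f y -> x = y.

Lemma is_bijection_iff f a b : is_bijection f a b <->
  is_fun f a b /\ injective_on f a /\ forall y, y in_ b -> exists x, x in_ a /\ app f x = y.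
Proof.
  unfold is_bijection; split.
  - intros [Hf H]; split; auto; split.
    + intros x y Hx Hy E; destruct (H (app f x)) as (z & Hz & Hu); [now apply fun_in with a|].
      rewrite <- (Hu x), <- (Hu y); auto; apply (fun_maps _ _ Hf); auto.
    + intros y Hy; destruct (H y Hy) as (x & Hx & _); apply (fun_maps _ _ Hf) in Hx; exists x.
      destruct Hx; auto.
  - intros (Hf & Hi & Hs); split; auto; intros y Hy; destruct (Hs y Hy) as (x & Hx & E).
    exists x; split; [apply (fun_maps _ _ Hf); auto|].
    intros x' Hx'; apply (fun_maps _ _ Hf) in Hx'; destruct Hx' as [Hx' E']; apply Hi; auto; congruence.
Qed.

(** Hilbert's hotel: 0 goes to [b], each n + 1 to n, and everything else stays. *)
Lemma bij_suc b : ordinal b -> subset omega b -> exists f, is_bijection f b (suc b).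
Proof.
  intros Ob Ho.
  set (g := fun x => ifset (x = emp) b (ifset (x in_ omega) (bigU x) x)).
  assert (Hg : dP (fun v => v 0 = g (v 1))).
  { unfold g; apply (dT_if (P := fun v => v 0 = emp) (s := fun _ => b)
      (t := fun v => ifset (v 0 in_ omega) (bigU (v 0)) (v 0))); [dp|dp|apply dT_if; dp]. }
  assert (G0 : g emp = b) by now apply if_true.
  assert (Hne : forall n, suc n <> emp :> V).
  { intros n E; apply (in_emp n); rewrite <- E; apply in_suc; auto. }
  assert (GS : forall n, n in_ omega -> g (suc n) = n).
  { intros n Hn; unfold g; rewrite if_false by auto; rewrite if_true by now apply suc_omega.
    apply bigU_suc, (ord_nat Hn). }
  assert (GI : forall x, ~ x in_ omega -> g x = x).
  { intros x Hx; unfold g; rewrite if_false; [now apply if_false|].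
    intros ->; apply Hx, emp_omega. }
  assert (Gc : forall x, x in_ b -> (x = emp /\ g x = b) \/ (exists n, n in_ omega /\ x = suc n /\ g x = n) \/
     (~ x in_ omega /\ g x = x)).
  { intros x Hx; destruct (classic (x in_ omega)) as [Hw|Hw]; [|auto].
    destruct (nat_case Hw) as [->|(n & Hn & ->)]; [auto|]; right; left; exists n; auto. }
  exists (mkfun b g); apply is_bijection_iff; split; [|split].
  - apply is_fun_mkfun; auto; intros x Hx; apply in_suc.
    destruct (Gc x Hx) as [[_ ->]|[(n & Hn & _ & ->)|[_ ->]]]; auto.
  - intros x y Hx Hy; rewrite !app_mkfun by auto; intros E.
    destruct (Gc x Hx) as [[-> E1]|[(n & Hn & -> & E1)|[Hnx E1]]];
      destruct (Gc y Hy) as [[-> E2]|[(m & Hm & -> & E2)|[Hny E2]]]; rewrite ?E1, ?E2 in E; auto;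
      try (f_equal; assumption); exfalso; rewrite ?E in *;
      solve [tauto|eapply mem_irrefl; eauto|rewrite <- E in *; eapply mem_irrefl; eauto].
  - intros y Hy; apply in_suc in Hy; destruct (classic (y in_ omega)) as [Hw|Hw].
    + exists (suc y); assert (Hb : suc y in_ b) by now apply Ho, suc_omega.
      split; auto; rewrite app_mkfun; auto.
    + destruct Hy as [Hy| ->].
      * exists y; split; auto; rewrite app_mkfun; auto.
      * exists emp; assert (emp in_ b) by apply Ho, emp_omega.
        split; auto; rewrite app_mkfun; auto.
Qed.

Lemma card_lim k : cardinal k -> subset omega k -> lim k.
Proof.
  intros [Ok Hk] Ho; split; [auto|split; [apply Ho, emp_omega|]].
  intros b Hb; assert (Ob := ord_in Ok Hb).
  assert (H := suc_sub Ok Hb); apply ord_sub in H; auto using ord_suc; destruct H as [H|H]; auto.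
  exfalso; apply (Hk b Hb); rewrite <- H; apply bij_suc; auto.
  destruct (ord_le_or_lt ord_omega Ob) as [H'|H']; auto.
  exfalso; apply (@mem_irrefl _ _ (suc b)); rewrite H at 2; now apply Ho, suc_omega.
Qed.

End Cardinals.

(** * Exacting cardinals embed ordinal definable sets *)

Section Cex.
Context {V : set_structure} {hZF : ZF V}.
Implicit Types a b c x y z f s t D E l A U : V.

(** With [U] equal to V_lam, an ordinal definable set of this kind is a counterexample to the
    embedding property. *)
Definition rigid A U := nonempty A /\ (forall x, x in_ A -> subset x U) /\
  forall x, x in_ A -> forall y, y in_ A -> forall k,
    elementary_embedding k U (Some x) U (Some y) -> forall a, a in_ U -> maps k a a.

Lemma absl_rigid : absl (fun v => rigid (v 0) (v 1)).
Proof.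
  apply absl_and; [|apply absl_and].
  - apply absl_iff with (fun v => exists x, x in_ v 0 /\ x in_ v 0).
    + intros v; split; [intros (x & H & _)|intros (x & H)]; exists x; auto.
    + apply absl_bex, absl_mem.
  - apply absl_ball, absl_subset.
  - apply absl_ball, absl_ball.
    apply (absl_gall (B := fun k v => elementary_embedding k (v 3) (Some (v 1)) (v 3) (Some (v 0)))).
    + intros l v x Hl Hv Hx; apply emb_fun in Hx; eapply fun_bound; eauto.
    + apply absl_emb.
    + apply absl_ball, absl_maps.
Qed.

Section Params.
(** [p] is the defining formula and [pr] will be the formula of [absl_rigid]. All variables of [p]
    lie below [N], so positions [N] and [S N] are free for V_lam and the level. *)
Variables (p pr : fml).
Let N := S (var_bound p).

(* Environment: the parameters of [p] at [1 .. N - 1], the set [U] at [N], the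
   level [u] at [S N]. [stage d] quantifies the last [d] of the first [N] entries. *)
Definition defines_rigid (v : nat -> V) := exists A, A in_ v (S N) /\
  ((forall x, x in_ v (S N) -> (sat (fun y => y in_ v (S N)) (upd v 0 x) p <-> x = A)) /\
   sat (fun y => y in_ v (S N)) (fun k => match k with 0 => A | _ => v N end) pr).

Fixpoint stage (d : nat) (v : nat -> V) : Prop :=
  match d with
  | 0 => defines_rigid v
  | S e => exists x, x in_ v (S N) /\ (ordinal x /\ stage e (upd v (N - d) x))
  end.

Lemma stage_ext d : forall v w, (forall k, k <= S N -> v k = w k) -> stage d v -> stage d w.
Proof.
  induction d as [|d IH]; simpl; intros v w H.
  - intros (A & HA & H1 & H2); exists A; rewrite <- !H by lia; split; [auto|split].
    + intros x Hx; rewrite <- (H1 x Hx); apply sat_ext; intros k Hk; unfold upd.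
      destruct (Nat.eqb k 0); auto; symmetry; apply H; unfold N; lia.
    + revert H2; apply sat_ext; intros [|k] _; auto.
  - intros (x & Hx & Ox & Hs); exists x; rewrite <- H by lia; split; [auto|split; auto].
    revert Hs; apply IH; intros k Hk; unfold upd; destruct (Nat.eqb k _); auto.
Qed.

Lemma d0_stage d : d <= N -> d0 (stage d).
Proof.
  induction d as [|d IH]; intros Hd.
  - apply (d0_bex (Q := fun A v =>
     (forall x, x in_ v (S N) -> (sat (fun y => y in_ v (S N)) (upd v 0 x) p <-> x = A)) /\
     sat (fun y => y in_ v (S N)) (fun k => match k with 0 => A | _ => v N end) pr)).
    apply d0_and.
    + apply d0_ball, d0_equiv; [|apply d0_eq].
      apply d0_iff with (2 := d0_sat (fun k => match k with 0 => 0 | S m => S (S k) end) (S (S (S N))) p).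
      intros v; apply sat_ext; intros [|k] _; auto.
    + apply d0_iff with (2 := d0_sat (fun k => match k with 0 => 0 | S m => S N end) (S (S N)) pr).
      intros v; apply sat_ext; intros [|k] _; auto.
  - apply (d0_bex (Q := fun x v => ordinal x /\ stage d (upd v (N - S d) x))).
    apply d0_and; [apply d0_ordinal|].
    apply d0_iff with (2 := d0_rename (fun k => if Nat.eqb k (N - S d) then 0 else S k) (IH ltac:(lia))).
    intros v; split; apply stage_ext; intros k _; unfold upd; destruct (Nat.eqb k _); auto.
Qed.

(** A Delta_0 substitute for [good], phrased by the elements of a level rather than by its index, so
    that it fits into the matrix of a Sigma_2 formula. *)
Definition lim_like u := (forall x, x in_ u -> exists y, y in_ u /\ x in_ y) /\
  exists w, w in_ u /\ inductive w.

Lemma lim_like_good a : ordinal a -> nonempty a -> lim_like (Vf a) -> good a.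
Proof.
  intros Oa [d Hd] [H1 (w & Hw & Hi)].
  assert (Ho : omega in_ Vf a).
  { apply Vf_super with w; auto; intros n Hn; exact (proj1 (in_omega n) Hn w Hi). }
  split; [|apply ord_in_Vf; auto using ord_omega].
  split; [auto|split].
  - apply ord_trans with omega; auto using emp_omega; apply ord_in_Vf; auto using ord_omega.
  - intros b Hb; assert (Ob := ord_in Oa Hb).
    destruct (H1 b) as (y & Hy & Hby); [now apply ord_sub_Vf|].
    apply in_Vf_rho in Hy; auto; apply rho_mem in Hby; rewrite rho_ord in Hby by auto.
    apply sub_lt_trans with (rho y); auto using ord_suc, ord_rho; apply suc_sub; auto using ord_rho.
Qed.

Lemma good_lim_like a : good a -> lim_like (Vf a).
Proof.
  intros Ha; pose proof Ha as [La Ho]; split.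
  - intros x Hx; exists (upair x x); split; [now apply lim_upair|apply in_upair; auto].
  - exists omega; split; [now apply good_omega|apply (proj2 (is_omega_iff omega) eq_refl)].
Qed.

(** [stage N] overwrites the entries below [N], so the constant environment only serves to put [U]
    at position [N]. *)
Definition wit U u := level u /\ lim_like u /\ U in_ u /\ stage N (upd (fun _ => U) (S N) u).

Lemma d0_empty i : d0 (V := V) (fun v => is_empty (v i)).
Proof.
  apply d0_iff with (fun v => forall x, x in_ v i -> ~ x in_ v i).
  { intros v; split; [intros H x Hx; exact (H x Hx Hx)|intros H x Hx; now apply H in Hx]. }
  apply d0_ball, d0_not, d0_mem.
Qed.
Lemma d0_succ i j : d0 (V := V) (fun v => is_succ (v i) (v j)).
Proof.
  apply d0_iff with (fun v => (subset (v j) (v i) /\ v j in_ v i) /\ forall z, z in_ v i -> ~ z in_ v j -> z = v j).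
  - intros v; split.
    + intros [[H1 H2] H3] z; split; [|intros [H| ->]; auto].
      intros Hz; destruct (classic (z in_ v j)); auto.
    + intros H; split; [split; [intros z Hz|]; apply H; auto|intros z Hz Hn; apply H in Hz; tauto].
  - apply d0_and; [apply d0_and; [apply d0_subset|apply d0_mem]|].
    apply d0_ball, d0_imp; [apply d0_not, d0_mem|apply d0_eq].
Qed.
Lemma d0_lim_like i : d0 (fun v => lim_like (v i)).
Proof.
  apply d0_and; [apply d0_ball, d0_bex, d0_mem|].
  apply d0_bex.
  apply d0_iff with (fun v => (exists e, e in_ v 0 /\ is_empty e) /\
    forall n, n in_ v 0 -> exists s, s in_ v 0 /\ is_succ s n).
  - intros v; split; (intros [(e & H1 & H2) H3]; split; [exists e; auto|]); intros n Hn;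
      destruct (H3 n Hn) as (s & Hs1 & Hs2); exists s; auto.
  - apply d0_and; [apply d0_bex, d0_empty|apply d0_ball, d0_bex, d0_succ].
Qed.

Lemma absl_wit : absl (fun v => wit (v 0) (v 1)).
Proof.
  apply absl_and; [apply absl_level|].
  apply absl_and; [apply d0_absl, d0_lim_like|].
  apply absl_and; [apply absl_mem|].
  apply d0_absl.
  apply d0_iff with (2 := d0_rename (fun k => if Nat.eqb k (S N) then 1 else 0) (d0_stage (le_n N))).
  intros v; split; apply stage_ext; intros k _; unfold upd; destruct (Nat.eqb k _); auto.
Qed.

(* [u] at [S N], its history at [S (S N)], the universally quantified [z] at [S (S (S N))] *)
Definition wit_matrix (v : nat -> V) :=
  ((forall y, y in_ v (S (S N)) -> (v (S (S (S N))) in_ y <->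
     exists c, c in_ v (S (S N)) /\ (c in_ y /\ subset (v (S (S (S N)))) c))) /\
   (v (S (S (S N))) in_ v (S N) <-> exists c, c in_ v (S (S N)) /\ subset (v (S (S (S N)))) c)) /\
  (lim_like (v (S N)) /\ v N in_ v (S N) /\ stage N v).

Lemma d0_wit_matrix : d0 wit_matrix.
Proof.
  apply d0_and; [apply d0_and|apply d0_and; [apply d0_lim_like|apply d0_and; [apply d0_mem|apply d0_stage; lia]]].
  - apply d0_ball, d0_equiv; [apply d0_mem|apply d0_bex, d0_and; [apply d0_mem|apply d0_subset]].
  - apply d0_equiv; [apply d0_mem|apply d0_bex, d0_subset].
Qed.

(** The two implications are those that carry a witness from [V] into V_l. Inside V_l the universal
    [z] ranges over V_l only, but it concerns elements of [u], of members of [h], and subsets of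
    members of [h], all of which are in V_l. *)
Lemma wit_sigma2 U : exists q, sigma 2 q /\
  (forall u, wit U u -> sat all_sets (fun _ => U) q) /\
  (forall l, good l -> U in_ Vf l -> sat (fun x => x in_ Vf l) (fun _ => U) q ->
     exists u, u in_ Vf l /\ wit U u).
Proof.
  destruct d0_wit_matrix as (m & Hm & Em).
  set (z := S (S (S N))); set (h := S (S N)); set (u0 := S N).
  exists (FEx u0 (FEx h (FNeg (FEx z (FNeg m))))).
  set (v := fun u h' z' => upd (upd (upd (fun _ => U) u0 u) h h') z z').
  assert (E : forall u h' z', wit_matrix (v u h' z') <->
    ((forall y, y in_ h' -> (z' in_ y <-> exists c, c in_ h' /\ (c in_ y /\ subset z' c))) /\
     (z' in_ u <-> exists c, c in_ h' /\ subset z' c)) /\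
    (lim_like u /\ U in_ u /\ stage N (upd (fun _ => U) (S N) u))).
  { intros u h' z'; unfold wit_matrix; fold z h u0.
    assert (Ez : v u h' z' z = z') by apply upd_same.
    assert (Eh : v u h' z' h = h') by (unfold v; rewrite upd_other by (unfold z, h; lia); apply upd_same).
    assert (Eu : v u h' z' u0 = u).
    { unfold v; rewrite !upd_other by (unfold z, h, u0; lia); apply upd_same. }
    assert (EN : v u h' z' N = U).
    { unfold v; rewrite !upd_other by (unfold z, h, u0; lia); auto. }
    rewrite Ez, Eh, Eu, EN.
    assert (Es : stage N (v u h' z') <-> stage N (upd (fun _ => U) (S N) u)).
    { assert (Ek : forall k, k <= S N -> v u h' z' k = upd (fun _ => U) (S N) u k).
      { intros k Hk; unfold v; rewrite upd_other by (unfold z; lia).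
        rewrite upd_other by (unfold h; lia); auto. }
      split; apply stage_ext; intros k Hk; [|symmetry]; auto. }
    rewrite Es; tauto. }
  split; [|split].
  - apply sigma_ex, sigma_ex, sigma_pi, sigma_ex, sigma_pi, sigma_delta0, Hm.
  - intros u ((h' & H1 & H2) & H3 & H4 & H5); exists u; split; [exact Logic.I|].
    exists h'; split; [exact Logic.I|]; intros (z' & _ & Hz); apply Hz.
    apply (Em (v u h' z')), E; split; [split|auto].
    + intros y Hy; rewrite (H1 y z' Hy); split; intros (c & H); exists c; tauto.
    + apply H2.
  - intros l Hl HU (u & Hu & h' & Hh & Hn); pose proof Hl as [[Ol _] _].
    assert (Hall : forall z', z' in_ Vf l -> wit_matrix (v u h' z')).
    { intros z' Hz'; apply Em; rewrite <- (delta0_trans Hm (Vf_trans Ol)).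
      - apply NNPP; intros H; apply Hn; exists z'; split; auto.
      - intros k; unfold v, upd; repeat destruct (Nat.eqb k _); auto. }
    assert (Hall' := fun z' Hz' => proj1 (E u h' z') (Hall z' Hz')); clear Hall Hn.
    exists u; split; auto.
    destruct (Hall' emp) as [_ (H3 & H4 & H5)]; [apply lim_emp, Hl|].
    split; [|auto]; exists h'; split.
    + intros y z' Hy; assert (Hyl : y in_ Vf l) by exact (Vf_trans Ol Hh Hy); split.
      * intros Hz; assert (Hzl : z' in_ Vf l) by exact (Vf_trans Ol Hyl Hz).
        apply (proj1 (Hall' z' Hzl)) in Hz; auto; destruct Hz as (c & Hc); exists c; tauto.
      * intros (c & Hc & Hcy & Hz); assert (Hcl : c in_ Vf l) by exact (Vf_trans Ol Hh Hc).
        assert (Hzl : z' in_ Vf l) by now apply Vf_super with c.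
        apply (proj1 (Hall' z' Hzl)); auto; exists c; auto.
    + intros z'; split.
      * intros Hz; assert (Hzl : z' in_ Vf l) by exact (Vf_trans Ol Hu Hz).
        now apply (proj1 (Hall' z' Hzl)).
      * intros (c & Hc & Hz); assert (Hcl : c in_ Vf l) by exact (Vf_trans Ol Hh Hc).
        assert (Hzl : z' in_ Vf l) by now apply Vf_super with c.
        apply (proj1 (Hall' z' Hzl)); exists c; auto.
Qed.

Lemma stage_intro d : forall v (b : nat -> V), d <= N -> (forall k, k < N -> b k in_ v (S N) /\ ordinal (b k)) ->
  defines_rigid (fun k => if Nat.ltb k (N - d) then v k else if Nat.ltb k N then b k else v k) -> stage d v.
Proof.
  induction d as [|d IH]; intros v b Hd Hb H.
  - apply (stage_ext (d := 0)) with (2 := H); intros k _.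
    rewrite Nat.sub_0_r; destruct (Nat.ltb k N); auto.
  - exists (b (N - S d)); destruct (Hb (N - S d)) as [H1 H2]; [lia|].
    split; [auto|split; auto].
    apply IH with (b := b); [lia| |].
    + intros k Hk; rewrite upd_other by lia; auto.
    + apply (stage_ext (d := 0)) with (2 := H); intros k _.
      destruct (Nat.ltb_spec k (N - S d)); destruct (Nat.ltb_spec k (N - d)); try lia.
      * rewrite upd_other by lia; auto.
      * assert (k = N - S d) by lia; subst; rewrite upd_same.
        destruct (Nat.ltb_spec (N - S d) N); [auto|lia].
      * destruct (Nat.ltb_spec k N); auto; rewrite upd_other by lia; auto.
Qed.

End Params.
End Cex.

Section Forward.
Context {V : set_structure} {hZF : ZF V}.
Implicit Types a b c x y z f s t D E l A U : V.

Lemma d0_dP (P : (nat -> V) -> Prop) : d0 P -> dP P.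
Proof.
  intros (q & _ & H); eapply dP_iff; [intros v; symmetry; apply H|].
  apply (@dP_sat_terms V (fun k v => v k) all_sets q); [apply (dP_prop True)|intros; apply dT_var].
Qed.

Lemma wit_def p pr : dP (fun v : nat -> V => wit p pr (v 0) (v 1)).
Proof.
  apply dP_and; [unfold level, history, level_of; dp|].
  apply dP_and; [apply d0_dP, d0_lim_like|].
  apply dP_and; [dp|]; apply d0_dP.
  apply d0_iff with (2 := d0_rename (fun k => if Nat.eqb k (S (S (var_bound p))) then 1 else 0) (@d0_stage V p pr _ (le_n _))).
  intros v; split; apply stage_ext; intros k _; unfold upd; destruct (Nat.eqb k _); auto.
Qed.

Variables (eta zeta X j lam : V).
Hypotheses (Oeta : ordinal eta) (Ozeta : ordinal zeta)
  (HX : elementary_substructure X (Vf eta)) (Hj : elementary_embedding j X None (Vf zeta) None).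

Notation jv v := (fun k => app j (v k)).

Lemma X_sub x : x in_ X -> x in_ Vf eta.
Proof. apply HX. Qed.
Lemma j_in x : x in_ X -> app j x in_ Vf zeta.
Proof. apply fun_in, (emb_fun Hj). Qed.

(** Delta_0 absoluteness rests on transitivity alone, so this is available before [eta] and [zeta]
    are known to be [good]; that fact is derived from it through [omega_lam]. *)
Lemma d0_transfer P v : d0 P -> (forall k, v k in_ X) -> (P v <-> P (jv v)).
Proof.
  intros (q & Hq & E) Hv; rewrite !E.
  rewrite <- (delta0_trans Hq (Vf_trans Oeta)) by (intros; apply X_sub, Hv).
  rewrite <- (delta0_trans Hq (Vf_trans Ozeta) (v := jv v)) by (intros; apply j_in, Hv).
  rewrite <- (sub_sat HX) by auto; apply (emb_sat Hj); auto.
Qed.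

Hypotheses (UX : subset (Vf lam) X) (lamX : lam in_ X) (Clam : cardinal lam)
  (jlam : app j lam = lam) (crit : exists a, a in_ lam /\ app j a <> a)
  (lameta : lam in_ eta) (lamzeta : lam in_ zeta).

Let Olam : ordinal lam := proj1 Clam.

Lemma lam_sub_X a : a in_ lam -> a in_ X.
Proof. intros H; apply UX, (ord_sub_Vf Olam), H. Qed.

Lemma nat_fixed n : n in_ omega -> n in_ lam -> app j n = n.
Proof.
  apply (omega_ind (P := fun n => n in_ lam -> app j n = n)); [dp| |].
  - intros H; pose proof (@d0_transfer (fun v => is_empty (v 0)) (fun _ => emp) (d0_empty 0)
      (fun _ => lam_sub_X H)) as T; simpl in T.
    rewrite !is_empty_iff in T; tauto.
  - intros m Hm IH H.
    assert (Hml : m in_ lam) by (apply ord_trans with (suc m); auto; apply in_suc; auto).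
    pose proof (@d0_transfer (fun v => is_succ (v 0) (v 1)) (fun k => match k with 0 => suc m | _ => m end)
      (d0_succ 0 1)) as T; simpl in T; rewrite !is_succ_iff, IH in T by auto.
    apply T; auto; intros [|k]; now apply lam_sub_X.
Qed.

(** Natural numbers are fixed by [j], so the ordinal below lam that [j] moves is infinite. *)
Lemma omega_lam : omega in_ lam.
Proof.
  destruct (ord_le_or_lt Olam ord_omega) as [H|H]; auto.
  destruct crit as (a & Ha & Hn); exfalso; apply Hn, nat_fixed; auto.
Qed.

Lemma good_lam : good lam.
Proof.
  split; [|apply omega_lam]; apply card_lim; auto; apply ord_sub; auto using ord_omega, omega_lam.
Qed.

Hypotheses (Geta : good eta) (Gzeta : good zeta).

Lemma transfer P v : absl P -> (forall k, v k in_ X) -> (P v <-> P (jv v)).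
Proof.
  intros (q & E) Hv.
  rewrite <- (E eta Geta v) by (intros k; apply X_sub, Hv).
  rewrite <- (E zeta Gzeta (jv v)) by (intros k; apply j_in, Hv).
  rewrite <- (sub_sat HX) by auto; apply (emb_sat Hj); auto.
Qed.

Lemma upd_in (v : nat -> V) k z D : (forall i, v i in_ D) -> z in_ D -> forall i, upd v k z i in_ D.
Proof. intros Hv Hz i; unfold upd; destruct (Nat.eqb i k); auto. Qed.

Lemma transfer_ex P v k z : absl P -> (forall i, v i in_ X) -> z in_ Vf eta -> P (upd v k z) ->
  exists z', z' in_ X /\ P (upd v k z').
Proof.
  intros (q & E) Hv Hz HP.
  assert (Hs : sat (fun x => x in_ Vf eta) v (FEx k q)).
  { exists z; split; auto; apply E; auto; intros i; apply upd_in; auto; intros; apply X_sub, Hv. }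
  apply (sub_sat HX) in Hs; auto; destruct Hs as (z' & Hz' & Hs); exists z'; split; auto.
  apply (sub_sat HX) in Hs; [|now apply upd_in].
  apply E in Hs; auto; intros i; apply X_sub; now apply upd_in.
Qed.

Lemma transfer_back P v k z : absl P -> (forall i, v i in_ X) -> z in_ Vf zeta -> P (upd (jv v) k z) ->
  exists z', z' in_ X /\ P (upd v k z').
Proof.
  intros (q & E) Hv Hz HP.
  assert (Hs : sat (fun x => x in_ Vf zeta) (jv v) (FEx k q)).
  { exists z; split; auto; apply E; auto; intros i; apply upd_in; auto; intros; apply j_in, Hv. }
  apply (emb_sat Hj) in Hs; auto; destruct Hs as (z' & Hz' & Hs); exists z'; split; auto.
  apply (sub_sat HX) in Hs; [|now apply upd_in].
  apply E in Hs; auto; intros i; apply X_sub; now apply upd_in.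
Qed.

(** Elementarity of X puts a solution of the condition into X, and uniqueness identifies it with
    [z]. Its image solves the same condition with the same parameters, so it is [z] again. *)
Lemma transfer_fix P v k z : absl P -> (forall i, v i in_ X /\ app j (v i) = v i) -> z in_ Vf eta ->
  P (upd v k z) -> (forall z', P (upd v k z') -> z' = z) -> z in_ X /\ app j z = z.
Proof.
  intros HP Hv Hz Pz Hu.
  destruct (transfer_ex HP (fun i => proj1 (Hv i)) Hz Pz) as (z' & Hz' & Pz').
  apply Hu in Pz' as E; subst z'; split; auto.
  apply Hu; apply (transfer HP) in Pz'; [|apply upd_in; auto; apply Hv].
  assert (E : (fun i => app j (upd v k z i)) = upd v k (app j z)).
  { apply functional_extensionality; intros i; unfold upd; destruct (Nat.eqb i k); auto; apply Hv. }
  now rewrite E in Pz'.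
Qed.

Lemma U_fixed : Vf lam in_ X /\ app j (Vf lam) = Vf lam.
Proof.
  (* V_lam is the only level that includes lam without containing it. *)
  apply (@transfer_fix (fun w => level (w 1) /\ (subset (w 0) (w 1) /\ ~ w 0 in_ w 1)) (fun _ => lam) 1); auto.
  - apply absl_and; [apply absl_level|apply absl_and; [apply absl_subset|apply absl_not, absl_mem]].
  - now apply Vf_in.
  - unfold upd; simpl; split; [apply level_iff; eauto|split; [now apply ord_sub_Vf|]].
    rewrite ord_in_Vf by auto; apply mem_irrefl.
  - unfold upd; simpl; intros z (Hl & H1 & H2); apply level_iff in Hl; destruct Hl as (a & Oa & ->).
    rewrite ord_in_Vf in H2 by auto.
    assert (Hs : subset lam a).
    { intros b Hb; rewrite <- ord_in_Vf; auto; now apply ord_in with lam. }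
    apply ord_sub in Hs; auto; destruct Hs as [H| ->]; tauto.
Qed.

Definition env2 a b (k : nat) : V := match k with 0 => a | _ => b end.
Definition env3 a b c (k : nat) : V := match k with 0 => a | 1 => b | _ => c end.
Definition env4 a b c d (k : nat) : V := match k with 0 => a | 1 => b | 2 => c | _ => d end.

Lemma j_mem x y : x in_ X -> y in_ X -> (x in_ y <-> app j x in_ app j y).
Proof.
  intros Hx Hy; apply (@transfer (fun v => v 0 in_ v 1) (env2 x y)); [apply absl_mem|].
  intros [|k]; auto.
Qed.
Lemma j_maps f x y : f in_ X -> x in_ X -> y in_ X -> (maps f x y <-> maps (app j f) (app j x) (app j y)).
Proof.
  intros Hf Hx Hy; apply (@transfer (fun v => maps (v 0) (v 1) (v 2)) (env3 f x y)); [apply absl_maps|].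
  intros [|[|k]]; auto.
Qed.
Lemma j_opair x y : x in_ X -> y in_ X -> opair x y in_ X -> app j (opair x y) = opair (app j x) (app j y).
Proof.
  intros Hx Hy Hp.
  pose proof (@transfer (fun v => is_opair (v 0) (v 1) (v 2)) (env3 (opair x y) x y) (absl_opair 0 1 2)) as T.
  simpl in T; rewrite !is_opair_iff in T; apply T; auto; intros [|[|k]]; auto.
Qed.

Lemma omega_fixed : omega in_ X /\ app j omega = omega.
Proof.
  assert (Ho : omega in_ X) by (apply lam_sub_X, omega_lam); split; auto.
  pose proof (@transfer (fun v => is_omega (v 0)) (fun _ => omega) (absl_omega 0)) as T.
  simpl in T; rewrite !is_omega_iff in T; apply T; auto.
Qed.

Lemma nat_fixed' n : n in_ omega -> n in_ X /\ app j n = n.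
Proof.
  intros Hn; assert (Hl : n in_ lam) by (apply ord_trans with omega; auto using omega_lam).
  split; [now apply lam_sub_X|now apply nat_fixed].
Qed.

Lemma Vomega_X x : x in_ Vf omega -> x in_ X.
Proof. intros Hx; apply UX, (Vf_mono_sub Olam omega_lam), Hx. Qed.

(** Codes may be nonstandard, so this is an induction inside [V], not one over [fml]. *)
Lemma formula_fixed c : is_formula true c -> app j c = c.
Proof.
  assert (Hp : forall x y, opair x y in_ Vf omega -> app j x = x -> app j y = y -> app j (opair x y) = opair x y).
  { intros x y H Ex Ey; destruct (opair_bound ord_omega H).
    rewrite j_opair by now apply Vomega_X. now rewrite Ex, Ey. }
  assert (Hn : forall n, app j (num n) = num n) by (intros n; apply nat_fixed', num_omega).
  assert (Hb : forall x, is_formula true x -> x in_ Vf omega) by (intros x; apply is_formula_Vomega).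
  destruct (@formula_intro V hZF true) as (I1 & I2 & I3 & I4 & I5 & I6).
  assert (Ho := fun n H => proj2 (@nat_fixed' n H)).
  apply (formula_ind (P := fun c => app j c = c)); [dp|..].
  - intros i k Hi Hk; assert (H := Hb _ (I1 i k Hi Hk)); apply Hp; auto; apply Hp; auto.
    apply (opair_bound ord_omega H).
  - intros i k Hi Hk; assert (H := Hb _ (I2 i k Hi Hk)); apply Hp; auto; apply Hp; auto.
    apply (opair_bound ord_omega H).
  - intros a Ha E; apply Hp; auto; apply (Hb _ (I3 a Ha)).
  - intros a b Ha Hb' Ea Eb; assert (H := Hb _ (I4 a b Ha Hb')); apply Hp; auto; apply Hp; auto.
    apply (opair_bound ord_omega H).
  - intros i a Hi Ha E; assert (H := Hb _ (I5 i a Hi Ha)); apply Hp; auto; apply Hp; auto.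
    apply (opair_bound ord_omega H).
  - intros _ i Hi; apply Hp; auto; apply (Hb _ (I6 eq_refl i Hi)).
Qed.

(** An assignment into V_lam need not be in X. Altered beyond the support of the formula it is an
    element of V_lam, hence of X, and [j] transfers the absolute statement of satisfaction over
    V_lam. *)
Lemma restr_elementary x : x in_ X -> elementary_embedding (restr j (Vf lam)) (Vf lam) (Some x)
  (Vf lam) (Some (app j x)).
Proof.
  intros Hx; destruct U_fixed as [HU EU], omega_fixed as [HO EO].
  assert (Hk : forall a, a in_ Vf lam -> app (restr j (Vf lam)) a = app j a) by (intros; now apply app_restr).
  assert (HjU : forall a, a in_ Vf lam -> app j a in_ Vf lam).
  { intros a Ha; rewrite <- EU; exact (proj1 (j_mem (UX Ha) HU) Ha). }
  apply emb_den; split; [auto|split].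
  { pose proof (emb_fun Hj) as Hf; apply is_fun_iff in Hf; apply is_fun_iff; split.
    - apply func_restr with X; auto; tauto.
    - intros a Ha; rewrite Hk; auto. }
  simpl; intros c s t Hc Hs Ht Hst.
  destruct (@finite_support V hZF (Vf lam) (Some x) c Hc) as (n1 & Hn1 & S1).
  destruct (@finite_support V hZF (Vf lam) (Some (app j x)) c Hc) as (n2 & Hn2 & S2).
  destruct (lim_max lim_omega Hn1 Hn2) as (n & Hn & L1 & L2).
  destruct (truncation good_lam Hs Hn) as (s' & Hs' & Fs' & Es').
  assert (HsX := UX Hs').
  assert (Fj : is_fun (app j s') omega (Vf lam)).
  { pose proof (@transfer (fun v => is_fun (v 0) (v 1) (v 2)) (env3 s' omega (Vf lam)) (absl_is_fun 0 1 2)) as T.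
    simpl in T; rewrite EO, EU in T; apply T; auto; intros [|[|k]]; auto. }
  assert (Ej : forall i, i in_ omega -> app (app j s') i = app j (app s' i)).
  { intros i Hi; destruct (nat_fixed' Hi) as [Hi1 Hi2].
    assert (Hm : maps s' i (app s' i)) by (apply (fun_maps _ _ Fs'); auto).
    apply (proj1 (j_maps HsX Hi1 (UX (fun_in Fs' Hi)))) in Hm.
    rewrite Hi2 in Hm; apply (fun_maps _ _ Fj) in Hm; symmetry; tauto. }
  rewrite (S1 s s') by (auto; intros k Hk'; symmetry; auto).
  rewrite (S2 t (app j s')); auto.
  - rewrite <- !satisfies_den by auto.
    rewrite <- EU at 2; rewrite <- (formula_fixed Hc) at 2.
    apply (@transfer (fun v => satisfies (v 0) (Some (v 1)) (v 2) (v 3)) (env4 (Vf lam) x c s'));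
      [apply absl_satisfies|intros [|[|[|k]]]; auto].
    apply Vomega_X; now apply is_formula_Vomega in Hc.
  - intros k Hk'.
    assert (Hko : k in_ omega) by (apply ord_trans with n2; auto using ord_omega).
    rewrite Ej, Hst, Hk, Es'; auto; now apply (fun_in Hs).
Qed.

Lemma wit_fixed p pr : (exists u, u in_ Vf zeta /\ wit p pr (Vf lam) u) ->
  exists u, u in_ X /\ app j u = u /\ wit p pr (Vf lam) u.
Proof.
  intros (u & Hu & Wu); destruct U_fixed as [HU EU].
  assert (H0 : exists u, u in_ X /\ wit p pr (Vf lam) u).
  (* As [j] fixes V_lam, the existence of a witness pulls back from V_zeta to X. *)
  { destruct (@transfer_back (fun v => wit p pr (v 0) (v 1)) (fun _ => Vf lam) 1 u (absl_wit p pr)) as (z & Hz & Wz); auto.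
    - unfold upd; simpl; now rewrite EU.
    - exists z; auto. }
  clear u Hu Wu; destruct H0 as (u & Hu & Wu).
  pose proof Wu as [Hl _]; apply level_iff in Hl; destruct Hl as (a & Oa & ->).
  pose proof (wit_def p pr) as Hd.
  destruct (@ord_least V hZF (fun a => wit p pr (Vf lam) (Vf a))) as (a0 & O0 & W0 & M0); [dp|eauto|].
  assert (Ha0 : a0 in_ eta).
  { apply X_sub in Hu; apply in_Vf_rho in Hu; auto; rewrite rho_Vf in Hu by auto.
    destruct (ord_le_or_lt O0 Oa) as [H|H]; [now apply sub_lt_trans with a|].
    now apply M0 in H. }
  exists (Vf a0).
  enough (H : Vf a0 in_ X /\ app j (Vf a0) = Vf a0) by tauto.
  assert (Hlev : forall b, ordinal b -> forall u', u' in_ Vf b -> level u' -> exists d, d in_ b /\ u' = Vf d).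
  { intros b Ob u' Hu' Hl'; apply level_iff in Hl'; destruct Hl' as (d & Od & ->); exists d; split; auto.
    apply in_Vf_rho in Hu'; auto; now rewrite rho_Vf in Hu'. }
  (* Levels are ordered by membership, so minimality is a condition on elements of the level and
     hence absolute. *)
  apply (@transfer_fix (fun w => wit p pr (w 0) (w 1) /\ forall u', u' in_ w 1 -> ~ wit p pr (w 0) u')
    (fun _ => Vf lam) 1); auto.
  - apply absl_and; [apply absl_wit|]; apply absl_ball, absl_not.
    apply (absl_sub2 (P := wit p pr) 1 0 (absl_wit p pr)).
  - now apply Vf_in.
  - unfold upd; simpl; split; auto; intros u' Hu' Wu'.
    destruct (Hlev a0 O0 u' Hu' (proj1 Wu')) as (d & Hd' & ->); exact (M0 d Hd' Wu').
  - unfold upd; simpl; intros z [Wz Mz]; pose proof Wz as [Hl _]; apply level_iff in Hl.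
    destruct Hl as (b & Ob & ->).
    destruct (ord_tri Ob O0) as [H|[->|H]]; auto; exfalso.
    + exact (M0 b H Wz).
    + apply (Mz (Vf a0)); auto; now apply Vf_in.
Qed.

(** After [e] rounds the first [e] parameters are fixed by [j]. The next one is the least ordinal
    that still admits a completion by the remaining quantifiers of [stage]; being least relative to
    fixed data, it is fixed too. *)
Lemma parameters_fixed p pr u : u in_ X -> app j u = u -> wit p pr (Vf lam) u ->
  exists v, (forall k, v k in_ X /\ app j (v k) = v k) /\
    v (S (var_bound p)) = Vf lam /\ v (S (S (var_bound p))) = u /\ defines_rigid p pr v.
Proof.
  intros Hu Eu Wu; set (N := S (var_bound p)).
  enough (H : forall e d, e + d = N -> exists v, (forall k, v k in_ X /\ app j (v k) = v k) /\
     v N = Vf lam /\ v (S N) = u /\ stage p pr d v) by exact (H N 0 (Nat.add_0_r N)).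
  pose proof Wu as (Hl & Hll & HUu & Hst).
  apply level_iff in Hl; destruct Hl as (a & Oa & Ea).
  induction e as [|e IH]; intros d Hd.
  - simpl in Hd; subst d; exists (upd (fun _ => Vf lam) (S N) u); split; [|split; [|split]].
    + intros k; unfold upd; destruct (Nat.eqb k (S N)); auto; apply U_fixed.
    + rewrite upd_other by lia; auto.
    + apply upd_same.
    + exact Hst.
  - destruct (IH (S d)) as (v & Hv & HvN & HvS & Hs); [lia|].
    cbn [stage] in Hs; fold N in Hs; set (k := N - S d) in Hs.
    assert (Hkd := d0_stage (V := V) pr (p := p) (d := d) ltac:(fold N; lia)).
    set (Q := fun w : nat -> V => (ordinal (w k) /\ w k in_ w (S N)) /\ (stage p pr d w /\
       forall x, x in_ w k -> ~ stage p pr d (upd w k x))).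
    assert (AQ : absl Q).
    { apply absl_and; [apply absl_and; [apply absl_ordinal|apply absl_mem]|].
      apply absl_and; [now apply d0_absl|]; apply absl_ball, absl_not.
      apply absl_iff with (2 := absl_rename (fun i => if Nat.eqb i k then 0 else S i) (d0_absl Hkd)).
      intros w; split; apply stage_ext; intros i _; unfold upd; destruct (Nat.eqb i k); auto. }
    destruct (@ord_least V hZF (fun x => x in_ u /\ stage p pr d (upd v k x))) as (x & Ox & (Hx & Sx) & Mx).
    { apply dP_and; [dp|].
      pose proof (dP_subst (t := upd (fun i _ => v i) k (fun w => w 0)) (d0_dP Hkd)) as H.
      eapply dP_iff; [|apply H].
      - intros w; split; apply stage_ext; intros i _; unfold upd; destruct (Nat.eqb i k); auto.
      - intros i; unfold upd; destruct (Nat.eqb i k); dp. }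
    { destruct Hs as (x & Hx & Ox & Sx); exists x; rewrite HvS in Hx; auto. }
    assert (Hkn : k <> S N /\ k <> N) by (unfold k; lia).
    assert (EQ : forall z, Q (upd v k z) <-> (ordinal z /\ z in_ u) /\ (stage p pr d (upd v k z) /\
       forall x, x in_ z -> ~ stage p pr d (upd v k x))).
    { intros z; unfold Q; rewrite upd_same, upd_other, HvS by lia.
      assert (E : forall y, stage p pr d (upd (upd v k z) k y) <-> stage p pr d (upd v k y)).
      { intros y; split; apply stage_ext; intros i _; unfold upd; destruct (Nat.eqb i k); auto. }
      split; (intros [H1 [H2 H3]]; split; [auto|split; auto]); intros y Hy Hn; apply (H3 y Hy); now apply E. }
    assert (Tu : transitive u) by (rewrite Ea; now apply Vf_trans).
    assert (Qx : Q (upd v k x)).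
    { apply EQ; split; auto; split; auto; intros y Hy Sy; apply (Mx y Hy); split; auto; exact (Tu x Hx y Hy). }
    assert (Hfix : x in_ X /\ app j x = x).
    { apply (@transfer_fix Q v k); auto.
      - exact (Vf_trans Oeta (X_sub Hu) Hx).
      - intros z Qz; apply EQ in Qz; destruct Qz as [[Oz Hz] [Sz Mz]].
        destruct (ord_tri Oz Ox) as [H|[H|H]]; auto; exfalso.
        + apply (Mx z H); auto.
        + apply (Mz x H); auto. }
    exists (upd v k x); split; [|split; [|split]]; auto.
    + intros i; unfold upd; destruct (Nat.eqb i k); auto.
    + rewrite upd_other by lia; auto.
    + rewrite upd_other by lia; auto.
Qed.

Lemma no_rigid p pr : (forall l v, good l -> envin l v -> (sat (fun x => x in_ Vf l) v pr <-> rigid (v 0) (v 1))) ->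
  ~ exists u, u in_ Vf zeta /\ wit p pr (Vf lam) u.
Proof.
  intros Hpr Hw; destruct (wit_fixed Hw) as (u & Hu & Eu & Wu).
  destruct (parameters_fixed Hu Eu Wu) as (v & Hv & HvN & HvS & A & HA & HA1 & HA2).
  pose proof Wu as (Hl & Hll & HUu & _); apply level_iff in Hl; destruct Hl as (a & Oa & Ea).
  assert (Ga : good a).
  { apply lim_like_good; auto; [|now rewrite <- Ea].
    rewrite Ea in HUu; apply in_Vf in HUu; auto; destruct HUu as (d & Hd & _); exists d; auto. }
  rewrite HvS in *; rewrite HvN in *.
  assert (HR : rigid A (Vf lam)).
  { rewrite Ea in *; apply (Hpr a _ Ga) in HA2; auto; intros [|k]; auto. }
  assert (FA : A in_ X /\ app j A = A).
  { set (N := S (var_bound p)) in *.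
    (* In the fixed level, [A] is the only solution of [p] at the fixed parameters. *)
    apply (@transfer_fix (fun w => w (S (S N)) in_ w (S N) /\
       sat (fun y => y in_ w (S N)) (upd w 0 (w (S (S N)))) p) v (S (S N))); auto.
    - apply absl_and; [apply absl_mem|]; apply d0_absl.
      apply d0_iff with (2 := d0_sat (fun k => match k with 0 => S (S N) | _ => k end) (S N) p).
      intros w; apply sat_ext; intros [|k] _; auto.
    - exact (Vf_trans Oeta (X_sub Hu) HA).
    - rewrite upd_same, upd_other, HvS by lia; split; auto.
      apply (@sat_ext V _ p (upd v 0 A)); [|now apply HA1].
      intros [|k] Hk; [now rewrite !upd_same|].
      rewrite !(upd_other _ _ (k := S k) (i := 0)) by lia; rewrite upd_other by (unfold N; lia); auto.
    - intros z; rewrite upd_same, upd_other, HvS by lia; intros [Hz Sz]; apply HA1; auto.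
      revert Sz; apply sat_ext; intros [|k] Hk; [now rewrite !upd_same|].
      rewrite !(upd_other _ _ (k := S k) (i := 0)) by lia; rewrite upd_other by (unfold N; lia); auto. }
  destruct FA as [AX AE], HR as ((x0 & Hx0) & HR2 & HR3).
  (* Elementarity of X yields a member of [A] inside X, where [j] is defined. *)
  destruct (@transfer_ex (fun w => w 1 in_ w 0) (fun _ => A) 1 x0) as (x & Hx & HxA); auto.
  { apply absl_mem. }
  { exact (Vf_trans Oeta (X_sub AX) Hx0). }
  unfold upd in HxA; simpl in HxA.
  assert (HyA : app j x in_ A) by (rewrite <- AE; exact (proj1 (j_mem Hx AX) HxA)).
  destruct crit as (b & Hb & Hnb); apply Hnb.
  assert (HbU : b in_ Vf lam) by now apply (ord_sub_Vf Olam).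
  pose proof (HR3 x HxA _ HyA _ (restr_elementary Hx) b HbU) as Hm.
  apply (fun_maps _ _ (emb_fun (restr_elementary Hx))) in Hm; destruct Hm as [_ Hm].
  rewrite app_restr in Hm; auto.
Qed.

End Forward.

Section ForwardMain.
Context {V : set_structure} {hZF : ZF V}.
Implicit Types a b c x y z f s t D E l A U : V.

Lemma C_mono n (a : V) : C_ (S n) a -> C_ n a.
Proof.
  intros [Oa (Va & Hr & H)]; split; auto; exists Va; split; auto; intros p v Hp Hv.
  specialize (H (FNeg p) v (sigma_pi Hp) Hv); simpl in H.
  destruct (classic (sat (fun x => x in_ Va) v p)), (classic (sat all_sets v p)); tauto.
Qed.

Lemma C_le m n (a : V) : m <= n -> C_ n a -> C_ m a.
Proof. induction 1; auto using C_mono. Qed.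

Lemma finite_superset (v : nat -> V) n : exists b, forall k, k < n -> v k in_ b.
Proof.
  induction n as [|n [b Hb]]; [exists emp; lia|].
  exists (cup b (upair (v n) (v n))); intros k Hk; rewrite in_cup, in_upair.
  destruct (Nat.eq_dec k n) as [->|Hne]; auto; left; apply Hb; lia.
Qed.

(** The defining formula [p] has to be reflected; rigidity is absolute for [good] levels and comes
    along. *)
Lemma rigid_wit lam A p v pr : ordinal lam -> (forall i, ordinal (v i)) ->
  (forall x, sat all_sets (upd v 0 x) p <-> x = A) -> rigid A (Vf lam) ->
  (forall l v, good l -> envin l v -> (sat (fun x => x in_ Vf l) v pr <-> rigid (v 0) (v 1))) ->
  exists u, wit p pr (Vf lam) u.
Proof.
  intros Ol Hv Hp HR Hpr; set (N := S (var_bound p)).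
  destruct (finite_superset v N) as [b Hb].
  destruct (reflection p (opair b (opair A (Vf lam)))) as (l & Gl & Hl & Hrefl).
  assert (Oll : ordinal l) by apply Gl.
  destruct (opair_bound Oll Hl) as [Hbl Hl']; destruct (opair_bound Oll Hl') as [HAl HUl]; clear Hl Hl'.
  assert (Hvl : forall k, k < N -> v k in_ Vf l) by (intros k Hk; exact (Vf_trans Oll Hbl (Hb k Hk))).
  exists (Vf l); split; [apply level_iff; eauto|split; [now apply good_lim_like|split; auto]].
  apply stage_intro with (b := v); [lia|..]; fold N.
  - intros k Hk; rewrite upd_same; auto.
  - set (w := fun k => if Nat.ltb k (N - N) then upd (fun _ => Vf lam) (S N) (Vf l) k
      else if Nat.ltb k N then v k else upd (fun _ => Vf lam) (S N) (Vf l) k).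
    assert (Ew : forall k, k < N -> w k = v k).
    { intros k Hk; unfold w; rewrite Nat.sub_diag; simpl.
      destruct (Nat.ltb_spec k N); auto; lia. }
    assert (EN : w N = Vf lam).
    { unfold w; rewrite Nat.sub_diag; simpl; rewrite Nat.ltb_irrefl; apply upd_other; lia. }
    assert (ES : w (S N) = Vf l).
    { unfold w; rewrite Nat.sub_diag; simpl; destruct (Nat.ltb_spec (S N) N); [lia|apply upd_same]. }
    clearbody w.
    exists A; fold N; rewrite ES; split; [auto|split].
    + intros x Hx.
      (* Position [S N] holds V_l, which is not in V_l. All positions from [N] on are reset to [A],
         so that the reflected equivalence applies. *)
      set (w' := fun k => if Nat.ltb k N then upd w 0 x k else A).
      assert (E' : forall k, k < var_bound p -> upd w 0 x k = w' k).
      { intros k Hk; unfold w'; destruct (Nat.ltb_spec k N); auto; unfold N in *; lia. }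
      rewrite (sat_ext _ E'), Hrefl.
      * rewrite <- (sat_ext _ E'), <- Hp; apply sat_ext; intros [|k] Hk; auto.
        rewrite !upd_other by lia; apply Ew; unfold N; lia.
      * intros k; unfold w'; destruct (Nat.ltb_spec k N); auto.
        unfold upd; destruct (Nat.eqb k 0); auto; rewrite Ew; auto.
    + rewrite EN; apply (Hpr l); auto; intros [|k]; auto.
Qed.

Theorem exacting_embeds (lam : V) : exacting lam -> forall A lam1 Vlam1,
    is_succ lam1 lam -> is_rank Vlam1 lam1 ->
    nonempty A -> ordinal_definable A -> subset A Vlam1 ->
    exists x y j Vlam : V,
      x in_ A /\ y in_ A /\ is_rank Vlam lam /\
      elementary_embedding j Vlam (Some x) Vlam (Some y) /\
      exists a, a in_ Vlam /\ ~ maps j a a.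
Proof.
  intros [[Cl _] (n & eta & X & zeta & j & Vlam & Veta & Vzeta & Hn & R1 & R2 & R3 & Ce & _ & He & HX & HUX & HlX
    & Cz & HCz & Hz & Hj & Hjl & a & Ha & Hna)] A lam1 Vlam1 Hs Hr HA (p & v & Hv & Hp) HAs.
  apply is_rank_iff in R1, R2, R3, Hr; destruct R1 as [Ol ->], R2 as [Oe ->], R3 as [Oz ->], Hr as [O1 ->].
  apply is_succ_iff in Hs; subst lam1.
  pose proof (emb_fun Hj) as Fj.
  apply (fun_maps _ _ Fj) in Hjl; destruct Hjl as [_ Hjl].
  assert (Hcrit : exists a, a in_ lam /\ app j a <> a).
  { exists a; split; auto; intros E; apply Hna, (fun_maps _ _ Fj); split; auto.
    apply HUX; now apply (ord_sub_Vf Ol). }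
  assert (Ho := omega_lam Oe Oz HX Hj HUX Cl Hcrit).
  assert (Hgood : forall k, cardinal k -> lam in_ k -> good k).
  { intros k Ck Hk; assert (Hok : omega in_ k) by (apply ord_trans with lam; auto; apply Ck).
    split; auto; apply card_lim; auto; apply ord_sub; auto using ord_omega; apply Ck. }
  assert (Ge := Hgood eta Ce He); assert (Gz := Hgood zeta Cz Hz).
  apply NNPP; intros Hno.
  assert (HR : rigid A (Vf lam)).
  { split; [auto|split].
    - intros x Hx; apply in_Vf_suc; auto.
    - intros x Hx y Hy k Hk b Hb; apply NNPP; intros Hnb; apply Hno.
      exists x, y, k, (Vf lam); split; [auto|split; [auto|split; [apply is_rank_iff; auto|split; [auto|eauto]]]]. }
  destruct absl_rigid as [pr Hpr].
  assert (Hpr' : forall l v, good l -> envin l v -> (sat (fun x => x in_ Vf l) v pr <-> rigid (v 0) (v 1))).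
  { intros; apply Hpr; auto. }
  destruct (rigid_wit Ol Hv Hp HR Hpr') as [u Hu].
  destruct (wit_sigma2 p pr (Vf lam)) as (q & Hq & Q1 & Q2).
  apply (no_rigid Oe Oz HX Hj HUX HlX Cl (eq_sym Hjl) Hcrit He Hz Ge Gz (p := p) Hpr').
  assert (HUz : Vf lam in_ Vf zeta) by now apply Vf_in.
  apply Q2; auto.
  (* As [n] is positive, [zeta] lies in C^(2), and the Sigma_2 statement passes down to V_zeta. *)
  assert (H2 : 2 <= S n) by lia.
  destruct (C_le H2 HCz) as [_ (Vz & HVz & Href)].
  apply is_rank_iff in HVz; destruct HVz as [_ ->].
  apply (Href q (fun _ => Vf lam) Hq); eauto.
Qed.

End ForwardMain.

(** * Parameter-free definability *)

Section ParameterFree.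
Context {V : set_structure}.

(** Ordinal definability admits ordinals alone as parameters, so [dP] is too generous; the ordinals
    enter as values of free variables in [vP_ordinal_definable]. *)
Definition vP (Q : (nat -> V) -> Prop) := exists p, forall v, Q v <-> sat all_sets v p.

Lemma vP_of Q : definable (I := unit) (M := fun _ => V) (C := Empty_set)
  (fun _ e => match e with end) false (fun _ v => Q v) -> vP Q.
Proof.
  intros (q & t & _ & E); exists (ren (fun k => match t k with inl n => n | inr e => match e with end end) q).
  intros v; rewrite sat_ren, (E tt v); apply sat_ext.
  intros k _; unfold lookup; destruct (t k) as [n|[]]; auto.
Qed.
Lemma vP_to Q : vP Q -> definable (I := unit) (M := fun _ => V) (C := Empty_set)
  (fun _ e => match e with end) false (fun _ v => Q v).
Proof. intros (q & E); exists q, inl; split; [discriminate|]; intros [] v; apply E. Qed.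
Lemma vP_iff (Q R : (nat -> V) -> Prop) : (forall v, Q v <-> R v) -> vP Q -> vP R.
Proof. intros H [p Hp]; exists p; intros; rewrite <- H; auto. Qed.
Lemma vP_mem i j : vP (fun v => v i in_ v j).
Proof. exists (FMem i j); simpl; tauto. Qed.
Lemma vP_eq i j : vP (fun v => v i = v j).
Proof. exists (FEq i j); simpl; tauto. Qed.
Lemma vP_not P : vP P -> vP (fun v => ~ P v).
Proof. intros [p Hp]; exists (FNeg p); simpl; intros; rewrite Hp; tauto. Qed.
Lemma vP_and P Q : vP P -> vP Q -> vP (fun v => P v /\ Q v).
Proof. intros [p Hp] [q Hq]; exists (FAnd p q); simpl; intros; rewrite Hp, Hq; tauto. Qed.
Lemma vP_or P Q : vP P -> vP Q -> vP (fun v => P v \/ Q v).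
Proof.
  intros HP HQ; apply vP_iff with (2 := vP_not (vP_and (vP_not HP) (vP_not HQ))); intros; tauto.
Qed.
Lemma vP_imp P Q : vP P -> vP Q -> vP (fun v => P v -> Q v).
Proof. intros HP HQ; apply vP_iff with (2 := vP_not (vP_and HP (vP_not HQ))); intros; tauto. Qed.
Lemma vP_equiv P Q : vP P -> vP Q -> vP (fun v => P v <-> Q v).
Proof. intros; apply vP_and; now apply vP_imp. Qed.
Lemma vP_ex (Q : V -> (nat -> V) -> Prop) :
  vP (fun v => Q (v 0) (fun k => v (S k))) -> vP (fun v => exists x, Q x v).
Proof.
  intros H; apply vP_of, (definable_ex (M := fun _ : unit => V) (Q := fun _ x v => Q x v)), vP_to, H.
Qed.
Lemma vP_all (Q : V -> (nat -> V) -> Prop) :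
  vP (fun v => Q (v 0) (fun k => v (S k))) -> vP (fun v => forall x, Q x v).
Proof.
  intros H; apply vP_of, (definable_all (M := fun _ : unit => V) (Q := fun _ x v => Q x v)), vP_to, H.
Qed.
Lemma vP_prop (P : Prop) : vP (fun _ => P).
Proof.
  destruct (classic P); [exists (FEq 0 0)|exists (FNeg (FEq 0 0))]; simpl; tauto.
Qed.

Lemma vP_ordinal_definable (Q : V -> V -> V -> Prop) A a b :
  (forall x y : V, (forall z, z in_ x <-> z in_ y) -> x = y) ->
  vP (fun v => Q (v 0) (v 1) (v 2)) -> ordinal a -> ordinal b ->
  (forall x, x in_ A <-> Q x a b) -> ordinal_definable A.
Proof.
  intros Hext HQ Ha Hb HA.
  assert (H : vP (fun v => forall y, y in_ v 0 <-> Q y (v 1) (v 2))).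
  { apply vP_all, vP_equiv; [apply vP_mem|].
    destruct HQ as [q Hq]; exists (ren (fun k => match k with 0 => 0 | S n => S (S n) end) q).
    intros v; rewrite sat_ren, <- Hq; tauto. }
  destruct H as [p Hp]; exists p, (fun k => match k with 1 => a | _ => b end); split.
  - intros [|[|k]]; auto.
  - intros x; rewrite <- Hp; unfold upd; simpl; split.
    + intros H; apply Hext; intros z; rewrite H, HA; tauto.
    + intros -> z; apply HA.
Qed.

End ParameterFree.

Ltac vp_step :=
  cbv beta;
  lazymatch goal with
  | |- vP (fun _ => ?a) => apply vP_prop
  | |- vP (fun v => _ /\ _) => apply vP_and
  | |- vP (fun v => _ \/ _) => apply vP_or
  | |- vP (fun v => ~ _) => apply vP_not
  | |- vP (fun v => _ <-> _) => apply vP_equiv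
  | |- vP (fun v => ex _) => apply vP_ex
  | |- vP (fun v => @eq _ _ _) => apply vP_eq
  | |- vP (fun v => mem _ _) => apply vP_mem
  | |- vP (fun v => forall x, _) => first [apply vP_imp | apply vP_all]
  | |- vP _ => first [apply vP_all | apply vP_ex | apply vP_and | apply vP_or | apply vP_not | apply vP_imp]
  end.
Ltac vp := repeat vp_step.

(** * Order types and injections *)

Section OrderType.
Context {V : set_structure} {hZF : ZF V}.
Implicit Types a b c x y z f : V.

Definition ran f : V := setof (fun z => exists q, opair q z in_ f).
Lemma isset_ran f : isset (fun z => exists q, opair q z in_ f).
Proof.
  apply isset_sub with (bigU (bigU f)); [|dp].
  intros z (q & H); apply in_bigU; exists (upair q z); split; [|apply in_upair; auto].
  apply in_bigU; exists (opair q z); split; auto.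
  assert (Hp : is_opair (opair q z) q z) by now apply is_opair_iff.
  destruct Hp as (s & d & H1 & H2 & H3); apply is_pair_iff in H2; subst d; apply H3; auto.
Qed.
Lemma in_ran f z : z in_ ran f <-> exists q, opair q z in_ f.
Proof. apply (in_setof _ (isset_ran f)). Qed.
Lemma dT_ran (s : (nat -> V) -> V) : dT s -> dT (fun v => ran (s v)).
Proof.
  apply dT_sub1; apply (dT_setof (P := fun z v => exists q, opair q z in_ v 0)); [intros; apply isset_ran|dp].
Qed.

Section Rel.
Variable Rel : V -> V -> Prop.
Hypotheses (Rel_def : dP (fun v => Rel (v 0) (v 1)))
  (Rel_trans : forall a b c, Rel a b -> Rel b c -> Rel a c)
  (Rel_set : forall a, isset (fun b => Rel b a))
  (Rel_ind : forall P, dP (fun v => P (v 0)) ->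
     (forall a, (forall b, Rel b a -> P b) -> P a) -> forall a, P a).

(** The Mostowski collapse of [Rel]; along a linear order it is the order type of the
    predecessors. *)
Definition otype : V -> V := recfun Rel (fun _ f => ran f).

Lemma otype_step_def : dP (fun v : nat -> V => v 0 = ran (v 2)).
Proof. apply (dT_ran (s := fun v => v 1)); dp. Qed.
Lemma otype_def : dP (fun v => v 0 = otype (v 1)).
Proof. apply (recfun_def Rel_def Rel_trans Rel_set Rel_ind otype_step_def). Qed.

Lemma in_otype z p : z in_ otype p <-> exists q, Rel q p /\ z = otype q.
Proof.
  unfold otype at 1; rewrite (recfun_eq Rel_def Rel_trans Rel_set Rel_ind otype_step_def), in_ran.
  split; intros (q & H).
  - apply (in_mkfun _ _ otype_def) in H; destruct H as (x & Hx & E); apply opair_inj in E; destruct E; subst.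
    exists x; split; auto; apply (in_setof x (Rel_set p)), Hx.
  - destruct H as [H ->]; exists q; apply (in_mkfun _ _ otype_def); exists q; split; auto.
    apply (in_setof q (Rel_set p)), H.
Qed.

Lemma otype_ord p : ordinal (otype p).
Proof.
  pose proof otype_def as Hd.
  revert p; apply (Rel_ind (P := fun p => ordinal (otype p))); [dp|].
  intros p IH; split.
  - intros z Hz w Hw; apply in_otype in Hz; destruct Hz as (q & Hq & ->).
    apply in_otype in Hw; destruct Hw as (q' & Hq' & ->); apply in_otype; eauto.
  - intros z Hz; apply in_otype in Hz; destruct Hz as (q & Hq & ->); exact (proj1 (IH q Hq)).
Qed.
Lemma otype_lt q p : Rel q p -> otype q in_ otype p.
Proof. intros H; apply in_otype; eauto. Qed.

End Rel.

Definition inj a b := exists f, is_fun f a b /\ injective_on f a.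

Lemma inj_mk a b (h : V -> V) : dP (fun v => v 0 = h (v 1)) -> (forall x, x in_ a -> h x in_ b) ->
  (forall x y, x in_ a -> y in_ a -> h x = h y -> x = y) -> inj a b.
Proof.
  intros Hd H1 H2; exists (mkfun a h); split; [now apply is_fun_mkfun|].
  intros x y Hx Hy; rewrite !app_mkfun by auto; auto.
Qed.
Lemma inj_sub a b : subset a b -> inj a b.
Proof. intros H; apply (inj_mk (h := fun x => x)); auto; dp. Qed.
Lemma inj_trans a b c : inj a b -> inj b c -> inj a c.
Proof.
  intros (f & Ff & If) (g & Fg & Ig); apply (inj_mk (h := fun x => app g (app f x))); [dp| |].
  - intros x Hx; apply (fun_in Fg), (fun_in Ff), Hx.
  - intros x y Hx Hy E; apply If; auto; apply Ig; auto; now apply (fun_in Ff).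
Qed.

Definition fst p : V := setof (fun z => exists x y, p = opair x y /\ z in_ x).
Definition snd p : V := setof (fun z => exists x y, p = opair x y /\ z in_ y).
Lemma isset_fst p : isset (fun z => exists x y, p = opair x y /\ z in_ x).
Proof.
  destruct (classic (exists x y, p = opair x y)) as [(x & y & ->)|H].
  - exists x; intros z; split; [eauto|intros (x' & y' & E & Hz); apply opair_inj in E; destruct E; now subst].
  - exists emp; intros z; rewrite in_emp; split; [tauto|intros (x & y & E & _); apply H; eauto].
Qed.
Lemma isset_snd p : isset (fun z => exists x y, p = opair x y /\ z in_ y).
Proof.
  destruct (classic (exists x y, p = opair x y)) as [(x & y & ->)|H].
  - exists y; intros z; split; [eauto|intros (x' & y' & E & Hz); apply opair_inj in E; destruct E; now subst].
  - exists emp; intros z; rewrite in_emp; split; [tauto|intros (x & y & E & _); apply H; eauto].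
Qed.
Lemma fst_opair x y : fst (opair x y) = x.
Proof.
  apply setof_eq; intros z; split; [eauto|intros (x' & y' & E & Hz); apply opair_inj in E; destruct E; now subst].
Qed.
Lemma snd_opair x y : snd (opair x y) = y.
Proof.
  apply setof_eq; intros z; split; [eauto|intros (x' & y' & E & Hz); apply opair_inj in E; destruct E; now subst].
Qed.
Lemma dT_fst (s : (nat -> V) -> V) : dT s -> dT (fun v => fst (s v)).
Proof.
  apply dT_sub1; apply (dT_setof (P := fun z v => exists x y, v 0 = opair x y /\ z in_ x)); [intros; apply isset_fst|dp].
Qed.
Lemma dT_snd (s : (nat -> V) -> V) : dT s -> dT (fun v => snd (s v)).
Proof.
  apply dT_sub1; apply (dT_setof (P := fun z v => exists x y, v 0 = opair x y /\ z in_ y)); [intros; apply isset_snd|dp].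
Qed.

Lemma inj_prod a b c d : inj a c -> inj b d -> inj (prod a b) (prod c d).
Proof.
  intros (f & Ff & If) (g & Fg & Ig).
  apply (inj_mk (h := fun p => opair (app f (fst p)) (app g (snd p)))).
  - dpw ltac:(first [apply dT_fst|apply dT_snd]).
  - intros p Hp; apply in_prod in Hp; destruct Hp as (x & y & Hx & Hy & ->); rewrite fst_opair, snd_opair.
    apply opair_in_prod; split; [now apply (fun_in Ff)|now apply (fun_in Fg)].
  - intros p q Hp Hq; apply in_prod in Hp, Hq.
    destruct Hp as (x & y & Hx & Hy & ->), Hq as (x' & y' & Hx' & Hy' & ->).
    rewrite !fst_opair, !snd_opair, !opair_inj; intros [E1 E2]; split; auto.
Qed.

Definition inverse f : V := setof (fun p => exists x y, opair x y in_ f /\ p = opair y x).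
Lemma isset_inverse f : isset (fun p => exists x y, opair x y in_ f /\ p = opair y x).
Proof.
  apply isset_iff with (fun p => exists q, q in_ f /\ exists x y, q = opair x y /\ p = opair y x).
  - intros p; split; [intros (q & Hq & x & y & -> & ->); eauto|intros (x & y & H & ->)].
    exists (opair x y); eauto.
  - apply isset_repl; [dp|]; intros q p p' _ (x & y & -> & ->) (x' & y' & E & ->).
    apply opair_inj in E; destruct E; now subst.
Qed.
Lemma in_inverse f x y : opair y x in_ inverse f <-> opair x y in_ f.
Proof.
  unfold inverse; rewrite (in_setof _ (isset_inverse f)); split; [|eauto].
  intros (x' & y' & H & E); apply opair_inj in E; destruct E; now subst.
Qed.
Lemma bij_inverse f a b : is_bijection f a b -> is_bijection (inverse f) b a /\
  (forall x, x in_ a -> app (inverse f) (app f x) = x) /\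
  (forall y, y in_ b -> app f (app (inverse f) y) = y).
Proof.
  intros H; apply is_bijection_iff in H; destruct H as (Ff & If & Sf).
  assert (Fu := proj1 (proj1 (is_fun_iff _ _ _) Ff)).
  assert (E1 : forall x, x in_ a -> app (inverse f) (app f x) = x).
  { intros x Hx; apply app_unique; [apply in_inverse, Fu, Hx|]; intros x' H; apply (proj1 (in_inverse f x' (app f x))) in H.
    apply (func_app _ _ Fu) in H; destruct H as [Hx' E]; apply If; auto. }
  assert (E2 : forall y, y in_ b -> app f (app (inverse f) y) = y).
  { intros y Hy; destruct (Sf y Hy) as (x & Hx & <-); now rewrite E1. }
  split; [|split; auto]; apply is_bijection_iff; split; [apply is_fun_iff; split; [split|]|split].
  - intros p Hp; pose proof Hp as Hp'; unfold inverse in Hp; apply setof_E in Hp; [|apply isset_inverse].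
    destruct Hp as (x & y & H & ->); apply (func_app _ _ Fu) in H; destruct H as [Hx ->].
    exists (app f x); split; [now apply (fun_in Ff)|now rewrite E1].
  - intros y Hy; destruct (Sf y Hy) as (x & Hx & <-); rewrite E1 by auto; apply in_inverse, Fu, Hx.
  - intros y Hy; destruct (Sf y Hy) as (x & Hx & <-); now rewrite E1.
  - intros y y' Hy Hy' E; rewrite <- (E2 y Hy), <- (E2 y' Hy'); now rewrite E.
  - intros x Hx; exists (app f x); split; [now apply (fun_in Ff)|auto].
Qed.
Lemma bij_inj f a b : is_bijection f a b -> inj a b /\ inj b a.
Proof.
  intros H; destruct (bij_inverse H) as [H' _]; apply is_bijection_iff in H, H'; split; eexists; split;
    [apply H|apply H|apply H'|apply H'].
Qed.

(** The Mostowski collapse of membership on [B]. Sets outside [B] get no predecessors, which keeps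
    the relation well-founded on all of [V]. *)
Lemma collapse B : (forall x, x in_ B -> ordinal x) -> exists i h, dP (fun v => v 0 = h (v 1)) /\ ordinal i /\
  (forall x, x in_ B -> h x in_ i /\ subset (h x) x /\ ordinal (h x)) /\
  (forall x y, x in_ B -> y in_ B -> h x = h y -> x = y) /\
  (forall z, z in_ i -> exists x, x in_ B /\ h x = z).
Proof.
  intros HB.
  set (Rel := fun b a => b in_ a /\ (b in_ B /\ a in_ B)).
  assert (Rd : dP (fun v => Rel (v 0) (v 1))) by (unfold Rel; dp).
  assert (Rt : forall a b c, Rel a b -> Rel b c -> Rel a c).
  { intros a b c (H1 & H2 & H3) (H4 & H5 & H6); split; auto; apply ord_trans with b; auto. }
  assert (Rs : forall a, isset (fun b => Rel b a)).
  { intros a; apply isset_sub with a; unfold Rel; [tauto|dp]. }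
  assert (Ri : forall P, dP (fun v => P (v 0)) -> (forall a, (forall b, Rel b a -> P b) -> P a) -> forall a, P a).
  { intros P HP IH a; destruct (classic (ordinal a)) as [Ha|Ha].
    - revert a Ha; apply ord_ind; auto; intros a Ha H; apply IH; intros b [Hb _]; auto.
    - apply IH; intros b (_ & _ & Hb); exfalso; apply Ha; auto. }
  set (h := otype Rel).
  assert (Hd : dP (fun v => v 0 = h (v 1))) by now apply otype_def.
  assert (Hlt : forall q p, Rel q p -> h q in_ h p) by (intros; now apply otype_lt).
  assert (Hin : forall z p, z in_ h p <-> exists q, Rel q p /\ z = h q) by (intros; now apply in_otype).
  assert (Ho : forall p, ordinal (h p)) by (intros; now apply otype_ord).
  clearbody h.
  assert (Hsub : forall x, ordinal x -> x in_ B -> subset (h x) x).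
  { apply (ord_ind (P := fun x => x in_ B -> subset (h x) x)); [dp|].
    intros x Ox IH Hx z Hz; apply Hin in Hz; destruct Hz as (q & (Hq1 & Hq2 & Hq3) & ->).
    apply sub_lt_trans with q; auto. }
  assert (Hi : isset (fun y => exists x, x in_ B /\ y = h x)) by now apply isset_image.
  exists (setof (fun y => exists x, x in_ B /\ y = h x)), h; split; [auto|split; [split|split; [|split]]].
  - intros z Hz w Hw; apply setof_E in Hz; auto; destruct Hz as (x & Hx & ->).
    apply Hin in Hw; destruct Hw as (q & (H1 & H2 & H3) & ->); apply setof_I; eauto.
  - intros z Hz; apply setof_E in Hz; auto; destruct Hz as (x & Hx & ->); apply Ho.
  - intros x Hx; split; [apply setof_I; eauto|split; auto].
  - intros x y Hx Hy E; destruct (ord_tri (HB x Hx) (HB y Hy)) as [H|[H|H]]; auto; exfalso.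
    + apply (mem_irrefl (x := h x)); rewrite E at 2; apply Hlt; split; auto.
    + apply (mem_irrefl (x := h x)); rewrite E at 1; apply Hlt; split; auto.
  - intros z Hz; apply setof_E in Hz; auto; destruct Hz as (x & Hx & ->); eauto.
Qed.

(** Cardinals are defined through bijections; collapsing the range of an injection gives a bijection
    with an ordinal of size at most [a]. *)
Lemma card_noinj k a : cardinal k -> a in_ k -> ~ inj k a.
Proof.
  intros [Ok Hk] Ha (f & Ff & If); assert (Oa := ord_in Ok Ha).
  assert (Fu := proj1 (proj1 (is_fun_iff _ _ _) Ff)).
  assert (Hr : forall y, y in_ ran f <-> exists x, x in_ k /\ y = app f x).
  { intros y; rewrite in_ran; split; intros (x & Hx); exists x; now apply (func_app _ _ Fu). }
  destruct (@collapse (ran f)) as (i & h & Hd & Oi & H1 & H2 & H3).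
  { intros y Hy; apply Hr in Hy; destruct Hy as (x & Hx & ->); apply ord_in with a; auto; now apply (fun_in Ff). }
  assert (Hi : i in_ k).
  { apply sub_lt_trans with a; auto; intros z Hz; destruct (H3 z Hz) as (x & Hx & <-).
    destruct (H1 x Hx) as (_ & Hs & Oh).
    apply Hr in Hx; destruct Hx as (y & Hy & ->); assert (Hfa := fun_in Ff Hy).
    apply sub_lt_trans with (app f y); auto; now apply ord_in with a. }
  apply (Hk i Hi).
  assert (Hb : is_bijection (mkfun k (fun x => h (app f x))) k i).
  { assert (Hd' : dP (fun v => v 0 = h (app f (v 1)))) by dp.
    apply is_bijection_iff; split; [|split].
    - apply is_fun_mkfun; auto; intros x Hx; destruct (H1 (app f x)); [apply Hr; eauto|auto].
    - intros x y Hx Hy; rewrite !(app_mkfun Hd') by auto; intros E; apply If; auto.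
      apply H2; auto; apply Hr; eauto.
    - intros z Hz; destruct (H3 z Hz) as (y & Hy & E); apply Hr in Hy; destruct Hy as (x & Hx & ->).
      exists x; split; auto; now rewrite (app_mkfun Hd'). }
  eexists; apply (bij_inverse Hb).
Qed.

Lemma ord_iso k k' (h : V -> V) : dP (fun v => v 0 = h (v 1)) -> ordinal k -> ordinal k' ->
  (forall x, x in_ k -> h x in_ k') -> (forall y, y in_ k' -> exists x, x in_ k /\ h x = y) ->
  (forall x y, x in_ k -> y in_ k -> (x in_ y <-> h x in_ h y)) -> k = k'.
Proof.
  intros Hd Ok Ok' H1 H2 H3.
  assert (Hid : forall x, ordinal x -> x in_ k -> h x = x).
  { apply (ord_ind (P := fun x => x in_ k -> h x = x)); [dp|].
    intros x Ox IH Hx; apply ext; intros z; split; intros Hz.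
    - assert (Hzk : z in_ k') by (apply ord_trans with (h x); auto).
      destruct (H2 z Hzk) as (y & Hy & <-); apply H3 in Hz; auto; rewrite IH; auto.
    - assert (Hzk : z in_ k) by (apply ord_trans with x; auto).
      apply H3 in Hz as Hz'; auto; rewrite IH in Hz'; auto. }
  apply ext; intros z; split; intros Hz.
  - rewrite <- (Hid z); auto; now apply ord_in with k.
  - destruct (H2 z Hz) as (y & Hy & <-); rewrite Hid; auto; now apply ord_in with k.
Qed.

Lemma inj_def : dP (fun v => inj (v 0) (v 1)).
Proof. unfold inj, injective_on, is_fun, maps, is_opair, is_pair, unique; dp. Qed.

(** Ordinals injecting into [a] are determined by well-orders of subsets of [a], which form a set.
    The orders are reflexive, so that [r] determines its field even when that has one element. *)
Lemma hartogs_ex a : exists k, ordinal k /\ ~ inj k a.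
Proof.
  set (R := fun r k => ordinal k /\ exists f, func f k /\ ((forall x, x in_ k -> app f x in_ a) /\ (injective_on f k /\
    forall u w, opair u w in_ r <-> exists x y, x in_ k /\ (y in_ k /\ ((x in_ y \/ x = y) /\ (u = app f x /\ w = app f y)))))).
  assert (HR : dP (fun v => R (v 0) (v 1))) by (unfold R, injective_on; dp).
  assert (Hs : isset (fun k => exists r, r in_ pow (prod a a) /\ R r k)).
  { apply isset_repl; auto; intros r k k' _ (Ok & f & Ff & Af & If & Ef) (Ok' & g & Fg & Ag & Ig & Eg).
    assert (Hdiag : forall f k u, ordinal k -> injective_on f k -> (forall u w, opair u w in_ r <-> exists x y, x in_ k /\
       (y in_ k /\ ((x in_ y \/ x = y) /\ (u = app f x /\ w = app f y)))) ->
       (opair u u in_ r <-> exists x, x in_ k /\ u = app f x)).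
    { intros f0 k0 u O0 I0 E0; rewrite E0; split; [intros (x & y & Hx & _ & _ & H & _); eauto|].
      intros (x & Hx & ->); exists x, x; auto. }
    assert (Hfg : forall x, x in_ k -> exists y, y in_ k' /\ app g y = app f x).
    { intros x Hx; assert (H : opair (app f x) (app f x) in_ r) by (apply (Hdiag f k); eauto).
      apply (Hdiag g k') in H; auto; destruct H as (y & Hy & E); eauto. }
    assert (Hgf : forall y, y in_ k' -> exists x, x in_ k /\ app g y = app f x).
    { intros y Hy; assert (H : opair (app g y) (app g y) in_ r) by (apply (Hdiag g k'); eauto).
      apply (Hdiag f k) in H; auto; destruct H as (x & Hx & E); eauto. }
    set (h := fun x => setof (fun z => z in_ k' /\ forall y, y in_ k' -> app g y = app f x -> z in_ y)).
    assert (Hi : forall x, isset (fun z => z in_ k' /\ forall y, y in_ k' -> app g y = app f x -> z in_ y)).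
    { intros x; apply isset_sep; dp. }
    assert (Hd : dP (fun v => v 0 = h (v 1))).
    { apply (setof1_def (P := fun z x => z in_ k' /\ forall y, y in_ k' -> app g y = app f x -> z in_ y)); auto; dp. }
    assert (Hh : forall x y, x in_ k -> y in_ k' -> app g y = app f x -> h x = y).
    { intros x y Hx Hy E; apply setof_eq; intros z; split.
      - intros Hz; split; [now apply ord_trans with y|].
        intros y' Hy' E'; assert (y' = y) by (apply Ig; auto; congruence); now subst.
      - intros [_ H]; auto. }
    clearbody h.
    assert (Hlt : forall (f0 k0 : V), ordinal k0 -> injective_on f0 k0 -> (forall u w, opair u w in_ r <-> exists x y, x in_ k0 /\
       (y in_ k0 /\ ((x in_ y \/ x = y) /\ (u = app f0 x /\ w = app f0 y)))) ->
       forall x y, x in_ k0 -> y in_ k0 -> (x in_ y <-> opair (app f0 x) (app f0 y) in_ r /\ app f0 x <> app f0 y)).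
    { intros f0 k0 O0 I0 E0 x y Hx Hy; rewrite E0; split.
      - intros H; split; [exists x, y; auto|intros E; apply I0 in E; auto; subst; now apply mem_irrefl in H].
      - intros [(x' & y' & Hx' & Hy' & H & E1 & E2) Hne]; apply I0 in E1, E2; auto; subst x' y'.
        destruct H; auto; subst; tauto. }
    apply (ord_iso Hd); auto.
    - intros x Hx; destruct (Hfg x Hx) as (y & Hy & E); now rewrite (Hh x y).
    - intros y Hy; destruct (Hgf y Hy) as (x & Hx & E); exists x; split; auto.
    - intros x y Hx Hy; destruct (Hfg x Hx) as (x' & Hx' & Ex), (Hfg y Hy) as (y' & Hy' & Ey).
      rewrite (Hh x x'), (Hh y y') by auto.
      rewrite (Hlt f k Ok If Ef x y), (Hlt g k' Ok' Ig Eg x' y'), Ex, Ey by auto; tauto. }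
  destruct (ord_unbounded (setof (fun k => exists r, r in_ pow (prod a a) /\ R r k))) as (k & Ok & Hk).
  exists k; split; auto; intros (f & Ff & If); apply Hk, setof_I; auto.
  pose proof Ff as Ff'; apply is_fun_iff in Ff'; destruct Ff' as [Fu Fin].
  assert (Hr : isset (fun p => exists x y, x in_ k /\ y in_ k /\ (x in_ y \/ x = y) /\ p = opair (app f x) (app f y))).
  { apply isset_sub with (prod a a); [|dp].
    intros p (x & y & Hx & Hy & _ & ->); apply opair_in_prod; auto. }
  exists (setof (fun p => exists x y, x in_ k /\ y in_ k /\ (x in_ y \/ x = y) /\ p = opair (app f x) (app f y))); split.
  - apply in_pow; intros p Hp; apply setof_E in Hp; auto; destruct Hp as (x & y & Hx & Hy & _ & ->).
    apply opair_in_prod; auto.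
  - split; auto; exists f; split; auto; split; auto; split; auto; intros u w; rewrite (in_setof _ Hr); split.
    + intros (x & y & Hx & Hy & H & E); apply opair_inj in E; exists x, y; tauto.
    + intros (x & y & Hx & Hy & H & -> & ->); exists x, y; auto.
Qed.

Definition hartogs a : V := leastord (fun k => ~ inj k a).

Lemma hartogs_spec a : ordinal (hartogs a) /\ ~ inj (hartogs a) a /\ forall k, k in_ hartogs a -> inj k a.
Proof.
  assert (Hd : dP (fun v => (fun k => ~ inj k a) (v 0))) by (pose proof inj_def; dp).
  destruct (leastord_spec Hd (hartogs_ex a)) as (H1 & H2 & H3); split; [auto|split; auto].
  intros k Hk; apply NNPP; intros Hn.
  assert (Ok := ord_in H1 Hk); apply (mem_irrefl (x := k)), (H3 k Ok Hn), Hk.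
Qed.

End OrderType.

Ltac dp_more := first [dp_hier | apply dT_ran | apply dT_fst | apply dT_snd | apply dT_updf | apply dT_if].
Ltac dp_user ::= dp_more.

(** * Consequences of DC *)

Section DependentChoice.
Context {V : set_structure} {hZF : ZF V}.
Implicit Types a b c d x y z f g s t S T : V.

Variables (lam S : V) (R : V -> V -> Prop).
Hypotheses (Llam : lim lam) (hDC : DC lam) (R_def : dP (fun v => R (v 0) (v 1))).

(** [R] sees the whole past of the sequence and thereby the stage reached; in this way different
    requirements are met at different stages. *)
Definition partial s b := is_fun s b S /\ forall c, c in_ b -> R (restr s c) (app s c).

Lemma is_fun_def : dP (fun v : nat -> V => is_fun (v 0) (v 1) (v 2)).
Proof. unfold is_fun, maps, is_opair, is_pair, unique; dp. Qed.

Lemma partial_def : dP (fun v => partial (v 0) (v 1)).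
Proof. pose proof is_fun_def; unfold partial; dp. Qed.

Let Olam : ordinal lam := proj1 Llam.

Lemma partial_func s b : partial s b -> func s b.
Proof. intros [H _]; apply is_fun_iff in H; tauto. Qed.

Lemma func_sub s t b c : func s b -> func t c -> subset s t ->
  subset b c /\ (forall x, x in_ b -> app s x = app t x) /\ s = restr t b.
Proof.
  intros Fs Ft H.
  assert (Hb : forall x, x in_ b -> x in_ c /\ app s x = app t x).
  { intros x Hx; apply (func_app _ _ Ft), H, Fs, Hx. }
  assert (Hbc : subset b c) by (intros x Hx; now apply Hb).
  split; [auto|split; [intros; now apply Hb|]].
  apply func_ext with b; auto; [now apply func_restr with c|].
  intros x Hx; rewrite app_restr by auto; now apply Hb.
Qed.

Lemma dom_unique s b c : func s b -> func s c -> b = c.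
Proof.
  intros H1 H2; apply ext; intros x; split; intros Hx;
    [apply (func_sub H1 H2 (fun y Hy => Hy))|apply (func_sub H2 H1 (fun y Hy => Hy))]; auto.
Qed.

(** Serves both for bounds of short chains in the tree and for the union along the branch. *)
Lemma chain_union C : (forall s, s in_ C -> exists b, b in_ lam /\ partial s b) ->
  (forall s t, s in_ C -> t in_ C -> subset s t \/ subset t s) ->
  exists c, ordinal c /\ subset c lam /\ partial (bigU C) c /\
    forall s b, s in_ C -> partial s b -> subset b c.
Proof.
  intros HC Hch.
  pose proof partial_def as Hpd.
  assert (Hi : isset (fun b => b in_ lam /\ exists s, s in_ C /\ partial s b)) by (apply isset_sep; dp).
  set (B := setof (fun b => b in_ lam /\ exists s, s in_ C /\ partial s b)).
  assert (HB : forall b, b in_ B <-> b in_ lam /\ exists s, s in_ C /\ partial s b) by (intros; exact (in_setof _ Hi)).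
  assert (Hc : forall x, x in_ bigU B <-> exists b s, b in_ lam /\ s in_ C /\ partial s b /\ x in_ b).
  { intros x; rewrite in_bigU; split.
    - intros (b & Hb & Hx); apply HB in Hb; destruct Hb as (Hb & s & Hs & Hp); eauto 6.
    - intros (b & s & Hb & Hs & Hp & Hx); exists b; split; auto; apply HB; eauto. }
  assert (Hval : forall s b x, s in_ C -> partial s b -> x in_ b -> opair x (app s x) in_ bigU C /\
     forall y, opair x y in_ bigU C -> y = app s x).
  { intros s b x Hs Hp Hx; pose proof (partial_func Hp) as Fs; split.
    - apply in_bigU; exists s; split; auto; now apply Fs.
    - intros y Hy; apply in_bigU in Hy; destruct Hy as (t & Ht & Hy); destruct (HC t Ht) as (d & _ & Hpt).
      pose proof (partial_func Hpt) as Ft; pose proof Hy as Hy'; apply (func_app _ _ Ft) in Hy; destruct Hy as [Hxd ->].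
      destruct (Hch s t Hs Ht) as [H|H].
      + symmetry; now apply (func_sub Fs Ft H).
      + now apply (func_sub Ft Fs H). }
  assert (Happ : forall s b x, s in_ C -> partial s b -> x in_ b -> app (bigU C) x = app s x).
  { intros s b x Hs Hp Hx; destruct (Hval s b x Hs Hp Hx); now apply app_unique. }
  assert (FU : func (bigU C) (bigU B)).
  { split.
    - intros p Hp; apply in_bigU in Hp; destruct Hp as (s & Hs & Hp); destruct (HC s Hs) as (b & Hb & Hps).
      pose proof (partial_func Hps) as Fs; destruct (proj1 Fs p Hp) as (x & Hx & ->); exists x; split.
      + apply Hc; eauto 7.
      + now rewrite (Happ s b).
    - intros x Hx; apply Hc in Hx; destruct Hx as (b & s & Hb & Hs & Hps & Hx).
      rewrite (Happ s b x); auto; now apply (Hval s b). }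
  assert (OB : ordinal (bigU B)).
  { apply ord_bigU; intros b Hb; apply HB in Hb; apply ord_in with lam; tauto. }
  exists (bigU B); split; [auto|split; [|split]].
  - intros x Hx; apply Hc in Hx; destruct Hx as (b & s & Hb & _ & _ & Hx); now apply ord_trans with b.
  - split.
    + apply is_fun_iff; split; auto; intros x Hx; apply Hc in Hx; destruct Hx as (b & s & Hb & Hs & Hps & Hx).
      rewrite (Happ s b x) by auto; destruct Hps as [Hps _]; now apply (fun_in Hps).
    + intros x Hx; apply Hc in Hx; destruct Hx as (b & s & Hb & Hs & Hps & Hx).
      assert (Ob := ord_in Olam Hb).
      rewrite (Happ s b x) by auto.
      assert (E : restr (bigU C) x = restr s x).
      { apply func_ext with x.
        - apply func_restr with (bigU B); auto; intros y Hy; apply Hc; exists b, s; repeat split; auto; try apply Hps.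
          now apply ord_trans with x.
        - apply func_restr with b; [now apply partial_func|]; intros y Hy; now apply ord_trans with x.
        - intros y Hy; rewrite !app_restr by auto; apply (Happ s b); auto; now apply ord_trans with x. }
      rewrite E; now apply Hps.
  - intros s b Hs Hp x Hx; destruct (HC s Hs) as (d & Hd & Hpd').
    rewrite (dom_unique (partial_func Hp) (partial_func Hpd')) in *.
    apply Hc; eauto 7.
Qed.

Hypothesis step : forall s b, b in_ lam -> partial s b -> exists x, x in_ S /\ R s x.

Lemma restr_id s b : func s b -> restr s b = s.
Proof. intros H; symmetry; apply (func_sub H H (fun y Hy => Hy)). Qed.

Lemma partial_extend s b x : ordinal b -> partial s b -> x in_ S -> R s x ->
  partial (cup s (upair (opair b x) (opair b x))) (suc b).
Proof.
  intros Ob Hp Hx HR; pose proof (partial_func Hp) as Fs.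
  set (t := cup s (upair (opair b x) (opair b x))).
  assert (Ht : forall k y, opair k y in_ t <-> (k in_ b /\ y = app s k) \/ (k = b /\ y = x)).
  { intros k y; unfold t; rewrite in_cup, in_upair, (func_app _ _ Fs), !opair_inj; tauto. }
  assert (Hk : forall k, k in_ b -> app t k = app s k).
  { intros k Hk; apply app_unique; [apply Ht; auto|]; intros y Hy; apply Ht in Hy.
    destruct Hy as [[_ H]|[H _]]; auto; subst; exfalso; exact (mem_irrefl Hk). }
  assert (Hb : app t b = x).
  { apply app_unique; [apply Ht; auto|]; intros y Hy; apply Ht in Hy.
    destruct Hy as [[H _]|[_ H]]; auto; exfalso; exact (mem_irrefl H). }
  assert (Ft : func t (suc b)).
  { split.
    - intros p Hp'; unfold t in Hp'; rewrite in_cup, in_upair in Hp'; destruct Hp' as [H|H].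
      + destruct (proj1 Fs p H) as (k & Hk' & ->); exists k; rewrite in_suc, Hk; auto.
      + assert (p = opair b x) by tauto; subst p; exists b; rewrite in_suc, Hb; auto.
    - intros k Hk'; apply in_suc in Hk'; apply Ht; destruct Hk' as [H| ->]; [rewrite Hk|rewrite Hb]; auto. }
  assert (Er : forall k, subset k b -> restr t k = restr s k).
  { intros k Hkb; apply func_ext with k.
    - apply func_restr with (suc b); auto; intros y Hy; apply in_suc; auto.
    - apply func_restr with b; auto.
    - intros y Hy; rewrite !app_restr by auto; auto. }
  split.
  - apply is_fun_iff; split; auto; intros k Hk'; apply in_suc in Hk'; destruct Hk' as [H| ->]; [|now rewrite Hb].
    rewrite Hk by auto; destruct Hp as [Hp _]; now apply (fun_in Hp).
  - intros k Hk'; apply in_suc in Hk'; destruct Hk' as [H| ->].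
    + rewrite Hk, Er by (auto; apply ord_sub; auto; now apply ord_in with b); now apply Hp.
    + rewrite Hb, Er by (intros y; auto); now rewrite restr_id.
Qed.

(** The tree consists of the sequences shorter than lam under proper extension. If lam is singular,
    a chain of fewer than lam nodes may have a union of length lam; assuming that no such sequence
    exists excludes this and makes the tree closed, whereupon the branch gives a contradiction. *)
Lemma DC_seq : exists f, partial f lam.
Proof.
  apply NNPP; intros Hno.
  pose proof partial_def as Hpd.
  assert (HT : isset (fun s => exists b, b in_ lam /\ partial s b)).
  { apply isset_sub with (pow (prod lam S)); [|dp].
    intros s (b & Hb & Hp); apply in_pow; intros p Hpp.
    pose proof (partial_func Hp) as Fs; destruct (proj1 Fs p Hpp) as (x & Hx & ->).
    destruct Hp as [Hp _]; apply opair_in_prod; split; [now apply ord_trans with b|now apply (fun_in Hp)]. }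
  set (T := setof (fun s => exists b, b in_ lam /\ partial s b)).
  assert (InT : forall s, s in_ T <-> exists b, b in_ lam /\ partial s b) by (intros; exact (in_setof _ HT)).
  assert (HRl : isset (fun p => exists s t, s in_ T /\ t in_ T /\ subset s t /\ s <> t /\ p = opair s t)).
  { apply isset_sub with (prod T T); [|dp]. intros p (s & t & Hs & Ht & _ & _ & ->); now apply opair_in_prod. }
  set (Rl := setof (fun p => exists s t, s in_ T /\ t in_ T /\ subset s t /\ s <> t /\ p = opair s t)).
  assert (Hm : forall s t, maps Rl s t <-> s in_ T /\ t in_ T /\ subset s t /\ s <> t).
  { intros s t; rewrite maps_iff; unfold Rl; rewrite (in_setof _ HRl); split.
    - intros (s' & t' & H1 & H2 & H3 & H4 & E); apply opair_inj in E; destruct E; subst; auto.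
    - intros (H1 & H2 & H3 & H4); exists s, t; auto. }
  assert (Hdlt : forall s t b c, b in_ lam -> c in_ lam -> partial s b -> partial t c -> subset s t -> s <> t -> b in_ c).
  { intros s t b c Hb Hc Ps Pt Hst Hne.
    destruct (func_sub (partial_func Ps) (partial_func Pt) Hst) as (H1 & _ & H2).
    apply ord_sub in H1; [|apply (ord_in Olam Hb)|apply (ord_in Olam Hc)].
    destruct H1 as [H1| ->]; auto; exfalso; apply Hne; rewrite H2; apply restr_id, partial_func, Pt. }
  destruct (hDC (T := T) (R := Rl)) as (br & [Fb Ib] & _).
  - split; [|split; [|split]].
    + intros s t H; apply Hm in H; tauto.
    + intros s H; apply Hm in H; tauto.
    + intros s t u H1 H2; apply Hm in H1, H2; apply Hm.
      destruct H1 as (A1 & A2 & A3 & A4), H2 as (B1 & B2 & B3 & B4); split; [auto|split; [auto|split]].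
      * intros x Hx; auto.
      * intros E; subst u; apply A4, ext; intros x; split; auto.
    + intros t u Ht [s0 Hs0] Hu; apply InT in Ht; destruct Ht as (c & Hc & Pt).
      destruct (ord_least (P := fun b => exists s, s in_ u /\ partial s b)) as (b & Ob & (m & Hmu & Pm) & Hmin).
      { dp. }
      { assert (H := Hu s0 Hs0); apply Hm in H; destruct H as (H & _); apply InT in H.
        destruct H as (b & Hb & Pb); exists b; split; eauto; now apply ord_in with lam. }
      exists m; split; auto; intros s Hs; destruct (classic (s = m)) as [|Hne]; auto; right.
      assert (Hs' := Hu s Hs); assert (Hm' := Hu m Hmu); apply Hm in Hs', Hm'; apply Hm.
      destruct Hs' as (Ts & _ & Ss & _), Hm' as (Tm & _ & Sm & _).
      split; [auto|split; [auto|split; auto]].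
      apply InT in Ts; destruct Ts as (d & Hd & Ps).
      assert (Hbd : subset b d).
      { destruct (ord_le_or_lt Ob (ord_in Olam Hd)) as [H|H]; auto; exfalso; apply (Hmin d H); eauto. }
      destruct (func_sub (partial_func Pm) (partial_func Pt) Sm) as (E1 & E2 & _).
      destruct (func_sub (partial_func Ps) (partial_func Pt) Ss) as (E3 & E4 & _).
      intros p Hp; pose proof (partial_func Pm) as Fm; pose proof (partial_func Ps) as Fs.
      destruct (proj1 Fm p Hp) as (x & Hx & ->); apply (func_app _ _ Fs); split; auto.
      rewrite E2, E4; auto.
  - intros d q Hd [Fq Iq].
    assert (Hi : isset (fun s => exists a, a in_ d /\ s = app q a)) by (apply isset_image; dp).
    destruct (@chain_union (setof (fun s => exists a, a in_ d /\ s = app q a))) as (c & Oc & Hc & Pc & _).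
    + intros s Hs; apply setof_E in Hs; auto; destruct Hs as (a & Ha & ->); apply InT; now apply (fun_in Fq).
    + intros s t Hs Ht; apply setof_E in Hs, Ht; auto.
      destruct Hs as (a & Ha & ->), Ht as (b & Hb & ->); assert (Od := ord_in Olam Hd).
      assert (Hlt : forall a b, a in_ d -> b in_ d -> a in_ b -> subset (app q a) (app q b)).
      { intros a' b' Ha' Hb' H; assert (H' : maps Rl (app q a') (app q b')).
        { apply (Iq a' b'); auto; apply (fun_maps _ _ Fq); auto. }
        apply Hm in H'; tauto. }
      destruct (ord_tri (ord_in Od Ha) (ord_in Od Hb)) as [H|[->|H]]; auto; left; intros x; auto.
    + assert (Hcl : c in_ lam).
      { apply ord_sub in Hc; auto; destruct Hc as [|E]; auto; subst c; exfalso; apply Hno; eauto. }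
      eexists; split; [apply InT; exists c; split; eauto|].
      intros a x Hax; apply (fun_maps _ _ Fq) in Hax; destruct Hax as [Ha ->].
      destruct (classic (app q a = bigU (setof (fun s => exists a, a in_ d /\ s = app q a)))) as [E|E]; auto; right.
      apply Hm; split; [now apply (fun_in Fq)|split; [apply InT; eauto|split; auto]].
      intros p Hp; apply in_bigU; exists (app q a); split; auto; apply setof_I; eauto.
  - intros s Hs; apply InT in Hs; destruct Hs as (b & Hb & Ps); assert (Ob := ord_in Olam Hb).
    destruct (step Hb Ps) as (x & Hx & HR).
    pose proof (partial_extend Ob Ps Hx HR) as Pt.
    exists (cup s (upair (opair b x) (opair b x))); apply Hm; split; [apply InT; eauto|split; [|split]].
    + apply InT; exists (suc b); split; auto; now apply Llam.
    + intros p Hp; apply in_cup; auto.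
    + intros E; rewrite <- E in Pt; pose proof (dom_unique (partial_func Ps) (partial_func Pt)) as E'.
      apply (mem_irrefl (x := b)); rewrite E' at 2; apply in_suc; auto.
  - assert (Hi : isset (fun s => exists a, a in_ lam /\ s = app br a)) by (apply isset_image; dp).
    assert (HbT : forall a, a in_ lam -> app br a in_ T) by (intros; now apply (fun_in Fb)).
    assert (Hlt : forall a b, a in_ lam -> b in_ lam -> a in_ b -> maps Rl (app br a) (app br b)).
    { intros a b Ha Hb H; apply (Ib a b); auto; apply (fun_maps _ _ Fb); auto. }
    destruct (@chain_union (setof (fun s => exists a, a in_ lam /\ s = app br a))) as (c & Oc & Hc & Pc & Hdom).
    + intros s Hs; apply setof_E in Hs; auto; destruct Hs as (a & Ha & ->); apply InT; auto.
    + intros s t Hs Ht; apply setof_E in Hs, Ht; auto.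
      destruct Hs as (a & Ha & ->), Ht as (b & Hb & ->).
      destruct (ord_tri (ord_in Olam Ha) (ord_in Olam Hb)) as [H|[->|H]].
      * left; apply Hlt in H; auto; apply Hm in H; tauto.
      * left; intros x; auto.
      * right; apply Hlt in H; auto; apply Hm in H; tauto.
    + enough (E : c = lam) by (subst c; eauto).
      apply ext; intros a; split; [auto|]; intros Ha.
      (* Proper extension raises the length at each step, so the a-th node has length at least a and
         the union has length lam. *)
      assert (Hgrow : forall a, ordinal a -> a in_ lam -> forall b, partial (app br a) b -> subset a b).
      { apply (ord_ind (P := fun a => a in_ lam -> forall b, partial (app br a) b -> subset a b)); [dp|].
        intros a' Oa' IH Ha' b Pb e He.
        assert (Hel : e in_ lam) by now apply ord_trans with a'.
        assert (Hbl : b in_ lam).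
        { apply HbT, InT in Ha'; destruct Ha' as (b' & Hb' & Pb').
          now rewrite (dom_unique (partial_func Pb) (partial_func Pb')). }
        destruct (proj1 (InT _) (HbT e Hel)) as (b' & Hb' & Pb').
        assert (H := Hlt e a' Hel Ha' He); apply Hm in H; destruct H as (_ & _ & H1 & H2).
        apply sub_lt_trans with b'; [apply (ord_in Oa' He)|apply (ord_in Olam Hbl)|apply (IH e He Hel _ Pb')
          |apply (ord_in Olam Hb')|now apply (Hdlt _ _ _ _ Hb' Hbl Pb' Pb)]. }
      assert (Hsa : suc a in_ lam) by now apply Llam.
      destruct (proj1 (InT _) (HbT _ Hsa)) as (b & Hb & Pb).
      apply (Hdom (app br (suc a)) b); auto; [apply setof_I; eauto|].
      apply (Hgrow (suc a)); auto; [apply (ord_in Olam Hsa)|apply in_suc; auto].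
Qed.

End DependentChoice.

Section ChoiceConsequences.
Context {V : set_structure} {hZF : ZF V}.
Implicit Types a b c d x y z f g s t S T : V.
Variable lam : V.
Hypotheses (Llam : lim lam) (hDC : DC lam).

(** The index to be served is the length of the past, recovered as the domain of [s];
    [bounded_witnesses] first places all candidates in one set. *)
Lemma AC_lam (Q : V -> V -> Prop) : dP (fun v => Q (v 0) (v 1)) ->
  (forall a, a in_ lam -> exists x, Q a x) -> exists f, func f lam /\ forall a, a in_ lam -> Q a (app f a).
Proof.
  intros HQ Hex.
  destruct (@bounded_witnesses V hZF (fun a x => a in_ lam -> Q a x)) with (s := lam) as (c & Oc & Hc).
  - dp.
  - intros a; destruct (classic (a in_ lam)) as [Ha|Ha]; [destruct (Hex a Ha) as [x Hx]; eauto|exists emp; tauto].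
  - destruct (@DC_seq V hZF lam (Vf c) (fun s x => forall b, func s b -> Q b x)) as (f & Ff & Hf); auto.
    + dp.
    + intros s b Hb Ps; destruct (Hc b Hb) as (x & Hx & HQx); exists x; split; auto.
      intros b' Fb'; rewrite (dom_unique Fb' (partial_func Ps)); auto.
    + apply is_fun_iff in Ff; destruct Ff as [Fu _]; exists f; split; auto.
      intros a Ha; apply (Hf a Ha); apply func_restr with lam; auto.
      intros x Hx; apply ord_trans with a; auto; apply Llam.
Qed.

(** New elements of [S] are listed by dependent choice; getting stuck before lam means that [S] is
    exhausted. *)
Lemma trichotomy S : inj lam S \/ exists b f, b in_ lam /\ is_bijection f b S.
Proof.
  apply NNPP; intros Hn; apply not_or_and in Hn; destruct Hn as [H1 H2].
  assert (Hfr : forall f c x, func f c -> (forall q, ~ opair q x in_ f) -> forall y, y in_ c -> app f y <> x).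
  { intros f c x Ff Hx y Hy E; apply (Hx y); subst x; now apply Ff. }
  assert (Hinj : forall f b, ordinal b -> partial S (fun s x => forall q, ~ opair q x in_ s) f b -> injective_on f b).
  { intros f b Ob [Ff Hf] x y Hx Hy E; apply is_fun_iff in Ff; destruct Ff as [Fu _].
    assert (Hlt : forall x y, x in_ b -> y in_ b -> x in_ y -> app f x <> app f y).
    { intros x' y' Hx' Hy' H; pose proof (Hf y' Hy') as H'.
      assert (Fr : func (restr f y') y').
      { apply func_restr with b; auto; intros z Hz; now apply ord_trans with y'. }
      pose proof (Hfr _ _ _ Fr H' x' H) as Hne; now rewrite app_restr in Hne. }
    destruct (ord_tri (ord_in Ob Hx) (ord_in Ob Hy)) as [H|[H|H]]; auto; exfalso.
    - exact (Hlt x y Hx Hy H E).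
    - exact (Hlt y x Hy Hx H (eq_sym E)). }
  apply H1.
  destruct (@DC_seq V hZF lam S (fun s x => forall q, ~ opair q x in_ s)) as (f & Pf); auto.
  - dp.
  - intros s b Hb Ps; apply NNPP; intros Hn; apply H2; exists b, s; split; auto.
    assert (Ob := ord_in (proj1 Llam) Hb).
    apply is_bijection_iff; split; [apply Ps|split; [now apply Hinj|]].
    intros y Hy; apply NNPP; intros Hy'; apply Hn; exists y; split; auto.
    intros q Hq; apply (func_app _ _ (partial_func Ps)) in Hq; apply Hy'; exists q; split; [tauto|].
    symmetry; tauto.
  - exists f; split; [apply Pf|apply Hinj; auto; apply Llam].
Qed.

End ChoiceConsequences.

(** * Embeddings of a level into itself *)

Section SelfEmbedding.
Context {V : set_structure} {hZF : ZF V}.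
Implicit Types a b c d x y z f g s t : V.
Variables (lam j : V) (P Q : option V).
Hypotheses (Olam : ordinal lam) (Hj : elementary_embedding j (Vf lam) P (Vf lam) Q).

Lemma e_transfer (G : V -> Prop) (Pd : (nat -> V) -> Prop) v : abslG G Pd -> G lam -> envin lam v ->
  (Pd v <-> Pd (fun k => app j (v k))).
Proof.
  intros [p Hp] HG Hv; rewrite <- (Hp lam HG v Hv), <- (Hp lam HG (fun k => app j (v k))).
  - apply (emb_sat Hj); auto.
  - intros k; apply (fun_in (emb_fun Hj)), Hv.
Qed.

Lemma e_push (G : V -> Prop) (Pd : (nat -> V) -> Prop) v : abslG G Pd -> G lam -> envin lam v ->
  Pd v -> Pd (fun k => app j (v k)).
Proof. intros H1 H2 H3; exact (proj1 (e_transfer H1 H2 H3)). Qed.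

Lemma env2_in x y : x in_ Vf lam -> y in_ Vf lam -> envin lam (env2 x y).
Proof. intros Hx Hy [|k]; auto. Qed.
Lemma env3_in x y z : x in_ Vf lam -> y in_ Vf lam -> z in_ Vf lam -> envin lam (env3 x y z).
Proof. intros Hx Hy Hz [|[|k]]; auto. Qed.

Lemma e_in x : x in_ Vf lam -> app j x in_ Vf lam.
Proof. apply (fun_in (emb_fun Hj)). Qed.
Lemma lam_U a : a in_ lam -> a in_ Vf lam.
Proof. apply ord_sub_Vf; auto. Qed.

Lemma e_mem x y : x in_ Vf lam -> y in_ Vf lam -> (x in_ y <-> app j x in_ app j y).
Proof.
  intros Hx Hy; exact (@e_transfer (@ordinal V) (fun v => v 0 in_ v 1) (env2 x y) (absl_mem 0 1) Olam (env2_in Hx Hy)).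
Qed.
Lemma e_ord a : a in_ lam -> ordinal (app j a) /\ app j a in_ lam.
Proof.
  intros Ha; assert (HU := lam_U Ha).
  assert (O : ordinal (app j a)).
  { exact (@e_push (@ordinal V) (fun v => ordinal (v 0)) (fun _ => a) (absl_ordinal 0) Olam (fun _ => HU) (ord_in Olam Ha)). }
  split; auto; rewrite <- ord_in_Vf; auto; now apply e_in.
Qed.
Lemma e_opair x y : x in_ Vf lam -> y in_ Vf lam -> opair x y in_ Vf lam ->
  app j (opair x y) = opair (app j x) (app j y).
Proof.
  intros Hx Hy Hp; apply is_opair_iff.
  refine (@e_push (@ordinal V) (fun v => is_opair (v 0) (v 1) (v 2)) (env3 (opair x y) x y)
    (absl_opair 0 1 2) Olam (env3_in Hp Hx Hy) _).
  now apply is_opair_iff.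
Qed.
Lemma e_suc a : suc a in_ Vf lam -> app j (suc a) = suc (app j a).
Proof.
  intros H; apply is_succ_iff.
  assert (Ha : a in_ Vf lam) by (apply (Vf_trans Olam H); apply in_suc; auto).
  refine (@e_push (@ordinal V) (fun v => is_succ (v 0) (v 1)) (env2 (suc a) a) (absl_succ 0 1) Olam (env2_in H Ha) _).
  now apply is_succ_iff.
Qed.
Lemma e_level a : a in_ lam -> app j (Vf a) = Vf (app j a).
Proof.
  intros Ha; destruct (e_ord Ha) as [Oj Hja]; assert (Oa := ord_in Olam Ha).
  assert (HVa : Vf a in_ Vf lam) by now apply Vf_in.
  assert (H : level (app j (Vf a)) /\ (subset (app j a) (app j (Vf a)) /\ ~ app j a in_ app j (Vf a))).
  { refine (@e_push (@ordinal V) (fun v => level (v 1) /\ (subset (v 0) (v 1) /\ ~ v 0 in_ v 1)) (env2 a (Vf a))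
      _ Olam (env2_in (lam_U Ha) HVa) _).
    - apply absl_and; [apply absl_level|apply absl_and; [apply absl_subset|apply absl_not, absl_mem]].
    - split; [apply level_iff; eauto|split; [now apply ord_sub_Vf|]].
      simpl; rewrite ord_in_Vf by auto; apply mem_irrefl. }
  destruct H as (Hl & H1 & H2); apply level_iff in Hl; destruct Hl as (b & Ob & Eb); rewrite Eb in *.
  rewrite ord_in_Vf in H2 by auto; f_equal.
  assert (Hs : subset (app j a) b).
  { intros z Hz; rewrite <- ord_in_Vf; auto; now apply ord_in with (app j a). }
  apply ord_sub in Hs; auto; destruct Hs; [tauto|auto].
Qed.

(** Induction on rank: the level whose index is the rank of [x] is fixed, so j(x) is a subset of it,
    and its elements are fixed by induction. *)
Lemma e_fix d : ordinal d -> subset d lam -> (forall a, a in_ d -> app j a = a) ->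
  forall x, x in_ Vf d -> app j x = x.
Proof.
  intros Od Hd Hf.
  assert (HdU : subset (Vf d) (Vf lam)).
  { apply ord_sub in Hd; auto; destruct Hd as [H| ->]; [now apply Vf_mono_sub|intros x; auto]. }
  apply (rk_lt_ind (Q := fun x => x in_ Vf d -> app j x = x)); [dp|].
  intros x IH Hx.
  assert (Hr : rho x in_ d) by now apply in_Vf_rho.
  assert (HVr : app j (Vf (rho x)) = Vf (rho x)) by (rewrite e_level, Hf; auto).
  assert (Hfix : forall y, y in_ Vf (rho x) -> app j y = y).
  { intros y Hy; apply in_Vf_rho in Hy; [|apply ord_rho]; apply IH; auto.
    apply in_Vf_rho; auto; now apply ord_trans with (rho x). }
  assert (Hsub : subset x (Vf (rho x))) by apply rho_spec.
  assert (Hjs : subset (app j x) (Vf (rho x))).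
  { assert (HVU : Vf (rho x) in_ Vf lam) by (apply Vf_in; auto).
    rewrite <- HVr; exact (@e_push (@ordinal V) (fun v => subset (v 0) (v 1)) (env2 x (Vf (rho x)))
      (absl_subset 0 1) Olam (env2_in (HdU _ Hx) HVU) Hsub). }
  apply ext; intros y; split; intros Hy.
  - assert (Hyr := Hjs y Hy); rewrite <- (Hfix y Hyr) in Hy; apply e_mem in Hy; auto.
    apply HdU, (Vf_mono_sub Od Hr), Hyr.
  - assert (Hyr := Hsub y Hy); rewrite <- (Hfix y Hyr); apply (proj1 (e_mem (HdU _ (Vf_mono_sub Od Hr Hyr)) (HdU _ Hx))), Hy.
Qed.

Lemma e_nat n : n in_ omega -> n in_ lam -> app j n = n.
Proof.
  apply (omega_ind (P := fun n => n in_ lam -> app j n = n)); [dp| |].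
  - intros H; apply is_empty_iff.
    refine (@e_push (@ordinal V) (fun v => is_empty (v 0)) (fun _ => emp) (absl_empty 0) Olam (fun _ => lam_U H) _).
    now apply is_empty_iff.
  - intros m Hm IH H; rewrite e_suc by (now apply lam_U); f_equal; apply IH.
    apply ord_trans with (suc m); auto; apply in_suc; auto.
Qed.

Definition crit d := d in_ lam /\ app j d <> d /\ forall a, a in_ d -> app j a = a.

Lemma crit_exists : (exists x, x in_ Vf lam /\ app j x <> x) -> exists d, crit d.
Proof.
  intros (x & Hx & Hn).
  destruct (@ord_least V hZF (fun d => d in_ lam /\ app j d <> d)) as (d & Od & (H1 & H2) & H3); [dp| |].
  - apply NNPP; intros Hno; apply Hn; apply (@e_fix lam); auto; [intros z; auto|].
    intros a Ha; apply NNPP; intros Hna; apply Hno; exists a; split; auto; now apply ord_in with lam.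
  - exists d; split; [auto|split; auto]; intros a Ha; apply NNPP; intros Hna; apply (H3 a Ha); split; auto.
    now apply ord_trans with d.
Qed.

Lemma e_increasing a : ordinal a -> a in_ lam -> subset a (app j a).
Proof.
  apply (ord_ind (P := fun a => a in_ lam -> subset a (app j a))); [dp|].
  intros b Ob IH Hb c Hc; assert (Hcl : c in_ lam) by now apply ord_trans with b.
  destruct (e_ord Hcl) as [Oc _], (e_ord Hb) as [Oj _].
  apply sub_lt_trans with (app j c); auto; [now apply ord_in with b|].
  apply (proj1 (e_mem (lam_U Hcl) (lam_U Hb))), Hc.
Qed.

Lemma crit_lt d : crit d -> d in_ app j d.
Proof.
  intros (H1 & H2 & H3); destruct (e_ord H1) as [Oj _]; assert (Od := ord_in Olam H1).
  assert (H := e_increasing Od H1); apply ord_sub in H; auto; destruct H as [H|H]; auto; congruence.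
Qed.

Lemma crit_range d x : crit d -> x in_ lam -> app j x <> d.
Proof.
  intros Hc Hx E; pose proof Hc as (H1 & H2 & H3); assert (Od := ord_in Olam H1).
  destruct (ord_tri (ord_in Olam Hx) Od) as [H|[H|H]].
  - rewrite (H3 x H) in E; subst; exact (mem_irrefl H).
  - subst x; contradiction.
  - apply (proj1 (e_mem (lam_U H1) (lam_U Hx))) in H; rewrite E in H.
    exact (mem_asym H (crit_lt Hc)).
Qed.

Lemma crit_omega d : crit d -> omega in_ lam.
Proof.
  intros (H1 & H2 & H3); destruct (ord_le_or_lt Olam ord_omega) as [H|H]; auto.
  exfalso; apply H2, e_nat; auto.
Qed.

Hypothesis Glam : good lam.

Lemma e_omega : app j omega = omega.
Proof.
  apply is_omega_iff; refine (@e_push good (fun v => is_omega (v 0)) (fun _ => omega) (absl_omega 0) Glam (fun _ => good_omega Glam) _).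
  now apply is_omega_iff.
Qed.

Lemma crit_gt_omega d : crit d -> omega in_ d.
Proof.
  intros (H1 & H2 & H3); assert (Od := ord_in Olam H1); destruct (ord_tri Od ord_omega) as [H|[ ->|H]]; auto; exfalso; apply H2.
  - now apply e_nat.
  - apply e_omega.
Qed.

Lemma crit_lim d : crit d -> lim d.
Proof.
  intros Hc; pose proof Hc as (H1 & H2 & H3); assert (Od := ord_in Olam H1); split; [auto|split].
  - apply ord_trans with omega; auto using emp_omega; now apply crit_gt_omega.
  - intros a Ha; assert (H := suc_sub Od Ha).
    apply ord_sub in H; auto; [|now apply ord_suc, ord_in with d]; destruct H as [H|H]; auto.
    exfalso; apply H2; rewrite <- H, e_suc; [now rewrite H3|]; rewrite H; now apply lam_U.
Qed.

Lemma e_maps f x y : f in_ Vf lam -> x in_ Vf lam -> y in_ Vf lam ->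
  (maps f x y <-> maps (app j f) (app j x) (app j y)).
Proof.
  intros Hf Hx Hy; exact (@e_transfer (@ordinal V) (fun v => maps (v 0) (v 1) (v 2)) (env3 f x y)
    (absl_maps 0 1 2) Olam (env3_in Hf Hx Hy)).
Qed.
Lemma e_is_fun f a b : f in_ Vf lam -> a in_ Vf lam -> b in_ Vf lam ->
  (is_fun f a b <-> is_fun (app j f) (app j a) (app j b)).
Proof.
  intros Hf Hx Hy; exact (@e_transfer good (fun v => is_fun (v 0) (v 1) (v 2)) (env3 f a b)
    (absl_is_fun 0 1 2) Glam (env3_in Hf Hx Hy)).
Qed.

(* A surjection g : V_c -> d would be mapped to a surjection onto j(d) with the same values. *)
Lemma crit_noinj d c : crit d -> c in_ d -> ~ inj d (Vf c).
Proof.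
  intros Hc Hcd (f & Ff & If); pose proof Hc as (H1 & H2 & H3).
  assert (Od := ord_in Olam H1); assert (Oc := ord_in Od Hcd).
  assert (Hcl : c in_ lam) by now apply ord_trans with d.
  (* The inverse of [f], with default 0 off its range; it maps V_c onto [d]. *)
  set (h := fun x => setof (fun z => exists i, i in_ d /\ app f i = x /\ z in_ i)).
  assert (Hi : forall x, isset (fun z => exists i, i in_ d /\ app f i = x /\ z in_ i)).
  { intros x; apply isset_sub with d; [|dp]; intros z (i & Hi & _ & Hz); now apply ord_trans with i. }
  assert (Hd : dP (fun v => v 0 = h (v 1))).
  { apply (setof1_def (P := fun z x => exists i, i in_ d /\ app f i = x /\ z in_ i)); auto; dp. }
  assert (Hh : forall i, i in_ d -> h (app f i) = i).
  { intros i Hid; apply setof_eq; intros z; split; [eauto|].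
    intros (i' & Hi' & E & Hz); apply If in E; auto; now subst. }
  assert (Hh0 : forall x, h x in_ d).
  { intros x; destruct (classic (exists i, i in_ d /\ app f i = x)) as [(i & Hid & <-)|Hn]; [now rewrite Hh|].
    replace (h x) with (emp (V := V)); [apply (crit_lim Hc)|].
    symmetry; apply setof_eq; intros z; rewrite in_emp; split; [tauto|]; intros (i & Hid & E & _); eauto. }
  clearbody h.
  assert (HVc : Vf c in_ Vf lam) by now apply Vf_in.
  assert (Fg : is_fun (mkfun (Vf c) h) (Vf c) d) by now apply is_fun_mkfun.
  assert (HgU : mkfun (Vf c) h in_ Vf lam) by (apply fun_bound with (Vf c) d; auto; now apply lam_U).
  assert (Hfix : forall x, x in_ Vf c -> app j x = x).
  { intros x Hx; apply (@e_fix d); auto; [|now apply (Vf_mono_sub Od Hcd)].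
    intros z Hz; now apply ord_trans with d. }
  assert (Fjg : is_fun (app j (mkfun (Vf c) h)) (Vf c) (app j d)).
  { apply (proj1 (e_is_fun HgU HVc (lam_U H1))) in Fg; rewrite (e_level Hcl), (H3 c Hcd) in Fg; exact Fg. }
  assert (Hs : forall y, y in_ app j d -> exists x, x in_ app j (Vf c) /\ maps (app j (mkfun (Vf c) h)) x y).
  { refine (@e_push (@ordinal V) (fun v => forall y, y in_ v 0 -> exists x, x in_ v 1 /\ maps (v 2) x y)
      (env3 d (Vf c) (mkfun (Vf c) h)) _ Olam (env3_in (lam_U H1) HVc HgU) _).
    - apply absl_ball, absl_bex, absl_maps.
    - simpl; intros y Hy; exists (app f y); split; [now apply (fun_in Ff)|].
      apply (fun_maps _ _ Fg); split; [now apply (fun_in Ff)|]; rewrite app_mkfun, Hh; auto; now apply (fun_in Ff). }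
  destruct (Hs d (crit_lt Hc)) as (x & Hx & Hm); rewrite (e_level Hcl), (H3 c Hcd) in Hx.
  apply (fun_maps _ _ Fjg) in Hm; destruct Hm as [_ Hm].
  assert (HxU : x in_ Vf lam) by exact (Vf_trans Olam HVc Hx).
  assert (Hgx : maps (mkfun (Vf c) h) x (h x)) by (apply (fun_maps _ _ Fg); rewrite app_mkfun; auto).
  assert (HhU : h x in_ Vf lam) by (apply lam_U, ord_trans with d; auto).
  apply (proj1 (e_maps HgU HxU HhU)) in Hgx; rewrite (Hfix x Hx), (H3 (h x) (Hh0 x)) in Hgx.
  apply (fun_maps _ _ Fjg) in Hgx; destruct Hgx as [_ E]; rewrite <- Hm in E.
  apply (mem_irrefl (x := d)); rewrite <- E at 1; apply Hh0.
Qed.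

(** [crit_noinj] is used twice: lam does not inject into V_c, so V_c has an enumeration shorter than
    lam, and its length cannot reach [d]. *)
Lemma crit_wo d c : DC lam -> crit d -> c in_ d -> exists b f, b in_ d /\ is_bijection f b (Vf c).
Proof.
  intros hDC Hc Hcd; pose proof Hc as (H1 & _); assert (Od := ord_in Olam H1).
  assert (Hn := crit_noinj Hc Hcd).
  destruct (trichotomy (proj1 Glam) hDC (Vf c)) as [H|(b & f & Hb & Hf)].
  - exfalso; apply Hn; apply inj_trans with lam; auto; apply inj_sub, ord_sub; auto.
  - exists b, f; split; auto; assert (Ob := ord_in Olam Hb).
    destruct (ord_le_or_lt Od Ob) as [H|H]; auto; exfalso; apply Hn.
    apply inj_trans with b; [now apply inj_sub|apply (bij_inj Hf)].
Qed.

End SelfEmbedding.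

(** * Products and regularity *)

Section Godel.
Context {V : set_structure} {hZF : ZF V}.
Implicit Types a b c d m x y z f g s t p q : V.

Lemma inj_cover A B (h : V -> V) : dP (fun v => v 0 = h (v 1)) ->
  (forall x y, x in_ A -> y in_ A -> h x = h y -> x = y) ->
  (forall z, z in_ B -> exists x, x in_ A /\ h x = z) -> inj B A.
Proof.
  intros Hd Hi Hs.
  assert (Hset : isset (fun y => exists x, x in_ A /\ y = h x)) by now apply isset_image.
  set (I := setof (fun y => exists x, x in_ A /\ y = h x)).
  assert (Hb : is_bijection (mkfun A h) A I).
  { apply is_bijection_iff; split; [apply is_fun_mkfun; auto; intros x Hx; apply setof_I; eauto|split].
    - intros x y Hx Hy; rewrite !app_mkfun by auto; auto.
    - intros y Hy; apply setof_E in Hy; auto; destruct Hy as (x & Hx & ->); exists x; split; auto.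
      now rewrite app_mkfun. }
  apply inj_trans with I; [|apply (bij_inj Hb)].
  apply inj_sub; intros z Hz; destruct (Hs z Hz) as (x & Hx & <-); apply setof_I; eauto.
Qed.

Lemma cup_max a b : ordinal a -> ordinal b -> (cup a b = a /\ subset b a) \/ (cup a b = b /\ subset a b).
Proof.
  intros Oa Ob; assert (H : subset a b \/ subset b a).
  { destruct (ord_le_or_lt Oa Ob) as [H|H]; auto; right; apply ord_sub; auto. }
  destruct H as [H|H]; [right|left]; (split; [|auto]); apply ext; intros z; rewrite in_cup; split; auto; intros [|]; auto.
Qed.
Lemma ord_cup a b : ordinal a -> ordinal b -> ordinal (cup a b).
Proof. intros Oa Ob; destruct (cup_max Oa Ob) as [[-> _]|[-> _]]; auto. Qed.

(** Goedel's ordering of pairs, by maximum and then lexicographically; [cup] is the maximum of two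
    ordinals. Predecessors of a pair with maximum m lie in the square of m + 1. *)
Definition glt p q := exists a b c d, p = opair a b /\ q = opair c d /\
  (ordinal a /\ ordinal b /\ ordinal c /\ ordinal d) /\
  (cup a b in_ cup c d \/ (cup a b = cup c d /\ (a in_ c \/ (a = c /\ b in_ d)))).

Lemma glt_iff a b c d : ordinal a -> ordinal b -> ordinal c -> ordinal d ->
  (glt (opair a b) (opair c d) <->
   cup a b in_ cup c d \/ (cup a b = cup c d /\ (a in_ c \/ (a = c /\ b in_ d)))).
Proof.
  intros Oa Ob Oc Od; split.
  - intros (a' & b' & c' & d' & E1 & E2 & _ & H); apply opair_inj in E1, E2; destruct E1, E2; subst; auto.
  - intros H; exists a, b, c, d; exact (conj eq_refl (conj eq_refl (conj (conj Oa (conj Ob (conj Oc Od))) H))).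
Qed.
Lemma glt_def : dP (fun v => glt (v 0) (v 1)).
Proof. unfold glt; dp. Qed.
Lemma glt_trans p q r : glt p q -> glt q r -> glt p r.
Proof.
  intros (a & b & c & d & -> & -> & (Oa & Ob & Oc & Od) & H) (c' & d' & e & f & E & -> & (_ & _ & Oe & Of) & H').
  apply opair_inj in E; destruct E; subst c' d'; apply glt_iff; auto.
  assert (O1 := ord_cup Oc Od); assert (O2 := ord_cup Oe Of).
  destruct H as [H|[H K]], H' as [H'|[H' K']].
  - left; now apply ord_trans with (cup c d).
  - left; now rewrite <- H'.
  - left; now rewrite H.
  - right; split; [congruence|].
    destruct K as [K|[-> K]], K' as [K'|[-> K']]; auto.
    + left; now apply ord_trans with c.
    + right; split; auto; now apply ord_trans with d.
Qed.
Lemma glt_bound p c d : ordinal c -> ordinal d -> glt p (opair c d) -> p in_ prod (suc (cup c d)) (suc (cup c d)).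
Proof.
  intros Oc Od (a & b & c' & d' & -> & E & (Oa & Ob & _ & _) & H).
  apply opair_inj in E; destruct E; subst c' d'.
  assert (O1 := ord_cup Oa Ob); assert (O2 := ord_cup Oc Od).
  assert (Hs : subset (cup a b) (cup c d)) by (apply ord_sub; auto; tauto).
  apply opair_in_prod; split; apply in_suc, ord_sub; auto; intros z Hz; apply Hs, in_cup; auto.
Qed.
Lemma glt_set p : isset (fun q => glt q p).
Proof.
  pose proof glt_def as Hd.
  destruct (classic (exists c d, ordinal c /\ ordinal d /\ p = opair c d)) as [(c & d & Oc & Od & ->)|H].
  - apply isset_sub with (prod (suc (cup c d)) (suc (cup c d))); [intros; now apply glt_bound|dp].
  - apply isset_sub with emp; [|dp]; intros q (a & b & c & d & _ & E & (_ & _ & Oc & Od) & _); exfalso; eauto 7.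
Qed.
Lemma glt_ind (P : V -> Prop) : dP (fun v => P (v 0)) ->
  (forall p, (forall q, glt q p -> P q) -> P p) -> forall p, P p.
Proof.
  intros HP IH.
  enough (H : forall m, ordinal m -> forall a, ordinal a -> forall b, ordinal b -> cup a b = m -> P (opair a b)).
  { intros p; apply IH; intros q (a & b & c & d & -> & _ & (Oa & Ob & _) & _); apply (H (cup a b)); auto using ord_cup. }
  apply (ord_ind (P := fun m => forall a, ordinal a -> forall b, ordinal b -> cup a b = m -> P (opair a b))); [dp|].
  intros m Om IHm.
  apply (ord_ind (P := fun a => forall b, ordinal b -> cup a b = m -> P (opair a b))); [dp|].
  intros a Oa IHa.
  apply (ord_ind (P := fun b => cup a b = m -> P (opair a b))); [dp|].
  intros b Ob IHb E; apply IH; intros q (a' & b' & c & d & -> & E' & (Oa' & Ob' & _ & _) & H).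
  apply opair_inj in E'; destruct E'; subst c d; rewrite E in H.
  destruct H as [H|[H [K|[-> K]]]]; [apply (IHm _ H); auto|apply (IHa _ K); auto|apply IHb; auto].
Qed.
Lemma glt_total a b c d : ordinal a -> ordinal b -> ordinal c -> ordinal d ->
  glt (opair a b) (opair c d) \/ opair a b = opair c d \/ glt (opair c d) (opair a b).
Proof.
  intros Oa Ob Oc Od; rewrite !glt_iff, opair_inj by auto.
  destruct (ord_tri (ord_cup Oa Ob) (ord_cup Oc Od)) as [H|[H|H]]; auto.
  destruct (ord_tri Oa Oc) as [K|[K|K]]; auto.
  destruct (ord_tri Ob Od) as [L|[L|L]]; auto 8.
  - right; right; right; split; auto.
Qed.

(* [d] stands for the critical point: products of smaller ordinals stay below it *)
Variable d : V.
Hypotheses (Ld : lim d) (omega_d : omega in_ d)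
  (d_wo : forall c, c in_ d -> exists b, b in_ d /\ inj (Vf c) b)
  (d_card : forall c, c in_ d -> ~ inj d c).

(** If [k] injects into a smaller ordinal, induction applies. Otherwise, for c below [k], the square
    of c + 1 injects into some e below [k], so every pair has order type below [k] in [glt]. For c +
    1 below [d], that e comes from the closure of V_d and the well-ordering of its levels, which
    starts the induction. *)
Lemma hessenberg m : ordinal m -> subset d m -> inj (prod m m) m.
Proof.
  assert (Od := proj1 Ld); pose proof inj_def as Hid.
  apply (ord_ind (P := fun m => subset d m -> inj (prod m m) m)); [dp|].
  intros k Ok IH Hd.
  destruct (classic (exists c, c in_ k /\ inj k c)) as [(c & Hc & Hi)|Hn].
  - assert (Oc := ord_in Ok Hc).
    destruct (ord_le_or_lt Od Oc) as [H|H].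
    + apply inj_trans with (prod c c); [now apply inj_prod|].
      apply inj_trans with c; [now apply IH|apply inj_sub, ord_sub; auto].
    + exfalso; apply (d_card H); apply inj_trans with k; auto; now apply inj_sub.
  - assert (Hok : subset omega k) by (intros x Hx; apply Hd, ord_trans with omega; auto).
    assert (Sk : forall c, c in_ k -> suc c in_ k).
    { intros c Hc; assert (Oc := ord_in Ok Hc); assert (H := suc_sub Ok Hc).
      apply ord_sub in H; auto using ord_suc; destruct H as [H|H]; auto; exfalso; apply Hn; exists c; split; auto.
      assert (Hoc : subset omega c).
      { destruct (ord_le_or_lt ord_omega Oc) as [K|K]; auto; exfalso.
        apply (mem_irrefl (x := k)); rewrite <- H at 1; now apply Hok, suc_omega. }
      destruct (bij_suc Oc Hoc) as [f Hf]; rewrite <- H; apply (bij_inj Hf). }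
    assert (Hsq : forall c, c in_ k -> exists e, e in_ k /\ inj (prod (suc c) (suc c)) e).
    { intros c Hc; assert (Hsc := Sk c Hc); assert (Osc := ord_in Ok Hsc).
      destruct (ord_le_or_lt Od Osc) as [H|H]; [exists (suc c); split; auto|].
      assert (HU : suc c in_ Vf d) by now apply ord_sub_Vf.
      assert (Hp := lim_prod Ld HU HU); apply in_Vf in Hp; auto; destruct Hp as (g & Hg & Hpg).
      destruct (d_wo Hg) as (e & He & Hie); exists e; split; auto.
      apply inj_trans with (Vf g); auto; now apply inj_sub. }
    set (r := otype glt).
    assert (Hrd : dP (fun v => v 0 = r (v 1))) by exact (otype_def glt_def glt_trans glt_set glt_ind).
    assert (Hrl : forall q p, glt q p -> r q in_ r p) by exact (otype_lt glt_def glt_trans glt_set glt_ind).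
    assert (Hri : forall z p, z in_ r p <-> exists q, glt q p /\ z = r q) by exact (in_otype glt_def glt_trans glt_set glt_ind).
    assert (Hro : forall p, ordinal (r p)) by exact (otype_ord glt_def glt_trans glt_set glt_ind).
    clearbody r.
    assert (Hinj : forall a b c e, ordinal a -> ordinal b -> ordinal c -> ordinal e ->
       r (opair a b) = r (opair c e) -> opair a b = opair c e).
    { intros a b c e Oa Ob Oc Oe E; destruct (glt_total Oa Ob Oc Oe) as [H|[H|H]]; auto;
        apply Hrl in H; rewrite E in H; now apply mem_irrefl in H. }
    apply (inj_mk (h := r)); auto.
    + intros p Hp; apply in_prod in Hp; destruct Hp as (a & b & Ha & Hb & ->).
      assert (Oa := ord_in Ok Ha); assert (Ob := ord_in Ok Hb).
      destruct (ord_le_or_lt Ok (Hro (opair a b))) as [H|H]; auto; exfalso; apply Hn.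
      assert (Hc : cup a b in_ k) by (destruct (cup_max Oa Ob) as [[-> _]|[-> _]]; auto).
      destruct (Hsq _ Hc) as (e & He & Hie); exists e; split; auto.
      apply inj_trans with (r (opair a b)); [now apply inj_sub|].
      apply inj_trans with (prod (suc (cup a b)) (suc (cup a b))); auto.
      assert (Oc := ord_suc (ord_cup Oa Ob)).
      apply (inj_cover (h := r)); auto.
      * intros x y Hx Hy; apply in_prod in Hx, Hy.
        destruct Hx as (x1 & x2 & Hx1 & Hx2 & ->), Hy as (y1 & y2 & Hy1 & Hy2 & ->); apply Hinj; now apply ord_in with (suc (cup a b)).
      * intros z Hz; apply Hri in Hz; destruct Hz as (q & Hq & ->); exists q; split; auto; now apply glt_bound.
    + intros x y Hx Hy; apply in_prod in Hx, Hy.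
      destruct Hx as (x1 & x2 & Hx1 & Hx2 & ->), Hy as (y1 & y2 & Hy1 & Hy2 & ->); apply Hinj; now apply ord_in with k.
Qed.

End Godel.

(** * Splitting a successor cardinal into stationary sets *)

Section Clubs.
Context {V : set_structure} {hZF : ZF V}.
Implicit Types a b c d i m x y z f g s t u w C th : V.

(** Choosing ordinals needs no axiom. The existence clause in [D] gives the value 0 where no ordinal
    qualifies, so that [h] is total and definable. *)
Lemma least_fun (P : V -> V -> Prop) : dP (fun v => P (v 0) (v 1)) ->
  exists h : V -> V, dP (fun v => v 0 = h (v 1)) /\ forall x, (exists a, ordinal a /\ P a x) ->
    ordinal (h x) /\ P (h x) x /\ forall c, ordinal c -> P c x -> subset (h x) c.
Proof.
  intros HP.
  set (D := fun z x => (exists a, ordinal a /\ P a x) /\ forall c, ordinal c -> P c x -> z in_ c).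
  assert (Hi : forall x, isset (fun z => D z x)).
  { intros x; destruct (classic (exists a, ordinal a /\ P a x)) as [(a & Oa & Pa)|H].
    - apply isset_sub with a; [intros z [_ H]; auto|unfold D; dp].
    - apply isset_sub with emp; [intros z [H' _]; tauto|unfold D; dp]. }
  exists (fun x => setof (fun z => D z x)); split; [apply setof1_def; auto; unfold D; dp|].
  intros x Hx.
  assert (Hd : dP (fun v => (fun a => P a x) (v 0))) by dp.
  assert (E : setof (fun z => D z x) = leastord (fun a => P a x)); [|rewrite E; exact (leastord_spec Hd Hx)].
  apply setof_eq; intros z; unfold leastord.
  rewrite (in_setof _ (isset_leastord Hd Hx)); unfold D; tauto.
Qed.

(* omega-closed unbounded subsets *)
Definition oclub C th :=
  subset C th /\ (forall b, b in_ th -> exists g, g in_ C /\ b in_ g) /\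
  forall w t u, is_omega w -> is_fun t w C ->
    (forall n s x y, n in_ w -> is_succ s n -> maps t n x -> maps t s y -> x in_ y) ->
    (forall z, z in_ u <-> exists n x, maps t n x /\ z in_ x) -> u in_ C.

(* The fibres of [f] over the points of [th] are omega-stationary. *)
Definition fat f th := is_fun f th th /\
  forall xi C, xi in_ th -> oclub C th -> exists a, a in_ C /\ maps f a xi.

Lemma oclub_def : dP (fun v => oclub (v 0) (v 1)).
Proof. unfold oclub, is_omega, inductive, is_empty, is_succ, is_fun, maps, is_opair, is_pair, subset, unique; dp. Qed.

Lemma fat_vP : vP (fun v : nat -> V => fat (v 0) (v 1)).
Proof. unfold fat, oclub, is_omega, inductive, is_empty, is_succ, is_fun, maps, is_opair, is_pair, subset, unique; vp. Qed.

Lemma oclub_closed C th (G : V -> V) u : oclub C th -> dP (fun v => v 0 = G (v 1)) ->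
  (forall n, n in_ omega -> G n in_ C) -> (forall n, n in_ omega -> G n in_ G (suc n)) ->
  (forall z, z in_ u <-> exists n, n in_ omega /\ z in_ G n) -> u in_ C.
Proof.
  intros (_ & _ & HC) Hd HG Hinc Hu.
  assert (Ft : is_fun (mkfun omega G) omega C) by now apply is_fun_mkfun.
  apply (HC omega (mkfun omega G) u); auto; [now apply is_omega_iff| |].
  - intros n s x y Hn Hs Hx Hy; apply is_succ_iff in Hs; subst s.
    apply (fun_maps _ _ Ft) in Hx, Hy; destruct Hx as [_ ->], Hy as [Hsn ->].
    rewrite !app_mkfun by auto; auto.
  - intros z; rewrite Hu; split.
    + intros (n & Hn & Hz); exists n, (G n); split; auto; apply (fun_maps _ _ Ft); rewrite app_mkfun; auto.
    + intros (n & x & Hx & Hz); apply (fun_maps _ _ Ft) in Hx; destruct Hx as [Hn ->].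
      rewrite app_mkfun in Hz by auto; eauto.
Qed.

Lemma oclub_intro C th : subset C th -> (forall b, b in_ th -> exists g, g in_ C /\ b in_ g) ->
  (forall t u, is_fun t omega C -> (forall n, n in_ omega -> app t n in_ app t (suc n)) ->
    (forall z, z in_ u <-> exists n, n in_ omega /\ z in_ app t n) -> u in_ C) -> oclub C th.
Proof.
  intros H1 H2 H3; split; [auto|split; auto]; intros w t u Hw Ft Hinc Hu.
  apply is_omega_iff in Hw; subst w; apply (H3 t u); auto.
  - intros n Hn; apply (Hinc n (suc n)); auto; [now apply is_succ_iff| |]; apply (fun_maps _ _ Ft); auto using suc_omega.
  - intros z; rewrite Hu; split.
    + intros (n & x & Hx & Hz); apply (fun_maps _ _ Ft) in Hx; destruct Hx as [Hn ->]; eauto.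
    + intros (n & Hn & Hz); exists n, (app t n); split; auto; apply (fun_maps _ _ Ft); auto.
Qed.

(** [th] is the Hartogs number of [m], characterised by the last two hypotheses, and may still equal
    lam; [m_sq] will be supplied by [hessenberg]. *)
Variables lam m th : V.
Hypotheses (Llam : lim lam) (hDC : DC lam) (Om : ordinal m) (omega_m : subset omega m)
  (m_sq : inj (prod m m) m) (Oth : ordinal th) (th_lam : subset th lam)
  (th_inj : forall a, a in_ th -> inj a m) (th_noinj : ~ inj th m).

Lemma m_in_th : m in_ th.
Proof.
  destruct (ord_le_or_lt Oth Om) as [H|H]; auto; exfalso; apply th_noinj; now apply inj_sub.
Qed.

Lemma th_lim : lim th.
Proof.
  split; [auto|split].
  - apply ord_trans with m; auto using m_in_th, emp_omega.
  - intros a Ha; assert (Oa := ord_in Oth Ha); assert (H := suc_sub Oth Ha).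
    apply ord_sub in H; auto using ord_suc; destruct H as [H|H]; auto; exfalso; apply th_noinj; rewrite <- H.
    destruct (ord_le_or_lt ord_omega Oa) as [K|K].
    + destruct (bij_suc Oa K) as [f Hf]; apply inj_trans with a; [apply (bij_inj Hf)|auto].
    + apply inj_sub; intros z Hz; apply omega_m; apply ord_trans with (suc a); auto using ord_omega, suc_omega.
Qed.

(** The data of Ulam's matrix: DC chooses injections into [m] for all ordinals below [th] at
    once. *)
Lemma injections : exists e, forall a, a in_ th -> is_fun (app e a) a m /\ injective_on (app e a) a.
Proof.
  destruct (AC_lam Llam hDC (Q := fun a f => a in_ th -> is_fun f a m /\ injective_on f a)) as (e & _ & He).
  - unfold injective_on, is_fun, maps, is_opair, is_pair, unique; dp.
  - intros a _; destruct (classic (a in_ th)) as [Ha|Ha]; [|exists emp; tauto].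
    destruct (th_inj Ha) as (f & Hf); eauto.
  - exists e; auto.
Qed.

(** Were the values cofinal, each b in [th] would be coded by the least i with b at most G(i),
    together with the value at b of the chosen injection of G(i) + 1. This would inject [th] into
    the square of [m], hence into [m]. *)
Lemma th_regular I (G : V -> V) : dP (fun v => v 0 = G (v 1)) -> subset I m ->
  (forall i, i in_ I -> G i in_ th) -> exists b, b in_ th /\ forall i, i in_ I -> G i in_ b.
Proof.
  intros HG HI Hin; apply NNPP; intros Hn; destruct injections as (e & He).
  assert (Hc : forall b, b in_ th -> exists i, i in_ I /\ b in_ suc (G i)).
  { intros b Hb; apply NNPP; intros Hb'; apply Hn; exists b; split; auto; intros i Hi.
    assert (Ob := ord_in Oth Hb); assert (OG := ord_in Oth (Hin i Hi)).
    destruct (ord_le_or_lt Ob OG) as [H|H]; auto; exfalso; apply Hb'; exists i; split; auto.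
    apply in_suc, ord_sub; auto. }
  destruct (@least_fun (fun i b => i in_ I /\ b in_ suc (G i))) as (L & HL & Ls); [dp|].
  assert (HLs : forall b, b in_ th -> L b in_ I /\ b in_ suc (G (L b)) /\ suc (G (L b)) in_ th).
  { intros b Hb; destruct (Ls b) as (_ & (H1 & H2) & _).
    - destruct (Hc b Hb) as (i & Hi & H); exists i; split; auto; apply ord_in with m; auto.
    - repeat match goal with |- _ /\ _ => split end; auto; apply th_lim; auto. }
  clear Ls.
  apply th_noinj, inj_trans with (prod m m); auto.
  apply (inj_mk (h := fun b => opair (L b) (app (app e (suc (G (L b)))) b))); [dp| |].
  - intros b Hb; destruct (HLs b Hb) as (H1 & H2 & H3); apply opair_in_prod; split; auto.
    destruct (He _ H3) as [Ff _]; now apply (fun_in Ff).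
  - intros x y Hx Hy E; apply opair_inj in E; destruct E as [E1 E2]; rewrite E1 in E2.
    destruct (HLs x Hx) as (H1 & H2 & H3), (HLs y Hy) as (H4 & H5 & H6); rewrite E1 in H2.
    destruct (He _ H6) as [_ If]; now apply If.
Qed.

Lemma th_sup (G : V -> V) : dP (fun v => v 0 = G (v 1)) -> (forall n, n in_ omega -> G n in_ th) ->
  exists u, u in_ th /\ forall z, z in_ u <-> exists n, n in_ omega /\ z in_ G n.
Proof.
  intros HG Hin; destruct (th_regular HG omega_m Hin) as (b & Hb & Hlt).
  assert (Hi : isset (fun y => exists n, n in_ omega /\ y = G n)) by now apply isset_image.
  exists (bigU (setof (fun y => exists n, n in_ omega /\ y = G n))).
  assert (E : forall z, z in_ bigU (setof (fun y => exists n, n in_ omega /\ y = G n)) <-> exists n, n in_ omega /\ z in_ G n).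
  { intros z; rewrite in_bigU; split.
    - intros (y & Hy & Hz); apply setof_E in Hy; auto; destruct Hy as (n & Hn & ->); eauto.
    - intros (n & Hn & Hz); exists (G n); split; auto; apply setof_I; eauto. }
  split; auto; assert (Ob := ord_in Oth Hb); apply sub_lt_trans with b; auto.
  - apply ord_bigU; intros y Hy; apply setof_E in Hy; auto; destruct Hy as (n & Hn & ->); apply ord_in with th; auto.
  - intros z Hz; apply E in Hz; destruct Hz as (n & Hn & Hz); apply ord_trans with (G n); auto.
Qed.

(** [N b] is the least point such that every one of the [m] sets has a member between [b] and it;
    regularity provides one. The limit of omega iterations is, by interleaving, also a limit of
    members of each set. *)
Lemma oclub_meet c b0 : (forall i, i in_ m -> oclub (app c i) th) -> b0 in_ th ->
  exists a, a in_ th /\ b0 in_ a /\ forall i, i in_ m -> a in_ app c i.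
Proof.
  intros Hc Hb0.
  assert (HcO : forall i g, i in_ m -> g in_ app c i -> g in_ th /\ ordinal g).
  { intros i g Hi Hg; assert (H : g in_ th) by (apply (proj1 (Hc i Hi)); auto); split; auto; now apply ord_in with th. }
  destruct (@least_fun (fun nu b => nu in_ th /\ forall i, i in_ m -> exists g, g in_ app c i /\ (b in_ g /\ g in_ nu)))
    as (N & HN & Ns); [dp|].
  assert (N1 : forall b, b in_ th -> N b in_ th /\ forall i, i in_ m -> exists g, g in_ app c i /\ (b in_ g /\ g in_ N b)).
  { intros b Hb; apply Ns.
    destruct (@least_fun (fun g i => g in_ app c i /\ b in_ g)) as (L & HL & Ls); [dp|].
    assert (L1 : forall i, i in_ m -> L i in_ app c i /\ b in_ L i).
    { intros i Hi; apply Ls; destruct (proj1 (proj2 (Hc i Hi)) b Hb) as (g & Hg & Hbg).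
      exists g; split; auto; now apply (HcO i). }
    destruct (@th_regular m L HL (fun x H => H)) as (nu & Hnu & Hlt).
    { intros i Hi; now apply (HcO i), L1. }
    exists nu; split; [now apply ord_in with th|split; auto].
    intros i Hi; exists (L i); destruct (L1 i Hi); auto. }
  clear Ns.
  set (s := iter N b0).
  assert (Hs : dP (fun v => v 0 = s (v 1))) by now apply iter_def.
  assert (s0 : s emp = b0) by now apply iter_emp.
  assert (sS : forall n, n in_ omega -> s (suc n) = N (s n)) by (intros n Hn; apply iter_suc; auto; exact (ord_nat Hn)).
  clearbody s.
  assert (Hsth : forall n, n in_ omega -> s n in_ th).
  { apply (omega_ind (P := fun n => s n in_ th)); [dp|now rewrite s0|].
    intros n Hn IH; rewrite sS by auto; now apply N1. }
  assert (Hem : emp in_ m) by (apply omega_m, emp_omega).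
  assert (Hinc : forall n, n in_ omega -> s n in_ s (suc n)).
  { intros n Hn; rewrite sS by auto; destruct (N1 (s n) (Hsth n Hn)) as [H1 H2].
    destruct (H2 emp Hem) as (g & Hg & H3 & H4); apply ord_trans with g; auto; now apply ord_in with th. }
  destruct (th_sup Hs Hsth) as (u & Hu & Eu); exists u; split; [auto|split].
  - apply Eu; exists (suc emp); split; [apply suc_omega, emp_omega|]; rewrite <- s0 at 1; apply Hinc, emp_omega.
  - intros i Hi.
    destruct (@least_fun (fun g b => g in_ app c i /\ b in_ g)) as (T & HT & Ts); [dp|].
    assert (T1 : forall n, n in_ omega -> T (s n) in_ app c i /\ s n in_ T (s n) /\ T (s n) in_ s (suc n)).
    { intros n Hn; rewrite sS by auto; destruct (N1 (s n) (Hsth n Hn)) as [H1 H2].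
      destruct (H2 i Hi) as (g & Hg & H3 & H4).
      destruct (Ts (s n)) as (O1 & (K1 & K2) & K3).
      { exists g; split; auto; now apply (HcO i). }
      split; [auto|split; auto].
      assert (Og := proj2 (HcO i g Hi Hg)); assert (ON := ord_in Oth H1).
      apply sub_lt_trans with g; auto. }
    apply (@oclub_closed (app c i) th (fun n => T (s n))); auto; [dp|intros n Hn; now apply T1| |].
    + intros n Hn; assert (Hsn := suc_omega Hn); destruct (T1 n Hn) as (A1 & A2 & A3), (T1 _ Hsn) as (B1 & B2 & B3).
      apply ord_trans with (s (suc n)); auto; now apply (HcO i).
    + intros z; rewrite Eu; split; intros (n & Hn & Hz); destruct (T1 n Hn) as (A1 & A2 & A3).
      * exists n; split; auto; apply ord_trans with (s n); auto; now apply (HcO i).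
      * exists (suc n); split; [now apply suc_omega|]; apply ord_trans with (T (s n)); auto.
        apply ord_in with th; auto using suc_omega.
Qed.

(* Ulam matrix: the sets {a : e_a(xi) = i} for i in m cover th above xi, so one of them is stationary. *)
Lemma fat_exists : exists f, fat f th.
Proof.
  destruct injections as (e & He); pose proof oclub_def as Hod; pose proof m_in_th as Hmth.
  set (pos := fun xi i => forall C, oclub C th -> exists a, a in_ C /\ (xi in_ a /\ app (app e a) xi = i)).
  assert (Hpd : dP (fun v => pos (v 0) (v 1))) by (unfold pos; dp).
  (* Otherwise choose for each i an omega-club with no a above xi satisfying e_a(xi) = i. A common
     element a above xi is refuted by i = e_a(xi). *)
  assert (A : forall xi, xi in_ th -> exists i, i in_ m /\ pos xi i).
  { intros xi Hxi; apply NNPP; intros Hn.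
    destruct (AC_lam Llam hDC (Q := fun i C => i in_ m -> oclub C th /\ forall a, a in_ C -> xi in_ a -> app (app e a) xi <> i))
      as (c & _ & Hc); [dp| |].
    - intros i _; destruct (classic (i in_ m)) as [Hi|Hi]; [|exists emp; tauto].
      apply NNPP; intros H; apply Hn; exists i; split; auto; intros C HC.
      apply NNPP; intros H'; apply H; exists C; intros _; split; auto.
      intros a Ha Hxa E; apply H'; eauto.
    - assert (Hml : subset m lam) by (intros i Hi; apply th_lam, ord_trans with m; auto).
      destruct (@oclub_meet c xi) as (a & Ha & Hxa & Hai); auto.
      { intros i Hi; apply Hc; auto. }
      destruct (He a Ha) as [Fe _]; assert (Hi := fun_in Fe Hxa).
      apply (proj2 (Hc _ (Hml _ Hi) Hi) a); auto. }
  (* A single i works for cofinally many xi, since [m] many bounds are not cofinal in [th]. *)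
  assert (B : exists i, i in_ m /\ forall b, b in_ th -> exists xi, xi in_ th /\ b in_ xi /\ pos xi i).
  { apply NNPP; intros Hn.
    destruct (@least_fun (fun b i => b in_ th /\ forall xi, xi in_ th -> pos xi i -> ~ b in_ xi)) as (L & HL & Ls); [dp|].
    assert (L1 : forall i, i in_ m -> L i in_ th /\ forall xi, xi in_ th -> pos xi i -> ~ L i in_ xi).
    { intros i Hi; apply Ls; apply NNPP; intros H; apply Hn; exists i; split; auto; intros b Hb.
      apply NNPP; intros H'; apply H; exists b; split; [now apply ord_in with th|split; auto].
      intros xi Hxi Hp Hb'; apply H'; eauto. }
    destruct (@th_regular m L HL (fun x H => H)) as (b & Hb & Hlt); [intros; now apply L1|].
    destruct (A b Hb) as (i & Hi & Hp); apply (proj2 (L1 i Hi) b); auto. }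
  destruct B as (i & Hi & HB); clear A.
  assert (HBs : isset (fun xi => xi in_ th /\ pos xi i)) by (apply isset_sep; dp).
  set (B := setof (fun xi => xi in_ th /\ pos xi i)).
  assert (InB : forall xi, xi in_ B <-> xi in_ th /\ pos xi i) by (intros; exact (in_setof _ HBs)).
  clearbody B.
  assert (OB : forall x, x in_ B -> ordinal x) by (intros x Hx; apply InB in Hx; apply ord_in with th; tauto).
  destruct (collapse OB) as (k & h & Hd & Ok & K1 & K2 & K3).
  (* A cofinal subset of [th] has order type [th], again by regularity. *)
  assert (Ek : k = th).
  { assert (Hkt : subset k th).
    { intros z Hz; destruct (K3 z Hz) as (x & Hx & <-); destruct (K1 x Hx) as (_ & Hs & Oh).
      pose proof Hx as Hx'; apply InB in Hx'; apply sub_lt_trans with x; auto; tauto. }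
    apply ord_sub in Hkt; auto; destruct Hkt as [Hkt|]; auto; exfalso.
    destruct (th_inj Hkt) as (f & Ff & If).
    destruct (@least_fun (fun x j => x in_ B /\ app f (h x) = j)) as (G & HG & Gs); [dp|].
    assert (HI : isset (fun j => j in_ m /\ exists x, x in_ B /\ app f (h x) = j)) by (apply isset_sep; dp).
    assert (G1 : forall x, x in_ B -> G (app f (h x)) = x).
    { intros x Hx; destruct (Gs (app f (h x))) as (_ & (H1 & H2) & _); [exists x; auto|].
      apply K2; auto; exact (If _ _ (proj1 (K1 _ H1)) (proj1 (K1 _ Hx)) H2). }
    destruct (@th_regular (setof (fun j => j in_ m /\ exists x, x in_ B /\ app f (h x) = j)) G) as (b & Hb & Hlt); auto.
    - intros j Hj; apply setof_E in Hj; tauto.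
    - intros j Hj; apply setof_E in Hj; auto; destruct Hj as (_ & x & Hx & <-); rewrite G1 by auto; now apply InB.
    - destruct (HB b Hb) as (xi & Hxi & Hbx & Hp); assert (HxB : xi in_ B) by (apply InB; auto).
      apply (mem_asym Hbx); rewrite <- (G1 xi HxB); apply Hlt, setof_I; auto; split; [|eauto].
      exact (fun_in Ff (proj1 (K1 _ HxB))). }
  subst k.
  (* [a] goes to the collapsed index of the xi in [B] with e_a(xi) = i, which is unique because e_a
     is injective; 0 is the default. *)
  destruct (@least_fun (fun z a => (exists xi, xi in_ B /\ (xi in_ a /\ (app (app e a) xi = i /\ z = h xi))) \/
    (~ (exists xi, xi in_ B /\ (xi in_ a /\ app (app e a) xi = i)) /\ z = emp))) as (F & HF & Fs); [dp|].
  assert (F1 : forall a xi, a in_ th -> xi in_ B -> xi in_ a -> app (app e a) xi = i -> F a = h xi).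
  { intros a xi Ha Hxi Hxa E; destruct (Fs a) as (_ & H & _).
    - exists (h xi); split; [now apply K1|left; eauto].
    - destruct H as [(xi' & H1 & H2 & H3 & ->)|[H _]]; [|exfalso; eauto].
      f_equal; destruct (He a Ha) as [_ Ie]; apply Ie; auto; congruence. }
  assert (F2 : forall a, a in_ th -> F a in_ th).
  { intros a Ha; destruct (classic (exists xi, xi in_ B /\ (xi in_ a /\ app (app e a) xi = i))) as [(xi & H1 & H2 & H3)|H].
    - rewrite (F1 a xi); auto; exact (proj1 (K1 _ H1)).
    - destruct (Fs a) as (_ & K & _); [exists emp; split; auto using ord_emp|].
      destruct K as [(xi & H1 & H2 & H3 & _)|[_ ->]]; [exfalso; eauto|apply th_lim]. }
  assert (Ff : is_fun (mkfun th F) th th) by now apply is_fun_mkfun.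
  exists (mkfun th F); split; auto; intros z C Hz HC; destruct (K3 z Hz) as (xi & Hxi & <-).
  pose proof Hxi as Hxi'; apply InB in Hxi'; destruct (proj2 Hxi' C HC) as (a & Ha & Hxa & E).
  assert (Hat : a in_ th) by (apply (proj1 HC); auto).
  exists a; split; auto; apply (fun_maps _ _ Ff); split; auto; rewrite app_mkfun, (F1 a xi); auto.
Qed.

(* The ordinals below [th] fixed by [j] form an omega-club, so [f'] takes the critical point at one of them,
   which is impossible since the critical point is not in the range of [j]. *)
Lemma fat_fix j f f' : good lam -> elementary_embedding j (Vf lam) (Some f) (Vf lam) (Some f') ->
  fat f th -> fat f' th -> forall a, a in_ th -> app j a = a.
Proof.
  intros Glam Hj [Ff _] [Ff' Hf'].
  assert (Olam := proj1 Llam).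
  assert (LU := lam_U Olam).
  (* [j] carries pairs of [f] to pairs of [f']. Hence it maps [th] to itself, even if [th] is lam
     and so no element of V_lam. *)
  assert (Hjf : forall a, a in_ th -> app j a in_ th /\ app f' (app j a) = app j (app f a)).
  { intros a Ha; assert (Hfa := fun_in Ff Ha).
    assert (Hau := LU a (th_lam Ha)); assert (Hfu := LU _ (th_lam Hfa)).
    assert (Hp := lim_opair Llam Hau Hfu).
    assert (H : opair a (app f a) in_ f) by (apply maps_iff, (fun_maps _ _ Ff); auto).
    apply (emb_pred Hj Hp) in H; rewrite (e_opair Olam Hj Hau Hfu Hp) in H; apply maps_iff in H.
    apply (fun_maps _ _ Ff') in H; destruct H; auto. }
  (* [j] is continuous along omega-sequences because it fixes omega and its elements; this is why
     closure is asked for such sequences only. *)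
  assert (Hcont : forall u t, u in_ lam -> is_fun t omega (suc u) -> (forall z, z in_ u -> exists n, n in_ omega /\ z in_ app t n) ->
     (forall n, n in_ omega -> app t n in_ lam /\ subset (app j (app t n)) u) -> app j u = u).
  { intros u t Hu Ft Hc Hn; assert (Ou := ord_in Olam Hu); assert (Huu := LU u Hu).
    assert (Hsu : suc u in_ Vf lam) by now apply lim_suc.
    assert (Hw := good_omega Glam).
    assert (Htu : t in_ Vf lam) by now apply (fun_bound Glam Ft).
    assert (Fjt : is_fun (app j t) omega (app j (suc u))).
    { rewrite <- (e_omega Hj Glam); now apply (e_is_fun Hj Glam Htu Hw Hsu). }
    apply ext; intros z; split; [|apply (e_increasing Olam Hj Ou Hu)].
    assert (Hpush : forall z, z in_ app j u -> exists n, n in_ app j omega /\ exists y, y in_ app j (suc u) /\ (maps (app j t) n y /\ z in_ y)).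
    { refine (@e_push V hZF lam j _ _ Hj (@ordinal V)
        (fun v => forall z, z in_ v 0 -> exists n, n in_ v 1 /\ exists y, y in_ v 2 /\ (maps (v 3) n y /\ z in_ y))
        (env4 u omega (suc u) t) _ Olam _ _).
      - apply absl_ball, absl_bex, absl_bex, absl_and; [apply absl_maps|apply absl_mem].
      - intros [|[|[|k]]]; auto.
      - simpl; intros z' Hz'; destruct (Hc z' Hz') as (n & Hnw & Hzn); exists n; split; auto.
        exists (app t n); split; [now apply (fun_in Ft)|split; auto]; apply (fun_maps _ _ Ft); auto. }
    intros Hz; destruct (Hpush z Hz) as (n & Hnw & y & Hy & Hm & Hzy).
    rewrite (e_omega Hj Glam) in Hnw; destruct (Hn n Hnw) as [H1 H2].
    assert (Hnl : n in_ lam) by (apply ord_trans with omega; auto; apply Glam).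
    assert (Hm' : maps t n (app t n)) by (apply (fun_maps _ _ Ft); auto).
    apply (proj1 (e_maps Olam Hj Htu (LU n Hnl) (LU _ H1))) in Hm'.
    rewrite (e_nat Olam Hj Hnw Hnl) in Hm'.
    apply (fun_maps _ _ Fjt) in Hm, Hm'; destruct Hm as [_ ->], Hm' as [_ E]; rewrite <- E in Hzy; auto. }
  assert (HC : isset (fun b => b in_ th /\ app j b = b)) by (apply isset_sep; dp).
  set (C := setof (fun b => b in_ th /\ app j b = b)).
  assert (InC : forall b, b in_ C <-> b in_ th /\ app j b = b) by (intros; exact (in_setof _ HC)).
  clearbody C.
  assert (Hclub : oclub C th).
  { apply oclub_intro.
    - intros b Hb; now apply InC.
    - intros b Hb.
      assert (Hd : dP (fun v => v 0 = suc (app j (v 1)))) by dp.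
      (* Each step passes beyond the image of the last point, so the supremum is closed under [j];
         the successor puts it above [b] even if [b] is fixed. *)
      set (s := iter (fun x => suc (app j x)) b).
      assert (Hs : dP (fun v => v 0 = s (v 1))) by exact (iter_def b Hd).
      assert (s0 : s emp = b) by exact (iter_emp b Hd).
      assert (sS : forall n, n in_ omega -> s (suc n) = suc (app j (s n))) by (intros n Hn; exact (iter_suc b Hd (ord_nat Hn))).
      clearbody s.
      assert (Hsth : forall n, n in_ omega -> s n in_ th).
      { apply (omega_ind (P := fun n => s n in_ th)); [dp|now rewrite s0|].
        intros n Hn IH; rewrite sS by auto; now apply th_lim, Hjf. }
      destruct (th_sup Hs Hsth) as (u & Hu & Eu); assert (Ou := ord_in Oth Hu).
      assert (Hsu : forall n, n in_ omega -> subset (app j (s n)) u).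
      { intros n Hn z Hz; apply Eu; exists (suc n); split; [now apply suc_omega|]; rewrite sS by auto; apply in_suc; auto. }
      assert (Hss : forall n, n in_ omega -> subset (s n) u) by (intros n Hn z Hz; apply Eu; eauto).
      exists u; split.
      + apply InC; split; auto; apply (Hcont u (mkfun omega s)); auto.
        * apply is_fun_mkfun; auto; intros n Hn; apply in_suc, ord_sub; auto; now apply ord_in with th; auto.
        * intros z Hz; apply Eu in Hz; destruct Hz as (n & Hn & Hz); exists n; split; auto; now rewrite app_mkfun.
        * intros n Hn; rewrite app_mkfun by auto; split; auto.
      + apply Eu; exists (suc emp); assert (He := emp_omega); split; [now apply suc_omega|].
        rewrite sS, s0 by auto; apply in_suc.
        assert (Ob := ord_in Oth Hb); assert (H := e_increasing Olam Hj Ob (th_lam Hb)).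
        apply ord_sub in H; auto; apply ord_in with th; auto; now apply Hjf.
    - intros t u Ft Hinc Eu.
      assert (Hd : dP (fun v => v 0 = app t (v 1))) by dp.
      assert (Ht : forall n, n in_ omega -> app t n in_ th /\ app j (app t n) = app t n).
      { intros n Hn; apply InC; now apply (fun_in Ft). }
      destruct (@th_sup (fun n => app t n) Hd) as (u' & Hu' & Eu'); [intros; now apply Ht|].
      assert (E : u = u') by (apply ext; intros z; rewrite Eu, Eu'; tauto); subst u'.
      assert (Ou := ord_in Oth Hu').
      apply InC; split; auto; apply (Hcont u t); auto.
      + apply is_fun_iff; apply is_fun_iff in Ft; destruct Ft as [Fu _]; split; auto.
        intros n Hn; apply in_suc, ord_sub; auto; [apply ord_in with th; auto; now apply Ht|].
        intros z Hz; apply Eu; eauto.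
      + intros z Hz; now apply Eu.
      + intros n Hn; destruct (Ht n Hn) as [H1 H2]; split; auto; rewrite H2; intros z Hz; apply Eu; eauto. }
  intros a Ha; apply NNPP; intros Hna.
  destruct (@ord_least V hZF (fun d => d in_ th /\ app j d <> d)) as (d & Od & (H1 & H2) & H3); [dp| |].
  { exists a; split; auto; now apply ord_in with th. }
  assert (Hcr : crit lam j d).
  { split; [auto|split; auto]; intros b Hb; apply NNPP; intros Hnb; apply (H3 b Hb); split; auto; now apply ord_trans with d. }
  destruct (Hf' d C H1 Hclub) as (b & Hb & Hm); apply InC in Hb; destruct Hb as [Hbt Eb].
  apply (fun_maps _ _ Ff') in Hm; destruct Hm as [_ Ed].
  destruct (Hjf b Hbt) as [_ E]; rewrite Eb in E.
  apply (crit_range Olam Hj Hcr (x := app f b)); [|congruence].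
  apply th_lam, (fun_in Ff Hbt).
Qed.

End Clubs.

(** * Cardinal arithmetic from embeddings *)

Section Reembedding.
Context {V : set_structure} {hZF : ZF V}.
Implicit Types a b c d i m x y z f g s t u w C th : V.
Variable lam : V.
Hypotheses (Clam : cardinal lam) (hDC : DC lam)
  (hE : forall A lam1 Vlam1 : V, is_succ lam1 lam -> is_rank Vlam1 lam1 ->
    nonempty A -> ordinal_definable A -> subset A Vlam1 ->
    exists x y j Vlam : V, x in_ A /\ y in_ A /\ is_rank Vlam lam /\
      elementary_embedding j Vlam (Some x) Vlam (Some y) /\ exists a, a in_ Vlam /\ ~ maps j a a).

Let Olam : ordinal lam := proj1 Clam.

Lemma od_embedding (Q : V -> V -> V -> Prop) a b : vP (fun v => Q (v 0) (v 1) (v 2)) -> ordinal a -> ordinal b ->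
  (forall x, Q x a b -> subset x (Vf lam)) -> (exists x, Q x a b) ->
  exists x y j, Q x a b /\ Q y a b /\ elementary_embedding j (Vf lam) (Some x) (Vf lam) (Some y) /\
    exists z, z in_ Vf lam /\ app j z <> z.
Proof.
  intros HQ Oa Ob Hs [x0 Hx0]; pose proof HQ as [p Hp].
  destruct (ZF_separation hZF p (fun k => match k with 1 => a | _ => b end) (pow (Vf lam))) as [A HA].
  assert (HA' : forall x, x in_ A <-> Q x a b).
  { intros x; rewrite HA, <- Hp, in_pow; unfold upd; simpl; split; [tauto|]; intros H; split; auto. }
  destruct (hE (A := A) (lam1 := suc lam) (Vlam1 := Vf (suc lam))) as (x & y & j & L & Hx & Hy & HL & Hj & z & Hz & Hn).
  - now apply is_succ_iff.
  - apply is_rank_iff; split; auto; now apply ord_suc.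
  - exists x0; now apply HA'.
  - apply (@vP_ordinal_definable V Q A a b); auto; apply ext.
  - intros x Hx; apply in_Vf_suc; auto; apply Hs; now apply HA'.
  - apply is_rank_iff in HL; destruct HL as [_ ->].
    exists x, y, j; split; [now apply HA'|split; [now apply HA'|split; auto]].
    exists z; split; auto; intros E; apply Hn, (fun_maps _ _ (emb_fun Hj)); auto.
Qed.

(** The family whose only member is the empty set already yields a nontrivial embedding. As natural
    numbers are fixed, lam exceeds omega. *)
Lemma some_crit : good lam /\ exists j P Q d, elementary_embedding j (Vf lam) P (Vf lam) Q /\ crit lam j d.
Proof.
  destruct (@od_embedding (fun x _ _ => is_empty x) emp emp) as (x & y & j & _ & _ & Hj & Hn); auto using ord_emp.
  - unfold is_empty; vp.
  - intros x Hx z Hz; exfalso; exact (Hx z Hz).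
  - exists emp; now apply is_empty_iff.
  - destruct (crit_exists Olam Hj Hn) as (d & Hd); split; [|exists j, (Some x), (Some y), d; auto].
    assert (Ho := crit_omega Olam Hj Hd); split; auto; apply card_lim; auto; apply ord_sub; auto using ord_omega.
Qed.

Lemma lam_good : good lam.
Proof. apply some_crit. Qed.

(* [fat_fix] needs m at least as large as some critical point, for Hessenberg; smaller m are dominated by that point. *)
Lemma high_crit m : m in_ lam -> exists th, ordinal th /\ m in_ th /\ th in_ lam /\
  (forall a, a in_ th -> inj a m) /\ ~ inj th m /\ exists j P Q d,
    elementary_embedding j (Vf lam) P (Vf lam) Q /\ crit lam j d /\ subset th d.
Proof.
  intros Hm; destruct some_crit as (Glam & j0 & P0 & Q0 & d0 & Hj0 & Hd0).
  pose proof Glam as [Llam Ho].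
  assert (Hd0l : d0 in_ lam) by apply Hd0; assert (Od0 := ord_in Olam Hd0l); assert (Om := ord_in Olam Hm).
  enough (H : forall k, k in_ lam -> subset d0 k -> exists th, ordinal th /\ k in_ th /\ th in_ lam /\
    (forall a, a in_ th -> inj a k) /\ ~ inj th k /\ exists j P Q d,
      elementary_embedding j (Vf lam) P (Vf lam) Q /\ crit lam j d /\ subset th d).
  { destruct (ord_le_or_lt Od0 Om) as [K|K]; [now apply H|].
    destruct (H d0 Hd0l) as (th & Oth & H1 & H2 & H3 & H4 & j & P & Q & d & Hj & Hd & Hs); [intros z; auto|].
    destruct (hartogs_spec m) as (A1 & A2 & A3).
    assert (Hsub : subset (hartogs m) th).
    { destruct (ord_le_or_lt A1 Oth) as [L|L]; auto; exfalso; apply H4.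
      apply inj_trans with m; [now apply A3|apply inj_sub, ord_sub; auto]. }
    exists (hartogs m); split; [auto|split; [|split; [|split; [auto|split; auto]]]].
    - destruct (ord_le_or_lt A1 Om) as [L|L]; auto; exfalso; apply A2; now apply inj_sub.
    - now apply sub_lt_trans with th.
    - exists j, P, Q, d; split; [auto|split; auto]; intros z Hz; auto. }
  clear m Hm Om; intros m Hm Hd0m; assert (Om := ord_in Olam Hm).
  destruct (hartogs_spec m) as (Oth & th_no & th_inj); set (th := hartogs m) in *; clearbody th.
  (* Here [th] could still be lam, if lam were the successor cardinal of [m]; [fat_fix] will exclude
     this, because the embedding moves some ordinal below lam. *)
  assert (Hth : subset th lam).
  { destruct (ord_le_or_lt Oth Olam) as [H|H]; auto; exfalso; apply (card_noinj Clam Hm); auto. }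
  assert (Hom : subset omega m).
  { intros n Hn; apply Hd0m; assert (K := crit_gt_omega Olam Hj0 Glam Hd0); now apply ord_trans with omega. }
  assert (Hsq : inj (prod m m) m).
  { apply (@hessenberg V hZF d0); auto.
    - exact (crit_lim Olam Hj0 Glam Hd0).
    - exact (crit_gt_omega Olam Hj0 Glam Hd0).
    - intros c Hc; destruct (crit_wo Olam Hj0 Glam hDC Hd0 Hc) as (b & f & Hb & Hf); exists b; split; auto; apply (bij_inj Hf).
    - intros c Hc Hi; apply (crit_noinj Olam Hj0 Glam Hd0 Hc); apply inj_trans with c; auto.
      apply inj_sub, ord_sub_Vf; now apply ord_in with d0. }
  destruct (@od_embedding (fun f a _ => fat f a) th emp) as (f & f' & j & Hf & Hf' & Hj & Hn); auto using ord_emp.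
  - pose proof (@fat_vP V) as K; exact K.
  - intros f [Ff _] p Hp; apply is_fun_iff in Ff; destruct Ff as [[Ff _] Hin].
    destruct (Ff p Hp) as (x & Hx & ->); apply lim_opair; auto; apply ord_sub_Vf; auto.
  - exact (fat_exists Llam hDC Om Hom Hsq Oth Hth th_inj th_no).
  - destruct (crit_exists Olam Hj Hn) as (d & Hd).
    assert (Hfix := fat_fix Llam hDC Om Hom Hsq Oth Hth th_inj th_no Glam Hj Hf Hf').
    assert (Hthd : subset th d).
    { destruct Hd as (K1 & K2 & K3); destruct (ord_le_or_lt Oth (ord_in Olam K1)) as [H|H]; auto.
      exfalso; apply K2; auto. }
    exists th; split; [auto|split; [|split; [|split; [auto|split; auto]]]].
    + exact (m_in_th Om Oth th_no).
    + destruct Hd as (K1 & _); apply sub_lt_trans with d; auto; now apply ord_in with lam.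
    + exists j, (Some f), (Some f'), d; auto.
Qed.

Lemma lam_limit_cardinal : limit_cardinal lam.
Proof.
  split; [auto|split; [exists omega; apply lam_good|]].
  intros m Hm _; destruct (high_crit Hm) as (th & Oth & H1 & H2 & H3 & H4 & _).
  exists th; split; [auto|split; auto]; split; auto; intros a Ha [f Hf]; apply H4.
  apply inj_trans with a; [apply (bij_inj Hf)|auto].
Qed.

(** Otherwise lam, and with it a critical point above [a], would inject into V_a, against
    [crit_noinj]. *)
Lemma level_bijection a : a in_ lam -> exists b f, b in_ lam /\ is_bijection f b (Vf a).
Proof.
  intros Ha; destruct (trichotomy (proj1 lam_good) hDC (Vf a)) as [H|H]; auto; exfalso.
  destruct (high_crit Ha) as (th & Oth & H1 & _ & _ & _ & j & P & Q & d & Hj & Hd & Hs).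
  apply (crit_noinj Olam Hj lam_good Hd (Hs a H1)); apply inj_trans with lam; auto.
  apply inj_sub, ord_sub; auto; [apply ord_in with lam; auto|left]; apply Hd.
Qed.

End Reembedding.

(** * Elementary hulls and their diagrams *)

Section Hull.
Context {V : set_structure} {hZF : ZF V}.
Implicit Types a b c d i m n x y z f g h p q s t u w D X U F : V.

Lemma is_fun_super f a b c : is_fun f a b -> subset b c -> is_fun f a c.
Proof. intros H K; apply is_fun_iff in H; apply is_fun_iff; split; [apply H|]; intros x Hx; apply K, H, Hx. Qed.

Lemma tarski_vaught D U : subset D U ->
  (forall c i s x, is_formula false c -> i in_ omega -> is_fun s omega D -> x in_ U -> updf s i x in_ den U None c ->
    exists y, y in_ D /\ updf s i y in_ den U None c) -> elementary_substructure D U.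
Proof.
  intros HD HTV; apply sub_den; split; auto; intros c s Hc; revert s.
  assert (dD := den_def D None); assert (dU := den_def U None); pose proof (@is_fun_def V) as Hfd.
  revert c Hc; apply (formula_ind (hp := false) (P := fun c => forall s, is_fun s omega D -> (s in_ den D None c <-> s in_ den U None c)));
    [dp| | | | | |discriminate].
  - intros i j Hi Hj s Hs; destruct (den_clauses None Hs) as (K & _), (den_clauses None (is_fun_super Hs HD)) as (K' & _).
    now rewrite K, K'.
  - intros i j Hi Hj s Hs; destruct (den_clauses None Hs) as (_ & K & _), (den_clauses None (is_fun_super Hs HD)) as (_ & K' & _).
    now rewrite K, K'.
  - intros a Ha IH s Hs; destruct (den_clauses None Hs) as (_ & _ & K & _), (den_clauses None (is_fun_super Hs HD)) as (_ & _ & K' & _).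
    rewrite K, K', (IH s Hs); tauto.
  - intros a b Ha Hb IHa IHb s Hs; destruct (den_clauses None Hs) as (_ & _ & _ & K & _), (den_clauses None (is_fun_super Hs HD)) as (_ & _ & _ & K' & _).
    rewrite K, K', (IHa s Hs), (IHb s Hs); tauto.
  - intros i a Hi Ha IH s Hs; destruct (den_clauses None Hs) as (_ & _ & _ & _ & K & _), (den_clauses None (is_fun_super Hs HD)) as (_ & _ & _ & _ & K' & _).
    rewrite K, K'; split.
    + intros (x & Hx & H); exists x; split; auto; apply IH; auto; now apply updf_spec.
    + intros (x & Hx & H); destruct (HTV a i s x Ha Hi Hs Hx H) as (y & Hy & H'); exists y; split; auto.
      apply IH; auto; now apply updf_spec.
Qed.

Section Level.
Variable lam : V.
Hypothesis Glam : good lam.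
Let Olam : ordinal lam := proj1 (proj1 Glam).

(** Every finite part of an assignment into X is named by an element of V_lam, the only kind of
    assignment a diagram can mention. *)
Lemma lift_finitely g X t n : is_fun g (Vf lam) X -> (forall x, x in_ X -> exists a, a in_ Vf lam /\ app g a = x) ->
  is_fun t omega X -> n in_ omega ->
  exists s, s in_ Vf lam /\ is_fun s omega (Vf lam) /\ forall k, k in_ n -> app g (app s k) = app t k.
Proof.
  intros Fg Sg Ft; pose proof (@is_fun_def V) as Hfd.
  apply (omega_ind (P := fun n => exists s, s in_ Vf lam /\ is_fun s omega (Vf lam) /\ forall k, k in_ n -> app g (app s k) = app t k)); [dp| |].
  - assert (He : emp in_ Vf lam) by (apply lim_emp, Glam).
    exists (mkfun omega (fun _ => emp)); split; [now apply const_bound|split].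
    + apply is_fun_mkfun; auto; dp.
    + intros k Hk; now apply in_emp in Hk.
  - intros m Hm (s & Hs & Fs & Es).
    destruct (Sg (app t m) (fun_in Ft Hm)) as (a & Ha & Ea).
    destruct (updf_spec Fs Hm Ha) as (U1 & U2 & U3).
    exists (updf s m a); split; [apply updf_bound; auto; now apply nat_bound|split; auto].
    intros k Hk; apply in_suc in Hk; destruct Hk as [Hk| ->]; [|congruence].
    rewrite U3; auto; intros ->; exact (mem_irrefl Hk).
Qed.

Lemma e_seq j P Q s : elementary_embedding j (Vf lam) P (Vf lam) Q -> s in_ Vf lam -> is_fun s omega (Vf lam) ->
  app j s in_ Vf lam /\ is_fun (app j s) omega (Vf lam) /\
  forall n, n in_ omega -> app (app j s) n = app j (app s n).
Proof.
  intros Hj Hs Fs; assert (Hjs := e_in Hj Hs).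
  assert (Hr : rho s in_ lam) by now apply in_Vf_rho.
  assert (HVr : Vf (rho s) in_ Vf lam) by now apply Vf_in.
  assert (Hval : forall n, n in_ omega -> maps s n (app s n)) by (intros n Hn; apply (fun_maps _ _ Fs); auto).
  (* V_lam is not in the domain of [j], so a codomain that is an element of V_lam has to be found
     first. *)
  assert (Fs' : is_fun s omega (Vf (rho s))).
  { apply is_fun_iff; apply is_fun_iff in Fs; split; [apply Fs|]; intros n Hn.
    assert (H := Hval n Hn); apply maps_iff in H; apply rho_mem in H.
    apply in_Vf_rho; [apply ord_rho|]; apply ord_trans with (rho (opair n (app s n))); auto using ord_rho.
    assert (K := proj2 (opair_rk n (app s n))); apply in_Vf_rho in K; auto using ord_rho. }
  apply (e_is_fun Hj Glam Hs (good_omega Glam) HVr) in Fs'; rewrite (e_omega Hj Glam) in Fs'.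
  assert (Fj : is_fun (app j s) omega (Vf lam)).
  { apply is_fun_super with (1 := Fs'); intros x Hx; apply (Vf_trans Olam (e_in Hj HVr) Hx). }
  split; [auto|split; auto]; intros n Hn.
  assert (Hnl : n in_ lam) by (apply ord_trans with omega; auto; apply Glam).
  assert (H := proj1 (e_maps Olam Hj Hs (nat_bound Glam Hn) (fun_in Fs Hn)) (Hval n Hn)).
  rewrite (e_nat Olam Hj Hn Hnl) in H; apply (fun_maps _ _ Fj) in H; symmetry; apply H.
Qed.

(** Codes lie in V_omega, so [e_fix] at omega covers the nonstandard ones too. *)
Lemma e_formula j P Q hp c : elementary_embedding j (Vf lam) P (Vf lam) Q -> is_formula hp c -> app j c = c.
Proof.
  intros Hj Hc; apply is_formula_Vomega in Hc; apply (@e_fix V hZF lam j P Q Olam Hj omega); auto using ord_omega.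
  - apply ord_sub; auto using ord_omega; left; apply Glam.
  - intros n Hn; apply (e_nat Olam Hj Hn); apply ord_trans with omega; auto; apply Glam.
Qed.

(* [z] is the elementary diagram of an elementary submodel of V_zeta enumerated by V_lam; the pairs
   (0, a) and (1, 0) name the elements a of V_lam and lam. *)
Definition is_diagram z l zeta := exists L U X g w,
  is_rank L l /\ is_rank U zeta /\ is_omega w /\ elementary_substructure X U /\ is_fun g L X /\
  (forall x, x in_ X -> exists a, a in_ L /\ maps g a x) /\
  (forall a e p, a in_ L -> is_empty e -> is_opair p e a -> maps g p a) /\
  (forall e o p, is_empty e -> is_succ o e -> is_opair p o e -> maps g p l) /\
  subset z L /\
  forall c s t p, is_formula false c -> s in_ L -> is_fun s w L -> is_fun t w U ->
    (forall n x y, maps s n x -> maps g x y -> maps t n y) -> is_opair p c s ->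
    (p in_ z <-> satisfies U None c t).

(** [is_diagram] is spelled out by graphs so that it unfolds to a formula without parameters; lam
    and zeta are then the only ordinals involved. *)
Lemma is_diagram_vP : vP (fun v : nat -> V => is_diagram (v 0) (v 1) (v 2)).
Proof.
  unfold is_diagram, elementary_substructure, satisfies, truth_set, is_update, is_formula, formula_closed,
    code_mem, code_eq, code_neg, code_and, code_ex, code_pred, tagged, is_rank, ordinal, transitive,
    is_omega, inductive, is_empty, is_succ, is_fun, maps, is_opair, is_pair, subset, unique.
  cbn [is_numeral has_pred]; unfold is_empty, is_succ; vp.
Qed.

Definition diagram z zeta X g :=
  elementary_substructure X (Vf zeta) /\ is_fun g (Vf lam) X /\
  (forall x, x in_ X -> exists a, a in_ Vf lam /\ app g a = x) /\
  (forall a, a in_ Vf lam -> app g (opair (num 0) a) = a) /\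
  app g (opair (num 1) emp) = lam /\ subset z (Vf lam) /\
  forall c s t, is_formula false c -> s in_ Vf lam -> is_fun s omega (Vf lam) -> is_fun t omega (Vf zeta) ->
    (forall n, n in_ omega -> app t n = app g (app s n)) -> (opair c s in_ z <-> t in_ den (Vf zeta) None c).

Lemma is_diagram_iff z zeta : ordinal zeta -> (is_diagram z lam zeta <-> exists X g, diagram z zeta X g).
Proof.
  intros Oz; split.
  - intros (L & U & X & g & w & HL & HU & Hw & HX & Fg & Sg & G0 & G1 & Hz & Hd).
    apply is_rank_iff in HL, HU; destruct HL as [_ ->], HU as [_ ->]; apply is_omega_iff in Hw; subst w.
    exists X, g; split; [auto|split; [auto|split; [|split; [|split; [|split; auto]]]]].
    + intros x Hx; destruct (Sg x Hx) as (a & Ha & Hm); apply (fun_maps _ _ Fg) in Hm; destruct Hm as [_ ->]; eauto.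
    + intros a Ha; assert (H := G0 a emp (opair emp a) Ha (proj2 (is_empty_iff _) eq_refl) (proj2 (is_opair_iff _ _ _) eq_refl)).
      apply (fun_maps _ _ Fg) in H; symmetry; apply H.
    + assert (H := G1 emp (suc emp) (opair (suc emp) emp) (proj2 (is_empty_iff _) eq_refl) (proj2 (is_succ_iff _ _) eq_refl)
        (proj2 (is_opair_iff _ _ _) eq_refl)).
      apply (fun_maps _ _ Fg) in H; symmetry; apply H.
    + intros c s t Hc Hs Fs Ft E.
      rewrite (Hd c s t (opair c s) Hc Hs Fs Ft); [now apply satisfies_den| |now apply is_opair_iff].
      intros n x y Hx Hy; apply (fun_maps _ _ Fs) in Hx; apply (fun_maps _ _ Fg) in Hy; apply (fun_maps _ _ Ft).
      destruct Hx as [Hn ->], Hy as [_ ->]; split; auto; symmetry; auto.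
  - intros (X & g & HX & Fg & Sg & G0 & G1 & Hz & Hd).
    assert (H1 : opair (suc emp) emp in_ Vf lam) by (apply good_opair; auto; [exact (good_num 1 Glam)|exact (good_num 0 Glam)]).
    exists (Vf lam), (Vf zeta), X, g, omega; split; [|split; [|split; [|split; [auto|split; [auto|split; [|split; [|split; [|split; [auto|]]]]]]]]].
    + now apply is_rank_iff.
    + now apply is_rank_iff.
    + now apply is_omega_iff.
    + intros x Hx; destruct (Sg x Hx) as (a & Ha & <-); exists a; split; auto; apply (fun_maps _ _ Fg); auto.
    + intros a e p Ha He Hp; apply is_empty_iff in He; subst e; apply is_opair_iff in Hp; subst p.
      apply (fun_maps _ _ Fg); split; [apply good_opair; auto; exact (good_num 0 Glam)|symmetry; exact (G0 a Ha)].
    + intros e o p He Ho Hp; apply is_empty_iff in He; subst e; apply is_succ_iff in Ho; subst o; apply is_opair_iff in Hp; subst p.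
      apply (fun_maps _ _ Fg); split; auto; symmetry; exact G1.
    + intros c s t p Hc Hs Fs Ft E Hp; apply is_opair_iff in Hp; subst p.
      rewrite (satisfies_den (P := None) Hc Ft); apply Hd; auto; intros n Hn.
      assert (H : maps t n (app g (app s n))); [|apply (fun_maps _ _ Ft) in H; symmetry; apply H].
      apply (E n (app s n)); [apply (fun_maps _ _ Fs); auto|apply (fun_maps _ _ Fg); split; auto; apply (fun_in Fs Hn)].
Qed.

(** A diagram is the theory in V_zeta of the elements named by V_lam. As [j] fixes formulas, it
    carries truths about names to truths about their images, which makes the induced map well
    defined and elementary. *)
Lemma diagram_embedding z z' zeta X g X' g' j : diagram z zeta X g -> diagram z' zeta X' g' ->
  elementary_embedding j (Vf lam) (Some z) (Vf lam) (Some z') ->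
  exists J, elementary_embedding J X None (Vf zeta) None /\
    forall a, a in_ Vf lam -> app J (app g a) = app g' (app j a).
Proof.
  intros (HX & Fg & Sg & _ & _ & _ & Hd) (HX' & Fg' & _ & _ & _ & _ & Hd') Hj.
  pose proof HX as HX0; apply sub_den in HX0; destruct HX0 as [SX EX].
  pose proof HX' as HX0; apply sub_den in HX0; destruct HX0 as [SX' _].
  assert (Fgz := is_fun_super Fg SX); assert (Fgz' := is_fun_super Fg' SX').
  assert (T : forall c s, is_formula false c -> s in_ Vf lam -> is_fun s omega (Vf lam) ->
    (mkfun omega (fun n => app g (app s n)) in_ den (Vf zeta) None c <->
     mkfun omega (fun n => app g' (app j (app s n))) in_ den (Vf zeta) None c)).
  { intros c s Hc Hs Fs.
    assert (d1 : dP (fun v => v 0 = app g (app s (v 1)))) by dp.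
    assert (d2 : dP (fun v => v 0 = app g' (app j (app s (v 1))))) by dp.
    destruct (e_seq Hj Hs Fs) as (Hjs & Fjs & Ejs).
    assert (Hcl : c in_ Vf lam) by (apply is_formula_Vomega in Hc; apply (Vf_mono_sub Olam (proj2 Glam)), Hc).
    assert (Hp := good_opair Glam Hcl Hs).
    rewrite <- (Hd c s), <- (Hd' c (app j s)); auto.
    - rewrite (emb_pred Hj Hp), (e_opair Olam Hj Hcl Hs Hp), (e_formula Hj Hc); tauto.
    - apply is_fun_mkfun; auto; intros n Hn; apply (fun_in Fgz'), (e_in Hj), (fun_in Fs Hn).
    - intros n Hn; rewrite app_mkfun, Ejs; auto.
    - apply is_fun_mkfun; auto; intros n Hn; apply (fun_in Fgz), (fun_in Fs Hn).
    - intros n Hn; rewrite app_mkfun; auto. }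
  (* Two names denote the same element exactly if the equation of variables 0 and 1 holds at
     them. *)
  assert (WD : forall a b, a in_ Vf lam -> b in_ Vf lam -> app g a = app g b -> app g' (app j a) = app g' (app j b)).
  { intros a b Ha Hb E.
    set (v := fun k => match k with 0 => a | _ => b end).
    assert (Hv : forall k, v k in_ Vf lam) by (intros [|k]; auto).
    destruct (asg_spec 2 Hv) as [As Ev]; assert (Bs := asg_bound 2 Glam Hv).
    assert (E0 := Ev 0 (Nat.lt_0_succ 1)); assert (E1 := Ev 1 (Nat.lt_succ_diag_r 1)); simpl v in E0, E1.
    set (s := asg v 2) in *; clearbody s.
    assert (d1 : dP (fun v => v 0 = app g (app s (v 1)))) by dp.
    assert (d2 : dP (fun v => v 0 = app g' (app j (app s (v 1))))) by dp.
    assert (F1 : is_fun (mkfun omega (fun n => app g (app s n))) omega (Vf zeta)).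
    { apply is_fun_mkfun; auto; intros n Hn; apply (fun_in Fgz), (fun_in As Hn). }
    assert (F2 : is_fun (mkfun omega (fun n => app g' (app j (app s n)))) omega (Vf zeta)).
    { apply is_fun_mkfun; auto; intros n Hn; apply (fun_in Fgz'), (e_in Hj), (fun_in As Hn). }
    assert (n0 := @num_omega V hZF 0); assert (n1 := @num_omega V hZF 1).
    assert (Hc : is_formula false (ceq (num 0) (num 1))) by now apply formula_intro.
    destruct (den_clauses None F1) as (_ & K1 & _), (den_clauses None F2) as (_ & K2 & _).
    assert (H := T _ s Hc Bs As); rewrite K1, K2, !app_mkfun, E0, E1 in H by auto; tauto. }
  assert (dJ : dP (fun v => v 0 = opair (app g (v 1)) (app g' (app j (v 1))))) by dp.
  assert (HJs := isset_image (f := fun a => opair (app g a) (app g' (app j a))) (Vf lam) dJ).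
  set (J := setof (fun p => exists a, a in_ Vf lam /\ p = opair (app g a) (app g' (app j a)))).
  assert (InJ : forall p, p in_ J <-> exists a, a in_ Vf lam /\ p = opair (app g a) (app g' (app j a))) by (intros; exact (in_setof _ HJs)).
  clearbody J.
  assert (EJ : forall a, a in_ Vf lam -> app J (app g a) = app g' (app j a)).
  { intros a Ha; apply app_unique; [apply InJ; eauto|]; intros y Hy; apply InJ in Hy; destruct Hy as (b & Hb & E).
    apply opair_inj in E; destruct E as [E ->]; apply WD; auto. }
  assert (FJ : is_fun J X (Vf zeta)).
  { apply is_fun_iff; split; [split|].
    - intros p Hp; apply InJ in Hp; destruct Hp as (a & Ha & ->); exists (app g a); split; [apply (fun_in Fg Ha)|].
      now rewrite EJ.
    - intros x Hx; destruct (Sg x Hx) as (a & Ha & <-); rewrite EJ by auto; apply InJ; eauto.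
    - intros x Hx; destruct (Sg x Hx) as (a & Ha & <-); rewrite EJ by auto; apply (fun_in Fgz'), (e_in Hj), Ha. }
  exists J; split; auto; apply emb_den; split; [auto|split; auto]; intros c t t2 Hc Ft Ft2 Et.
  cbn [has_pred] in Hc.
  rewrite (EX c t Hc Ft).
  destruct (@finite_support V hZF (Vf zeta) None c Hc) as (n & Hn & Hsup).
  destruct (lift_finitely Fg Sg Ft Hn) as (s & Hs & Fs & Es).
  assert (d1 : dP (fun v => v 0 = app g (app s (v 1)))) by dp.
  assert (d2 : dP (fun v => v 0 = app g' (app j (app s (v 1))))) by dp.
  assert (Hnw : subset n omega) by (intros k Hk; apply ord_trans with n; auto using ord_omega).
  rewrite (Hsup t (mkfun omega (fun n => app g (app s n)))), (Hsup t2 (mkfun omega (fun n => app g' (app j (app s n))))).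
  - now apply T.
  - auto.
  - apply is_fun_mkfun; auto; intros k Hk; apply (fun_in Fgz'), (e_in Hj), (fun_in Fs Hk).
  - intros k Hk; assert (Hkw := Hnw k Hk); rewrite (app_mkfun d2 Hkw), (Et k Hkw), <- (Es k Hk); apply EJ, (fun_in Fs Hkw).
  - now apply is_fun_super with X.
  - apply is_fun_mkfun; auto; intros k Hk; apply (fun_in Fgz), (fun_in Fs Hk).
  - intros k Hk; assert (Hkw := Hnw k Hk); rewrite (app_mkfun d1 Hkw); now rewrite Es.
Qed.

End Level.
End Hull.

Section HullExistence.
Context {V : set_structure} {hZF : ZF V}.
Implicit Types a b c d i m n x y z f g h p q s t u w D X U F : V.

Variables lam zeta : V.
Hypotheses (Glam : good lam) (hDC : DC lam) (Gzeta : good zeta) (lam_zeta : lam in_ zeta)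
  (Hlev : forall a, a in_ lam -> exists b f, b in_ lam /\ is_bijection f b (Vf a)).

Let Olam : ordinal lam := proj1 (proj1 Glam).
Let Ozeta : ordinal zeta := proj1 (proj1 Gzeta).

(** A bijection of V_a with an ordinal below lam reduces this to [AC_lam]. *)
Lemma AC_level a (Q : V -> V -> Prop) : a in_ lam -> dP (fun v => Q (v 0) (v 1)) ->
  (forall b, b in_ Vf a -> exists y, Q b y) -> exists x, func x (Vf a) /\ forall b, b in_ Vf a -> Q b (app x b).
Proof.
  intros Ha HQ Hex; destruct (Hlev Ha) as (k & f & Hk & Hf).
  destruct (bij_inverse Hf) as (Hf' & E1 & E2); apply is_bijection_iff in Hf, Hf'.
  destruct (AC_lam (proj1 Glam) hDC (Q := fun i y => i in_ k -> Q (app f i) y)) as (h & _ & Hh); [dp| |].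
  - intros i _; destruct (classic (i in_ k)) as [Hi|Hi]; [|exists emp; tauto].
    destruct (Hex (app f i)) as [y Hy]; [now apply (fun_in (proj1 Hf))|eauto].
  - assert (Hd : dP (fun v => v 0 = app h (app (inverse f) (v 1)))) by dp.
    exists (mkfun (Vf a) (fun b => app h (app (inverse f) b))); split; [now apply func_mkfun|].
    intros b Hb; rewrite (app_mkfun Hd) by auto; assert (Hi := fun_in (proj1 Hf') Hb).
    rewrite <- (E2 b Hb) at 1; apply Hh; auto; now apply ord_trans with k.
Qed.

(** Position r of the sequence holds a function on V_(r+1), of which only the values at terms of
    rank exactly r are read. *)
Definition val s b : V := app (app s (rho b)) b.

(* [y] is an admissible value for the term [b], given the values [val s] of the terms of smaller rank;
   the pair (2, (c, (i, t))) names a witness for the i-th variable of the formula c at the values named by t. *)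
Definition term_value s b y := y in_ Vf zeta /\ ((forall a, b = opair (num 0) a -> y = a) /\
  ((b = opair (num 1) emp -> y = lam) /\
  forall c i t q x, b = opair (num 2) (opair c (opair i t)) -> is_formula false c -> i in_ omega ->
    is_fun t omega (Vf lam) -> is_fun q omega (Vf zeta) -> (forall n, n in_ omega -> app q n = val s (app t n)) ->
    x in_ Vf zeta -> updf q i x in_ den (Vf zeta) None c -> updf q i y in_ den (Vf zeta) None c)).

Lemma term_value_def : dP (fun v => term_value (v 0) (v 1) (v 2)).
Proof.
  pose proof (@is_fun_def V) as H1; pose proof (@is_formula_def V hZF false) as H2.
  pose proof (den_def (Vf zeta) None) as H3; unfold term_value, val; dp.
Qed.

Lemma term_value_exists s b : b in_ Vf lam -> exists y, term_value s b y.
Proof.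
  intros Hb; assert (HLZ := Vf_mono_sub Ozeta lam_zeta).
  destruct (classic (exists a, b = opair (num 0) a)) as [(a & ->)|H0].
  { exists a; split; [apply HLZ; now apply opair_bound in Hb|split; [|split]].
    - intros a' E; apply opair_inj in E; tauto.
    - intros E; apply opair_inj in E; destruct E as [E _]; now apply num_neq in E.
    - intros c i t q x E; apply opair_inj in E; destruct E as [E _]; now apply num_neq in E. }
  destruct (classic (b = opair (num 1) emp)) as [->|H1].
  { exists lam; split; [now apply ord_sub_Vf|split; [intros a E; exfalso; eauto|split; [auto|]]].
    intros c i t q x E; apply opair_inj in E; destruct E as [E _]; now apply num_neq in E. }
  destruct (classic (exists c i t q x, b = opair (num 2) (opair c (opair i t)) /\ is_fun q omega (Vf zeta) /\
    (forall n, n in_ omega -> app q n = val s (app t n)) /\ x in_ Vf zeta /\ updf q i x in_ den (Vf zeta) None c))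
    as [(c & i & t & q & x & -> & Fq & Eq & Hx & Hd)|H2].
  { exists x; split; [auto|split; [intros a E; exfalso; eauto|split; [tauto|]]].
    intros c' i' t' q' x' E _ Hi' _ Fq' Eq' _ _.
    apply opair_inj in E; destruct E as [_ E]; apply opair_inj in E; destruct E as [-> E].
    apply opair_inj in E; destruct E as [-> ->].
    replace q' with q; auto; apply (fun_eq Fq Fq'); intros n Hn; now rewrite Eq, Eq'. }
  (* The term asks for no witness, or none exists; the conditions are then vacuous for any element
     of V_zeta. *)
  exists emp; split; [apply lim_emp, Gzeta|split; [intros a E; exfalso; eauto|split; [tauto|]]].
  intros c i t q x E _ _ _ Fq Eq Hx Hd; exfalso; apply H2; exists c, i, t, q, x; auto.
Qed.

Lemma rho_snd x y : rho y in_ rho (opair x y).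
Proof. apply in_Vf_rho; [apply ord_rho|apply opair_rk]. Qed.

(** Stage a of the dependent choice treats all terms in V_(a+1) at once by [AC_level], so lam stages
    reach all of V_lam. *)
Lemma skolem_function : exists g, is_fun g (Vf lam) (Vf zeta) /\
  (forall a, a in_ Vf lam -> app g (opair (num 0) a) = a) /\ app g (opair (num 1) emp) = lam /\
  forall c i t q x, is_formula false c -> i in_ omega -> t in_ Vf lam -> is_fun t omega (Vf lam) ->
    is_fun q omega (Vf zeta) -> (forall n, n in_ omega -> app q n = app g (app t n)) ->
    x in_ Vf zeta -> updf q i x in_ den (Vf zeta) None c ->
    updf q i (app g (opair (num 2) (opair c (opair i t)))) in_ den (Vf zeta) None c.
Proof.
  pose proof term_value_def as Hd; pose proof (proj1 Glam) as Llam.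
  set (R := fun s x => forall a, func s a -> func x (Vf (suc a)) /\ forall b, b in_ Vf (suc a) -> term_value s b (app x b)).
  assert (HR : dP (fun v => R (v 0) (v 1))) by (unfold R; dp).
  destruct (@DC_seq V hZF lam (pow (prod (Vf lam) (Vf zeta))) R Llam hDC HR) as (F & PF).
  { intros s a Ha Ps; assert (Hsa : suc a in_ lam) by now apply Llam.
    destruct (@AC_level (suc a) (fun b y => term_value s b y) Hsa) as (x & Fx & Hx); [dp| |].
    - intros b Hb; apply term_value_exists; now apply (Vf_mono_sub Olam Hsa).
    - exists x; split.
      + apply in_pow; intros p Hp; destruct (proj1 Fx p Hp) as (b & Hb & ->); apply opair_in_prod; split; [|now apply Hx].
        now apply (Vf_mono_sub Olam Hsa).
      + intros a' Fa'; now rewrite (dom_unique Fa' (partial_func Ps)). }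
  assert (FF := partial_func PF).
  assert (HF : forall b, b in_ Vf lam -> term_value (restr F (rho b)) b (val F b)).
  { intros b Hb; assert (Hr : rho b in_ lam) by now apply in_Vf_rho.
    apply (proj2 PF (rho b) Hr (rho b)).
    - apply func_restr with lam; auto; apply ord_sub; auto using ord_rho.
    - apply in_Vf_suc; [apply ord_rho|]; apply rho_spec. }
  assert (Hv : dP (fun v => v 0 = val F (v 1))) by (unfold val; dp).
  exists (mkfun (Vf lam) (val F)); split; [|split; [|split]].
  - apply is_fun_mkfun; auto; intros b Hb; apply (HF b Hb).
  - intros a Ha; assert (Hp := good_opair Glam (good_num 0 Glam) Ha); rewrite app_mkfun by auto.
    now apply (proj1 (proj2 (HF _ Hp))).
  - assert (Hp := good_opair Glam (good_num 1 Glam) (good_num 0 Glam)); change (num 0) with (emp (V := V)) in Hp.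
    rewrite app_mkfun by auto; now apply (proj1 (proj2 (proj2 (HF _ Hp)))).
  - intros c i t q x Hc Hi Ht Ft Fq Eq Hx Hden.
    assert (Hcl : c in_ Vf lam) by (pose proof Hc as Hc'; apply is_formula_Vomega in Hc'; apply (Vf_mono_sub Olam (proj2 Glam)), Hc').
    assert (Hp := good_opair Glam (good_num 2 Glam) (good_opair Glam Hcl (good_opair Glam (nat_bound Glam Hi) Ht))).
    rewrite app_mkfun by auto; apply (proj2 (proj2 (proj2 (HF _ Hp))) c i t q x); auto.
    intros n Hn; rewrite Eq, app_mkfun by (auto; apply (fun_in Ft Hn)).
    (* The names listed by [t] have smaller rank than the term, so the part of the sequence known at
       its stage already gives their final values. *)
    unfold val; rewrite app_restr; auto.
    assert (Hm : maps t n (app t n)) by (apply (fun_maps _ _ Ft); auto).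
    apply maps_iff, rho_mem in Hm.
    assert (H1 := rho_snd n (app t n)); assert (H2 := rho_snd i t); assert (H3 := rho_snd c (opair i t)).
    assert (H4 := rho_snd (num 2) (opair c (opair i t))).
    assert (O := @ord_rho V hZF).
    apply ord_trans with (rho (opair c (opair i t))); auto; apply ord_trans with (rho (opair i t)); auto.
    apply ord_trans with (rho t); auto; apply ord_trans with (rho (opair n (app t n))); auto.
Qed.

Lemma updf_agree s q i x n D : is_fun s omega D -> is_fun q omega D -> i in_ omega -> x in_ D ->
  (forall k, k in_ n -> app s k = app q k) -> forall k, k in_ n -> app (updf s i x) k = app (updf q i x) k.
Proof.
  intros Fs Fq Hi Hx E k Hk; destruct (updf_spec Fs Hi Hx) as (_ & A & B), (updf_spec Fq Hi Hx) as (_ & A' & B').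
  destruct (classic (k = i)) as [->|Hne]; [congruence|]; rewrite B, B'; auto.
Qed.

Lemma diagram_exists : exists z X g, diagram lam z zeta X g.
Proof.
  destruct skolem_function as (g & Fg & G0 & G1 & Gs).
  assert (Fu := proj1 (proj1 (is_fun_iff _ _ _) Fg)).
  set (X := ran g).
  assert (InX : forall x, x in_ X <-> exists a, a in_ Vf lam /\ app g a = x).
  { intros x; unfold X; rewrite in_ran; split; intros (a & H); exists a; [|apply (func_app _ _ Fu); intuition congruence].
    apply (func_app _ _ Fu) in H; intuition congruence. }
  clearbody X.
  assert (FgX : is_fun g (Vf lam) X) by (apply is_fun_iff; split; auto; intros a Ha; apply InX; eauto).
  assert (HX : subset X (Vf zeta)) by (intros x Hx; apply InX in Hx; destruct Hx as (a & Ha & <-); apply (fun_in Fg Ha)).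
  assert (SX : forall x, x in_ X -> exists a, a in_ Vf lam /\ app g a = x) by (intros; now apply InX).
  assert (Hd : dP (fun v => v 0 = den (Vf zeta) None (v 1))) by apply den_def.
  pose proof (@is_fun_def V) as Hfd; pose proof (@is_formula_def V hZF false) as Hcd.
  assert (Hz : isset (fun p => p in_ Vf lam /\ exists c s t, p = opair c s /\ (is_fun t omega (Vf zeta) /\
    ((forall n, n in_ omega -> app t n = app g (app s n)) /\ t in_ den (Vf zeta) None c)))) by (apply isset_sep; dp).
  match type of Hz with isset ?P => exists (setof P), X, g end; split; [|split; [auto|split; [auto|split; [auto|split; [auto|split]]]]].
  - apply tarski_vaught; auto; intros c i s x Hc Hi Fs Hx H.
    destruct (@finite_support V hZF (Vf zeta) None c Hc) as (n & Hn & Hsup).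
    (* [s] need not be named by an element of V_lam; the Skolem term is built from a [t] that names
       the part of [s] on which [c] depends. *)
    destruct (lift_finitely Glam FgX SX Fs Hn) as (t & Ht & Ft & Et).
    assert (dq : dP (fun v => v 0 = app g (app t (v 1)))) by dp.
    set (q := mkfun omega (fun n => app g (app t n))).
    assert (Fq : is_fun q omega (Vf zeta)) by (apply is_fun_mkfun; auto; intros k Hk; apply (fun_in Fg), (fun_in Ft Hk)).
    assert (Eq : forall k, k in_ omega -> app q k = app g (app t k)) by (intros k Hk; exact (app_mkfun dq Hk)).
    clearbody q.
    assert (Fsz := is_fun_super Fs HX).
    assert (Esq : forall k, k in_ n -> app s k = app q k).
    { intros k Hk; rewrite Eq, Et; auto; now apply ord_trans with n; auto using ord_omega. }
    assert (Hagree : forall y, y in_ Vf zeta -> (updf s i y in_ den (Vf zeta) None c <-> updf q i y in_ den (Vf zeta) None c)).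
    { intros y Hy; apply Hsup; [now apply updf_spec|now apply updf_spec|now apply (updf_agree Fsz Fq)]. }
    assert (Hcl : c in_ Vf lam) by (pose proof Hc as Hc'; apply is_formula_Vomega in Hc'; apply (Vf_mono_sub Olam (proj2 Glam)), Hc').
    assert (Hp := good_opair Glam (good_num 2 Glam) (good_opair Glam Hcl (good_opair Glam (nat_bound Glam Hi) Ht))).
    exists (app g (opair (num 2) (opair c (opair i t)))); split; [apply InX; eauto|].
    apply Hagree; [apply (fun_in Fg Hp)|]; apply (Gs c i t q x); auto; now apply Hagree.
  - intros p Hp; apply setof_E in Hp; [|exact Hz]; apply Hp.
  - intros c s t Hc Hs Fs Ft E; split; intros H.
    + apply setof_E in H; auto; destruct H as (_ & c' & s' & t' & Ep & Ft' & E' & H').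
      apply opair_inj in Ep; destruct Ep; subst c' s'.
      replace t with t'; auto; apply (fun_eq Ft' Ft); intros n Hn; now rewrite E, E'.
    + apply setof_I; auto; split; [|exists c, s, t; auto].
      apply good_opair; auto; apply is_formula_Vomega in Hc; apply (Vf_mono_sub Olam (proj2 Glam)), Hc.
Qed.

End HullExistence.

(** * Cardinals in C^(2) *)

#[local] Transparent dP.
Lemma vP_dP {V : set_structure} (Q : (nat -> V) -> Prop) : vP Q -> dP Q.
Proof. intros [p Hp]; exists p, inl; split; [discriminate|]; intros [] v; apply Hp. Qed.
#[local] Opaque dP.

Section Reflecting.
Context {V : set_structure} {hZF : ZF V}.
Implicit Types a b c d l x y z f s D : V.

Definition elem (n : nat) (D E : V -> Prop) :=
  forall p v, sigma n p -> (forall k, D (v k)) -> (sat D v p <-> sat E v p).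

Lemma elem_up n (D E : V -> Prop) p v : (forall x, D x -> E x) -> elem n D E -> sigma (S n) p ->
  (forall k, D (v k)) -> sat D v p -> sat E v p.
Proof.
  intros HDE Hel Hp; revert v; remember (S n) as m eqn:Em.
  induction Hp as [p Hp|m p Hp _|m i p Hp IH]; [discriminate| |]; injection Em as ->; intros v Hv; simpl.
  - rewrite (Hel p v); auto.
  - intros (x & Hx & H); exists x; split; auto; apply IH; auto.
    intros k; unfold upd; destruct (Nat.eqb k i); auto.
Qed.

(** [b] collects witnesses for the leading existential quantifiers; what remains is the negation of
    a Sigma_n formula, which levels in [G] judge correctly. *)
Lemma elem_down n (G : V -> Prop) p v : (forall b, G b -> ordinal b /\ elem n (fun x => x in_ Vf b) all_sets) ->
  sigma (S n) p -> sat all_sets v p ->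
  exists b, forall l, G l -> b in_ Vf l -> envin l v -> sat (fun x => x in_ Vf l) v p.
Proof.
  intros HG Hp; revert v; remember (S n) as m eqn:Em.
  induction Hp as [p Hp|m p Hp _|m i p Hp IH]; [discriminate| |]; injection Em as ->; intros v; simpl.
  - intros H; exists emp; intros l Hl _ Hv; destruct (HG l Hl) as [_ He]; now rewrite (He p v).
  - intros (x & _ & H); destruct (IH eq_refl _ H) as (b & Hb); exists (opair x b); intros l Hl Hxb Hv.
    apply opair_bound in Hxb; [|now apply HG]; destruct Hxb as [Hx Hb']; exists x; split; auto; apply Hb; auto.
    intros k; unfold upd; destruct (Nat.eqb k i); auto.
Qed.

Lemma sigma0_elem D (E : V -> Prop) : transitive D -> E = all_sets -> elem 0 (fun x => x in_ D) E.
Proof. intros HD -> p v Hp; inversion Hp; subst; intros Hv; now apply delta0_trans. Qed.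

(** A Sigma_(n+1) truth about elements of V_l holds in some level of [G]. The last hypothesis
    reflects it to an n-elementary set inside V_l, from which it persists up to V_l. Truth is handed
    over as a code and an assignment, so that a definable closure can arrange the reflection. *)
Lemma elem_step n (G : V -> Prop) l : (forall b, G b -> ordinal b /\ elem n (fun x => x in_ Vf b) all_sets) ->
  (forall b, exists k, G k /\ b in_ Vf k) -> good l -> elem n (fun x => x in_ Vf l) all_sets ->
  (forall k c s, G k -> is_formula false c -> is_fun s omega (Vf k) -> s in_ Vf l -> s in_ den (Vf k) None c ->
    exists D, subset D (Vf l) /\ elem n (fun x => x in_ D) all_sets /\ is_fun s omega D /\ s in_ den D None c) ->
  elem (S n) (fun x => x in_ Vf l) all_sets.
Proof.
  intros HG Hcof Hl Hel Hrefl p v Hp Hv; split; [now apply elem_up with n; auto; exact (fun _ _ => I)|].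
  intros H; destruct (elem_down HG Hp H) as (b & Hb); destruct (Hcof (opair b (Vf l))) as (k & Hk & Hbk).
  destruct (HG k Hk) as [Ok _]; apply opair_bound in Hbk; auto; destruct Hbk as [Hbk Hlk].
  assert (Hvk : envin k v) by (intros i; exact (Vf_trans Ok Hlk (Hv i))).
  assert (Hs := Hb k Hk Hbk Hvk).
  destruct (asg_spec (var_bound p) Hvk) as [Fs Es]; assert (Hsl := asg_bound (var_bound p) Hl Hv).
  rewrite <- (den_code None Fs Es) in Hs; set (s := asg v (var_bound p)) in *; clearbody s.
  destruct (Hrefl k (code p) s Hk (is_formula_code (hp := false) p) Fs Hsl Hs) as (D & HD & HDe & FD & HDs).
  apply (@den_code V hZF D None p s (fun k => app s (num k)) FD) in HDs; auto.
  assert (Hvs : forall k, app s (num k) in_ D) by (intros i; apply (fun_in FD), num_omega).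
  apply (@elem_up n (fun x => x in_ D) (fun x => x in_ Vf l)) in HDs; auto.
  - rewrite (@sat_ext V _ p v (fun k => app s (num k))); auto; intros i Hi; symmetry; auto.
  - intros q w Hq Hw; rewrite (HDe q w Hq Hw), (Hel q w Hq); [tauto|auto].
Qed.

(** Code and assignment are bundled into one set [a], so that [closure_point] ranges over both;
    transitivity makes [D] Sigma_0-elementary. *)
Definition models D a := exists c s w, is_opair a c s /\ is_omega w /\ is_formula false c /\ transitive D /\
  is_fun s w D /\ satisfies D None c s.

Lemma models_def : dP (fun v => models (v 0) (v 1)).
Proof.
  apply vP_dP; unfold models, satisfies, truth_set, is_update, is_formula, formula_closed,
    code_mem, code_eq, code_neg, code_and, code_ex, code_pred, tagged, transitive,
    is_omega, inductive, is_empty, is_succ, is_fun, maps, is_opair, is_pair, subset, unique.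
  cbn [is_numeral has_pred]; unfold is_empty, is_succ; vp.
Qed.

Lemma models_iff D c s : models D (opair c s) <->
  is_formula false c /\ transitive D /\ is_fun s omega D /\ s in_ den D None c.
Proof.
  split.
  - intros (c' & s' & w & Hp & Hw & Hc & HD & Fs & H); apply is_opair_iff, opair_inj in Hp; destruct Hp; subst c' s'.
    apply is_omega_iff in Hw; subst w; rewrite (satisfies_den (P := None) Hc Fs) in H; auto.
  - intros (Hc & HD & Fs & H); exists c, s, omega; split; [now apply is_opair_iff|split; [now apply is_omega_iff|]].
    split; [auto|split; [auto|split; [auto|]]]; now apply (satisfies_den (P := None) Hc Fs).
Qed.

Definition reflects1 a D := (exists D', models D' a) -> models D a.
(** A property definable inside [V] that implies Sigma_1-elementarity, by [closed1_elem]. [C_ 1] is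
    stated with metatheoretic formulas and could not enter the next closure directly. *)
Definition closed1 l := good l /\ forall a, a in_ Vf l -> exists D, D in_ Vf l /\ reflects1 a D.

Lemma reflects1_def : dP (fun v => reflects1 (v 0) (v 1)).
Proof. pose proof models_def; unfold reflects1; dp. Qed.
Lemma closed1_def : dP (fun v => closed1 (v 0)).
Proof. pose proof reflects1_def; unfold closed1, good, lim; dp. Qed.

Lemma good_of b l : lim l -> opair b omega in_ Vf l -> good l /\ b in_ Vf l.
Proof.
  intros Ll H; destruct (opair_bound (proj1 Ll) H) as [H1 H2]; split; auto; split; auto.
  apply ord_in_Vf; auto using ord_omega; apply Ll.
Qed.

Lemma good_above b : exists l, good l /\ b in_ Vf l.
Proof.
  destruct (@closure_point V hZF (fun _ _ => True)) with (b := opair b omega) as (l & Ll & Hb & _); [dp|intros; now exists emp|].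
  exists l; now apply good_of.
Qed.

Lemma closed1_above b : exists l, closed1 l /\ b in_ Vf l.
Proof.
  destruct (@closure_point V hZF reflects1 reflects1_def) with (b := opair b omega) as (l & Ll & Hb & Hc).
  - intros a; destruct (classic (exists D, models D a)) as [[D HD]|H]; [exists D; intros _; auto|exists emp; intros K; tauto].
  - exists l; destruct (good_of Ll Hb); split; auto; split; auto.
Qed.

Lemma closed1_elem l : closed1 l -> elem 1 (fun x => x in_ Vf l) all_sets.
Proof.
  intros [Gl Hl]; assert (Ol := proj1 (proj1 Gl)); apply (elem_step (G := good)).
  - intros b Hb; assert (Ob := proj1 (proj1 Hb)); split; auto; apply sigma0_elem; auto; exact (fun x Hx y Hy => Vf_trans Ob Hx Hy).
  - apply good_above.
  - auto.
  - apply sigma0_elem; auto; exact (fun x Hx y Hy => Vf_trans Ol Hx Hy).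
  - intros k c s Hk Hc Fs Hs H; assert (Ok := proj1 (proj1 Hk)).
    assert (Hcl : c in_ Vf l) by (pose proof Hc as Hc'; apply is_formula_Vomega in Hc'; apply (Vf_mono_sub Ol (proj2 Gl)), Hc').
    destruct (Hl (opair c s) (good_opair Gl Hcl Hs)) as (D & HD & HR).
    assert (Hm : models D (opair c s)).
    { apply HR; exists (Vf k); apply models_iff; split; [auto|split; [|auto]]; exact (fun x Hx y Hy => Vf_trans Ok Hx Hy). }
    apply models_iff in Hm; destruct Hm as (_ & HT & HF & Hd); exists D; split; [|split; [|auto]].
    + intros x Hx; exact (Vf_trans Ol HD Hx).
    + now apply sigma0_elem.
Qed.

(** The same reflection one step higher: [closed1] levels take the place of transitive sets. *)
Definition models2 b a := closed1 b /\ models (Vf b) a.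
Definition reflects2 a b := (exists b', models2 b' a) -> models2 b a.

Lemma C2_cardinal_above x : exists zeta, cardinal zeta /\ good zeta /\ C_ 2 zeta /\ x in_ Vf zeta.
Proof.
  pose proof models_def as M1; pose proof reflects1_def as R1; pose proof closed1_def as K1; pose proof inj_def as I1.
  assert (R2 : dP (fun v => reflects2 (v 0) (v 1))) by (unfold reflects2, models2; dp).
  (* Three closures at once: [reflects1] and [reflects2] give C^(2), and an ordinal [k] that does
     not inject into [a] makes the limit a cardinal. *)
  destruct (@closure_point V hZF (fun a y => exists D b k, y = opair D (opair b k) /\ (reflects1 a D /\ (reflects2 a b /\ (ordinal k /\ ~ inj k a)))))
    with (b := opair x omega) as (l & Ll & Hx & Hc).
  - dp.
  - intros a.
    assert (HD : exists D, reflects1 a D).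
    { destruct (classic (exists D, models D a)) as [[D HD]|H]; [exists D; intros _; auto|exists emp; intros K; tauto]. }
    assert (Hb : exists b, reflects2 a b).
    { destruct (classic (exists b, models2 b a)) as [[b Hb]|H]; [exists b; intros _; auto|exists emp; intros K; tauto]. }
    destruct HD as [D HD], Hb as [b Hb], (hartogs_ex a) as (k & Ok & Hk); exists (opair D (opair b k)), D, b, k; auto.
  - destruct (good_of Ll Hx) as [Gl Hxl]; pose proof (proj1 Ll) as Ol.
    assert (Hcl : forall a, a in_ Vf l -> exists D b k, (D in_ Vf l /\ reflects1 a D) /\ (b in_ Vf l /\ reflects2 a b) /\
       (k in_ Vf l /\ ordinal k /\ ~ inj k a)).
    { intros a Ha; destruct (Hc a Ha) as (y & Hy & D & b & k & -> & H1 & H2 & H3 & H4).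
      apply opair_bound in Hy; auto; destruct Hy as [Hy1 Hy2]; apply opair_bound in Hy2; auto; destruct Hy2.
      exists D, b, k; auto 6. }
    assert (Kl : closed1 l) by (split; auto; intros a Ha; destruct (Hcl a Ha) as (D & _ & _ & H & _); eauto).
    exists l; split; [|split; [auto|split; [|auto]]].
    + split; auto; intros a Ha [f Hf]; destruct (Hcl a (ord_sub_Vf Ol Ha)) as (_ & _ & k & _ & _ & Hk & Ok & Hn).
      apply Hn; apply inj_trans with l; [|apply (bij_inj Hf)]; apply inj_sub, ord_sub; auto; left; now rewrite <- ord_in_Vf.
    + split; auto; exists (Vf l); split; [now apply is_rank_iff|]; intros p v Hp Hv; revert p v Hp Hv.
      apply (@elem_step 1 closed1 l).
      * intros b Hb; split; [apply Hb|now apply closed1_elem].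
      * apply closed1_above.
      * auto.
      * now apply closed1_elem.
      * intros k c s Hk Hcc Fs Hs H; assert (Ok := proj1 (proj1 (proj1 Hk))).
        assert (Hccl : c in_ Vf l) by (pose proof Hcc as Hc'; apply is_formula_Vomega in Hc'; apply (Vf_mono_sub Ol (proj2 Gl)), Hc').
        destruct (Hcl (opair c s) (good_opair Gl Hccl Hs)) as (_ & b & _ & _ & (Hb & HR) & _).
        assert (Hm : models2 b (opair c s)).
        { apply HR; exists k; split; auto; apply models_iff; split; [auto|split; [|auto]]; exact (fun x Hx y Hy => Vf_trans Ok Hx Hy). }
        destruct Hm as [Kb Hm]; apply models_iff in Hm; destruct Hm as (_ & _ & HF & Hd).
        assert (Ob := proj1 (proj1 (proj1 Kb))).
        exists (Vf b); split; [|split; [now apply closed1_elem|auto]].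
        apply Vf_mono_sub; auto; now rewrite <- ord_in_Vf.
Qed.

End Reflecting.

Theorem theorem3p4 (V : set_structure) (hZF : ZF V)
    (lam : V) (hlam : cardinal lam) (hDC : DC lam) :
  exacting lam <->
  forall A lam1 Vlam1 : V,
    is_succ lam1 lam -> is_rank Vlam1 lam1 ->
    nonempty A -> ordinal_definable A -> subset A Vlam1 ->
    exists x y j Vlam : V,
      x in_ A /\ y in_ A /\ is_rank Vlam lam /\
      elementary_embedding j Vlam (Some x) Vlam (Some y) /\
      exists a, a in_ Vlam /\ ~ maps j a a.
Proof.
  split; [exact (@exacting_embeds V hZF lam)|]; intros hE.
  assert (Glam := lam_good hlam hE); assert (Olam := proj1 hlam).
  split; [exact (lam_limit_cardinal hlam hDC hE)|].
  destruct (C2_cardinal_above lam) as (zeta & Hcz & Gz & HC & Hlz).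
  assert (Oz := proj1 Hcz); rewrite ord_in_Vf in Hlz by auto.
  assert (Hsub := Vf_mono_sub Oz Hlz).
  destruct (diagram_exists Glam hDC Gz Hlz (level_bijection hlam hDC hE)) as (z0 & X0 & g0 & Hd0).
  destruct (@od_embedding V hZF lam hlam hE (fun z a b => is_diagram z a b) lam zeta) as (z & z' & j & Hz & Hz' & Hj & Hn); auto.
  - apply is_diagram_vP.
  - intros z Hz; apply (is_diagram_iff Glam z Oz) in Hz; destruct Hz as (X & g & Hd); apply Hd.
  - exists z0; apply (is_diagram_iff Glam z0 Oz); eauto.
  - apply (is_diagram_iff Glam _ Oz) in Hz, Hz'; destruct Hz as (X & g & Hd), Hz' as (X' & g' & Hd').
    destruct (diagram_embedding Glam Hd Hd' Hj) as (J & HJ & EJ).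
    destruct Hd as (HX & Fg & _ & G0 & G1 & _), Hd' as (_ & _ & _ & G0' & G1' & _).
    destruct (crit_exists Olam Hj Hn) as (d & Hdl & Hdn & _).
    assert (Hnum : forall n x, n in_ omega -> x in_ Vf lam -> opair n x in_ Vf lam /\ app j (opair n x) = opair n (app j x)).
    { intros n x Hnw Hx; assert (Hnl := nat_bound Glam Hnw); assert (Hp := good_opair Glam Hnl Hx); split; auto.
      rewrite (e_opair Olam Hj Hnl Hx Hp), (e_nat Olam Hj Hnw); auto; apply ord_trans with omega; auto; apply Glam. }
    (* The name (0, a) is sent to (0, j(a)), which names j(a) in the other hull; so J extends j.
       Likewise the name (1, 0) of lam is fixed below. *)
    assert (HLX : forall a, a in_ Vf lam -> a in_ X /\ app J a = app j a).
    { intros a Ha; destruct (Hnum (num 0) a (num_omega 0) Ha) as [Hp E]; rewrite <- (G0 a Ha) at 1 2; split; [apply (fun_in Fg Hp)|].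
      rewrite EJ, E by auto; apply G0'; now apply (e_in Hj). }
    assert (Hel : emp in_ Vf lam) by (apply lim_emp, Glam).
    destruct (Hnum (num 1) emp (num_omega 1) Hel) as [Hp E].
    assert (Ee : app j emp = emp) by (apply (e_nat Olam Hj (@emp_omega V hZF)); apply (proj1 Glam)).
    assert (HlX : lam in_ X) by (rewrite <- G1; apply (fun_in Fg Hp)).
    assert (Hll : app J lam = lam) by (rewrite <- G1 at 1; rewrite EJ, E, Ee; auto).
    assert (Hr : is_rank (Vf zeta) zeta) by now apply is_rank_iff.
    (* Both ends are the same V_zeta. With n = 1, membership of zeta in C^(2) covers the
       requirements on source and target. *)
    exists 1, zeta, X, zeta, J, (Vf lam), (Vf zeta), (Vf zeta).
    split; [auto|split; [now apply is_rank_iff|split; [auto|split; [auto|]]]].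
    split; [auto|split; [now apply C_mono|split; [auto|split; [auto|split; [|split; [auto|]]]]]].
    { intros a Ha; now apply HLX. }
    split; [auto|split; [auto|split; [auto|split; [auto|split]]]].
    + apply (fun_maps _ _ (emb_fun HJ)); auto.
    + exists d; split; auto; intros Hm; apply (fun_maps _ _ (emb_fun HJ)) in Hm; destruct Hm as [_ Hm].
      apply Hdn; rewrite <- (proj2 (HLX d (ord_sub_Vf Olam Hdl))); auto.
Qed.
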